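(* Let $G$ be the simply connected simple complex algebraic group of type $E_6$ and let $H\subset G$ be the maximal reductive subgroup of type $A_5\times A_1$. Then for $k\in\mathbb{N}$ we have the following branching rules: \begin{align*} \text{i)}\quad & \mathrm{res}^G_H(V_{k\omega_1})=\bigoplus_{a_1+2a_2+a_3=k}V_{a_1\lambda_2+a_2\lambda_4+a_3\lambda_5}\otimes V_{a_3\lambda_6},\\ \text{ii)}\quad & \mathrm{res}^G_H(V_{k\omega_6})=\bigoplus_{a_1+2a_2+a_3=k}V_{a_1\lambda_1+a_2\lambda_2+a_3\lambda_4}\otimes V_{a_1\lambda_6}, \end{align*} where the $a_i$ run over non-negative integers.
   Context: The ground field is $\mathbb{C}$. Fix a maximal torus $T$ and a Borel subgroup $B\supset T$ of $G$, with simple roots $\alpha_1,\ldots,\alpha_6$ and fundamental weights $\omega_1,\ldots,\omega_6$ in Bourbaki numbering. The subgroup $H$ is the subsystem subgroup containing $T$ obtained by adjoining the smallest root to the Dynkin diagram of $E_6$ and omitting $\alpha_2$. Its simple roots are chosen as follows: the $A_5$ factor has simple roots $\beta_1=\alpha_1$, $\beta_2=\alpha_3$, $\beta_3=\alpha_4$, $\beta_4=\alpha_5$, $\beta_5=\alpha_6$, and the $A_1$ factor has simple root $\beta_6=\alpha_1+2\alpha_2+2\alpha_3+3\alpha_4+2\alpha_5+\alpha_6$ (the highest root of $G$). $\lambda_1,\ldots,\lambda_6$ are the corresponding fundamental weights of $H$, so $\lambda_1,\ldots,\lambda_5$ belong to the $A_5$ factor and $\lambda_6$ to the $A_1$ factor.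 $V_\mu$ denotes the irreducible module of highest weight $\mu$ (of $G$, or of the relevant factor of $H$); $V_\mu\otimes V_\nu$ is the outer tensor product of an $A_5$-module and an $A_1$-module, viewed as an $H$-module. $\mathrm{res}^G_H$ denotes restriction of a $G$-module to $H$; equality means isomorphism of $H$-modules.
   Formalization: The simple roots of A5 are numbered in reverse, β1,…,β5 = α6, α5, α4, α3, α1; with β1,…,β5 = α1, α3, α4, α5, α6 both formulas fail for every k ≥ 1 (the right-hand sides of i) and ii) are interchanged). *)

(* Defs.v *)
From HB Require Import structures.
From mathcomp Require Import all_boot all_order all_algebra.
From mathcomp Require Import mpoly mxtens.
From mathcomp Require Import boolp classical_sets.

Set Implicit Arguments.
Unset Strict Implicit.
Unset Printing Implicit Defensive.

Import Order.TTheory GRing.Theory Num.Theory.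
Local Open Scope classical_set_scope.
Local Open Scope ring_scope.

(* Algebraic groups are identified with their groups of points inside GL_n(F),
   F being algebraically closed in the intended use.  Functions defined on a
   subgroup of GL_n(F) (morphisms, characters, representations) are total
   functions on 'M[F]_n that only matter on that subgroup. *)

Definition mxeval (F : fieldType) (n : nat) (p : {mpoly F[n * n]})
    (g : 'M[F]_n) : F :=
  p.@[fun k => mxvec g 0 k].

Definition zariski_closed (F : fieldType) (n : nat) (Z : set 'M[F]_n) : Prop :=
  exists E : set {mpoly F[n * n]},
    Z = [set g | g \in unitmx /\ forall p, E p -> mxeval p g = 0].

Definition zariski_connected (F : fieldType) (n : nat)
    (Z : set 'M[F]_n) : Prop :=
  forall A B : set 'M[F]_n, zariski_closed A -> zariski_closed B ->
    Z = A `|` B -> A `&` B = set0 -> A = set0 \/ B = set0.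

Definition subgroup (F : fieldType) (n : nat) (G : set 'M[F]_n) : Prop :=
  [/\ forall g, G g -> g \in unitmx,
      G 1%:M,
      forall g h, G g -> G h -> G (g *m h) &
      forall g, G g -> G (invmx g)].

Definition linear_algebraic_group (F : fieldType) (n : nat)
    (G : set 'M[F]_n) : Prop :=
  subgroup G /\ zariski_closed G.

Definition simple_algebraic_group (F : fieldType) (n : nat)
    (G : set 'M[F]_n) : Prop :=
  [/\ linear_algebraic_group G,
      zariski_connected G,
      ~ (forall g h, G g -> G h -> g *m h = h *m g) &
      forall N : set 'M[F]_n,
        linear_algebraic_group N -> zariski_connected N -> N `<=` G ->
        (forall g x, G g -> N x -> N (g *m x *m invmx g)) ->
        N = [set 1%:M] \/ N = G].

Definition regular_on (F : fieldType) (n : nat) (S : set 'M[F]_n)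
    (f : 'M[F]_n -> F) : Prop :=
  exists (p : {mpoly F[n * n]}) (e : nat),
    forall g, S g -> f g = mxeval p g / \det g ^+ e.

(* For S a subgroup this is a homomorphism of algebraic groups S -> GL_m, that
   is, a rational representation of S on column vectors. *)
Definition algebraic_hom (F : fieldType) (n m : nat) (S : set 'M[F]_n)
    (f : 'M[F]_n -> 'M[F]_m) : Prop :=
  [/\ forall i j, regular_on S (fun g => f g i j),
      f 1%:M = 1%:M &
      forall g h, S g -> S h -> f (g *m h) = f g *m f h].

Definition diagonal_group (F : fieldType) (r : nat) : set 'M[F]_r :=
  [set d | d \in unitmx /\ is_diag_mx d].

Definition torus (F : fieldType) (n : nat) (T : set 'M[F]_n) : Prop :=
  linear_algebraic_group T /\
  exists (r : nat) (f : 'M[F]_n -> 'M[F]_r) (f' : 'M[F]_r -> 'M[F]_n),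
    [/\ algebraic_hom T f, algebraic_hom (@diagonal_group F r) f',
        forall t, T t -> diagonal_group (f t) /\ f' (f t) = t &
        forall d, diagonal_group d -> T (f' d) /\ f (f' d) = d].

Definition maximal_torus (F : fieldType) (n : nat) (G T : set 'M[F]_n) : Prop :=
  [/\ torus T, T `<=` G &
      forall T' : set 'M[F]_n, torus T' -> T `<=` T' -> T' `<=` G -> T' = T].

(* The tangent space of G at 1: matrices annihilated by the differentials at 1
   of all polynomials vanishing on G. *)
Definition Lie (F : fieldType) (n : nat) (G : set 'M[F]_n) : set 'M[F]_n :=
  [set X | forall p : {mpoly F[n * n]}, (forall g, G g -> mxeval p g = 0) ->
     \sum_k mxvec X 0 k * mxeval p^`M(k) 1%:M = 0].

Definition character (F : fieldType) (n : nat) (T : set 'M[F]_n)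
    (chi : 'M[F]_n -> F) : Prop :=
  [/\ regular_on T chi, chi 1%:M = 1 &
      forall s t, T s -> T t -> chi (s *m t) = chi s * chi t].

(* Cocharacters are functions on F that only matter on nonzero scalars. *)
Definition cocharacter (F : fieldType) (n : nat) (T : set 'M[F]_n)
    (gamma : F -> 'M[F]_n) : Prop :=
  [/\ forall c, c != 0 -> T (gamma c),
      forall c d, c != 0 -> d != 0 -> gamma (c * d) = gamma c *m gamma d &
      forall i j, exists (p : {poly F}) (e : nat),
        forall c, c != 0 -> gamma c i j = p.[c] / c ^+ e].

(* <chi, gamma> = m *)
Definition pairing (F : fieldType) (n : nat) (chi : 'M[F]_n -> F)
    (gamma : F -> 'M[F]_n) (m : int) : Prop :=
  forall c, c != 0 -> chi (gamma c) = c ^ m.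

(* The character group is written multiplicatively:
   this is the integral combination \sum_i m_i alpha_i. *)
Definition comb (F : fieldType) (n : nat) (I : finType)
    (alpha : I -> 'M[F]_n -> F) (m : I -> int) : 'M[F]_n -> F :=
  fun t => \prod_i alpha i t ^ m i.

Definition is_root (F : fieldType) (n : nat) (G T : set 'M[F]_n)
    (chi : 'M[F]_n -> F) : Prop :=
  [/\ character T chi,
      exists2 t, T t & chi t != 1 &
      exists X, [/\ Lie G X, X != 0 &
        forall t, T t -> t *m X *m invmx t = chi t *: X]].

(* A base alpha stands for the choice of the Borel subgroup containing T that
   is generated by T and the root subgroups of the positive roots. *)
Definition root_base (F : fieldType) (n : nat) (I : finType)
    (G T : set 'M[F]_n) (alpha : I -> 'M[F]_n -> F) : Prop :=
  [/\ forall i, is_root G T (alpha i),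
      forall m : I -> int,
        (forall t, T t -> comb alpha m t = 1) -> forall i, m i = 0 &
      forall chi, is_root G T chi ->
        exists m : I -> int, (forall t, T t -> chi t = comb alpha m t) /\
          ((forall i, 0 <= m i) \/ (forall i, m i <= 0))].

(* u is an isomorphism of the additive group onto the root subgroup of chi
   (in characteristic 0 an injective morphism from G_a is one onto its
   image). *)
Definition root_hom (F : fieldType) (n : nat) (G T : set 'M[F]_n)
    (chi : 'M[F]_n -> F) (u : F -> 'M[F]_n) : Prop :=
  [/\ forall c, G (u c),
      forall c d, u (c + d) = u c *m u d,
      forall i j, exists p : {poly F}, forall c, u c i j = p.[c],
      injective u &
      forall t c, T t -> t *m u c *m invmx t = u (chi t * c)].

Definition root_subgroup (F : fieldType) (n : nat) (G T : set 'M[F]_n)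
    (chi : 'M[F]_n -> F) : set 'M[F]_n :=
  [set g | exists u c, root_hom G T chi u /\ g = u c].

Definition SL2 (F : fieldType) : set 'M[F]_2 := [set x | \det x = 1].

(* gamma is the coroot of chi: there is a morphism SL_2 -> G sending the upper
   and lower unitriangular matrices to the root subgroups of chi and -chi, and
   diag(c, 1/c) to gamma c. *)
Definition is_coroot (F : fieldType) (n : nat) (G T : set 'M[F]_n)
    (chi : 'M[F]_n -> F) (gamma : F -> 'M[F]_n) : Prop :=
  cocharacter T gamma /\
  exists phi : 'M[F]_2 -> 'M[F]_n,
    [/\ algebraic_hom (@SL2 F) phi,
        forall x, SL2 x -> G (phi x),
        root_hom G T chi (fun c => phi (1%:M + c *: delta_mx 0 1)),
        root_hom G T (fun t => (chi t)^-1)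
          (fun c => phi (1%:M + c *: delta_mx 1 0)) &
        forall c, c != 0 ->
          gamma c = phi (c *: delta_mx 0 0 + c^-1 *: delta_mx 1 1)].

(* Every abstract integral weight is a character of T. *)
Definition simply_connected (F : fieldType) (n : nat) (I : finType)
    (T : set 'M[F]_n) (alphav : I -> F -> 'M[F]_n) : Prop :=
  forall m : I -> int,
    exists chi, character T chi /\ forall i, pairing chi (alphav i) (m i).

Definition fundamental_weights (F : fieldType) (n : nat) (I : finType)
    (T : set 'M[F]_n) (alphav : I -> F -> 'M[F]_n)
    (omega : I -> 'M[F]_n -> F) : Prop :=
  forall j, character T (omega j) /\
    forall i, pairing (omega j) (alphav i) (i == j)%:Z.

(* The subgroup generated by the root subgroups of the roots lying in the
   Z-span of the family beta. *)
Definition subsystem_group (F : fieldType) (n : nat) (I : finType)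
    (G T : set 'M[F]_n) (beta : I -> 'M[F]_n -> F) : set 'M[F]_n :=
  smallest (@subgroup F n)
    [set g | exists chi (m : I -> int),
       [/\ is_root G T chi, forall t, T t -> chi t = comb beta m t &
           root_subgroup G T chi g]].

Definition irreducible_rep (F : fieldType) (n d : nat) (S : set 'M[F]_n)
    (rho : 'M[F]_n -> 'M[F]_d) : Prop :=
  (0 < d)%N /\
  forall U : {vspace 'cV[F]_d},
    (forall g u, S g -> u \in U -> rho g *m u \in U) ->
    U = 0%VS \/ U = fullv.

(* rho is a realization of the irreducible S-module of highest weight chi, for
   S = G or a subgroup generated by root subgroups of G, with maximal torus
   T `&` S and simple roots delta; chi is a character of T `&` S. *)
Definition irreducible_of_highest_weight (F : fieldType) (n d : nat)
    (I : finType) (G T S : set 'M[F]_n) (delta : I -> 'M[F]_n -> F)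
    (chi : 'M[F]_n -> F) (rho : 'M[F]_n -> 'M[F]_d) : Prop :=
  [/\ algebraic_hom S rho,
      irreducible_rep S rho &
      exists v : 'cV[F]_d,
        [/\ v != 0,
            forall gamma (m : I -> int), is_root G T gamma ->
              (forall t, T t -> gamma t = comb delta m t) ->
              (forall i, 0 <= m i) ->
              forall g, root_subgroup G T gamma g -> rho g *m v = v &
            forall t, T t -> S t -> rho t *m v = chi t *: v]].

Definition rep_iso (F : fieldType) (n d e : nat) (S : set 'M[F]_n)
    (rho : 'M[F]_n -> 'M[F]_d) (sigma : 'M[F]_n -> 'M[F]_e) : Prop :=
  exists (P : 'M[F]_(d, e)) (Q : 'M[F]_(e, d)),
    [/\ P *m Q = 1%:M, Q *m P = 1%:M &
        forall g, S g -> rho g *m P = P *m sigma g].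

Definition dsum_rep (F : fieldType) (n : nat) (I : finType) (d : I -> nat)
    (sigma : forall a, 'M[F]_n -> 'M[F]_(d a)) (g : 'M[F]_n) :
    'M[F]_(\sum_(j < #|I|) d (enum_val j)) :=
  \mxdiag_(j < #|I|) sigma (enum_val j) g.

(* sigma is the outer tensor product of the K-module rhoA and the L-module
   rhoB, viewed as a module for the group H with commuting factors K and L. *)
Definition outer_tensor_rep (F : fieldType) (n dA dB : nat)
    (H K L : set 'M[F]_n)
    (rhoA : 'M[F]_n -> 'M[F]_dA) (rhoB : 'M[F]_n -> 'M[F]_dB)
    (sigma : 'M[F]_n -> 'M[F]_(dA * dB)) : Prop :=
  algebraic_hom H sigma /\
  forall x y, K x -> L y -> sigma (x *m y) = rhoA x *t rhoB y.

Definition branches (F : fieldType) (n N : nat) (I : finType)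
    (dA dB : I -> nat) (H K L : set 'M[F]_n) (rho : 'M[F]_n -> 'M[F]_N)
    (rhoA : forall a, 'M[F]_n -> 'M[F]_(dA a))
    (rhoB : forall a, 'M[F]_n -> 'M[F]_(dB a)) : Prop :=
  exists sigma : forall a, 'M[F]_n -> 'M[F]_(dA a * dB a),
    (forall a, outer_tensor_rep H K L (rhoA a) (rhoB a) (sigma a)) /\
    rep_iso H rho (dsum_rep sigma).

Definition int_matrix (m n : nat) (rows : seq (seq int)) : 'M[int]_(m, n) :=
  \matrix_(i, j) nth 0 (nth [::] rows i) j.

(* Bourbaki numbering: the branch node alpha_4 is joined to alpha_2, alpha_3
   and alpha_5. *)
Definition E6_cartan : 'M[int]_6 := int_matrix 6 6
  [:: [::  2;  0; -1;  0;  0;  0];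
      [::  0;  2;  0; -1;  0;  0];
      [:: -1;  0;  2; -1;  0;  0];
      [::  0; -1; -1;  2; -1;  0];
      [::  0;  0;  0; -1;  2; -1];
      [::  0;  0;  0;  0; -1;  2]].

Definition simply_connected_simple_E6 (F : fieldType) (n : nat)
    (G T : set 'M[F]_n) (alpha : 'I_6 -> 'M[F]_n -> F)
    (alphav : 'I_6 -> F -> 'M[F]_n) : Prop :=
  [/\ simple_algebraic_group G,
      maximal_torus G T,
      root_base G T alpha,
      forall i, is_coroot G T (alpha i) (alphav i) &
      (forall i j, pairing (alpha i) (alphav j) (E6_cartan i j)) /\
      simply_connected T alphav].

(* beta_1, .., beta_5 = alpha_6, alpha_5, alpha_4, alpha_3, alpha_1, and beta_6
   is the highest root.  Pitfall: the direction of the A_5 chain matters.  The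
   highest weight omega_6 pairs to 1 with the coroots of alpha_6 and of the
   highest root, and to 0 with the other coroots of the chain; so
   V_(omega_6) restricted to A_5 A_1 contains V_(lambda_1) (x) V_(lambda_6)
   when beta_1 = alpha_6, whereas numbering the chain from alpha_1 puts that
   module in V_(omega_1). *)
Definition E6_beta_coords : 'M[int]_6 := int_matrix 6 6
  [:: [:: 0; 0; 0; 0; 0; 1];
      [:: 0; 0; 0; 0; 1; 0];
      [:: 0; 0; 0; 1; 0; 0];
      [:: 0; 0; 1; 0; 0; 0];
      [:: 1; 0; 0; 0; 0; 0];
      [:: 1; 2; 2; 3; 2; 1]].

Definition E6_beta (F : fieldType) (n : nat)
    (alpha : 'I_6 -> 'M[F]_n -> F) : 'I_6 -> 'M[F]_n -> F :=
  fun j => comb alpha (E6_beta_coords j).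

(* The subfamilies indexed by 1, .., 5 and by 6. *)
Definition A5_part (X : Type) (f : 'I_6 -> X) : 'I_5 -> X :=
  fun j => f (lift ord_max j).

Definition A1_part (X : Type) (f : 'I_6 -> X) : 'I_1 -> X :=
  fun _ => f ord_max.

Definition A5_factor (F : fieldType) (n : nat) (G T : set 'M[F]_n)
    (alpha : 'I_6 -> 'M[F]_n -> F) : set 'M[F]_n :=
  subsystem_group G T (A5_part (E6_beta alpha)).

Definition A1_factor (F : fieldType) (n : nat) (G T : set 'M[F]_n)
    (alpha : 'I_6 -> 'M[F]_n -> F) : set 'M[F]_n :=
  subsystem_group G T (A1_part (E6_beta alpha)).

Definition A5A1_subgroup (F : fieldType) (n : nat) (G T : set 'M[F]_n)
    (alpha : 'I_6 -> 'M[F]_n -> F) : set 'M[F]_n :=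
  smallest (@subgroup F n) (T `|` subsystem_group G T (E6_beta alpha)).

(* Simple roots and fundamental weights are numbered from 1. *)
Definition node (k : nat) : 'I_6 := inord k.-1.

(* Triples of natural numbers with a_1 + 2 a_2 + a_3 = k; the bounds a_i <= k
   are automatic. *)
Definition triples (k : nat) : finType :=
  {a : 'I_k.+1 * 'I_k.+1 * 'I_k.+1 | (a.1.1 + 2 * a.1.2 + a.2 == k)%N}.

Definition tr1 (k : nat) (a : triples k) : nat := (val a).1.1.
Definition tr2 (k : nat) (a : triples k) : nat := (val a).1.2.
Definition tr3 (k : nat) (a : triples k) : nat := (val a).2.

(* Main.v *)
Require Import Defs.
From HB Require Import structures.
From mathcomp Require Import all_boot all_order all_algebra.
From mathcomp Require Import ring lra zify.
From mathcomp Require Import mpoly mxtens.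
From mathcomp Require Import complex.
From mathcomp Require Import boolp classical_sets reals.

Set Implicit Arguments.
Unset Strict Implicit.
Unset Printing Implicit Defensive.

Import Order.TTheory GRing.Theory Num.Theory.
Local Open Scope classical_set_scope.
Local Open Scope ring_scope.

(** The module V_(k omega_1) is realized in the degree k forms on the 27-dimensional minuscule
module, as the span of the powers l^k of the points l of the cone over the highest weight orbit.
This cone has a point l0 whose orbit under the negative Borel subalgebra of A5 x A1 is open, so
a vector killed by the raising operators of A5 x A1 is determined by its pairing with l0^k under
the Fischer form; hence the restriction is multiplicity free.  The products p1^a1 p2^a2 p3^a3 of
three such vectors, of degrees 1, 2, 1, do not vanish at l0, so their projections provide all
highest weight vectors of the restriction when a1 + 2 a2 + a3 = k.

On the group side, simplicity of G makes the trace form nondegenerate on its Lie algebra, which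
gives the usual root space decomposition, and nilpotent exponentials carry representations of
the group to representations of the Chevalley generators.  Part ii) is part i) for the base of
roots twisted by the diagram automorphism. *)

(** No dimension formula is used. Completeness is read off the four nonzero coordinates of l0: a
    highest weight vector not orthogonal to l0^k shares a monomial with it, hence its weight is a
    sum of k weights of these coordinates. Two of them are the weights of p1 and p3, the other two
    are the weight of p2 minus the weight of p1, respectively p3. Dominance then leaves exactly the
    weights of the products p1^a1 p2^a2 p3^a3 with a1 + 2 a2 + a3 = k. On the group side the
    obstacle is that G is just a closed group of matrices: one-dimensional root spaces, the absence
    of multiples of roots and generation by root subgroups must all come out of simplicity. The
    lever is Chevalley's replicas: with X = S + N tangent to G, the one-parameter groups obtained
    from integral coordinates of the eigenvalues of S, and exp(N), lie in G. The differential of a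
    representation is taken as the tangent space of its graph. As root vectors are determined only
    up to scalars, the abstract module and the polynomial model are compared up to scalars
    throughout. *)

Lemma two_neq0 (F : numDomainType) : (2%:R : F) != 0. Proof. by rewrite pnatr_eq0. Qed.

(** * Polynomial identities over an infinite field *)

Section PolyFacts.
Variable F : numFieldType.

Lemma natr_inj (m n : nat) : (m%:R == n%:R :> F) = (m == n).
Proof. exact: eqr_nat. Qed.
Lemma fact_neq0 k : k`!%:R != 0 :> F.
Proof. by rewrite pnatr_eq0 -lt0n fact_gt0. Qed.

Lemma poly0_inf (p : {poly F}) (s : seq F) :
 (forall c, c \notin s -> p.[c] = 0) -> p = 0.
Proof.
move=> p0; apply/eqP/negPn/negP => pn0.
(* Of the integers 0, ..., N - 1 at most [size s] lie in [s], so at least [size p] of them are roots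
   of [p], one more than a nonzero [p] can have. *)
pose N := (size p + size s)%N.
pose t := [seq x <- [seq (i%:R : F) | i <- iota 0 N] | x \notin s].
have ut : uniq t.
 rewrite filter_uniq // map_inj_uniq ?iota_uniq //.
 by move=> i j /eqP; rewrite natr_inj => /eqP.
have rt : all (root p) t.
 apply/allP => x; rewrite mem_filter => /andP [xs _].
 by rewrite /root p0.
have := max_poly_roots pn0 rt ut.
rewrite /t size_filter.
set r := map _ _.
have ur : uniq r.
 rewrite map_inj_uniq ?iota_uniq //.
 by move=> i j /eqP; rewrite natr_inj => /eqP.
have sr : size r = N by rewrite size_map size_iota.
have sz : (count (mem s) r <= size s)%N.
 rewrite -size_filter; apply: uniq_leq_size; first exact: filter_uniq.
 by move=> x; rewrite mem_filter => /andP[].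
have := count_predC (mem s) r; rewrite sr; move: sz.
rewrite /N; move: (count (mem s) r) => a.
have -> : count (fun x => x \notin s) r = count (predC (mem s)) r by [].
move=> h1 h2 h3; have := leq_add h1 h3; rewrite addnS.
by move=> h; move: h; rewrite h2 addnC ltnn.
Qed.

Lemma poly_ext (p q : {poly F}) : (forall c, p.[c] = q.[c]) -> p = q.
Proof.
move=> pq; apply/eqP; rewrite -subr_eq0; apply/eqP.
by apply: (@poly0_inf _ [::]) => c _; rewrite !hornerE pq subrr.
Qed.

Lemma poly_ext0 (p q : {poly F}) : (forall c, c != 0 -> p.[c] = q.[c]) -> p = q.
Proof.
move=> pq; apply/eqP; rewrite -subr_eq0; apply/eqP.
apply: (@poly0_inf _ [:: 0]) => c; rewrite inE => cn.
by rewrite !hornerE pq // subrr.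
Qed.

End PolyFacts.

(** * Nilpotent matrices and their exponentials *)

Section Nilp.
Variable F : fieldType.

Definition nilp (n : nat) (X : 'M[F]_n) : Prop := X ^+ n = 0.

Lemma mxX0 n (X : 'M[F]_n) : X ^+ 0 = 1%:M.
Proof. by []. Qed.
Lemma mxM n (X Y : 'M[F]_n) : X * Y = X *m Y.
Proof. by []. Qed.
Lemma mx_n0 (X Y : 'M[F]_0) : X = Y.
Proof. by apply/matrixP => -[]. Qed.

(** The minimal polynomial divides a power of the variable, so it is itself such a power, and
    Cayley-Hamilton bounds its degree by the matrix size. Every nilpotency exponent can thus be
    normalized to the size, which makes the truncation in [expm] harmless. *)
Lemma nilpP n (X : 'M[F]_n) K : X ^+ K = 0 -> nilp X.
Proof.
case: n X => [X _|n X XK0]; first exact: mx_n0.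
rewrite /nilp.
have hK : horner_mx X (('X - 0%:P) ^+ K) = 0.
 by rewrite subr0 rmorphXn /= horner_mx_X.
have [k kK mpk] := dvdp_exp_XsubCP (mxminpoly_min hK).
have : (size (mxminpoly X) <= n.+2)%N.
 rewrite -(size_char_poly X) dvdp_leq ?mxminpoly_dvd_char //.
 by rewrite -size_poly_eq0 size_char_poly.
rewrite (eqp_size mpk) size_exp_XsubC ltnS => kn.
have := mx_root_minpoly X.
have /eqpP [[c1 c2] /= /andP [c10 c20] E] := mpk => H.
have : c2 *: (X ^+ k) = 0.
 transitivity (horner_mx X (c2 *: ('X - 0%:P) ^+ k)).
  by rewrite linearZ /= subr0 rmorphXn /= horner_mx_X.
 by rewrite -E linearZ /= H scaler0.
move/eqP; rewrite scaler_eq0 (negPf c20) /= => /eqP Xk.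
have -> : X ^+ n.+1 = X ^+ (n.+1 - k) * X ^+ k by rewrite -exprD subnK.
by rewrite Xk mulr0.
Qed.

Lemma nilp_ge n (X : 'M[F]_n) k : nilp X -> (n <= k)%N -> X ^+ k = 0.
Proof. by move=> nX nk; rewrite -(subnK nk) exprD [X ^+ n]nX mulr0. Qed.
Lemma nilp0 n : nilp (0 : 'M[F]_n).
Proof. by apply: (@nilpP _ _ 1); rewrite expr1. Qed.

Lemma exprZmx n (X : 'M[F]_n) c k : (c *: X) ^+ k = c ^+ k *: X ^+ k.
Proof.
elim: k => [|k IH]; first by rewrite !expr0 scale1r.
by rewrite !exprS IH mxM -scalemxAl -scalemxAr scalerA.
Qed.

Lemma nilpZ n (X : 'M[F]_n) c : nilp X -> nilp (c *: X).
Proof. by rewrite /nilp exprZmx => ->; rewrite scaler0. Qed.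

Lemma exprJmx n (P X : 'M[F]_n) k : P \in unitmx ->
 (P *m X *m invmx P) ^+ k = P *m X ^+ k *m invmx P.
Proof.
move=> Pu; elim: k => [|k IH]; first by rewrite !expr0 mulmx1 mulmxV.
rewrite !exprS IH !mxM !mulmxA; congr (_ *m _ *m _).
by rewrite -!mulmxA mulVmx // mulmx1.
Qed.

Lemma nilpJ n (P X : 'M[F]_n) : P \in unitmx -> nilp X ->
 nilp (P *m X *m invmx P).
Proof. by move=> Pu; rewrite /nilp exprJmx // => ->; rewrite mulmx0 mul0mx. Qed.

End Nilp.

Section Expm.
Variable F : numFieldType.
Implicit Types (n : nat).

(** The sum stops at the matrix size, so this is the exponential only on nilpotent matrices; in
    exchange it is polynomial in the entries. [expmE] allows any longer truncation. *)
Definition expm n (X : 'M[F]_n) : 'M[F]_n :=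
 \sum_(k < n) (k`!%:R)^-1 *: X ^+ k.

Lemma expmE n (X : 'M[F]_n) K : nilp X -> (n <= K)%N ->
 expm X = \sum_(k < K) (k`!%:R)^-1 *: X ^+ k.
Proof.
move=> nX nK; rewrite /expm.
rewrite -(big_mkord xpredT (fun k => (k`!%:R)^-1 *: X ^+ k)).
rewrite -(big_mkord xpredT (fun k => (k`!%:R)^-1 *: X ^+ k)).
rewrite [RHS](big_cat_nat (n := n)) //= [X in _ + X]big1_seq ?addr0 //.
move=> i /andP [_]; rewrite mem_index_iota => /andP [ni _].
by rewrite nilp_ge // scaler0.
Qed.

Lemma expm0 n : expm (0 : 'M[F]_n) = 1%:M.
Proof.
case: n => [|n]; first exact: mx_n0.
rewrite /expm big_ord_recl expr0 fact0 invr1 scale1r big1 ?addr0 // => i _.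
by rewrite expr0n scaler0.
Qed.

Lemma nilpD n (X Y : 'M[F]_n) : X *m Y = Y *m X -> nilp X -> nilp Y ->
 nilp (X + Y).
Proof.
move=> cXY nX nY; apply: (@nilpP _ _ _ (n + n)).
rewrite exprDn_comm; last exact: cXY.
apply: big1 => i _.
have [ni|ni] := leqP n i; first by rewrite (nilp_ge nY ni) mulr0 mul0rn.
by rewrite (nilp_ge nX) ?mul0r ?mul0rn //; lia.
Qed.

Lemma expmD n (X Y : 'M[F]_n) : X *m Y = Y *m X -> nilp X -> nilp Y ->
 expm (X + Y) = expm X *m expm Y.
Proof.
move=> cXY nX nY.
have nXY := nilpD cXY nX nY.
rewrite (expmE (K := n + n) nXY) ?leq_addr //.
pose G i j : 'M[F]_n := ((i`!%:R)^-1 * (j`!%:R)^-1) *: (X ^+ i *m Y ^+ j).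
have -> : expm X *m expm Y = \sum_(i < n + n) \sum_(j < n + n) G i j.
 rewrite (expmE (K := n + n) nX) ?leq_addr //.
 rewrite (expmE (K := n + n) nY) ?leq_addr //.
 rewrite mulmx_suml; apply: eq_bigr => i _; rewrite mulmx_sumr.
 by apply: eq_bigr => j _; rewrite -scalemxAl -scalemxAr scalerA.
have G0 i j : (n + n <= i + j)%N -> G i j = 0.
 move=> nij; rewrite /G; have [ni|ni] := leqP n i.
  by rewrite (nilp_ge nX ni) mul0mx scaler0.
 by rewrite (nilp_ge nY) ?mulmx0 ?scaler0 //; lia.
(* Terms with i + j >= 2n vanish, so the square of index pairs may be cut down to the triangle i + j
   < 2n, where the binomial theorem applies. *)
transitivity (\sum_(k < n + n) \sum_(i < k.+1) G (k - i)%N i).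
 apply: eq_bigr => k _; rewrite exprDn_comm; last exact: cXY.
 rewrite scaler_sumr; apply: eq_bigr => i _.
 rewrite /G -mxM -scaler_nat scalerA; congr (_ *: _).
 have ik : (i <= k)%N by rewrite -ltnS.
 have := bin_fact ik => /(congr1 (fun x => x%:R : F)).
 rewrite !natrM => <-.
 have a := fact_neq0 F i; have b := fact_neq0 F (k - i).
 have c : 'C(k, i)%:R != 0 :> F by rewrite pnatr_eq0 -lt0n bin_gt0.
 by field; rewrite a b c.
have -> : \sum_(k < n + n) \sum_(i < k.+1) G (k - i)%N i =
 \sum_(k < n + n) \sum_(i < n + n | (i <= k)%N) G (k - i)%N i.
 apply: eq_bigr => k _.
 by rewrite (big_ord_widen_cond _ xpredT (fun i => G (k - i)%N i) (ltn_ord k)).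
rewrite (exchange_big_dep xpredT) //= [RHS]exchange_big /=.
apply: eq_bigr => j _.
rewrite -(big_mkord (fun k => j <= k)%N (fun k => G (k - j)%N j)).
rewrite -(big_mkord xpredT (fun k => G k j)).
have jn : (j <= n + n)%N by apply: ltnW.
rewrite [LHS](big_cat_nat (n := j)) //= [X in X + _]big1_seq ?add0r; last first.
 by move=> i /andP [ji]; rewrite mem_index_iota; lia.
rewrite [RHS](big_cat_nat (n := (n + n - j)%N)) ?leq_subr //=.
rewrite [X in _ = _ + X]big1_seq ?addr0; last first.
 by move=> i /andP [_]; rewrite mem_index_iota => h; apply: G0; lia.
rewrite -{1}[val j]add0n big_addn big_seq_cond [RHS]big_seq_cond.
apply: eq_big => i; first by rewrite leq_addl.
by rewrite addnK.
Qed.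

Lemma expmZD n (X : 'M[F]_n) c d : nilp X ->
 expm ((c + d) *: X) = expm (c *: X) *m expm (d *: X).
Proof.
move=> nX; rewrite scalerDl expmD //; try exact: nilpZ.
by rewrite -!scalemxAl -!scalemxAr !scalerA mulrC.
Qed.

Lemma expmN n (X : 'M[F]_n) : nilp X -> expm X *m expm (- X) = 1%:M.
Proof.
move=> nX; rewrite -scaleN1r -{1}(scale1r X) -expmZD //.
by rewrite subrr scale0r expm0.
Qed.

Lemma expm_unit n (X : 'M[F]_n) : nilp X -> expm X \in unitmx.
Proof. by move=> /expmN /mulmx1_unit []. Qed.

Lemma invmx_expm n (X : 'M[F]_n) : nilp X -> invmx (expm X) = expm (- X).
Proof.
move=> nX; rewrite -[RHS]mul1mx -(mulVmx (expm_unit nX)) -mulmxA.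
by rewrite expmN // mulmx1.
Qed.

Lemma expmJ n (P X : 'M[F]_n) : P \in unitmx ->
 expm (P *m X *m invmx P) = P *m expm X *m invmx P.
Proof.
move=> Pu; rewrite /expm mulmx_sumr mulmx_suml; apply: eq_bigr => k _.
by rewrite exprJmx // -scalemxAr -scalemxAl.
Qed.

Lemma expm_poly n (X : 'M[F]_n) i j :
 exists p : {poly F}, forall c, expm (c *: X) i j = p.[c].
Proof.
exists (\sum_(k < n) ((k`!%:R)^-1 * (X ^+ k) i j) *: 'X^k) => c.
rewrite /expm summxE horner_sum; apply: eq_bigr => k _.
by rewrite exprZmx scalerA mxE hornerZ hornerXn; ring.
Qed.

Lemma expm_fix n (X : 'M[F]_n) m (v : 'M[F]_(n, m)) : nilp X ->
 (forall c, expm (c *: X) *m v = v) -> X *m v = 0.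
Proof.
move=> nX H; apply/matrixP => i j; rewrite [RHS]mxE.
(* The length [n.+2] guarantees terms of degree 0 and 1 whatever [n] is. The coefficient of degree 1
   is an entry of X v, and it vanishes because the polynomial is constant. *)
pose p : {poly F} := \sum_(k < n.+2) ((k`!%:R)^-1 * (X ^+ k *m v) i j) *: 'X^k.
have : p = (v i j)%:P.
 apply: poly_ext => c; rewrite hornerC -{1}(H c).
 rewrite (expmE (K := n.+2)); [|exact: nilpZ|by lia].
 rewrite mulmx_suml summxE /p horner_sum; apply: eq_bigr => k _.
 rewrite exprZmx scalerA -scalemxAl [RHS]mxE hornerZ hornerXn; ring.
move/(congr1 (fun q : {poly F} => q`_1)); rewrite coefC /= /p coef_sum.
rewrite !big_ord_recl big1 ?addr0.
 by rewrite !coefZ !coefXn /= mulr0 add0r expr1 invr1 mul1r mulr1.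
by move=> k _; rewrite coefZ coefXn /= mulr0.
Qed.

(* Comparing the linear terms in d of u (c + d) = u c * u d gives u' = u * u'(0). *)
Lemma additive_hom_expm n (u : F -> 'M[F]_n) :
 (forall c d, u (c + d) = u c *m u d) -> u 0 = 1%:M ->
 (forall i j, exists p : {poly F}, forall c, u c i j = p.[c]) ->
 exists X, nilp X /\ forall c, u c = expm (c *: X).
Proof.
move=> uD u0 up.
have [p Hp] : exists p : 'I_n -> 'I_n -> {poly F}, forall i j c, u c i j = (p i j).[c].
 exists (fun i j => projT1 (cid (up i j))) => i j.
 exact: (projT2 (cid (up i j))).
pose A k : 'M[F]_n := \matrix_(i, j) (p i j)`_k.
have A0 : A 0%N = 1%:M.
 by rewrite -u0; apply/matrixP => i j; rewrite mxE Hp horner_coef0.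
have AS k : A k.+1 = (k.+1%:R)^-1 *: (A k *m A 1%N).
 have E i j : (p i j)^`() = \sum_l (p l j)`_1 *: p i l.
  apply: poly_ext => c.
  have : (p i j) \Po (c%:P + 'X) = \sum_l (p i l).[c] *: p l j.
   apply: poly_ext => d; rewrite horner_comp !hornerE -Hp uD mxE horner_sum.
   by apply: eq_bigr => l _; rewrite !hornerE !Hp.
  move/(congr1 (fun q : {poly F} => q^`().[0])).
  rewrite deriv_comp derivD derivC derivX add0r mulr1 horner_comp !hornerE => ->.
  rewrite raddf_sum /= !horner_sum; apply: eq_bigr => l _.
  by rewrite derivZ !hornerE horner_coef0 coef_deriv mulr1n mulrC.
 apply/matrixP => i j; rewrite !mxE.
 have := congr1 (fun q : {poly F} => q`_k) (E i j).
 rewrite coef_deriv coef_sum -mulr_natl => h.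
 apply: (@mulfI _ (k.+1%:R)); first by rewrite pnatr_eq0.
 rewrite mulr1 mulr_natl h mulrA mulfV ?pnatr_eq0 // mul1r; apply: eq_bigr => l _.
 by rewrite coefZ !mxE mulrC.
have AE k : A k = (k`!%:R)^-1 *: (A 1%N) ^+ k.
 elim: k => [|k IH]; first by rewrite A0 fact0 invr1 scale1r.
 rewrite AS IH -scalemxAl scalerA factS natrM invfM exprSr mxM.
 by [].
(* [K] exceeds the degree of every entry, so the coefficient [A K] is zero; by [AE] it equals A_1^K
   / K!, hence the derivative at 0 is nilpotent. *)
pose K := \max_(i < n) \max_(j < n) size (p i j).
have AK : A K = 0.
 apply/matrixP => i j; rewrite !mxE nth_default //.
 by rewrite /K; apply: leq_trans (leq_bigmax i); apply: (leq_bigmax j).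
have nX : nilp (A 1%N).
 apply: (@nilpP _ _ _ K); have := AE K; rewrite AK => /esym /eqP.
 by rewrite scaler_eq0 invr_eq0 (negPf (fact_neq0 _ _)) => /eqP.
exists (A 1%N); split=> // c.
rewrite (expmE (K := (n + K)%N)); [|exact: nilpZ|exact: leq_addr].
apply/matrixP => i j; rewrite Hp summxE.
rewrite (@horner_coef_wide _ (n + K)%N); last first.
 apply: leq_trans (leq_addl _ _).
 by rewrite /K; apply: leq_trans (leq_bigmax i); apply: (leq_bigmax j).
apply: eq_bigr => k _.
have -> : (p i j)`_k = A k i j by rewrite mxE.
rewrite AE exprZmx scalerA mxE [RHS]mxE; ring.
Qed.

Lemma expm_inj n (X Y : 'M[F]_n) : nilp X -> nilp Y ->
 (forall c, expm (c *: X) = expm (c *: Y)) -> X = Y.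
Proof.
move=> nX nY H; apply/matrixP => i j.
pose p (Z : 'M[F]_n) : {poly F} :=
 \sum_(k < n.+2) ((k`!%:R)^-1 * (Z ^+ k) i j) *: 'X^k.
have pE Z c : nilp Z -> (p Z).[c] = expm (c *: Z) i j.
 move=> nZ; rewrite (expmE (K := n.+2)); [|exact: nilpZ|by lia].
  rewrite summxE horner_sum; apply: eq_bigr => k _.
  by rewrite exprZmx scalerA mxE hornerZ hornerXn; ring.
have : p X = p Y by apply: poly_ext => c; rewrite !pE // H.
move/(congr1 (fun q : {poly F} => q`_1)); rewrite /p !coef_sum.
rewrite !big_ord_recl ![\sum_(_ < n) _]big1 ?addr0; last 2 first.
- by move=> k _; rewrite coefZ coefXn /= mulr0.
- by move=> k _; rewrite coefZ coefXn /= mulr0.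
by rewrite !coefZ !coefXn /= !mulr0 !add0r !expr1 invr1 !mul1r !mulr1.
Qed.

End Expm.

(** * Diagonalizable matrices, Laurent polynomials, Jordan decomposition *)

Section Cdiag.
Variables (F : fieldType) (n : nat).
Implicit Types (P : 'M[F]_n) (d : 'I_n -> F).

(** The rows of [P] are left eigenvectors with eigenvalues [d]. Keeping the eigenvalues as a
    function turns pointwise operations on them (powers, replicas, exponents of a cocharacter) into
    operations on matrices with the same [P]. *)
Definition cdiag P d : 'M[F]_n := invmx P *m diag_mx (\row_i d i) *m P.

Lemma cdiagM P d e : P \in unitmx ->
 cdiag P d *m cdiag P e = cdiag P (fun i => d i * e i).
Proof.
move=> Pu; rewrite /cdiag !mulmxA mulmxK // -[_ *m diag_mx _ *m diag_mx _]mulmxA.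
by rewrite mulmx_diag; congr (_ *m diag_mx _ *m _); apply/rowP => i; rewrite !mxE.
Qed.

Lemma eq_cdiag P d e : d =1 e -> cdiag P d = cdiag P e.
Proof. by move=> /funext ->. Qed.

Lemma cdiag1 P : P \in unitmx -> cdiag P (fun _ => 1) = 1%:M.
Proof.
move=> Pu; rewrite /cdiag (_ : \row__ _ = const_mx 1); last first.
 by apply/rowP => i; rewrite !mxE.
by rewrite diag_const_mx mulmx1 mulVmx.
Qed.

Lemma cdiagD P d e : cdiag P d + cdiag P e = cdiag P (fun i => d i + e i).
Proof.
rewrite /cdiag -mulmxDl -mulmxDr -raddfD; congr (_ *m diag_mx _ *m _).
by apply/rowP => i; rewrite !mxE.
Qed.

Lemma cdiagZ P c d : c *: cdiag P d = cdiag P (fun i => c * d i).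
Proof.
rewrite /cdiag scalemxAl scalemxAr -linearZ; congr (_ *m diag_mx _ *m _).
by apply/rowP => i; rewrite !mxE.
Qed.

Lemma cdiag0 P : cdiag P (fun _ => 0) = 0.
Proof.
rewrite /cdiag (_ : \row__ _ = 0); last by apply/rowP => i; rewrite !mxE.
by rewrite raddf0 mulmx0 mul0mx.
Qed.

Lemma cdiag_sum P (I : Type) (s : seq I) (d : I -> 'I_n -> F) :
 \sum_(l <- s) cdiag P (d l) = cdiag P (fun i => \sum_(l <- s) d l i).
Proof.
elim: s => [|a s IH].
 by rewrite big_nil -(cdiag0 P); apply: eq_cdiag => i; rewrite big_nil.
by rewrite big_cons IH cdiagD; apply: eq_cdiag => i; rewrite big_cons.
Qed.

Lemma mul_cdiag P d : P \in unitmx -> P *m cdiag P d = diag_mx (\row_i d i) *m P.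
Proof. by move=> Pu; rewrite /cdiag !mulmxA mulmxV // mul1mx. Qed.

Lemma cdiag_conjE P d i j : P \in unitmx ->
 (P *m cdiag P d *m invmx P) i j = d i *+ (i == j).
Proof.
by move=> Pu; rewrite mul_cdiag // mulmxK // !mxE.
Qed.

Lemma cdiag_inj P d e : P \in unitmx -> cdiag P d = cdiag P e -> d =1 e.
Proof.
move=> Pu /(congr1 (fun A => P *m A *m invmx P)) E i.
by have := congr1 (fun A : 'M_n => A i i) E; rewrite !cdiag_conjE // eqxx.
Qed.

Lemma cdiag_unit P d : P \in unitmx -> (forall i, d i != 0) ->
 cdiag P d \in unitmx /\ invmx (cdiag P d) = cdiag P (fun i => (d i)^-1).
Proof.
move=> Pu d0.
have E : cdiag P d *m cdiag P (fun i => (d i)^-1) = 1%:M.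
 by rewrite cdiagM // -(cdiag1 Pu); apply: eq_cdiag => i; rewrite mulfV.
have [U _] := mulmx1_unit E; split=> //.
by rewrite -[RHS]mul1mx -(mulVmx U) -mulmxA E mulmx1.
Qed.

(** In the eigenbasis the commutator has entries W_ij (d_j - d_i), so commuting means preserving the
    eigenspaces. *)
Lemma comm_cdiagP P d (Z : 'M[F]_n) : P \in unitmx ->
 (Z *m cdiag P d = cdiag P d *m Z) <->
 (forall i j, (P *m Z *m invmx P) i j * (d j - d i) = 0).
Proof.
move=> Pu; set W := P *m Z *m invmx P.
have ZW : Z = invmx P *m W *m P by rewrite /W !mulmxA mulVmx // mul1mx mulmxKV.
have E1 : Z *m cdiag P d = invmx P *m (W *m diag_mx (\row_i d i)) *m P.
 by rewrite {1}ZW /cdiag !mulmxA mulmxK.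
have E2 : cdiag P d *m Z = invmx P *m (diag_mx (\row_i d i) *m W) *m P.
 by rewrite {1}ZW /cdiag !mulmxA mulmxK.
rewrite E1 E2; split=> [E i j|E].
 have : W *m diag_mx (\row_i d i) = diag_mx (\row_i d i) *m W.
  have := congr1 (fun A => P *m A *m invmx P) E.
  by rewrite !mulmxA mulmxV // !mul1mx !mulmxK.
 move/matrixP/(_ i j); rewrite mul_diag_mx mul_mx_diag !mxE => e.
 by rewrite mulrBr e mulrC subrr.
congr (_ *m _ *m _); apply/matrixP => i j.
rewrite mul_diag_mx mul_mx_diag [LHS]mxE [RHS]mxE ![(\row__ _) _ _]mxE; have := E i j.
by rewrite mulrBr => /eqP; rewrite subr_eq0 => /eqP ->; rewrite mulrC.
Qed.

End Cdiag.

Section Laurent.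
Variable F : numFieldType.

Lemma prodf_exprz (I : Type) (s : seq I) (x : F) (k : I -> int) : x != 0 ->
 \prod_(i <- s) x ^ (k i) = x ^ (\sum_(i <- s) k i).
Proof.
move=> x0; elim: s => [|a s IH]; first by rewrite !big_nil expr0z.
by rewrite !big_cons IH expfzDr.
Qed.

Lemma seq_int_bound (I : eqType) (s : seq I) (k : I -> int) :
 exists N : nat, forall i, i \in s -> 0 <= k i + N%:Z.
Proof.
elim: s => [|a s [N IH]]; first by exists 0%N.
exists (N + `|k a|)%N => x; rewrite inE => /orP [/eqP ->|/IH]; lia.
Qed.

(** Independence of the characters c -> c^k of the multiplicative group, for lists with repeated
    exponents: multiplication by a large power of c removes the negative exponents and leaves a
    polynomial with infinitely many zeros. *)
Lemma laurent1 (I : eqType) (s : seq I) (a : I -> F) (k : I -> int) :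
 (forall c, c != 0 -> \sum_(i <- s) a i * c ^ (k i) = 0) ->
 forall kap, \sum_(i <- s | k i == kap) a i = 0.
Proof.
move=> H kap.
have [N1 HN1] := seq_int_bound s k.
pose N := (N1 + `|kap|)%N.
have HN i : i \in s -> 0 <= k i + N%:Z by move=> /HN1; rewrite /N; lia.
pose p : {poly F} := \sum_(i <- s) a i *: 'X^(absz (k i + N%:Z)).
have p0 : p = 0.
 apply: poly_ext0 => c c0; rewrite horner0 /p horner_sum.
 transitivity (c ^ N%:Z * \sum_(i <- s) a i * c ^ (k i)); last by rewrite H ?mulr0.
 rewrite mulr_sumr big_seq [RHS]big_seq; apply: eq_bigr => i si.
 rewrite hornerZ hornerXn mulrCA -expfzDr // [N%:Z + _]addrC; congr (_ * _).
 by rewrite -[in RHS](gez0_abs (HN i si)).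
have := congr1 (fun q : {poly F} => q`_(absz (kap + N%:Z))) p0.
rewrite coef0 /p coef_sum => E; apply: etrans E.
rewrite big_mkcond big_seq [RHS]big_seq; apply: eq_bigr => i si.
rewrite coefZ coefXn.
have -> : (absz (kap + N%:Z) == absz (k i + N%:Z)) = (k i == kap).
 by have := HN i si; rewrite /N; lia.
by case: eqP; rewrite ?mulr1 ?mulr0.
Qed.

(** The direction (1, M, M^2, ...) is used: [v i] pairs to zero with it exactly when [M] is a root
    of the polynomial with coefficients [v i], and [M] is chosen to be a root of none of the nonzero
    ones. *)
Lemma separating (r : nat) (I : eqType) (s : seq I) (v : I -> 'I_r -> int) :
 exists N : 'I_r -> int, forall i, i \in s ->
  \sum_l N l * v i l = 0 -> forall l, v i l = 0.
Proof.
pose q i : {poly F} := \sum_(l < r) (v i l)%:~R *: 'X^l.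
pose p : {poly F} := \prod_(i <- s | q i != 0) q i.
have p0 : p != 0 by rewrite prodf_seq_neq0; apply/allP => i _; apply/implyP.
have [M HM] : exists M : nat, ~~ root p M%:R.
 apply: contrapT => /forallNP H.
 have := @max_poly_roots _ p [seq (i%:R : F) | i <- iota 0 (size p)] p0.
 rewrite [X in (X < _)%N]size_map size_iota ltnn => H1; apply: (notF (H1 _ _)).
  by apply/allP => x /mapP [i _ ->]; apply/negPn/negP/H.
 rewrite map_inj_uniq ?iota_uniq // => i j /eqP; by rewrite natr_inj => /eqP.
exists (fun l => (M ^ l)%N%:Z) => i si E l.
have q0 : q i = 0.
 apply/eqP/negPn/negP => qi0; move/negP: HM; apply.
 rewrite /root /p horner_prod prodf_seq_eq0; apply/hasP; exists i => //.
 rewrite qi0 /= /q horner_sum; apply/eqP.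
 have := congr1 (fun z : int => z%:~R : F) E; rewrite rmorph0 => E'; apply: etrans E'.
 rewrite rmorph_sum; apply: eq_bigr => j _.
 by rewrite hornerZ hornerXn rmorphM /= mulrC -natrX.
have := congr1 (fun z : {poly F} => z`_l) q0; rewrite coef0 /q coef_sum.
rewrite (bigD1 l) //= big1 ?addr0.
 by rewrite coefZ coefXn eqxx mulr1 => /eqP; rewrite intr_eq0 => /eqP.
move=> j jl; rewrite coefZ coefXn; case: eqP => [e|_]; last by rewrite mulr0.
by case/eqP: jl; apply/val_inj.
Qed.

Definition monom (r : nat) (x : 'I_r -> F) (k : 'I_r -> int) : F :=
 \prod_l x l ^ k l.

Lemma monomD r (x : 'I_r -> F) k1 k2 : (forall l, x l != 0) ->
 monom x (fun l => k1 l + k2 l) = monom x k1 * monom x k2.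
Proof.
by move=> x0; rewrite /monom -big_split; apply: eq_bigr => l _; rewrite expfzDr.
Qed.

Lemma monomM r (x y : 'I_r -> F) k :
 monom (fun l => x l * y l) k = monom x k * monom y k.
Proof.
by rewrite /monom -big_split; apply: eq_bigr => l _; rewrite expfzMl.
Qed.

Lemma monom_neq0 r (x : 'I_r -> F) k : (forall l, x l != 0) -> monom x k != 0.
Proof. by move=> x0; apply/prodf_neq0 => l _; rewrite expfz_neq0. Qed.
Lemma monom0 r (x : 'I_r -> F) : monom x (fun _ => 0) = 1.
Proof. by rewrite /monom big1 // => l _; rewrite expr0z. Qed.
Lemma monom1 r k : monom (fun _ : 'I_r => 1) k = 1.
Proof. by rewrite /monom big1 // => l _; rewrite exp1rz. Qed.

Lemma monomMz r (x : 'I_r -> F) k (m : int) :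
 monom x (fun l => k l * m) = monom x k ^ m.
Proof.
rewrite /monom; elim/big_rec2: _ => [|l y z _ ->]; first by rewrite exp1rz.
by rewrite expfzMl exprz_exp.
Qed.

Lemma monom_sum r (x : 'I_r -> F) (I : Type) (s : seq I) (k : I -> 'I_r -> int) :
 (forall l, x l != 0) ->
 monom x (fun l => \sum_(i <- s) k i l) = \prod_(i <- s) monom x (k i).
Proof.
move=> x0; elim: s => [|a s IH].
 rewrite big_nil -(monom0 x); congr monom; apply/funext => l; exact: big_nil.
rewrite big_cons -IH -monomD //; congr monom; apply/funext => l; exact: big_cons.
Qed.

Lemma laurentn (r : nat) (I : eqType) (s : seq I) (a : I -> F) (k : I -> 'I_r -> int) :
 (forall x, (forall l, x l != 0) -> \sum_(i <- s) a i * monom x (k i) = 0) ->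
 forall kap, \sum_(i <- s | [forall l, k i l == kap l]) a i = 0.
Proof.
move=> H kap.
(* The substitution x_l = c^(N l) reduces to one variable; [N] is chosen so that no exponent other
   than [kap] is sent to the same integer as [kap]. *)
have [N HN] := separating s (fun i l => k i l - kap l).
suff /(_ (\sum_l N l * kap l)) E :
  forall kk, \sum_(i <- s | \sum_l N l * k i l == kk) a i = 0; last first.
 apply: laurent1 => c c0; apply: etrans (H (fun l => c ^ N l) _); last first.
  by move=> l; rewrite expfz_neq0.
 apply: eq_bigr => i _; congr (_ * _).
 rewrite /monom -prodf_exprz //; apply: eq_bigr => l _; by rewrite exprz_exp.
apply: etrans E; rewrite big_seq_cond [RHS]big_seq_cond; apply: eq_bigl => i.
case si : (i \in s) => //=; apply/forallP/eqP => [h|h l].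
 by apply: eq_bigr => l _; rewrite (eqP (h l)).
have /(_ _ l) := HN i si; rewrite -subr_eq0 => ->//.
by under eq_bigr do rewrite mulrBr; rewrite sumrB h subrr.
Qed.

End Laurent.

Section Diag.
Variable F : numFieldType.

Lemma similar_cdiag n (P A : 'M[F]_n) : P \in unitmx -> similar_diag P A ->
 exists d, A = cdiag P d.
Proof.
move=> Pu /similar_diagPex [D /(similarP Pu) E].
exists (fun i => D 0 i); rewrite /cdiag (_ : \row__ _ = D); last first.
 by apply/rowP => i; rewrite mxE.
by rewrite -mulmxA -E mulKmx.
Qed.

Lemma cdiag_similar n (P : 'M[F]_n) d : P \in unitmx -> similar_diag P (cdiag P d).
Proof.
move=> Pu; apply/similar_diagPex; exists (\row_i d i).
by apply/(similarP Pu); rewrite mul_cdiag.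
Qed.

Lemma row_diag_mul n (d : 'rV[F]_n) (P : 'M[F]_n) i :
 row i (diag_mx d *m P) = d 0 i *: row i P.
Proof. by apply/rowP => j; rewrite mul_diag_mx !mxE. Qed.

Lemma split_diag n (A : 'M[F]_n) (rs : seq F) : uniq rs ->
 \prod_(x <- rs) (A - x%:M) = 0 ->
 exists P d, P \in unitmx /\ A = cdiag P d.
Proof.
case: n A => [A _ _|n A urs E].
 by exists 1%:M, (fun=> 0); split; [exact: unitmx1|exact: mx_n0].
have [P Pu sP] : diagonalizable A.
 apply/diagonalizableP; exists rs => //; apply: mxminpoly_min.
 rewrite rmorph_prod -[RHS]E /=; apply: eq_bigr => x _.
 by rewrite rmorphB /= horner_mx_X horner_mx_C.
by have [d Ad] := similar_cdiag Pu sP; exists P, d.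
Qed.

Lemma cdiag_family n r (Y : 'I_r -> 'M[F]_n) :
 (forall l, exists P d, P \in unitmx /\ Y l = cdiag P d) ->
 (forall l l', Y l *m Y l' = Y l' *m Y l) ->
 exists P, P \in unitmx /\ exists d, forall l, Y l = cdiag P (d l).
Proof.
move=> Yd Yc.
have [P Pu /allP sP] : codiagonalizable [seq Y l | l <- enum 'I_r].
 apply/codiagonalizableP; split.
  by move=> A B /mapP [l _ ->] /mapP [l' _ ->]; exact: Yc.
 move=> A /mapP [l _ ->]; have [P [d [Pu ->]]] := Yd l.
 by exists P => //; exact: cdiag_similar.
exists P; split=> //.
have h l : exists d, Y l = cdiag P d.
 by apply: similar_cdiag => //; apply: sP; apply: map_f; rewrite mem_enum.
by exists (fun l => projT1 (cid (h l))) => l; exact: (projT2 (cid (h l))).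
Qed.

Lemma common_denominator n (g : F -> 'M[F]_n) :
 (forall i j, exists (p : {poly F}) (e : nat),
    forall c, c != 0 -> g c i j = p.[c] / c ^+ e) ->
 exists (K e : nat) (A : nat -> 'M[F]_n),
  forall c, c != 0 -> c ^+ e *: g c = \sum_(k < K) c ^+ k *: A k.
Proof.
move=> H.
pose p i j := projT1 (cid (H i j)).
have [e0 He0] : exists e0 : 'I_n -> 'I_n -> nat, forall i j c, c != 0 ->
  g c i j = (p i j).[c] / c ^+ e0 i j.
 exists (fun i j => projT1 (cid (projT2 (cid (H i j))))) => i j.
 exact: (projT2 (cid (projT2 (cid (H i j))))).
pose e := \max_(i < n) \max_(j < n) e0 i j.
have e0e i j : (e0 i j <= e)%N.
 by apply: leq_trans (leq_bigmax i); apply: (leq_bigmax j).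
pose q i j : {poly F} := 'X^(e - e0 i j) * p i j.
pose K := \max_(i < n) \max_(j < n) size (q i j).
have qK i j : (size (q i j) <= K)%N.
 by apply: leq_trans (leq_bigmax i); apply: (leq_bigmax j).
exists K, e, (fun k => \matrix_(i, j) (q i j)`_k) => c c0.
apply/matrixP => i j; rewrite summxE mxE He0 //.
transitivity (q i j).[c].
 have cn : c ^+ e0 i j != 0 by rewrite expf_neq0.
 by rewrite hornerM hornerXn -{1}(subnK (e0e i j)) exprD; field.
rewrite (horner_coef_wide c (qK i j)); apply: eq_bigr => k _.
by rewrite !mxE mulrC.
Qed.

Lemma mx_poly_ext0 n (K : nat) (A B : nat -> 'M[F]_n) :
 (forall c, c != 0 -> \sum_(k < K) c ^+ k *: A k = \sum_(k < K) c ^+ k *: B k) ->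
 forall k, (k < K)%N -> A k = B k.
Proof.
move=> H k kK; apply/matrixP => i j.
have : \poly_(k < K) A k i j = \poly_(k < K) B k i j.
 apply: poly_ext0 => c c0; rewrite !horner_poly.
 have := congr1 (fun M : 'M_n => M i j) (H c c0); rewrite !summxE.
 move=> E; transitivity (\sum_(k0 < K) (c ^+ k0 *: A k0) i j).
  by apply: eq_bigr => l _; rewrite mxE mulrC.
 by rewrite E; apply: eq_bigr => l _; rewrite mxE mulrC.
by move/(congr1 (fun q : {poly F} => q`_k)); rewrite !coef_poly kK.
Qed.

(* The coefficients of c |-> g c are orthogonal idempotents with sum 1. *)
Lemma laurent_hom n (g : F -> 'M[F]_n) :
 (forall c d, c != 0 -> d != 0 -> g (c * d) = g c *m g d) -> g 1 = 1%:M ->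
 (forall i j, exists (p : {poly F}) (e : nat),
    forall c, c != 0 -> g c i j = p.[c] / c ^+ e) ->
 exists (P : 'M[F]_n) (z : 'I_n -> int), P \in unitmx /\
  forall c, c != 0 -> g c = cdiag P (fun i => c ^ z i).
Proof.
move=> gM g1 /common_denominator [K [e [A HA]]].
have AB k d : (k < K)%N -> d != 0 ->
  A k *m (\sum_(l < K) d ^+ l *: A l) = d ^+ k *: A k.
 move=> kK d0.
 apply: (mx_poly_ext0 (A := fun k => A k *m (\sum_(l < K) d ^+ l *: A l))
   (B := fun k => d ^+ k *: A k) _ kK) => c c0.
 transitivity ((c ^+ e *: g c) *m (d ^+ e *: g d)).
  rewrite !HA // mulmx_suml; apply: eq_bigr => l _; by rewrite -scalemxAl.
 rewrite -scalemxAl -scalemxAr -gM // scalerA -exprMn HA ?mulf_neq0 //.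
 by apply: eq_bigr => l _; rewrite exprMn scalerA.
have AA k l : (k < K)%N -> (l < K)%N -> A k *m A l = (k == l)%:R *: A k.
 move=> kK lK.
 apply: (mx_poly_ext0 (A := fun l => A k *m A l)
   (B := fun l => (k == l)%:R *: A k) _ lK) => d d0.
 transitivity (d ^+ k *: A k).
  rewrite -AB // mulmx_sumr; apply: eq_bigr => j _; by rewrite -scalemxAr.
 rewrite (bigD1 (Ordinal kK)) //= eqxx scale1r big1 ?addr0 // => j jk.
 rewrite (_ : (k == j) = false) ?scale0r ?scaler0 //.
 by apply/negP => /eqP kj; case/eqP: jk; apply/val_inj.
have A1 : \sum_(k < K) A k = 1%:M.
 have := HA 1 (oner_neq0 _); rewrite expr1n scale1r g1 => ->.
 by apply: eq_bigr => k _; rewrite expr1n scale1r.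
(* [Z] has eigenvalue k on the summand cut out by the idempotent [A k]; diagonalizing this single
   matrix diagonalizes all the idempotents at once. *)
pose Z := \sum_(k < K) k%:R *: A k.
have AZ k : (k < K)%N -> A k *m Z = k%:R *: A k.
 move=> kK; rewrite /Z mulmx_sumr (bigD1 (Ordinal kK)) //= big1 ?addr0.
  by rewrite -scalemxAr AA // eqxx scale1r.
 move=> j jk; rewrite -scalemxAr AA // (_ : (k == j) = false) ?scale0r ?scaler0 //.
 by apply/negP => /eqP kj; case/eqP: jk; apply/val_inj.
have [P [d [Pu Zd]]] : exists P d, P \in unitmx /\ Z = cdiag P d.
 apply: (@split_diag _ Z [seq i%:R | i <- iota 0 K]).
  by rewrite map_inj_uniq ?iota_uniq // => i j /eqP; rewrite natr_inj => /eqP.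
 rewrite big_map (_ : iota 0 K = index_iota 0 K); last by rewrite /index_iota subn0.
 set X := \prod_(_ <- _) _; rewrite -[X]mul1mx -A1 mulmx_suml big1 // => k _.
 rewrite /X; have : val k \in index_iota 0 K by rewrite mem_index_iota ltn_ord.
 elim: (index_iota 0 K) => // j s IH; rewrite big_cons inE mxM mulmxA.
 rewrite mulmxBr AZ // mul_mx_scalar -scalerBl -scalemxAl.
 by case/orP => [/eqP ->|/IH ->]; rewrite ?subrr ?scale0r ?scaler0.
have ZA k : (k < K)%N -> Z *m A k = k%:R *: A k.
 move=> kK; rewrite /Z mulmx_suml (bigD1 (Ordinal kK)) //= big1 ?addr0.
  by rewrite -scalemxAl AA // eqxx scale1r.
 move=> j jk; rewrite -scalemxAl AA // (_ : (val j == k) = false) ?scale0r ?scaler0 //.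
 by apply/negP => /eqP kj; case/eqP: jk; apply/val_inj.
have PA k i : (k < K)%N -> d i != k%:R -> row i P *m A k = 0.
 move=> kK dk.
 have rZ : row i P *m Z = d i *: row i P.
  by rewrite Zd -row_mul mul_cdiag // row_diag_mul mxE.
 have : d i *: (row i P *m A k) = k%:R *: (row i P *m A k).
  by rewrite (scalemxAl (d i) (row i P) (A k)) -rZ -mulmxA ZA // -scalemxAr.
 move/eqP; rewrite -subr_eq0 -scalerBl scaler_eq0 subr_eq0 (negPf dk) /=.
 by move/eqP.
have ex i : exists k : 'I_K, d i = k%:R.
 apply: contrapT => /forallNP H.
 have : row i P = 0.
  rewrite -[LHS]mulmx1 -A1 mulmx_sumr big1 // => k _.
  by apply: PA => //; apply/eqP => h; apply: (H k).
 move/(congr1 (fun v => v *m invmx P)); rewrite mul0mx -row_mul mulmxV //.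
 move/rowP/(_ i); rewrite !mxE eqxx => /eqP; by rewrite oner_eq0.
pose kk i := projT1 (cid (ex i)).
have dk i : d i = (kk i)%:R := projT2 (cid (ex i)).
(* The exponents are shifted by [e] because the [A k] are the coefficients of c^e g(c). *)
exists P, (fun i => (kk i)%:Z - e%:Z); split=> // c c0.
apply: (@scalerI _ _ (c ^+ e)); first by rewrite expf_neq0.
rewrite HA // cdiagZ.
rewrite (_ : cdiag P _ = cdiag P (fun i => c ^+ kk i)); last first.
 apply: eq_cdiag => i; rewrite -[c ^+ e]/(c ^ e%:Z) -expfzDr // addrC subrK //.
have : P *m \sum_(k < K) c ^+ k *: A k = diag_mx (\row_i c ^+ kk i) *m P.
 apply/row_matrixP => i; rewrite row_mul row_diag_mul mxE.
 rewrite mulmx_sumr -[in RHS](mulmx1 (row i P)) -A1 mulmx_sumr scaler_sumr.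
 apply: eq_bigr => k _; rewrite -scalemxAr.
 have [->//|nk] := eqVneq (kk i) k.
 by rewrite PA ?scaler0 // dk natr_inj.
by move=> E; rewrite /cdiag -mulmxA -E mulKmx.
Qed.

Lemma taylor_coef (p : {poly F}) x k : (p \Po ('X + x%:P))`_k = (p^`N(k)).[x].
Proof.
rewrite /comp_poly addrC nderiv_taylor; last exact: mulrC.
rewrite coef_sum (eq_bigr (fun i : 'I_(size (p^:P)) => (p^`N(i)).[x] * (k == i)%:R)); last first.
 move=> i _; by rewrite nderivn_map horner_map /= mul_polyC coefZ coefXn.
rewrite size_map_polyC.
have [kp|kp] := ltnP k (size p).
 rewrite (bigD1 (Ordinal kp)) //= eqxx mulr1 big1 ?addr0 // => i ik.
 rewrite (_ : (k == i) = false) ?mulr0 //; apply/negP => /eqP e.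
 by case/eqP: ik; apply/val_inj.
rewrite nderivn_poly0 // horner0 big1 // => i _.
by rewrite gtn_eqF ?mulr0 // (leq_trans (ltn_ord i)).
Qed.

Lemma comp_XsubC_exp (p : {poly F}) x m :
 (('X - x%:P) ^+ m * p) \Po ('X + x%:P) = 'X^m * (p \Po ('X + x%:P)).
Proof.
by rewrite comp_polyM rmorphXn /= comp_polyB comp_polyX comp_polyC addrK.
Qed.

(* Here [b i l] stands for the coefficient of exp (nu i * t) * t ^ l / l!. *)
Lemma exp_poly_indep (I : eqType) (s : seq I) (nu : I -> F) (M : nat)
  (b : I -> nat -> F) :
 uniq s -> {in s &, injective nu} ->
 (forall k, \sum_(i <- s) \sum_(l < M) 'C(k, l)%:R * nu i ^+ (k - l) * b i l = 0) ->
 forall i l, i \in s -> (l < M)%N -> b i l = 0.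
Proof.
move=> us nui H.
(* The hypothesis is this vanishing for q = X^k, and it extends linearly: the [b i l] are the
   coefficients of a combination of divided derivatives at the points nu_i that kills all
   polynomials. *)
have L (q : {poly F}) : \sum_(i <- s) \sum_(l < M) (q^`N(l)).[nu i] * b i l = 0.
 pose G k := \sum_(i <- s) \sum_(l < M) (('X^k : {poly F})^`N(l)).[nu i] * b i l.
 have G0 k : G k = 0.
  rewrite -[RHS](H k); apply: eq_bigr => i _; apply: eq_bigr => l _.
  by rewrite nderivnXn hornerMn hornerXn -mulr_natl.
 transitivity (\sum_(k < size q) q`_k * G k); last first.
  by rewrite big1 // => k _; rewrite G0 mulr0.
 rewrite -{1}(coefK q) poly_def.
 under [RHS]eq_bigr do rewrite mulr_sumr.
 rewrite [RHS]exchange_big /=; apply: eq_bigr => i _.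
 under [RHS]eq_bigr do rewrite mulr_sumr.
 rewrite [RHS]exchange_big /=; apply: eq_bigr => l _.
 rewrite linear_sum horner_sum mulr_suml; apply: eq_bigr => k _.
 by rewrite linearZ hornerZ mulrA.
move=> i l si; move: l; apply: contrapT => /existsNP [l0 /not_implyP [l0M bl0]].
have ex : exists l, (l < M)%N && (b i l != 0).
 by exists l0; rewrite l0M; apply/eqP.
have ub l : (l < M)%N && (b i l != 0) -> (l <= M)%N by move=> /andP [/ltnW].
have [l /andP [lM bl] lmax] := ex_maxnP ex ub.
(* With [l] the largest order for which [b i l] is nonzero, the test polynomial (X - nu_i)^l r
   vanishes to order M at the other points and to order l at nu_i, so only the term r(nu_i) b_il
   survives. *)
pose r : {poly F} := \prod_(j <- s | j != i) ('X - (nu j)%:P) ^+ M.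
have := L (('X - (nu i)%:P) ^+ l * r).
have lowD (x : F) (m k : nat) (p : {poly F}) : (k < m)%N ->
  ((('X - x%:P) ^+ m * p)^`N(k)).[x] = 0.
 by move=> km; rewrite -taylor_coef comp_XsubC_exp coefXnM km.
rewrite (bigD1_seq i) //= [X in _ + X]big1_seq ?addr0; last first.
 move=> j /andP [ji sj]; apply: big1 => k _.
 have -> : ('X - (nu i)%:P) ^+ l * r = ('X - (nu j)%:P) ^+ M *
   (('X - (nu i)%:P) ^+ l * \prod_(h <- rem j s | h != i) ('X - (nu h)%:P) ^+ M).
  by rewrite mulrCA /r (big_rem j) //= ji.
 by rewrite lowD ?mul0r.
rewrite (bigD1 (Ordinal lM)) //= big1 ?addr0; last first.
 move=> k kl; have [kl'|kl'] := ltnP k l; first by rewrite lowD ?mul0r.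
 have -> : b i k = 0; last by rewrite mulr0.
 apply/eqP/negPn/negP => bk; have := lmax k; rewrite ltn_ord bk => /(_ isT) h.
 by case/eqP: kl; apply/val_inj/eqP; rewrite eqn_leq h.
move/eqP; rewrite mulf_eq0 (negPf bl) orbF => /eqP.
have -> : ((('X - (nu i)%:P) ^+ l * r)^`N(l)).[nu i] = r.[nu i].
 rewrite -taylor_coef comp_XsubC_exp coefXnM ltnn subnn -horner_coef0.
 by rewrite horner_comp !hornerE.
move=> r0; have : r.[nu i] != 0; last by rewrite r0 eqxx.
rewrite /r horner_prod prodf_seq_neq0; apply/allP => j sj; apply/implyP => ji.
rewrite horner_exp !hornerE expf_neq0 // subr_eq0.
by apply/eqP => /nui; rewrite si sj => /(_ isT isT) h; rewrite h eqxx in ji.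
Qed.

(** Take the fewest elements whose integer combinations give all [lam i]. An integer relation with
    y_j nonzero would allow mu_j to be dropped after dividing the others by y_j. Applied to
    eigenvalues, the coordinates [z] become the exponents of the one-parameter groups that replace a
    semisimple matrix. *)
Lemma int_basis n (lam : 'I_n -> F) : exists (s : nat) (mu : 'I_s -> F) (z : 'I_n -> 'I_s -> int),
 (forall i, lam i = \sum_j (z i j)%:~R * mu j) /\
 (forall y : 'I_s -> int, \sum_j (y j)%:~R * mu j = 0 -> forall j, y j = 0).
Proof.
pose Q s := `[< exists (mu : 'I_s -> F) (z : 'I_n -> 'I_s -> int),
  forall i, lam i = \sum_j (z i j)%:~R * mu j >].
have ex : exists s, Q s.
 exists n; apply/asboolP; exists lam, (fun i j => (i == j)%:Z) => i.
 rewrite (bigD1 i) //= eqxx mul1r big1 ?addr0 // => j ji.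
 by rewrite eq_sym (negPf ji) mul0r.
case: (ex_minnP ex) => s /asboolP [mu [z Hz]] smin.
exists s, mu, z; split=> // y Hy j; apply/eqP/negPn/negP => yj.
case: s => [|s] in mu z Hz smin y Hy j yj *; first by case: j {yj}.
suff : Q s by move/smin; rewrite ltnn.
apply/asboolP.
exists (fun l => mu (lift j l) / (y j)%:~R).
exists (fun i l => z i (lift j l) * y j - z i j * y (lift j l)) => i.
have yj0 : (y j)%:~R != 0 :> F by rewrite intr_eq0.
have Ej : mu j = - \sum_l (y (lift j l))%:~R * (mu (lift j l) / (y j)%:~R).
 apply: (@mulfI _ (y j)%:~R) => //; apply/eqP; rewrite -subr_eq0.
 rewrite mulrN opprK mulr_sumr.
 move: Hy; rewrite (bigD1_ord j) //= => Hy; rewrite -[X in _ == X]Hy.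
 apply/eqP; congr (_ + _); apply: eq_bigr => l _.
 by field.
rewrite Hz (bigD1_ord j) //= Ej mulrN mulr_sumr -sumrN -big_split /=.
apply: eq_bigr => l _; rewrite rmorphB !rmorphM /=; by field.
Qed.

End Diag.

Section Jordan.
Variable F : numClosedFieldType.

Lemma crt_roots (rs : seq F) M : uniq rs ->
 exists q : {poly F}, forall x, x \in rs -> ('X - x%:P) ^+ M %| q - x%:P.
Proof.
elim: rs => [|x rs IH] /=; first by exists 0.
case/andP => xrs urs; have [q Hq] := IH urs.
pose A : {poly F} := ('X - x%:P) ^+ M.
pose B : {poly F} := \prod_(y <- rs) ('X - y%:P) ^+ M.
have : coprimep A B.
 rewrite /B big_seq; elim/big_rec: _ => [|y p ys cp]; first exact: coprimep1.
 rewrite coprimepMr cp andbT /A; apply: coprimep_expl; apply: coprimep_expr.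
 by rewrite coprimep_XsubC2 // subr_eq0; apply: contraNneq xrs => <-.
case/Bezout_eq1_coprimepP => -[u v] /= E.
exists (q * (u * A) + x%:P * (v * B)) => y; rewrite inE => /orP [/eqP ->|yrs].
 have -> : q * (u * A) + x%:P * (v * B) - x%:P = A * (u * (q - x%:P)).
  by rewrite -[X in _ - X]mulr1 -E; ring.
 exact: dvdp_mulr.
have -> : q * (u * A) + x%:P * (v * B) - y%:P = (q - y%:P) + B * (v * (x%:P - q)).
 by rewrite -[X in X - y%:P + _]mulr1 -E; ring.
apply: dvdp_add; first exact: Hq.
by apply: dvdp_mulr; rewrite /B (big_rem y) //= dvdp_mulr.
Qed.

Lemma prod_coprime_dvd (rs : seq F) M (p : {poly F}) : uniq rs ->
 (forall x, x \in rs -> ('X - x%:P) ^+ M %| p) ->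
 \prod_(x <- rs) ('X - x%:P) ^+ M %| p.
Proof.
elim: rs => [|x rs IH] /=; first by rewrite big_nil dvd1p.
case/andP => xrs urs H; rewrite big_cons Gauss_dvdp; last first.
 rewrite big_seq; elim/big_rec: _ => [|y q ys cp]; first exact: coprimep1.
 rewrite coprimepMr cp andbT; apply: coprimep_expl; apply: coprimep_expr.
 by rewrite coprimep_XsubC2 // subr_eq0; apply: contraNneq xrs => <-.
rewrite H ?mem_head // IH // => y ys; apply: H; by rewrite inE ys orbT.
Qed.

(** By the Chinese remainder theorem some polynomial [q] is congruent to x modulo (X - x)^M for
    every eigenvalue x, and q(X) is the semisimple part. Being a polynomial in [X], it commutes with
    all that commutes with [X]. *)
Lemma jordan n (X : 'M[F]_n) : exists S N : 'M[F]_n,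
 [/\ X = S + N, exists P d, P \in unitmx /\ S = cdiag P d, nilp N &
   forall Z : 'M[F]_n, Z *m X = X *m Z -> Z *m S = S *m Z /\ Z *m N = N *m Z].
Proof.
case: n X => [X|n X].
 exists 0, 0; split; first exact: mx_n0; last by move=> Z; rewrite !mulmx0 !mul0mx.
  by exists 1%:M, (fun=> 0); split; [exact: unitmx1|exact: mx_n0].
 exact: mx_n0.
have [r0 Hr0] := closed_field_poly_normal (char_poly X).
pose rs := undup r0; pose M := size r0.
have urs : uniq rs by exact: undup_uniq.
pose f : {poly F} := \prod_(x <- rs) ('X - x%:P).
have chi0 (q : {poly F}) : (forall x, x \in rs -> ('X - x%:P) ^+ M %| q) -> horner_mx X q = 0.
 move=> /(prod_coprime_dvd urs) Hq.
 have : char_poly X %| q.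
  apply: dvdp_trans Hq; rewrite (monicP (char_poly_monic X)) scale1r in Hr0.
  rewrite Hr0 prodrXl -/f.
  have : all (mem rs) r0 by apply/allP => x xr; rewrite /= /rs mem_undup.
  rewrite /M /f; elim: (r0) => [|x s IH] /=.
   by rewrite big_nil expr0.
  case/andP => xr sr; rewrite big_cons exprS dvdp_mul //; last by apply: IH.
  by rewrite (big_rem x) //= dvdp_mulr.
 case/dvdpP => g ->; by rewrite rmorphM /= Cayley_Hamilton mulr0.
have [q Hq] := crt_roots M urs.
exists (horner_mx X q), (X - horner_mx X q); split.
- by rewrite addrC subrK.
- apply: (@split_diag _ _ _ rs urs).
 transitivity (horner_mx X (f \Po q)).
  rewrite /f rmorph_prod rmorph_prod /=; apply: eq_bigr => x _.
  by rewrite comp_polyB comp_polyX comp_polyC rmorphB /= horner_mx_C.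
 apply: chi0 => x xrs; apply: dvdp_trans (Hq x xrs) _.
 rewrite /f rmorph_prod /= (big_rem x) //= comp_polyB comp_polyX comp_polyC.
 exact: dvdp_mulr.
- apply: (@nilpP _ _ _ M).
 rewrite -{1}(horner_mx_X X) -rmorphB -rmorphXn; apply: chi0 => x xrs.
 have [->|M0] := posnP M; first by rewrite !expr0.
 apply: dvdp_exp2r.
 have -> : 'X - q = ('X - x%:P) - (q - x%:P) by rewrite opprB addrA subrK.
 apply: dvdp_sub => //; apply: dvdp_trans (Hq x xrs).
 by rewrite -(prednK M0) exprS dvdp_mulr.
- move=> Z ZX; have ZS : Z *m horner_mx X q = horner_mx X q *m Z.
  exact: comm_mx_horner.
 by split=> //; rewrite mulmxBr mulmxBl ZS ZX.
Qed.

End Jordan.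

(** * Subspaces given by predicates, and Engel's theorem *)

Section SubVspace.
Variables (F : fieldType) (V : vectType F).

(** A subspace of largest dimension contained in [P] exhausts it, since adjoining the line of one
    more vector would enlarge it. *)
Lemma sub_vspace (P : V -> Prop) : P 0 -> (forall u v, P u -> P v -> P (u + v)) ->
 (forall c u, P u -> P (c *: u)) ->
 exists U : {vspace V}, forall u, u \in U <-> P u.
Proof.
move=> P0 PD PZ.
pose Q (d : nat) := `[< exists U : {vspace V}, (forall u, u \in U -> P u) /\ \dim U = d >].
have ex : exists d, Q d.
 exists 0%N; apply/asboolP; exists 0%VS; rewrite dimv0; split=> // u.
 by rewrite memv0 => /eqP ->.
have ub d : Q d -> (d <= \dim {: V})%N.
 by move=> /asboolP [U [_ <-]]; rewrite dimvS // subvf.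
case: (ex_maxnP ex ub) => d /asboolP [U [UP dU]] dmax.
exists U => u; split; first exact: UP.
move=> Pu; have : Q (\dim (U + <[u]>)).
 apply/asboolP; exists (U + <[u]>)%VS; split=> // w.
 case/memv_addP => u1 /UP Pu1 [u2 /vlineP [c ->] ->].
 by apply: PD => //; apply: PZ.
move/dmax; rewrite -dU => le.
have /eqP E : U == (U + <[u]>)%VS by rewrite eqEdim addvSl le.
by rewrite E; apply: subvP (addvSr _ _) _ (memv_line _).
Qed.

End SubVspace.

Section Engel.
Variables (F : fieldType) (n : nat).

Definition brk (X Y : 'M[F]_n) : 'M[F]_n := X *m Y - Y *m X.

Lemma brkD X Y Z : brk X (Y + Z) = brk X Y + brk X Z.
Proof. by rewrite /brk mulmxDr mulmxDl opprD addrACA. Qed.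
Lemma brkZ X c Y : brk X (c *: Y) = c *: brk X Y.
Proof. by rewrite /brk -scalemxAr -scalemxAl scalerBr. Qed.
Lemma brkC X Y : brk X Y = - brk Y X.
Proof. by rewrite /brk opprB. Qed.
Lemma brkDl X Y Z : brk (X + Y) Z = brk X Z + brk Y Z.
Proof. by rewrite brkC brkD opprD -!brkC. Qed.
Lemma brkZl X c Y : brk (c *: X) Y = c *: brk X Y.
Proof. by rewrite brkC brkZ -scalerN -brkC. Qed.

Lemma brk_jacobi X Y Z : brk (brk X Y) Z = brk X (brk Y Z) - brk Y (brk X Z).
Proof.
rewrite /brk !mulmxBl !mulmxBr !mulmxA !opprB.
move: (X *m Y *m Z) (Y *m X *m Z) (Z *m X *m Y) (Z *m Y *m X) (X *m Z *m Y) (Y *m Z *m X).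
by move=> a b c d e f; apply/matrixP => i j; rewrite !mxE; ring.
Qed.

Lemma iter_ad k (X Y : 'M[F]_n) : exists c : nat -> F,
 iter k (brk X) Y = \sum_(i < k.+1) c i *: (X ^+ i *m Y *m X ^+ (k - i)).
Proof.
elim: k => [|k [c IH]].
 by exists (fun=> 1); rewrite big_ord1 scale1r expr0 mul1mx mulmx1.
exists (fun i => (if i is i'.+1 then c i' else 0) - (if (i <= k)%N then c i else 0)).
rewrite iterS IH /brk mulmx_sumr mulmx_suml.
under [RHS]eq_bigr do rewrite scalerBl.
rewrite sumrB; congr (_ - _).
 rewrite [RHS]big_ord_recl scale0r add0r; apply: eq_bigr => i _.
 by rewrite -scalemxAr !mulmxA /= exprS mxM subSS.
rewrite [RHS]big_ord_recr /= ltnn scale0r addr0; apply: eq_bigr => i _.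
have ik : (i <= k)%N by rewrite -ltnS.
by rewrite ik -scalemxAl -!mulmxA subSn // exprSr mxM.
Qed.

Lemma ad_nilp (X : 'M[F]_n) : nilp X -> forall Y, iter (n + n) (brk X) Y = 0.
Proof.
move=> nX Y; have [c ->] := iter_ad (n + n) X Y; apply: big1 => i _.
have [h|h] := leqP n i; first by rewrite (nilp_ge nX h) !mul0mx scaler0.
by rewrite (@nilp_ge _ _ X (n + n - i)) // ?mulmx0 ?scaler0 //; lia.
Qed.

(** Engel's theorem for an arbitrary nilpotent action and a pair of invariant subspaces U < W. This
    generality lets the induction on the dimension be used twice: for a maximal proper subalgebra M
    acting by brackets on L modulo M, and for M acting on W modulo U. *)
Lemma engel (r : nat) (L : {vspace 'M[F]_n}) : (\dim L <= r)%N ->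
 {in L &, forall X Y, brk X Y \in L} -> {in L, forall X, nilp X} ->
 forall (E : vectType F) (act : 'M[F]_n -> E -> E),
 (forall X c u v, X \in L -> act X (c *: u + v) = c *: act X u + act X v) ->
 (forall u c X Y, X \in L -> Y \in L -> act (c *: X + Y) u = c *: act X u + act Y u) ->
 {in L &, forall X Y u, act (brk X Y) u = act X (act Y u) - act Y (act X u)} ->
 {in L, forall X, exists K, forall u, iter K (act X) u = 0} ->
 forall U W : {vspace E}, (U <= W)%VS -> U != W ->
 {in L, forall X u, u \in U -> act X u \in U} ->
 {in L, forall X u, u \in W -> act X u \in W} ->
 exists v, [/\ v \in W, v \notin U & {in L, forall X, act X v \in U}].
Proof.
elim: r L => [|r IH] L dL Lb Ln E act actD actL actb actn U W UW nUW LU LW.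
 have [v vW vU] : exists2 v, v \in W & v \notin U.
  apply: contrapT => /forall2NP H; case/eqP: nUW; apply/eqP; rewrite eqEsubv UW /=.
  by apply/subvP => v vW; case: (H v) => // /negP; rewrite negbK.
 exists v; split=> // X; move: dL; rewrite leqn0 dimv_eq0 => /eqP -> .
 rewrite memv0 => /eqP ->; have := actL v (-1) 0 0 (mem0v _) (mem0v _).
 by rewrite scaler0 addr0 scaleN1r addNr => ->; exact: mem0v.
have [L0|Ln0] := eqVneq L 0%VS.
 by apply: (IH L) => //; rewrite L0 dimv0.
pose Q (d : nat) := `[< exists M : {vspace 'M[F]_n}, [/\ (M <= L)%VS, M != L,
  {in M &, forall X Y, brk X Y \in M} & \dim M = d] >].
have ex : exists d, Q d.
 exists 0%N; apply/asboolP; exists 0%VS; split; rewrite ?sub0v ?dimv0 1?eq_sym //.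
 by move=> X Y; rewrite !memv0 => /eqP -> _; rewrite /brk mul0mx mulmx0 subrr.
have ub d : Q d -> (d <= \dim L)%N.
 by move=> /asboolP [M [ML _ _ <-]]; exact: dimvS.
case: (ex_maxnP ex ub) => d /asboolP [M [ML nML Mb dM]] dmax.
have dMr : (\dim M <= r)%N.
 rewrite -ltnS; apply: leq_trans dL; rewrite ltn_neqAle dimvS // andbT.
 by apply: contra nML => /eqP e; rewrite eqEdim ML e leqnn.
have inL X : X \in M -> X \in L by exact: (subvP ML).
have [x [xL xM Mx]] : exists x, [/\ x \in L, x \notin M & {in M, forall X, brk X x \in M}].
 apply: (IH M dMr Mb _ 'M[F]_n brk) => //.
 - by move=> X /inL /Ln.
 - by move=> X c u v _; rewrite brkD brkZ.
 - by move=> u c X Y _ _; rewrite brkDl brkZl.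
 - by move=> X Y _ _ u; exact: brk_jacobi.
 - by move=> X /inL /Ln nX; exists (n + n)%N; exact: ad_nilp.
 - by move=> X XM u uM; first [exact: Mb | apply: Lb => //; exact: inL].
 - by move=> X XM u uM; first [exact: Mb | apply: Lb => //; exact: inL].
(* Since [x] normalizes [M], the sum is a subalgebra, and maximality of [M] makes it all of [L]. *)
have LE : L = (M + <[x]>)%VS.
 pose M' := (M + <[x]>)%VS.
 have M'L : (M' <= L)%VS by rewrite subv_add ML /= -memvE.
 apply/eqP; rewrite eq_sym; apply/negPn/negP => nM'.
 have : Q (\dim M').
  apply/asboolP; exists M'; split=> // X Y.
  case/memv_addP => X1 X1M [X2 /vlineP [c1 ->] ->].
  case/memv_addP => Y1 Y1M [Y2 /vlineP [c2 ->] ->].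
  have : brk (X1 + c1 *: x) (Y1 + c2 *: x) \in M.
   rewrite brkD !brkDl !brkZ !brkZl (brkC x Y1) {4}/brk subrr !scaler0 addr0.
   apply: rpredD; last by apply: rpredZ; exact: Mx.
   apply: rpredD; first exact: Mb.
   by apply: rpredZ; rewrite rpredN; exact: Mx.
  exact: subvP (addvSl _ _) _.
 move/dmax; rewrite -dM leqNgt => /negP; apply.
 rewrite ltn_neqAle dimvS ?addvSl // andbT; apply: contra xM => /eqP e.
 have /eqP -> : M == M' by rewrite eqEdim addvSl e leqnn.
 exact: subvP (addvSr _ _) _ (memv_line _).
have [W' HW'] : exists W' : {vspace E}, forall v, v \in W' <-> (v \in W /\ {in M, forall X, act X v \in U}).
 apply: sub_vspace.
 - split; first exact: mem0v.
  move=> X XM; have := actD X (-1) 0 0 (inL _ XM).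
  by rewrite scaler0 addr0 scaleN1r addNr => ->; exact: mem0v.
 - move=> u v [uW uM] [vW vM]; split; first exact: rpredD.
  move=> X XM; have := actD X 1 u v (inL _ XM); rewrite !scale1r => ->.
  by apply: rpredD; [exact: uM|exact: vM].
 - move=> c u [uW uM]; split; first exact: rpredZ.
  move=> X XM; have := actD X c u 0 (inL _ XM); rewrite addr0 => ->.
  apply: rpredD; first by apply: rpredZ; exact: uM.
  have := actD X (-1) 0 0 (inL _ XM).
  by rewrite scaler0 addr0 scaleN1r addNr => ->; exact: mem0v.
have [v0 [v0W v0U v0M]] : exists v, [/\ v \in W, v \notin U & {in M, forall X, act X v \in U}].
 apply: (IH M dMr Mb _ E act) => //.
 - by move=> X /inL /Ln.
 - by move=> X c u v /inL; exact: actD.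
 - by move=> u c X Y /inL XL /inL; exact: actL.
 - by move=> X Y /inL XL /inL YL; exact: actb.
 - by move=> X /inL; exact: actn.
 - by move=> X /inL; exact: LU.
 - by move=> X /inL; exact: LW.
(* The space [W'] of vectors of W killed by M modulo U is stable under [x] because [M, x] lies in M.
   The last iterate of [v0] under [x] that is outside U is then killed modulo U by all of L. *)
have xW' v : v \in W' -> act x v \in W'.
 move/HW' => [vW vM]; apply/HW'; split; first exact: LW.
 move=> X XM; have := actb X x (inL _ XM) xL v; move/eqP.
 rewrite eq_sym subr_eq => /eqP ->; apply: rpredD; first by apply: vM; exact: Mx.
 by apply: LU => //; exact: vM.
have [K HK] := actn x xL.
have ex' : exists k, iter k (act x) v0 \in U by exists K; rewrite HK mem0v.
case: (ex_minnP ex') => k; case: k => [|k]; first by rewrite /= (negPf v0U).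
move=> kU kmin; exists (iter k (act x) v0).
have itW j : iter j (act x) v0 \in W'.
 elim: j => [|j IHj] /=; [by apply/HW'|exact: xW'].
have /HW' [iW iM] := itW k.
split=> //; first by apply/negP => /kmin; rewrite ltnn.
move=> X; rewrite LE => /memv_addP [X1 X1M [X2 /vlineP [c ->] ->]].
rewrite addrC actL //; last by exact: inL.
by apply: rpredD; [apply: rpredZ; rewrite -iterS|exact: iM].
Qed.

Lemma engel_prod (L : {vspace 'M[F]_n}) :
 {in L &, forall X Y, brk X Y \in L} -> {in L, forall X, nilp X} ->
 forall s : seq 'M[F]_n, (n <= size s)%N -> {in s, forall X, X \in L} ->
 \prod_(X <- s) X = 0.
Proof.
move=> Lb Ln.
pose act (X : 'M[F]_n) (v : 'cV[F]_n) := X *m v.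
pose K (U : {vspace 'cV[F]_n}) := {in L, forall X u, u \in U -> act X u \in U}.
have step U : K U -> U != fullv -> exists U', [/\ K U', (\dim U < \dim U')%N &
  {in L, forall X u, u \in U' -> act X u \in U}].
 move=> KU Unf.
 have [v [_ vU vL]] : exists v, [/\ v \in (fullv : {vspace 'cV[F]_n}), v \notin U & {in L, forall X, act X v \in U}].
  apply: (engel (leqnn _) Lb Ln (act := act)) => //; rewrite ?subvf //.
  - by move=> X c u w _; rewrite /act mulmxDr -scalemxAr.
  - by move=> u c X Y _ _; rewrite /act mulmxDl -scalemxAl.
  - by move=> X Y _ _ u; rewrite /act /brk mulmxBl !mulmxA.
  - move=> X /Ln nX; exists n => u.
   have E k : iter k (act X) u = X ^+ k *m u.
    elim: k => [|k IH]; first by rewrite expr0 mul1mx.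
    by rewrite iterS IH /act exprS mxM mulmxA.
   by rewrite E [X ^+ n]nX mul0mx.
  - by move=> X _ u _; exact: memvf.
 exists (U + <[v]>)%VS.
 have A : {in L, forall X u, u \in (U + <[v]>)%VS -> act X u \in U}.
  move=> X XL u /memv_addP [u1 u1U [u2 /vlineP [c ->] ->]].
  rewrite /act mulmxDr -scalemxAr; apply: rpredD; first exact: KU.
  by apply: rpredZ; exact: vL.
 split=> //.
  by move=> X XL u uU; apply: subvP (addvSl _ _) _ _; exact: A.
 rewrite ltn_neqAle dimvS ?addvSl // andbT; apply: contra vU => /eqP e.
 have /eqP -> : U == (U + <[v]>)%VS by rewrite eqEdim addvSl e leqnn.
 exact: subvP (addvSr _ _) _ (memv_line _).
(* The k-th subspace is killed by every product of k elements of L; each step applies Engel modulo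
   the current subspace and raises the dimension, until dimension n is reached. *)
have chain k : (k <= n)%N -> exists U, [/\ K U, (k <= \dim U)%N &
  forall s : seq 'M[F]_n, size s = k -> {in s, forall X, X \in L} ->
   forall u, u \in U -> (\prod_(X <- s) X) *m u = 0].
 elim: k => [|k IHk] kn.
  exists 0%VS; split=> //.
   move=> X _ u; rewrite memv0 => /eqP ->; by rewrite /act mulmx0 mem0v.
  by move=> s _ _ u; rewrite memv0 => /eqP ->; rewrite mulmx0.
 have [U [KU kU sU]] := IHk (ltnW kn).
 have [Uf|Unf] := eqVneq U fullv.
  exists U; split=> //; first by rewrite Uf dimvf /dim /= muln1.
  move=> s; case/lastP: s => // s X; rewrite size_rcons => -[sk] sL u uU.
  rewrite -cats1 big_cat big_seq1 /= mxM -mulmxA sU //.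
   by move=> Y Ys; apply: sL; rewrite mem_rcons inE Ys orbT.
  by apply: KU => //; apply: sL; rewrite mem_rcons mem_head.
 have [U' [KU' dU' LU']] := step U KU Unf.
 exists U'; split=> //; first exact: leq_ltn_trans dU'.
 move=> s; case/lastP: s => // s X; rewrite size_rcons => -[sk] sL u uU.
 rewrite -cats1 big_cat big_seq1 /= mxM -mulmxA sU //.
  by move=> Y Ys; apply: sL; rewrite mem_rcons inE Ys orbT.
 by apply: LU' => //; apply: sL; rewrite mem_rcons mem_head.
have [U [_ nU sU]] := chain n (leqnn n).
have Uf : U = fullv.
 by apply/eqP; rewrite eqEdim subvf dimvf /dim /= muln1 nU.
move=> s ns sL; rewrite -(cat_take_drop n s) big_cat /=.
suff -> : \prod_(X <- take n s) X = 0 by rewrite mul0r.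
apply/row_matrixP => i; apply/rowP => j.
have := sU (take n s) _ _ (delta_mx j 0) _.
rewrite Uf size_takel // => /(_ erefl _ (memvf _)) E.
have := E (fun X XS => sL X (mem_take XS)).
by move/colP/(_ i); rewrite -colE !mxE => ->.
Qed.

End Engel.

(** * Regular functions and Zariski closure *)

Section Regular.
Variables (F : fieldType) (n : nat).
Implicit Types (S A Z : set 'M[F]_n) (p : {mpoly F[n * n]}).

Definition GLset : set 'M[F]_n := [set g | g \in unitmx].

Definition mxvar : 'M[{mpoly F[n * n]}]_n := \matrix_(i, j) 'X_(mxvec_index i j).

Lemma mxeval_var g i j : mxeval (mxvar i j) g = g i j.
Proof. by rewrite /mxeval mxE mevalXU mxvecE. Qed.
Lemma mxevalM p q g : mxeval (p * q) g = mxeval p g * mxeval q g.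
Proof. exact: mevalM. Qed.
Lemma mxevalD p q g : mxeval (p + q) g = mxeval p g + mxeval q g.
Proof. exact: mevalD. Qed.
Lemma mxevalZ c p g : mxeval (c *: p) g = c * mxeval p g.
Proof. exact: mevalZ. Qed.

Lemma mxeval_sum (I : Type) (s : seq I) (P : pred I) (q : I -> {mpoly F[n * n]}) g :
 mxeval (\sum_(i <- s | P i) q i) g = \sum_(i <- s | P i) mxeval (q i) g.
Proof. by rewrite /mxeval raddf_sum. Qed.
Lemma mxevalX p k g : mxeval (p ^+ k) g = mxeval p g ^+ k.
Proof. by rewrite /mxeval rmorphXn. Qed.

Lemma mxeval_det g : mxeval (\det mxvar) g = \det g.
Proof.
rewrite /mxeval -det_map_mx; congr (\det _); apply/matrixP => i j.
by rewrite mxE -[LHS]/(mxeval _ _) mxeval_var.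
Qed.

Lemma regular_const S c : regular_on S (fun=> c).
Proof. by exists c%:MP, 0%N => g _; rewrite expr0 divr1 /mxeval mevalC. Qed.
Lemma regular_entry S i j : regular_on S (fun g => g i j).
Proof. by exists (mxvar i j), 0%N => g _; rewrite expr0 divr1 mxeval_var. Qed.
Lemma regular_eq S f h : (forall g, S g -> f g = h g) -> regular_on S f -> regular_on S h.
Proof. by move=> E [p [e H]]; exists p, e => g Sg; rewrite -E // H. Qed.
Lemma regular_sub S S' f : S' `<=` S -> regular_on S f -> regular_on S' f.
Proof. by move=> E [p [e H]]; exists p, e => g /E; exact: H. Qed.

Lemma regularM S f h : regular_on S f -> regular_on S h ->
 regular_on S (fun g => f g * h g).
Proof.
move=> [p [e Hp]] [q [d Hq]]; exists (p * q), (e + d)%N => g Sg.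
by rewrite Hp // Hq // mxevalM exprD invfM mulrACA.
Qed.

Variable S : set 'M[F]_n.
Hypothesis SU : S `<=` GLset.

Lemma det_neq0 g : S g -> \det g != 0.
Proof. by move=> /SU; rewrite /GLset /= unitmxE unitfE. Qed.

Lemma regularD f h : regular_on S f -> regular_on S h ->
 regular_on S (fun g => f g + h g).
Proof.
move=> [p [e Hp]] [q [d Hq]].
exists (p * (\det mxvar) ^+ d + q * (\det mxvar) ^+ e), (e + d)%N => g Sg.
rewrite Hp // Hq // mxevalD !mxevalM !mxevalX mxeval_det exprD.
have D := det_neq0 Sg.
by field; rewrite !expf_neq0.
Qed.

Lemma regularZ c f : regular_on S f -> regular_on S (fun g => c * f g).
Proof. by move=> rf; apply: regularM => //; exact: regular_const. Qed.

Lemma regular_sum (I : Type) (s : seq I) (P : pred I) (f : I -> 'M[F]_n -> F) :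
 (forall i, regular_on S (f i)) -> regular_on S (fun g => \sum_(i <- s | P i) f i g).
Proof.
move=> rf; elim: s => [|a s IH].
 by apply: regular_eq (regular_const S 0) => g _; rewrite big_nil.
case Pa: (P a); last by apply: regular_eq IH => g _; rewrite big_cons Pa.
apply: regular_eq (regularD (rf a) IH) => g _; by rewrite big_cons Pa.
Qed.

Lemma regular_prod (I : Type) (s : seq I) (P : pred I) (f : I -> 'M[F]_n -> F) :
 (forall i, regular_on S (f i)) -> regular_on S (fun g => \prod_(i <- s | P i) f i g).
Proof.
move=> rf; elim: s => [|a s IH].
 by apply: regular_eq (regular_const S 1) => g _; rewrite big_nil.
case Pa: (P a); last by apply: regular_eq IH => g _; rewrite big_cons Pa.
apply: regular_eq (regularM (rf a) IH) => g _; by rewrite big_cons Pa.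
Qed.

Lemma regularX f k : regular_on S f -> regular_on S (fun g => f g ^+ k).
Proof.
move=> rf; elim: k => [|k IH].
 by apply: regular_eq (regular_const S 1) => g _; rewrite expr0.
by apply: regular_eq (regularM rf IH) => g _; rewrite exprS.
Qed.

Lemma regular_meval (m : nat) (q : {mpoly F[m]}) (f : 'I_m -> 'M[F]_n -> F) :
 (forall k, regular_on S (f k)) -> regular_on S (fun g => q.@[fun k => f k g]).
Proof.
move=> rf; apply: (@regular_eq _ (fun g => \sum_(m <- msupp q) q@_m * \prod_i f i g ^+ m i)).
 by move=> g _; rewrite mevalE.
apply: regular_sum => k; apply: regularZ; apply: regular_prod => i; exact: regularX.
Qed.

Lemma regular_det (m : nat) (f : 'M[F]_n -> 'M[F]_m) :
 (forall i j, regular_on S (fun g => f g i j)) -> regular_on S (fun g => \det (f g)).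
Proof.
move=> rf; rewrite /determinant; apply: regular_sum => s; apply: regularZ.
by apply: regular_prod => i.
Qed.

Lemma regular_detV : regular_on S (fun g => (\det g)^-1).
Proof. by exists 1, 1%N => g _; rewrite /mxeval meval1 div1r expr1. Qed.

Lemma regular_mulmx (a b c : nat) (f : 'M[F]_n -> 'M[F]_(a, b)) (h : 'M[F]_n -> 'M[F]_(b, c)) :
 (forall i j, regular_on S (fun g => f g i j)) ->
 (forall i j, regular_on S (fun g => h g i j)) ->
 forall i j, regular_on S (fun g => (f g *m h g) i j).
Proof.
move=> rf rh i j.
apply: (@regular_eq _ (fun g => \sum_k f g i k * h g k j)).
 by move=> g _; rewrite mxE.
by apply: regular_sum => k; apply: regularM.
Qed.

Lemma regular_mulmxl (a b : nat) (A : 'M[F]_(a, b)) c (h : 'M[F]_n -> 'M[F]_(b, c)) :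
 (forall i j, regular_on S (fun g => h g i j)) ->
 forall i j, regular_on S (fun g => (A *m h g) i j).
Proof. by apply: regular_mulmx => i j; exact: regular_const. Qed.

Lemma regular_mulmxr (a b c : nat) (A : 'M[F]_(b, c)) (h : 'M[F]_n -> 'M[F]_(a, b)) :
 (forall i j, regular_on S (fun g => h g i j)) ->
 forall i j, regular_on S (fun g => (h g *m A) i j).
Proof. by move=> rh; apply: regular_mulmx => // i j; exact: regular_const. Qed.

Lemma regular_invmx i j : regular_on S (fun g => invmx g i j).
Proof.
apply: (@regular_eq _ (fun g => (\det g)^-1 * ((-1) ^+ (j + i) *
  \det (row' j (col' i g))))).
 by move=> g Sg; rewrite /invmx; move: (SU Sg); rewrite /GLset /= => ->; rewrite !mxE.
apply: regularM; first exact: regular_detV.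
apply: regularZ; apply: regular_det => k l.
by apply: (@regular_eq _ (fun g => g (lift j k) (lift i l))) (regular_entry _ _ _) => g _; rewrite !mxE.
Qed.

End Regular.

Section Closure.
Variables (F : fieldType) (n : nat).
Implicit Types (S A Z : set 'M[F]_n) (p : {mpoly F[n * n]}).
Local Notation GLset := (@GLset F n).

Definition vanishes_on A p := forall a, A a -> mxeval p a = 0.

Definition zcl A : set 'M[F]_n :=
 [set g | g \in unitmx /\ forall p, vanishes_on A p -> mxeval p g = 0].

Lemma sub_zcl A : A `<=` GLset -> A `<=` zcl A.
Proof. by move=> AU g Ag; split; [exact: AU|move=> p; exact]. Qed.
Lemma zcl_closed A : zariski_closed (zcl A).
Proof. by exists (vanishes_on A). Qed.
Lemma zcl_vanish A p : vanishes_on A p -> vanishes_on (zcl A) p.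
Proof. by move=> pA g [_]; apply. Qed.

Lemma zcl_min A Z : zariski_closed Z -> A `<=` Z -> zcl A `<=` Z.
Proof.
move=> [E ->] AE g [gu H]; split=> // p Ep; apply: H => a /AE [_]; exact.
Qed.

Lemma closed_unit Z : zariski_closed Z -> Z `<=` GLset.
Proof. by move=> [E ->] g []. Qed.

Lemma closed_zcl Z : zariski_closed Z -> zcl Z = Z.
Proof.
move=> Zc; apply/seteqP; split; first exact: zcl_min.
by apply: sub_zcl; exact: closed_unit.
Qed.

(** The closure is defined by polynomials; a regular function differs from one by a power of the
    determinant, which is invertible on [A]. Closure arguments therefore extend to functions such as
    matrix inversion. *)
Lemma zcl_regular A f : A `<=` GLset -> regular_on GLset f ->
 (forall a, A a -> f a = 0) -> forall g, zcl A g -> f g = 0.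
Proof.
move=> AU [p [e H]] fA g [gu Hg]; rewrite H // Hg ?mul0r // => a Aa.
have := fA a Aa; rewrite H; last exact: AU.
move/eqP; rewrite mulf_eq0 invr_eq0 => /orP [/eqP //|].
rewrite expf_eq0 => /andP [_]; have := AU _ Aa.
by rewrite /GLset /= unitmxE unitfE => /negP.
Qed.

Lemma closed_regular (Fam : set ('M[F]_n -> F)) :
 (forall f, Fam f -> regular_on GLset f) ->
 zariski_closed [set g | g \in unitmx /\ forall f, Fam f -> f g = 0].
Proof.
move=> rF; exists [set p | forall g, g \in unitmx ->
  (forall f, Fam f -> f g = 0) -> mxeval p g = 0].
apply/seteqP; split=> g [gu H]; split=> //.
 by move=> p; apply.
move=> f Ff; have [p [e Hf]] := rF f Ff; rewrite Hf // H ?mul0r // => h hu Hh.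
have := Hh f Ff; rewrite Hf // => /eqP; rewrite mulf_eq0 invr_eq0 => /orP [/eqP //|].
by rewrite expf_eq0 => /andP [_]; move: hu; rewrite unitmxE unitfE => /negP.
Qed.

Lemma subGL : GLset `<=` GLset. Proof. by []. Qed.

Lemma regular_trans p (g h : 'M[F]_n) : regular_on GLset (fun x => mxeval p (g *m x *m h)).
Proof.
apply: (@regular_meval _ _ GLset subGL _ p (fun k x => mxvec (g *m x *m h) 0 k)) => k.
case/mxvec_indexP: k => i j.
apply: (@regular_eq _ _ _ (fun x => (g *m x *m h) i j)); first by move=> x _; rewrite mxvecE.
apply: regular_mulmxr => //; apply: regular_mulmxl => //; exact: regular_entry.
Qed.

(** Multiplication is treated one argument at a time: translation by an element of [A] is regular
    and preserves [A], hence its closure; then an element of the closure is fixed on the right and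
    the same argument runs on the left. *)
Lemma zcl_subgroup A : subgroup A -> subgroup (zcl A).
Proof.
move=> [AU A1 AM AV].
have AU' : A `<=` GLset by [].
have zAM a g : A a -> zcl A g -> zcl A (a *m g).
 move=> Aa zg; split; first by rewrite unitmx_mul AU // zg.1.
 move=> p pA; rewrite -[a *m g]mulmx1.
 apply: (zcl_regular AU' (regular_trans p a 1%:M)) zg => b Ab.
 by rewrite mulmx1; apply: pA; exact: AM.
split.
- by move=> g [].
- exact: sub_zcl.
- move=> g h zg zh; split; first by rewrite unitmx_mul zg.1 zh.1.
 move=> p pA; rewrite -[g]mul1mx.
 apply: (zcl_regular AU' (regular_trans p 1%:M h)) zg => b Ab.
 by rewrite mul1mx; apply: (zAM b h Ab zh).2.
- move=> g zg; split; first by rewrite unitmx_inv zg.1.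
 move=> p pA.
 have rp : regular_on GLset (fun x => mxeval p (invmx x)).
  apply: (@regular_meval _ _ GLset subGL _ p (fun k x => mxvec (invmx x) 0 k)) => k.
  case/mxvec_indexP: k => i j.
  apply: (@regular_eq _ _ _ (fun x => invmx x i j)); first by move=> x _; rewrite mxvecE.
  exact: regular_invmx.
 by apply: (zcl_regular AU' rp) zg => b Ab; apply: pA; exact: AV.
Qed.

End Closure.

(** * The Lie algebra of a matrix group *)

Section Chain.
Variables (F : fieldType) (A : comAlgType F) (N : nat).

Definition ev (h : 'I_N -> A) (p : {mpoly F[N]}) : A := mmap (in_alg A) h p.

Variable d : A -> A.
Hypotheses (dD : forall a b, d (a + b) = d a + d b) (dZ : forall c a, d (c *: a) = c *: d a)
 (dM : forall a b, d (a * b) = d a * b + a * d b).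
Variable h : 'I_N -> A.

(** An abstract derivation is taken because the rule serves both for the derivative of one-variable
    polynomials and for the vector field along the exponential curve. The polynomials satisfying it
    contain the variables and are closed under linear combinations and products. *)
Lemma chain_rule p : d (ev h p) = \sum_k ev h p^`M(k) * d (h k).
Proof.
pose C q := d (ev h q) = \sum_k ev h q^`M(k) * d (h k).
have evD q r : ev h (q + r) = ev h q + ev h r by exact: mmapD.
have evZ c q : ev h (c *: q) = c *: ev h q.
 by rewrite /ev mmapZ; rewrite /= mulr_algl.
have evM q r : ev h (q * r) = ev h q * ev h r by rewrite /ev rmorphM.
have CD q r : C q -> C r -> C (q + r).
 move=> Cq Cr; rewrite /C evD dD Cq Cr -big_split; apply: eq_bigr => k _.
 by rewrite mderivD evD mulrDl.
have CZ c q : C q -> C (c *: q).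
 move=> Cq; rewrite /C evZ dZ Cq scaler_sumr; apply: eq_bigr => k _.
 by rewrite mderivZ evZ scalerAl.
have CM q r : C q -> C r -> C (q * r).
 move=> Cq Cr; rewrite /C evM dM Cq Cr mulr_suml mulr_sumr -big_split /=.
 apply: eq_bigr => k _; rewrite mderivM evD !evM mulrDl.
 by rewrite mulrAC mulrA.
have d1 : d 1 = 0.
 by apply: (addrI (d 1)); rewrite addr0 -{3}[1](mulr1 1) dM mulr1 mul1r.
have C1 : C 1.
 rewrite /C /ev rmorph1 d1 big1 // => k _.
 by rewrite -mpolyC1 mderivC mmap0 mul0r.
have CX k : C 'X_k.
 rewrite /C (bigD1 k) //= big1 ?addr0.
  rewrite mderivX mnmE eqxx scale1r (_ : (_ - _)%MM = 0%MM); last first.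
   by apply/mnmP => i; rewrite mnmBE mnm0E subnn.
  by rewrite mpolyX0 /ev rmorph1 mul1r mmapX mmap1U.
 by move=> j jk; rewrite mderivX mnmE eq_sym (negPf jk) scale0r /ev mmap0 mul0r.
have CXm m : C 'X_[m].
 rewrite mpolyXE_id; elim/big_ind: _ => //= i _.
 by elim: (m i) => [|k IH]; rewrite ?expr0 // exprS; apply: CM.
elim/mpolyind: p => [|c m p _ _ Cp]; last by apply: CD => //; apply: CZ.
by rewrite -/(C 0) -(scale0r 1); apply: CZ.
Qed.

End Chain.

Section LieSpace.
Variables (F : numFieldType) (n : nat).
Implicit Types (G : set 'M[F]_n) (p : {mpoly F[n * n]}) (X Y g h : 'M[F]_n).

Definition dp p g X : F := \sum_k mxvec X 0 k * mxeval p^`M(k) g.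

Lemma ev_horner (N : nat) (h : 'I_N -> {poly F}) (q : {mpoly F[N]}) c :
 (ev h q).[c] = q.@[fun k => (h k).[c]].
Proof.
rewrite /ev; elim/mpolyind: q => [|a m q _ _ IH].
 by rewrite mmap0 meval0 horner0.
rewrite mmapD mmapZ mevalD mevalZ hornerD IH /= mulr_algl hornerZ.
rewrite mmapX mevalX /mmap1 horner_prod; congr (_ * _ + _).
by apply: eq_bigr => i _; rewrite horner_exp.
Qed.

Lemma dpE p g X : exists P : {poly F},
 (forall c, P.[c] = mxeval p (g + c *: X)) /\ P^`().[0] = dp p g X.
Proof.
pose h k : {poly F} := (mxvec g 0 k)%:P + (mxvec X 0 k) *: 'X.
exists (ev h p); split=> [c|].
 rewrite ev_horner /mxeval; apply: meval_eq => k; rewrite /h !hornerE.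
 by rewrite linearD linearZ !mxE mulrC.
rewrite (@chain_rule _ _ _ (fun q => q^`())); last 3 first.
- by move=> a b; rewrite derivD.
- by move=> c a; rewrite derivZ.
- by move=> a b; rewrite derivM.
rewrite horner_sum /dp; apply: eq_bigr => k _.
rewrite hornerM ev_horner mulrC /h derivD derivC add0r derivZ derivX alg_polyC hornerC.
by congr (_ * _); apply: meval_eq => i; rewrite !hornerE.
Qed.

Lemma dp_unique p g X (P : {poly F}) :
 (forall c, P.[c] = mxeval p (g + c *: X)) -> P^`().[0] = dp p g X.
Proof.
move=> H; have [Q [HQ <-]] := dpE p g X; congr (_^`().[0]).
by apply: poly_ext => c; rewrite H HQ.
Qed.

Lemma Lie_curve G (g : F -> 'M[F]_n) (gp : 'I_n -> 'I_n -> {poly F}) :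
 (forall c i j, (gp i j).[c] = g c i j) -> (forall c, G (g c)) -> g 0 = 1%:M ->
 Lie G (\matrix_(i, j) (gp i j)^`().[0]).
Proof.
move=> Hgp Gg g0 p Hp.
pose h (k : 'I_(n * n)) : {poly F} := mxvec (\matrix_(i, j) gp i j) 0 k.
have hE c k : (h k).[c] = mxvec (g c) 0 k.
 by case/mxvec_indexP: k => i j; rewrite /h !mxvecE mxE Hgp.
have E0 : ev h p = 0.
 apply: poly_ext => c; rewrite horner0 ev_horner -(Hp (g c)) //.
 by apply: meval_eq => k; rewrite hE.
have := congr1 (fun q : {poly F} => q^`().[0]) E0.
rewrite (@chain_rule _ _ _ (fun q => q^`())); last 3 first.
- by move=> a b; rewrite derivD.
- by move=> c a; rewrite derivZ.
- by move=> a b; rewrite derivM.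
rewrite deriv0 horner0 horner_sum => E; apply: etrans E; apply: eq_bigr => k _.
rewrite hornerM ev_horner mulrC; congr (_ * _).
 by apply: meval_eq => i; rewrite hE g0.
by case/mxvec_indexP: k => i j; rewrite /h !mxvecE !mxE.
Qed.

Lemma LieP G X : Lie G X <-> forall p, vanishes_on G p -> dp p 1%:M X = 0.
Proof. by []. Qed.
Lemma Lie0 G : Lie G 0.
Proof. by move=> p _; apply: big1 => k _; rewrite linear0 mxE mul0r. Qed.

Lemma LieD G X Y : Lie G X -> Lie G Y -> Lie G (X + Y).
Proof.
move=> HX HY p Hp.
transitivity (dp p 1%:M X + dp p 1%:M Y); last by rewrite [dp _ _ X]HX // [dp _ _ _]HY // addr0.
rewrite -big_split; by apply: eq_bigr => k _; rewrite linearD mxE mulrDl.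
Qed.

Lemma LieZ G c X : Lie G X -> Lie G (c *: X).
Proof.
move=> HX p Hp; transitivity (c * dp p 1%:M X); last by rewrite [dp _ _ _]HX // mulr0.
rewrite mulr_sumr; by apply: eq_bigr => k _; rewrite linearZ mxE mulrA.
Qed.

Lemma Lie_sum G (I : Type) (s : seq I) (P : pred I) (X : I -> 'M[F]_n) :
 (forall i, P i -> Lie G (X i)) -> Lie G (\sum_(i <- s | P i) X i).
Proof. by move=> H; elim/big_rec: _ => [|i Y Pi LY]; [exact: Lie0|apply: LieD => //; exact: H]. Qed.

Lemma Lie_vspace G : exists L : {vspace 'M[F]_n}, forall X, X \in L <-> Lie G X.
Proof.
apply: sub_vspace; first exact: Lie0; first by move=> u v; exact: LieD.
by move=> c u; exact: LieZ.
Qed.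

Lemma poly_trans p (g h : 'M[F]_n) : exists q, forall x, mxeval q x = mxeval p (g *m x *m h).
Proof.
pose lq : 'M[{mpoly F[n * n]}]_n := map_mx (@mpolyC _ _) g *m mxvar F n *m map_mx (@mpolyC _ _) h.
exists (mmap (@mpolyC _ _) (fun k => mxvec lq 0 k) p) => x.
rewrite /mxeval /mmap raddf_sum /= [RHS]mevalE; apply: eq_bigr => m _.
rewrite rmorphM /= mevalC; congr (_ * _).
rewrite /mmap1 rmorph_prod /=; apply: eq_bigr => k _.
rewrite rmorphXn /=; congr (_ ^+ _).
case/mxvec_indexP: k => i j; rewrite !mxvecE /lq !mxE rmorph_sum /=.
apply: eq_bigr => l _; rewrite !mxE rmorphM /= mevalC rmorph_sum /=; congr (_ * _).
apply: eq_bigr => u _; rewrite !mxE rmorphM /= mevalC mevalXU mxvecE //.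
Qed.

Lemma dp_trans p q (g h X : 'M[F]_n) :
 (forall x, mxeval q x = mxeval p (g *m x *m h)) ->
 dp q 1%:M X = dp p (g *m h) (g *m X *m h).
Proof.
move=> H; have [P [HP <-]] := dpE q 1%:M X; apply: dp_unique => c.
by rewrite HP H mulmxDr mulmxDl mulmx1 -scalemxAr -scalemxAl.
Qed.

Lemma Lie_conj G g X : subgroup G -> G g -> Lie G X -> Lie G (g *m X *m invmx g).
Proof.
move=> [GU G1 GM GV] Gg /LieP HX; apply/LieP => p Hp.
have [q Hq] := poly_trans p g (invmx g).
have := dp_trans X Hq; rewrite mulmxV; last exact: GU.
move=> <-; apply: HX => x Gx; rewrite Hq; apply: Hp.
by apply: (GM); [exact: GM|exact: GV].
Qed.

Lemma dp_left G g X p : subgroup G -> G g -> Lie G X -> vanishes_on G p ->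
 dp p g (g *m X) = 0.
Proof.
move=> [GU G1 GM GV] Gg /LieP HX Hp.
have [q Hq] := poly_trans p g 1%:M.
have := dp_trans X Hq; rewrite !mulmx1 => <-; apply: HX => x Gx; rewrite Hq mulmx1.
by apply: Hp; exact: GM.
Qed.

(* The left-invariant derivation with value X at 1. *)
Definition lder X p : {mpoly F[n * n]} :=
 \sum_k p^`M(k) * mxvec (mxvar F n *m map_mx (@mpolyC _ _) X) 0 k.

Lemma mxeval_lder X p g : mxeval (lder X p) g = dp p g (g *m X).
Proof.
rewrite /lder mxeval_sum /dp; apply: eq_bigr => k _.
rewrite mxevalM mulrC; congr (_ * _).
case/mxvec_indexP: k => i j; rewrite !mxvecE !mxE mxeval_sum.
apply: eq_bigr => l _; rewrite mxevalM; congr (_ * _); first by rewrite -mxeval_var.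
by rewrite mxE /mxeval mevalC.
Qed.

(** The ideal of [G] is stable under the left-invariant derivations given by tangent vectors;
    iterating this controls all Taylor coefficients along the curve exp(tX). *)
Lemma lder_vanish G X p : subgroup G -> Lie G X -> vanishes_on G p ->
 vanishes_on G (lder X p).
Proof. by move=> sG HX Hp g Gg; rewrite mxeval_lder (dp_left sG Gg HX Hp). Qed.

Lemma Lie_expm G X : nilp X -> (forall c, G (expm (c *: X))) -> Lie G X.
Proof.
move=> nX H.
pose gp i j : {poly F} := \sum_(k < n.+2) ((k`!%:R)^-1 * (X ^+ k) i j) *: 'X^k.
have gpE c i j : (gp i j).[c] = expm (c *: X) i j.
 rewrite (expmE (K := n.+2)); [|exact: nilpZ|by lia].
 rewrite summxE horner_sum; apply: eq_bigr => k _.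
 by rewrite exprZmx scalerA mxE hornerZ hornerXn; ring.
have := Lie_curve gpE H; rewrite scale0r expm0 => /(_ erefl).
congr Lie; apply/matrixP => i j; rewrite mxE horner_coef0 coef_deriv /gp coef_sum.
rewrite !big_ord_recl big1 ?addr0; last by move=> k _; rewrite coefZ coefXn /= mulr0.
by rewrite !coefZ !coefXn /= mulr0 add0r expr1 invr1 mul1r mulr1.
Qed.

(** The conjugation curve is polynomial in c with linear coefficient [X, Y], and a subspace
    containing all values of a polynomial curve contains its coefficients. *)
Lemma brk_mem (L : {vspace 'M[F]_n}) X Y : nilp X ->
 (forall c, expm (c *: X) *m Y *m expm (- (c *: X)) \in L) -> brk X Y \in L.
Proof.
move=> nX H.
(* [f] has kernel [L], which turns membership into the vanishing of a polynomial. *)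
pose f : 'End('M[F]_n) := (\1 - projv L)%VF.
have fL Z : Z \in L <-> f Z = 0.
 rewrite /f lfunE /= opp_lfunE id_lfunE; split=> [ZL|/eqP].
  by rewrite projv_id // subrr.
 by rewrite subr_eq0 => /eqP ->; exact: memv_proj.
apply/fL.
pose C K (M : nat -> 'M[F]_n) c := \sum_(k < K) c ^+ k *: M k.
pose e k := (k`!%:R)^-1 *: X ^+ k.
have eE c : expm (c *: X) = C n.+2 e c.
 rewrite (expmE (K := n.+2)); [|exact: nilpZ|by lia].
 by apply: eq_bigr => k _; rewrite exprZmx /e scalerA mulrC -scalerA.
have eN c : expm (- (c *: X)) = C n.+2 (fun k => (-1) ^+ k *: e k) c.
 rewrite -scaleNr eE; apply: eq_bigr => k _.
 by rewrite [RHS]scalerA -exprMn mulrN1.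
pose M k := \sum_(i < n.+2) \sum_(j < n.+2 | (i + j == k)%N) (-1) ^+ j *: (e i *m Y *m e j).
have E c : expm (c *: X) *m Y *m expm (- (c *: X)) = C (n.+2 + n.+2)%N M c.
 rewrite eE eN /C !mulmx_suml /M.
 under [RHS]eq_bigr do rewrite scaler_sumr.
 rewrite [RHS]exchange_big /=; apply: eq_bigr => i _.
 rewrite mulmx_sumr; under [RHS]eq_bigr do rewrite scaler_sumr.
 rewrite (exchange_big_dep xpredT) //=; apply: eq_bigr => j _.
 have ij : (i + j < n.+2 + n.+2)%N by rewrite -addSn leq_add // ltnW.
 rewrite (big_pred1 (Ordinal ij)); last first.
  by move=> k /=; rewrite -val_eqE /= eq_sym.
 rewrite -!scalemxAl -!scalemxAr !scalerA /= exprD; congr (_ *: _); ring.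
have M1 : M 1%N = brk X Y.
 rewrite /M !big_ord_recl /= [X in _ + (_ + X)]big1; last first.
  by move=> i _; rewrite big1.
 rewrite addr0 (big_pred1 (lift ord0 ord0)); last by move=> j; rewrite /= -val_eqE.
 rewrite (big_pred1 ord0); last by move=> j; rewrite /= -val_eqE /= /bump add1n eqSS.
 rewrite /= /bump /= /e fact0 invr1 !scale1r expr0 mul1mx mulmx1 add1n expr1.
 by rewrite !expr1 scaleN1r /brk addrC.
rewrite -M1; apply: (mx_poly_ext0 (K := (n.+2 + n.+2)%N) (A := fun k => f (M k)) (B := fun=> 0)) => //.
move=> c _; rewrite [RHS]big1; last by move=> k _; rewrite scaler0.
have /fL := H c; rewrite E /C linear_sum /= => H'.
by apply: etrans H'; apply: eq_bigr => k _; rewrite linearZ.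
Qed.

End LieSpace.

Section GroupSum.
Variables (F : fieldType) (I K : eqType) (s : seq I) (key : I -> K).

Lemma big_by_key (v : I -> F) :
 \sum_(m <- s) v m = \sum_(x <- undup (map key s)) \sum_(m <- s | key m == x) v m.
Proof.
under [RHS]eq_bigr do rewrite big_mkcond.
rewrite exchange_big /= big_seq [RHS]big_seq; apply: eq_bigr => m ms.
rewrite (bigD1_seq (key m)) ?undup_uniq //=; last by rewrite mem_undup map_f.
rewrite eqxx big1 ?addr0 // => x.
by rewrite eq_sym => /negPf ->.
Qed.

Lemma group_sum0 (a v : I -> F) :
 (forall x, \sum_(m <- s | key m == x) a m = 0) ->
 (forall m m', m \in s -> m' \in s -> key m = key m' -> v m = v m') ->
 \sum_(m <- s) a m * v m = 0.
Proof.
move=> a0 vk; rewrite big_by_key big_seq big1 // => x.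
rewrite mem_undup => /mapP [m0 m0s ->].
rewrite -[RHS](mul0r (v m0)) -[in RHS](a0 (key m0)) mulr_suml.
rewrite big_seq_cond [RHS]big_seq_cond; apply: eq_bigr => m /andP [ms /eqP km].
by rewrite (vk m m0).
Qed.

End GroupSum.

Lemma conj_mul3 (R : pzRingType) n (U V D L : 'M[R]_n) : V *m U = 1%:M ->
 (U *m D *m V) *m (U *m L *m V) = U *m (D *m L) *m V.
Proof.
by move=> VU; rewrite !mulmxA -(mulmxA (U *m D) V U) VU mulmx1.
Qed.

Lemma diag_mxE (R : pzRingType) n (v : 'rV[R]_n) i j : diag_mx v i j = v 0 i *+ (i == j).
Proof. by rewrite mxE. Qed.

Notation int_free r mu :=
 (forall y : 'I_r -> int, \sum_j (y j)%:~R * mu j = 0 -> forall j, y j = 0).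

(** * Exponentials and replicas of Lie algebra elements *)

Section ExpCurve.
Variables (F : numFieldType) (n : nat) (Q : 'M[F]_n) (lam : 'I_n -> F) (N : 'M[F]_n).
Hypotheses (Qu : Q \in unitmx) (nN : nilp N).
Let S := cdiag Q lam.
Hypothesis SN : S *m N = N *m S.
Local Notation A := {mpoly F[n.+1]}.
Local Notation Cm := (map_mx (@mpolyC n.+1 F)).
Let X := S + N.

Let xv (i : 'I_n) : A := 'X_(lift ord_max i).
Let tv : A := 'X_ord_max.
Let E : 'M[A]_n := \sum_(l < n) tv ^+ l *: Cm ((l`!%:R)^-1 *: N ^+ l).
Let Dx : 'M[A]_n := Cm (invmx Q) *m diag_mx (\row_i xv i) *m Cm Q.
(** The curve exp(tX), with the functions exp(lam_i t) replaced by independent variables and t by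
    one further variable, so that it becomes polynomial. *)
Let gam : 'M[A]_n := Dx *m E.

Definition pt (x : 'I_n -> F) (tau : F) (k : 'I_n.+1) : F :=
 if unlift ord_max k is Some i then x i else tau.

Lemma pt_lift x tau i : pt x tau (lift ord_max i) = x i.
Proof. by rewrite /pt liftK. Qed.
Lemma pt_max x tau : pt x tau ord_max = tau.
Proof. by rewrite /pt unlift_none. Qed.
Lemma map_Cm v (M : 'M[F]_n) : map_mx (meval v) (Cm M) = M.
Proof. by apply/matrixP => i j; rewrite !mxE mevalC. Qed.

Lemma gam_pt x tau : map_mx (meval (pt x tau)) gam = cdiag Q x *m expm (tau *: N).
Proof.
rewrite /gam /Dx !map_mxM !map_Cm map_diag_mx; congr (_ *m _ *m _ *m _).
 by congr diag_mx; apply/rowP => i; rewrite !mxE /= /xv mevalXU pt_lift.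
rewrite /E raddf_sum; apply: eq_bigr => l _ /=.
rewrite map_mxZ map_Cm rmorphXn /= mevalXU pt_max exprZmx !scalerA.
by rewrite mulrC.
Qed.

(** The derivation d/dt in these variables: it multiplies x_i by lam_i, since x_i stands for
    exp(lam_i t), and takes the value 1 on the time variable. *)
Let d (a : A) : A :=
 \sum_i lam i *: (xv i * a^`M(lift ord_max i)) + a^`M(ord_max).

Let dD a b : d (a + b) = d a + d b.
Proof.
rewrite /d mderivD addrACA -big_split; congr (_ + _); apply: eq_bigr => i _.
by rewrite mderivD mulrDr scalerDr.
Qed.

Let dZ c a : d (c *: a) = c *: d a.
Proof.
rewrite /d [RHS]scalerDr mderivZ.
congr (_ + _).
rewrite [RHS]scaler_sumr; apply: eq_bigr => i _.
by rewrite mderivZ -scalerAr !scalerA mulrC.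
Qed.

Let dM a b : d (a * b) = d a * b + a * d b.
Proof.
rewrite /d mderivM mulrDl mulrDr addrACA; congr (_ + _).
rewrite mulr_suml mulr_sumr -big_split; apply: eq_bigr => i _.
rewrite mderivM mulrDr scalerDr -scalerAl -scalerAr !mulrA; congr (_ + _ *: _).
by rewrite [xv i * a]mulrC.
Qed.

Let d0 : d 0 = 0.
Proof. by rewrite -(scale0r (0 : A)) dZ !scale0r. Qed.

Let dC c : d c%:MP = 0.
Proof.
rewrite /d mderivC addr0 big1 // => i _.
by rewrite mderivC mulr0 scaler0.
Qed.

Let d_sum (I : Type) (s : seq I) (P : pred I) (f : I -> A) :
 d (\sum_(i <- s | P i) f i) = \sum_(i <- s | P i) d (f i).
Proof.
elim/big_rec2: _ => [|i y z _ <-]; first exact: d0.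
by rewrite dD.
Qed.

Let dmx (M1 M2 : 'M[A]_n) : map_mx d (M1 *m M2) = map_mx d M1 *m M2 + M1 *m map_mx d M2.
Proof.
apply/matrixP => i j; rewrite !mxE d_sum -big_split; apply: eq_bigr => k _.
by rewrite dM !mxE.
Qed.

Let dCm (M : 'M[F]_n) : map_mx d (Cm M) = 0.
Proof. by apply/matrixP => i j; rewrite !mxE dC. Qed.

Let d_xv i : d (xv i) = lam i *: xv i.
Proof.
rewrite /d /xv mderivX mnmE eq_sym (negPf (neq_lift _ _)) scale0r addr0.
rewrite (bigD1 i) //= big1 ?addr0.
 rewrite mderivX mnmE eqxx scale1r (_ : (_ - _)%MM = 0%MM) ?mpolyX0 ?mulr1 //.
 by apply/mnmP => j; rewrite mnmBE mnm0E subnn.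
move=> j ji; rewrite mderivX mnmE (_ : (_ == _) = false) ?scale0r ?mulr0 ?scaler0 //.
by apply/negP => /eqP /lift_inj e; rewrite e eqxx in ji.
Qed.

Let d_tv : d tv = 1.
Proof.
rewrite /d /tv big1 ?add0r.
 rewrite mderivX mnmE eqxx scale1r (_ : (_ - _)%MM = 0%MM) ?mpolyX0 //.
 by apply/mnmP => j; rewrite mnmBE mnm0E subnn.
by move=> i _; rewrite mderivX mnmE (negPf (neq_lift _ _)) scale0r mulr0 scaler0.
Qed.

Let d_tvX l : d (tv ^+ l) = l%:R *: tv ^+ l.-1.
Proof.
elim: l => [|l IH]; first by rewrite expr0 scale0r -[1]/(1%:MP) dC.
rewrite exprS dM d_tv IH mul1r -scalerAr.
case: l {IH} => [|l]; first by rewrite expr0 scale0r addr0 scale1r.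
by rewrite /= -exprS -{1}[tv ^+ _]scale1r -scalerDl addrC natr1.
Qed.

Let CmM (M1 M2 : 'M[F]_n) : Cm (M1 *m M2) = Cm M1 *m Cm M2.
Proof. exact: map_mxM. Qed.

Let d_E : map_mx d E = E *m Cm N.
Proof.
rewrite /E mulmx_suml.
transitivity (\sum_(l < n) l%:R *: tv ^+ l.-1 *: Cm ((l`!%:R)^-1 *: N ^+ l)).
 apply/matrixP => i j; rewrite mxE !summxE d_sum; apply: eq_bigr => l _.
 by rewrite !mxE dM dC mulr0 addr0 d_tvX.
pose f l := tv ^+ l *: Cm ((l`!%:R)^-1 *: N ^+ l.+1).
have e m : m = n ->
  \sum_(l < m) l%:R *: tv ^+ l.-1 *: Cm ((l`!%:R)^-1 *: N ^+ l) = \sum_(l < m) f l.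
 case: m => [|m] mn; first by rewrite !big_ord0.
 rewrite big_ord_recl scale0r scale0r add0r big_ord_recr /=.
 have -> : f m = 0 by rewrite /f mn [N ^+ n]nN scaler0 map_mx0 scaler0.
 rewrite addr0; apply: eq_bigr => l _.
 apply/matrixP => i j; rewrite !mxE /= /bump /= add1n factS natrM invfM.
 rewrite -scalerAl -mul_mpolyC mulrCA -mpolyCM !mulrA add0n.
 by rewrite mulfV ?pnatr_eq0 // mul1r.
rewrite (e n erefl); apply: eq_bigr => l _.
by rewrite /f -scalemxAl -CmM -scalemxAl -mxM -exprSr.
Qed.

Let SE : Cm S *m E = E *m Cm S.
Proof.
rewrite /E mulmx_sumr mulmx_suml; apply: eq_bigr => l _.
rewrite -scalemxAr -scalemxAl -!CmM -scalemxAr -scalemxAl; congr (_ *: Cm (_ *: _)).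
elim: (val l) => [|k IH]; first by rewrite mulmx1 mul1mx.
by rewrite exprS mxM mulmxA SN -mulmxA IH mulmxA.
Qed.

Let d_diag : map_mx d (diag_mx (\row_i xv i)) =
 diag_mx (\row_i xv i) *m Cm (diag_mx (\row_i lam i)).
Proof.
apply/matrixP => i j; rewrite mul_diag_mx [RHS]mxE.
rewrite [LHS]mxE [X in _ * X]mxE !diag_mxE ![(\row__ _) 0 i]mxE.
have [->|ij] := eqVneq i j; last by rewrite !mulr0n d0 mpolyC0 mulr0.
by rewrite !mulr1n d_xv mulrC mul_mpolyC.
Qed.

Let d_Dx : map_mx d Dx = Dx *m Cm S.
Proof.
rewrite /Dx !dmx !dCm mul0mx add0r mulmx0 addr0 d_diag.
have VU : Cm Q *m Cm (invmx Q) = 1%:M by rewrite -CmM mulmxV // map_mx1.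
have -> : Cm S = Cm (invmx Q) *m Cm (diag_mx (\row_i lam i)) *m Cm Q.
 by rewrite -CmM -CmM.
by rewrite (conj_mul3 _ _ VU).
Qed.

Let d_gam : map_mx d gam = gam *m Cm X.
Proof.
rewrite /gam dmx d_E d_Dx -mulmxA SE.
have -> : Cm X = Cm S + Cm N by rewrite -map_mxD.
by rewrite mulmxDr !mulmxA.
Qed.

Let h k := mxvec gam 0 k.

Lemma meval_ev v (q : {mpoly F[n * n]}) :
 (ev h q).@[v] = mxeval q (map_mx (meval v) gam).
Proof.
rewrite /ev /mxeval; elim/mpolyind: q => [|a m q _ _ IH].
 by rewrite mmap0 !meval0.
rewrite mmapD mmapZ /= !mevalD IH mulr_algl !mevalZ; congr (_ * _ + _).
rewrite mmapX mevalX /mmap1 rmorph_prod /=; apply: eq_bigr => k _.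
rewrite rmorphXn /=; congr (_ ^+ _).
by case/mxvec_indexP: k => i j; rewrite /h !mxvecE [RHS]mxE.
Qed.

(** Along the curve d gam = gam X, so the chain rule turns d/dt into the left-invariant derivation
    of [X]. *)
Lemma d_ev p : d (ev h p) = ev h (lder X p).
Proof.
rewrite (chain_rule dD dZ dM) /lder.
have evs : forall s (f : 'I_(n * n) -> {mpoly F[n * n]}),
  ev h (\sum_(k <- s) f k) = \sum_(k <- s) ev h (f k).
 by move=> s f; rewrite /ev rmorph_sum.
rewrite evs; apply: eq_bigr => k _; rewrite /ev rmorphM /=; congr (_ * _).
case/mxvec_indexP: k => i j; rewrite /h !mxvecE.
transitivity ((map_mx d gam) i j); first by rewrite [RHS]mxE.
rewrite d_gam [LHS]mxE [in RHS]mxE rmorph_sum /=; apply: eq_bigr => l _.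
rewrite rmorphM /=; congr (_ * _); last first.
 by rewrite [LHS]mxE [X in mmap _ _ X]mxE mmapC /= -mul_mpolyC mulr1.
by rewrite [in RHS]mxE mmapX mmap1U mxvecE.
Qed.

Lemma gam_1 : map_mx (meval (pt (fun=> 1) 0)) gam = 1%:M.
Proof. by rewrite gam_pt cdiag1 // scale0r expm0 mulmx1. Qed.
Lemma iter_d_ev k p : iter k d (ev h p) = ev h (iter k (lder X) p).
Proof. by elim: k => //= k ->; rewrite d_ev. Qed.

Let nu (m : 'X_{1..n.+1}) : F := \sum_i lam i * (m (lift ord_max i))%:R.
Let tl (m : 'X_{1..n.+1}) : nat := m ord_max.

Let e1 := pt (fun=> 1) 0.

Let d_mono m : d 'X_[m] = nu m *: 'X_[m] + (tl m)%:R *: 'X_[m - U_(ord_max)].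
Proof.
rewrite /d mderivX; congr (_ + _); rewrite /nu scaler_suml; apply: eq_bigr => i _.
rewrite mderivX -scalerAr scalerA; have [->|mi] := posnP (m (lift ord_max i)).
 by rewrite mulr0 !scale0r.
rewrite /xv -mpolyXD; congr (_ *: 'X_[_]); apply/mnmP => j.
rewrite mnmDE mnmBE mnm1E; case: eqP => [<-|_]; last by rewrite subn0.
by rewrite add1n subn1 prednK.
Qed.

Let meval_e1 m : ('X_[m]).@[e1] = (tl m == 0%N)%:R.
Proof.
rewrite mevalX (bigD1_ord ord_max) //= big1 ?mulr1.
 by rewrite /e1 pt_max expr0n.
by move=> i _; rewrite /e1 pt_lift expr1n.
Qed.

Let iter_dD k a b : iter k d (a + b) = iter k d a + iter k d b.
Proof. by elim: k => //= k ->; rewrite dD. Qed.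

Let iter_dZ k c a : iter k d (c *: a) = c *: iter k d a.
Proof. by elim: k => //= k ->; rewrite dZ. Qed.

(** The right-hand side is the k-th derivative at 0 of exp(nu t) t^l, which is what the monomial
    becomes on the true curve. *)
Let iter_mono k m : (iter k d 'X_[m]).@[e1] =
 'C(k, tl m)%:R * nu m ^+ (k - tl m) * ((tl m)`!)%:R.
Proof.
elim: k m => [|k IH] m.
 rewrite /= meval_e1 sub0n expr0 mulr1; case: (tl m) => [|l]; first by rewrite bin0 fact0 mulr1.
 by rewrite mul0r.
rewrite iterSr d_mono iter_dD !iter_dZ mevalD !mevalZ !IH.
case El: (tl m) => [|l].
 rewrite mul0r addr0 !bin0 !subn0 exprS; ring.
have -> : nu (m - U_(ord_max)) = nu m.
 apply: eq_bigr => i _; rewrite mnmBE mnm1E.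
 by rewrite (negPf (neq_lift _ _)) subn0.
have -> : tl (m - U_(ord_max)) = l by rewrite /tl mnmBE mnm1E eqxx -/(tl m) El subn1.
rewrite binS natrD subSS factS natrM.
have [kl|kl] := ltnP k l.+1.
 rewrite (bin_small kl) mul0r mul0r mulr0 !add0r; ring.
by rewrite -(subnSK kl) exprS; ring.
Qed.

(* If X = S + N lies in the Lie algebra, Taylor coefficients of p along the curve cancel in
  groups with the same exponent. *)
Lemma coef_groups p :
 (forall k, mxeval (iter k (lder X) p) 1%:M = 0) ->
 forall x l, \sum_(m <- msupp (ev h p) | (nu m, tl m) == (x, l)) (ev h p)@_m = 0.
Proof.
move=> Hp; set P := ev h p.
have H k : \sum_(m <- msupp P) P@_m * ('C(k, tl m)%:R * nu m ^+ (k - tl m) * ((tl m)`!)%:R) = 0.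
 rewrite -[RHS](Hp k) -gam_1 -meval_ev -iter_d_ev -/P.
 rewrite {3}[P]mpolyE; elim: (msupp P) => [|m s IH].
  rewrite !big_nil; have -> : iter k d 0 = 0 by elim: k {Hp} => //= k ->; exact: d0.
  by rewrite meval0.
 by rewrite !big_cons iter_dD iter_dZ mevalD mevalZ -/e1 iter_mono IH.
pose s := undup [seq nu m | m <- msupp P].
pose M := msize P.
pose b x l := \sum_(m <- msupp P | (nu m, tl m) == (x, l)) P@_m * (l`!)%:R.
have tlM m : m \in msupp P -> (tl m < M)%N.
 move=> /msize_mdeg_lt; apply: leq_ltn_trans.
 rewrite mdegE (bigD1 ord_max) //=; exact: leq_addr.
have b0 : forall x l, x \in s -> (l < M)%N -> b x l = 0.
 apply: (@exp_poly_indep _ _ s id); rewrite ?undup_uniq //.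
 move=> k; apply: etrans (H k); rewrite [RHS](big_by_key _ nu); apply: eq_bigr => x _.
 under eq_bigr do rewrite mulr_sumr big_mkcond.
 rewrite exchange_big /= [RHS]big_mkcond big_seq [RHS]big_seq.
 apply: eq_bigr => m ms.
 rewrite (bigD1 (Ordinal (tlM m ms))) //= xpair_eqE eqxx andbT big1 ?addr0.
  by case: eqP => // <-; ring.
 move=> l lm; rewrite xpair_eqE (_ : (tl m == l) = false) ?andbF //.
 by apply/negP => /eqP e; case/eqP: lm; apply/val_inj.
move=> x l; have [lM|lM] := ltnP l M; last first.
 rewrite big_seq_cond big1 // => m /andP [/tlM tm]; rewrite xpair_eqE => /andP [_ /eqP e].
 by move: tm; rewrite e ltnNge lM.
case xs: (x \in s); last first.
 rewrite big_seq_cond big1 // => m /andP [ms]; rewrite xpair_eqE => /andP [/eqP e _].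
 by move: xs; rewrite /s mem_undup -e map_f.
have := b0 x l xs lM; rewrite /b -mulr_suml => /eqP; rewrite mulf_eq0.
by rewrite (negPf (fact_neq0 _ _)) orbF => /eqP.
Qed.

(** Two monomials with the same rate [nu] have, by independence of the mu_j, the same integer
    exponents, hence the same value once x_i is replaced by the monomial c^(z_i). The cancellation
    of [coef_groups] thus survives the substitution; this is the heart of Chevalley's theorem on
    replicas. *)
Lemma meval_group p r (mu : 'I_r -> F) (z : 'I_n -> 'I_r -> int) :
 (forall i, lam i = \sum_j (z i j)%:~R * mu j) ->
 int_free r mu ->
 (forall k, mxeval (iter k (lder X) p) 1%:M = 0) ->
 forall c tau, (forall j, c j != 0) ->
 mxeval p (cdiag Q (fun i => monom c (z i)) *m expm (tau *: N)) = 0.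
Proof.
move=> lamE mui Hp c tau c0.
rewrite -gam_pt -meval_ev mevalE.
apply: (group_sum0 (key := fun m => (nu m, tl m))) => [[x l]|m m' _ _ [nE tE]].
 exact: coef_groups.
rewrite !(bigD1_ord ord_max) //= !pt_max -/(tl m) -/(tl m') tE; congr (_ * _).
have E1 m0 : \prod_(i < n) pt (fun i => monom c (z i)) tau (lift ord_max i) ^+ m0 (lift ord_max i) =
  monom c (fun j => \sum_(i < n) z i j * (m0 (lift ord_max i))%:Z).
 rewrite (@monom_sum _ _ c _ _ (fun i j => z i j * (m0 (lift ord_max i))%:Z)) //.
 by apply: eq_bigr => i _; rewrite pt_lift monomMz.
rewrite !E1; congr monom; apply/funext => j; apply/eqP; rewrite -subr_eq0; apply/eqP.
move: j; apply: mui.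
have E2 (m0 : 'X_{1..n.+1}) : nu m0 = \sum_j (\sum_i z i j * (m0 (lift ord_max i))%:Z)%:~R * mu j.
 rewrite /nu; under eq_bigr do rewrite lamE mulr_suml.
 rewrite exchange_big; apply: eq_bigr => j _; rewrite rmorph_sum mulr_suml.
 by apply: eq_bigr => i _; rewrite rmorphM /=; ring.
under eq_bigr do rewrite rmorphB mulrBl.
by rewrite sumrB -!E2 nE subrr.
Qed.

(** Vanishing of [p] on the one-parameter group c -> c^z is a Laurent identity. Its coefficients
    cancel in groups of equal exponent, and so do the terms of the derivative at c = 1, which are
    multiplied by that exponent. *)
Lemma dp_curve p : N = 0 -> (forall i, exists z : int, lam i = z%:~R) ->
 (forall c, c != 0 -> forall z : 'I_n -> int, (forall i, lam i = (z i)%:~R) ->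
   mxeval p (cdiag Q (fun i => c ^ z i)) = 0) ->
 dp p 1%:M S = 0.
Proof.
move=> N0 Hz Hp; pose z i := projT1 (cid (Hz i)).
have zE i : lam i = (z i)%:~R := projT2 (cid (Hz i)).
have XS : X = S by rewrite /X N0 addr0.
have -> : dp p 1%:M S = mxeval (lder X p) 1%:M by rewrite mxeval_lder mul1mx XS.
rewrite -gam_1 -meval_ev -d_ev; set P := ev h p.
pose key (m : 'X_{1..n.+1}) (j : 'I_2) : int :=
 if j == 0 then \sum_i z i * (m (lift ord_max i))%:Z else (tl m)%:Z.
have H : forall kap, \sum_(m <- msupp P | [forall j, key m j == kap j]) P@_m = 0.
 apply: laurentn => x x0.
 have : P.@[pt (fun i => x 0 ^ z i) (x 1)] = 0.
  rewrite meval_ev gam_pt N0 scaler0 expm0 mulmx1; exact: Hp.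
 rewrite mevalE => E1; apply: etrans E1; apply: eq_bigr => m _; congr (_ * _).
 rewrite (bigD1_ord ord_max) //= pt_max mulrC /monom !big_ord_recl big_ord0 mulr1.
 congr (_ * _).
  rewrite /key /= -prodf_exprz //; apply: eq_bigr => i _.
  by rewrite pt_lift -exprz_exp.
 by rewrite /key /= (_ : lift ord0 ord0 = 1) //; apply/val_inj.
rewrite {1}[P]mpolyE d_sum raddf_sum /=.
rewrite (eq_bigr (fun m => P@_m * (nu m * (tl m == 0%N)%:R + (tl m == 1%N)%:R))); last first.
 move=> m _; rewrite dZ mevalZ d_mono mevalD !mevalZ !meval_e1; congr (_ * (_ + _)).
 rewrite {2}/tl mnmBE mnm1E eqxx subn1 -/(tl m).
 by case: (tl m) => [|[|l]] /=; rewrite ?mul0r ?mul1r ?mulr0.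
apply: (group_sum0 (key := fun m => [ffun j => key m j])) => [x|m m' _ _ /ffunP E1].
 apply: etrans (H x); apply: eq_bigl => m; apply/eqP/forallP => [<- j|h0].
  by rewrite ffunE.
 by apply/ffunP => j; rewrite ffunE; apply/eqP.
have tE : tl m = tl m' by have := E1 1; rewrite !ffunE /key /= => -[].
have nE : nu m = nu m'.
 have nz m0 : nu m0 = (key m0 0)%:~R.
  rewrite /nu /key /= rmorph_sum; apply: eq_bigr => i _; by rewrite zE rmorphM.
 by rewrite !nz; have := E1 0; rewrite !ffunE => ->.
by rewrite tE nE.
Qed.

End ExpCurve.

Section Exponentials.
Variables (F : numFieldType) (n : nat).

Lemma int_diag_Lie (K : set 'M[F]_n) (Q : 'M[F]_n) (z : 'I_n -> int) : Q \in unitmx ->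
 (forall c, c != 0 -> K (cdiag Q (fun i => c ^ z i))) ->
 Lie K (cdiag Q (fun i => (z i)%:~R)).
Proof.
move=> Qu HK p Hp.
apply: (dp_curve Qu (nilp0 F n)) => //; first by rewrite mulmx0 mul0mx.
 by move=> i; exists (z i).
move=> c c0 z' Hz'; rewrite (@eq_cdiag _ _ _ _ (fun i => c ^ z i)); last first.
 by move=> i; have /eqP := Hz' i; rewrite eqr_int => /eqP ->.
by apply: Hp; exact: HK.
Qed.

Lemma exp_jordan (G : set 'M[F]_n) (X N Q : 'M[F]_n) (lam : 'I_n -> F) r
  (mu : 'I_r -> F) (z : 'I_n -> 'I_r -> int) :
 subgroup G -> zariski_closed G -> Lie G X ->
 Q \in unitmx -> nilp N -> cdiag Q lam *m N = N *m cdiag Q lam ->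
 X = cdiag Q lam + N ->
 (forall i, lam i = \sum_j (z i j)%:~R * mu j) ->
 int_free r mu ->
 forall c tau, (forall j, c j != 0) ->
 G (cdiag Q (fun i => monom c (z i)) *m expm (tau *: N)).
Proof.
move=> sG cG LX Qu nN SN XE lamE mui c tau c0.
rewrite -(closed_zcl cG); split.
 rewrite unitmx_mul expm_unit ?andbT; last exact: nilpZ.
 by case: (cdiag_unit (d := fun i => monom c (z i)) Qu) => // i; exact: monom_neq0.
move=> p Hp; apply: (meval_group Qu nN SN lamE mui) => // k.
have : vanishes_on G (iter k (lder (cdiag Q lam + N)) p).
 by elim: k => //= k IH; apply: lder_vanish => //; rewrite -XE.
by apply; case: sG.
Qed.

Lemma expm_Lie (G : set 'M[F]_n) N : subgroup G -> zariski_closed G -> Lie G N ->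
 nilp N -> G (expm N).
Proof.
move=> sG cG LN nN.
(* The case of zero semisimple part: an empty family [mu], and tau = 1. *)
have := @exp_jordan G N N 1%:M (fun=> 0) 0 (fun=> 0) (fun _ _ => 0) sG cG LN.
rewrite unitmx1 cdiag0 mul0mx mulmx0 add0r => /(_ isT nN erefl erefl).
move=> /(_ _ _ (fun=> 0) 1); rewrite scale1r => H.
have := H _ _ _; rewrite (_ : cdiag _ _ = 1%:M) ?mul1mx; last first.
 rewrite (_ : (fun=> _) = (fun=> 1)) ?cdiag1 ?unitmx1 //.
 by apply/funext => i; rewrite /monom big_ord0.
apply.
- by move=> i; rewrite big_ord0.
- by move=> y _ [].
- by case.
Qed.

End Exponentials.

Lemma invmx_uniq (F : fieldType) n (A B : 'M[F]_n) : A *m B = 1%:M -> invmx A = B.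
Proof.
by move=> E; have [U _] := mulmx1_unit E; rewrite -[RHS]mul1mx -(mulVmx U) -mulmxA E mulmx1.
Qed.

(** * Subgroups generated by a set *)

Section Gens.
Variables (F : fieldType) (n : nat).
Implicit Types (B S : set 'M[F]_n).

Notation gens B := (smallest (@subgroup F n) B).

Lemma GL_subgroup : subgroup (@GLset F n).
Proof.
split=> //; first exact: unitmx1.
 by move=> g h; rewrite /GLset /= unitmx_mul => -> ->.
by move=> g; rewrite /GLset /= unitmx_inv.
Qed.

Lemma gens_subgroup B : B `<=` @GLset F n -> subgroup (gens B).
Proof.
move=> BU; split.
- move=> g Bg; apply: (Bg (@GLset F n)); split=> //; exact: GL_subgroup.
- by move=> A [[_ A1 _ _] _].
- move=> g h Bg Bh A HA; have [_ _ AM _] := HA.1; apply: AM; [exact: Bg|exact: Bh].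
- move=> g Bg A HA; have [_ _ _ AV] := HA.1; apply: AV; exact: Bg.
Qed.

Lemma sub_gens B : B `<=` gens B.
Proof. exact: sub_smallest. Qed.
Lemma gens_min B S : subgroup S -> B `<=` S -> gens B `<=` S.
Proof. by move=> sS BS; exact: smallest_sub. Qed.

Lemma gens_ind B (P : 'M[F]_n -> Prop) : B `<=` @GLset F n -> (forall g, B g -> B (invmx g)) -> P 1%:M ->
 (forall g x, gens B g -> B x -> P g -> P (g *m x)) -> forall g, gens B g -> P g.
Proof.
move=> BU BV P1 PM; have sB := gens_subgroup BU; have [GU G1 GM GV] := sB.
(* [P] is only known to pass through right multiplication by generators. Asking this for g and for
   its inverse makes the set of such g a subgroup, so it contains everything generated. *)
pose W := [set g | [/\ gens B g, forall h, gens B h -> P h -> P (h *m g) & forall h, gens B h -> P h -> P (h *m invmx g)]].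
suff sW : subgroup W.
 move=> g Bg; rewrite -[g]mul1mx; suff /gens_min-/(_ sW g Bg) [_ h _] : B `<=` W by exact: h.
 move=> x Bx; split=> [|h gh Ph|h gh Ph]; [exact: sub_gens | exact: PM | by apply: PM => //; exact: BV].
split=> [g [/GU //]||g h [Bg Pg Pg'] [Bh Ph Ph']|g [Bg Pg Pg']].
- by split=> // h _; rewrite ?invmx1 mulmx1.
- split=> [|k Bk Pk|k Bk Pk]; first exact: GM.
   by rewrite mulmxA; apply: Ph; [exact: GM | exact: Pg].
  have -> : invmx (g *m h) = invmx h *m invmx g.
   by apply: invmx_uniq; rewrite mulmxA mulmxK ?GU // mulmxV ?GU.
  by rewrite mulmxA; apply: Pg'; [apply: GM => //; exact: GV | exact: Ph'].
by split; rewrite ?invmxK //; exact: GV.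
Qed.

End Gens.
Notation gens B := (smallest (@subgroup _ _) B).

Section Trace.
Variable F : numClosedFieldType.

Lemma nilp_tr n (N : 'M[F]_n) : nilp N -> \tr N = 0.
Proof.
case: n N => [N _|n N nN]; first by rewrite /mxtrace big_ord0.
have [r Hr] := closed_field_poly_normal (char_poly N).
rewrite (monicP (char_poly_monic N)) scale1r in Hr.
have r0 x : x \in r -> x = 0.
 move=> xr; have : eigenvalue N x.
  by rewrite eigenvalue_root_char Hr root_prod_XsubC.
 case/eigenvalueP => v vN v0.
 have E k : v *m N ^+ k = x ^+ k *: v.
  elim: k => [|k IH]; first by rewrite !expr0 mulmx1 scale1r.
  by rewrite exprSr mxM mulmxA IH -scalemxAl vN scalerA -exprSr.
 have := E n.+1; rewrite [N ^+ _]nN mulmx0 => /esym /eqP; rewrite scaler_eq0 (negPf v0) orbF.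
 by rewrite expf_eq0 => /andP [_ /eqP].
have sr : size r = n.+1.
 by have := size_char_poly N; rewrite Hr size_prod_XsubC => -[].
have := char_poly_trace N (ltn0Sn n); rewrite Hr.
have -> : \prod_(z <- r) ('X - z%:P) = 'X^(n.+1) :> {poly F}.
 rewrite -sr big_seq; transitivity (\prod_(z <- r | z \in r) ('X : {poly F})).
  by apply: eq_bigr => z /r0 ->; rewrite subr0.
 by rewrite -big_seq big_const_seq count_predT iter_mulr_1.
by rewrite coefXn /= (ltn_eqF (leqnn _)) => /esym /eqP; rewrite oppr_eq0 => /eqP.
Qed.

Lemma tr_cdiag_mul n (P : 'M[F]_n) d : P \in unitmx -> \tr (cdiag P d) = \sum_i d i.
Proof.
move=> Pu; rewrite /cdiag mxtrace_mulC mulmxA mulmxV // mul1mx mxtrace_diag.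
by apply: eq_bigr => i _; rewrite mxE.
Qed.

Lemma nilp_mul_comm n (A N : 'M[F]_n) : A *m N = N *m A -> nilp N -> nilp (A *m N).
Proof.
move=> c nN; rewrite /nilp -mxM exprMn_comm; last exact: c.
by rewrite [N ^+ n]nN mulr0.
Qed.

End Trace.

(** * Simple groups and the trace form *)

Section Simple.
Variables (F : numClosedFieldType) (n : nat).
Implicit Types (G : set 'M[F]_n) (X Y g h : 'M[F]_n).

Definition exps (Q : set 'M[F]_n) : set 'M[F]_n := [set g | exists2 X, Q X & g = expm X].

Lemma curve_poly (p : {mpoly F[n * n]}) (g : F -> 'M[F]_n) :
 (forall i j, exists q : {poly F}, forall c, g c i j = q.[c]) ->
 exists P : {poly F}, forall c, P.[c] = mxeval p (g c).
Proof.
move=> H; pose q i j := projT1 (cid (H i j)).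
have qE i j c : g c i j = (q i j).[c] := projT2 (cid (H i j)) c.
exists (ev (fun k => mxvec (\matrix_(i, j) q i j) 0 k) p) => c.
rewrite ev_horner; apply: meval_eq => k; case/mxvec_indexP: k => i j.
by rewrite !mxvecE mxE qE.
Qed.

Lemma line_poly (h X : 'M[F]_n) i j :
 exists q : {poly F}, forall c, (h *m expm (c *: X)) i j = q.[c].
Proof.
pose q l := projT1 (cid (expm_poly X l j)).
have qE l c : expm (c *: X) l j = (q l).[c] := projT2 (cid (expm_poly X l j)) c.
exists (\sum_l h i l *: q l) => c; rewrite mxE horner_sum; apply: eq_bigr => l _.
by rewrite hornerZ qE.
Qed.

Lemma exps_unit (Q : set 'M[F]_n) : (forall X, Q X -> nilp X) -> exps Q `<=` @GLset F n.
Proof. by move=> nQ g [X QX ->]; apply: expm_unit; exact: nQ. Qed.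

(** Every line c -> h exp(cX) is irreducible: if an equation of A and an equation of B were both
    nonzero somewhere on it, a product of two nonzero polynomials in c would vanish identically. So
    a line that starts in A stays in A, and such lines join 1 to the whole generated group. *)
Lemma exps_connected (Q : set 'M[F]_n) : (forall X, Q X -> nilp X) ->
 (forall c X, Q X -> Q (c *: X)) -> zariski_connected (zcl (gens (exps Q))).
Proof.
move=> nQ QZ; have EU := exps_unit nQ; have sE := gens_subgroup EU.
suff H : forall A B : set 'M[F]_n, zariski_closed A -> zariski_closed B ->
  zcl (gens (exps Q)) = A `|` B -> A `&` B = set0 -> A 1%:M -> B = set0.
 move=> A B cA cB E AB0.
 have : (A `|` B) 1%:M by rewrite -E; apply: sub_zcl; case: sE.
 case=> [A1|B1]; first by right; apply: (H A B).
 by left; apply: (H B A) => //; rewrite ?(setUC B) // setIC.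
move=> A B cA cB E AB0 A1.
have inAB g : gens (exps Q) g -> A g \/ B g.
 by move=> Eg; have : (A `|` B) g by rewrite -E; apply: sub_zcl => //; case: sE.
have notAB g : A g -> B g -> False by move=> Ag Bg; have : (A `&` B) g by []; rewrite AB0.
have line h X : gens (exps Q) h -> Q X -> A h -> A (h *m expm X).
 move=> Eh QX Ah.
 have lineE c : gens (exps Q) (h *m expm (c *: X)).
  case: sE => _ _ EM _; apply: EM => //; apply: sub_gens.
  by exists (c *: X) => //; exact: QZ.
 have := lineE 1; rewrite scale1r => E1.
 case: (inAB _ E1) => // Bh; exfalso.
 have hU : h \in unitmx by case: sE => EU' _ _ _; exact: EU'.
 have h1U : h *m expm X \in unitmx by case: sE => EU' _ _ _; exact: EU'.
 have [p Ap ph] : exists2 p, (forall g, A g -> mxeval p g = 0) & mxeval p (h *m expm X) != 0.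
  case: (cA) => EA AE; apply: contrapT => Hn; apply: (notAB (h *m expm X)) => //.
  rewrite AE; split=> // p Ep; apply/eqP/negPn/negP => pn; apply: Hn.
  by exists p => // g; rewrite AE => -[_]; exact.
 have [q Bq qh] : exists2 q, (forall g, B g -> mxeval q g = 0) & mxeval q h != 0.
  case: (cB) => EB BE; apply: contrapT => Hn; apply: (notAB h) => //.
  rewrite BE; split=> // q Eq; apply/eqP/negPn/negP => qn; apply: Hn.
  by exists q => // g; rewrite BE => -[_]; exact.
 have [P PE] := curve_poly p (line_poly h X).
 have [P' P'E] := curve_poly q (line_poly h X).
 have : P * P' = 0.
  apply: poly_ext => c; rewrite hornerM horner0 PE P'E.
  by case: (inAB _ (lineE c)) => [/Ap ->|/Bq ->]; rewrite ?mul0r ?mulr0.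
 move/eqP; rewrite mulf_eq0 => /orP [] /eqP P0.
  by move: (PE 1); rewrite P0 horner0 scale1r => /esym /eqP; rewrite (negPf ph).
 move: (P'E 0); rewrite P0 horner0 scale0r expm0 mulmx1 => /esym /eqP.
 by rewrite (negPf qh).
have EA : gens (exps Q) `<=` A.
 have EV g : exps Q g -> exps Q (invmx g).
  case=> X QX ->; exists (- X); first by rewrite -scaleN1r; exact: QZ.
  by rewrite invmx_expm //; exact: nQ.
 by apply: (gens_ind EU EV A1) => g _ Eg [X QX ->] Ag; exact: line.
apply/seteqP; split=> // g Bg.
have zg : zcl (gens (exps Q)) g by rewrite E; right.
by apply: (notAB g) => //; apply: zcl_min zg.
Qed.

Lemma normal_zcl (B : set 'M[F]_n) g : B `<=` @GLset F n ->
 (forall x, B x -> B (g *m x *m invmx g)) -> g \in unitmx ->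
 forall x, zcl B x -> zcl B (g *m x *m invmx g).
Proof.
move=> BU BN gu x zx; split; first by rewrite !unitmx_mul gu zx.1 unitmx_inv gu.
move=> p Hp; apply: (zcl_regular BU (regular_trans p g (invmx g))) zx => b Bb.
by apply: Hp; exact: BN.
Qed.

(* A nonzero conjugation-stable cone of nilpotents of the Lie algebra generates a closed
  connected normal subgroup, which is all of G by simplicity. *)
Lemma simple_exps G (Q : set 'M[F]_n) : simple_algebraic_group G ->
 (forall X, Q X -> nilp X) -> (forall c X, Q X -> Q (c *: X)) ->
 (forall X, Q X -> Lie G X) -> (forall g X, G g -> Q X -> Q (g *m X *m invmx g)) ->
 (exists2 X, Q X & X != 0) -> zcl (gens (exps Q)) = G.
Proof.
move=> [[sG cG] _ _ simple] nQ QZ QL QA [X0 QX0 X00].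
have EU := exps_unit nQ; have sE := gens_subgroup EU.
have EU' : gens (exps Q) `<=` @GLset F n by case: sE.
have [GU G1 GM GV] := sG.
have EG : gens (exps Q) `<=` G.
 by apply: gens_min => // g [X QX ->]; apply: expm_Lie => //; [exact: QL|exact: nQ].
have EN g x : G g -> gens (exps Q) x -> gens (exps Q) (g *m x *m invmx g).
 move=> Gg; have gu := GU g Gg; move: x.
 have [_ E1 EM EV] := sE.
 apply: gens_min.
  split.
  - move=> x /EU'; rewrite /GLset /= !unitmx_mul unitmx_inv gu andbT.
   by [].
  - by rewrite /= mulmx1 mulmxV.
  - move=> x y /= Hx Hy; have := EM _ _ Hx Hy.
   by rewrite !mulmxA mulmxKV.
  - move=> x /= Hx; have xu : x \in unitmx.
    by move: (EU' _ Hx); rewrite /GLset /= !unitmx_mul unitmx_inv gu andbT.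
   rewrite (_ : g *m _ *m _ = invmx (g *m x *m invmx g)); first exact: EV.
   apply/esym/invmx_uniq; rewrite !mulmxA mulmxKV // mulmxK //.
   by rewrite mulmxV.
 move=> x [X QX ->] /=; apply: sub_gens; exists (g *m X *m invmx g); first exact: QA.
 by rewrite expmJ.
have := simple (zcl (gens (exps Q))) (conj (zcl_subgroup sE) (zcl_closed _))
 (exps_connected nQ QZ) (zcl_min cG EG).
case=> [g x Gg zx||//].
 by apply: normal_zcl => // [y|]; [exact: EN|exact: GU].
(* If the closure were trivial, exp(c X0) = 1 for all c would force X0 = 0. *)
move=> E; case/eqP: X00; apply: (expm_inj (nQ _ QX0) (nilp0 F n)) => c.
rewrite scaler0 expm0.
have : zcl (gens (exps Q)) (expm (c *: X0)).
 by apply: sub_zcl => //; apply: sub_gens; exists (c *: X0) => //; exact: QZ.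
by rewrite E.
Qed.

(** A matrix commuting with the diagonal matrix of [lam] preserves its eigenspaces, and [d], being a
    function of [lam], is constant on each of them. *)
Lemma comm_replica (Q Z : 'M[F]_n) (lam d : 'I_n -> F) : Q \in unitmx ->
 (forall i j, lam i = lam j -> d i = d j) ->
 Z *m cdiag Q lam = cdiag Q lam *m Z -> Z *m cdiag Q d = cdiag Q d *m Z.
Proof.
move=> Qu ld /(comm_cdiagP _ _ Qu) H; apply/(comm_cdiagP _ _ Qu) => i j.
have /eqP := H i j; rewrite mulf_eq0 => /orP [/eqP ->|]; first by rewrite mul0r.
by rewrite subr_eq0 => /eqP /ld ->; rewrite subrr mulr0.
Qed.

(** With all c_j = 1 the group of [exp_jordan] reduces to exp(tau N), so N is tangent; with tau = 0
    and a single c_j different from 1 it reduces to the one-parameter group of the j-th replica. *)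
Lemma jordan_Lie G X : subgroup G -> zariski_closed G -> Lie G X ->
 exists Q lam N r (mu : 'I_r -> F) (z : 'I_n -> 'I_r -> int),
 [/\ [/\ Q \in unitmx, nilp N, X = cdiag Q lam + N & Lie G N],
   (forall i, lam i = \sum_j (z i j)%:~R * mu j),
   int_free r mu,
   (forall j c, c != 0 -> G (cdiag Q (fun i => c ^ z i j))) &
   forall Z, Z *m X = X *m Z -> Z *m cdiag Q lam = cdiag Q lam *m Z /\ Z *m N = N *m Z].
Proof.
move=> sG cG LX; have [S [N [XE [Q [lam [Qu SE]]] nN ZX]]] := jordan X.
rewrite {}SE in XE ZX.
have [r [mu [z [lamE mui]]]] := int_basis lam.
have SN : cdiag Q lam *m N = N *m cdiag Q lam.
 by apply: (ZX (cdiag Q lam) _).2; have [<- _] := ZX X erefl.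
have H := exp_jordan sG cG LX Qu nN SN XE lamE mui.
exists Q, lam, N, r, mu, z; split=> //.
 split=> //; apply: Lie_expm => // c.
 have := H (fun=> 1) c (fun=> oner_neq0 _).
 rewrite (_ : (fun i => _) = (fun=> 1)) ?cdiag1 // ?mul1mx //.
 by apply/funext => i; rewrite monom1.
move=> j c c0; have := H (fun l => if l == j then c else 1) 0.
rewrite scale0r expm0 mulmx1 (_ : (fun i => _) = (fun i => c ^ z i j)).
 by apply=> l; case: ifP => // _; exact: oner_neq0.
apply/funext => i; rewrite /monom (bigD1 j) //= eqxx big1 ?mulr1 // => l /negPf ->.
by rewrite exp1rz.
Qed.

Lemma lam_z (r : nat) (lam : 'I_n -> F) (mu : 'I_r -> F) (z : 'I_n -> 'I_r -> int) :
 (forall i, lam i = \sum_j (z i j)%:~R * mu j) ->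
 int_free r mu ->
 forall i i', lam i = lam i' -> forall j, z i j = z i' j.
Proof.
move=> lamE mui i i' E j; apply/eqP; rewrite -subr_eq0; apply/eqP; move: j; apply: mui.
under eq_bigr do rewrite rmorphB mulrBl.
by rewrite sumrB -!lamE E subrr.
Qed.

(** Expanded in the independent mu_k, the vanishing for j says that the sum over i of z_ik z_ij is 0
    for every k. For k = j this is a sum of squares of integers, so all z_ij vanish. *)
Lemma replica_tr0 (r : nat) (lam : 'I_n -> F) (mu : 'I_r -> F) (z : 'I_n -> 'I_r -> int) :
 (forall i, lam i = \sum_j (z i j)%:~R * mu j) ->
 int_free r mu ->
 (forall j, \sum_i lam i * (z i j)%:~R = 0) -> forall i, lam i = 0.
Proof.
move=> lamE mui H i; rewrite lamE big1 // => j _.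
have Hj : \sum_i z i j * z i j = 0.
 move: (H j); under eq_bigr do rewrite lamE mulr_suml.
 rewrite exchange_big /= => E.
 apply: (mui (fun k => \sum_i z i k * z i j)); apply: etrans E.
 apply: eq_bigr => k _; rewrite rmorph_sum mulr_suml; apply: eq_bigr => l _.
 by rewrite rmorphM /=; ring.
have : forall i, i \in index_enum 'I_n -> z i j * z i j = 0.
 move=> l _; apply: (psumr_eq0P _ Hj) => // l' _.
 by rewrite -expr2 sqr_ge0.
move/(_ i (mem_index_enum i))/eqP; rewrite mulf_eq0 orbb => /eqP ->.
by rewrite mul0r.
Qed.

(** Pairing [X] with a replica of its semisimple part sees only that part, since the nilpotent part
    times a commuting replica is nilpotent; [replica_tr0] then kills the semisimple part. *)
Lemma rad_nilp G X : subgroup G -> zariski_closed G -> Lie G X ->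
 (forall Y, Lie G Y -> \tr (X *m Y) = 0) -> nilp X.
Proof.
move=> sG cG LX trX.
have [Q [lam [N [r [mu [z [[Qu nN XE LN] lamE mui zG ZX]]]]]]] := jordan_Lie sG cG LX.
suff S0 : forall i, lam i = 0.
 by rewrite XE (_ : lam = fun=> 0) ?cdiag0 ?add0r //; apply/funext.
apply: (replica_tr0 lamE mui) => j.
have LY : Lie G (cdiag Q (fun i => (z i j)%:~R)) by apply: int_diag_Lie => // c; exact: zG.
have := trX _ LY; rewrite XE mulmxDl linearD /= cdiagM // tr_cdiag_mul //.
rewrite [\tr (N *m _)]nilp_tr ?addr0 //.
have NS : N *m cdiag Q lam = cdiag Q lam *m N.
 have := ZX (cdiag Q lam) _; case; last by move=> _ ->.
 by have [-> _] := ZX X erefl.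
have c : N *m cdiag Q (fun i => (z i j)%:~R) = cdiag Q (fun i => (z i j)%:~R) *m N.
 by apply: comm_replica NS => // i i' /(lam_z lamE mui) ->.
rewrite c; apply: nilp_mul_comm => //.
Qed.

Lemma rad_unipotent (L : {vspace 'M[F]_n}) :
 {in L &, forall X Y, brk X Y \in L} -> {in L, forall X, nilp X} ->
 forall g, zcl (gens (exps [set X | X \in L])) g -> (g - 1%:M) ^+ n = 0.
Proof.
move=> Lb Ln.
have EU : exps [set X | X \in L] `<=` @GLset F n by apply: exps_unit => X; exact: Ln.
have sE := gens_subgroup EU.
(* The Engel filtration: [V k] consists of the vectors killed by all products of at least k elements
   of L. Below, [U] collects the g for which g - 1 lowers it, a condition that passes to products,
   so (g - 1)^n = 0 on the generated group; as a polynomial identity it extends to the closure. *)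
pose V k (v : 'cV[F]_n) := forall s : seq 'M[F]_n, {in s, forall X, X \in L} ->
 (k <= size s)%N -> (\prod_(X <- s) X) *m v = 0.
have V0 v : V 0%N v -> v = 0.
 by move=> /(_ [::]); rewrite big_nil mul1mx; apply.
have Vn v : V n v by move=> s sL ns; rewrite (engel_prod Lb Ln) // mul0mx.
have VD k u v : V k u -> V k v -> V k (u + v).
 by move=> Hu Hv s sL ks; rewrite mulmxDr Hu // Hv // addr0.
have VZ k c u : V k u -> V k (c *: u).
 by move=> Hu s sL ks; rewrite -scalemxAr Hu // scaler0.
have VS k u : V k u -> V k.+1 u by move=> Hu s sL ks; apply: Hu => //; exact: ltnW.
have VL k X u : X \in L -> V k.+1 u -> V k (X *m u).
 move=> XL Hu s sL ks; have := Hu (rcons s X).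
 rewrite -cats1 big_cat big_seq1 /= mxM -mulmxA; apply.
  by move=> Y; rewrite mem_cat inE => /orP [/sL|/eqP ->].
 by rewrite size_cat addn1 ltnS.
pose U := [set g : 'M[F]_n | forall k v, V k.+1 v -> V k ((g - 1%:M) *m v)].
have UV g k v : U g -> V k v -> V k (g *m v).
 case: k => [|k] Ug; first by move/V0 => ->; rewrite mulmx0 => s _ _; rewrite mulmx0.
 move=> Hv; have -> : g *m v = (g - 1%:M) *m v + v by rewrite mulmxBl mul1mx subrK.
 by apply: VD => //; apply: VS; exact: Ug.
have U1 : U 1%:M.
 by move=> k v _; rewrite subrr mul0mx => s _ _; rewrite mulmx0.
have UM g h : U g -> U h -> U (g *m h).
 move=> Ug Uh k v Hv.
 have -> : (g *m h - 1%:M) *m v = (g - 1%:M) *m (h *m v) + (h - 1%:M) *m v.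
  by rewrite !mulmxBl !mul1mx mulmxA addrA subrK.
 by apply: VD; [apply: Ug; exact: UV|exact: Uh].
have UE X : X \in L -> U (expm X).
 move=> XL k v Hv.
 have [n0|n0] := posnP n.
  have -> : (expm X - 1%:M) *m v = 0.
   by apply/matrixP => i; move: (ltn_ord i); rewrite {2}n0.
  by move=> s _ _; rewrite mulmx0.
 rewrite (expmE (K := n.+1)); [|exact: Ln|exact: leqnSn].
 rewrite big_ord_recl expr0 fact0 invr1 scale1r addrAC subrr add0r mulmx_suml.
 elim/big_rec: _ => [|i y _ Hy]; first by move=> s _ _; rewrite mulmx0.
 apply: VD => //; rewrite -scalemxAl; apply: VZ.
 rewrite /= /bump /= add1n exprS mxM -mulmxA; apply: (VL) => //.
 elim: (val i) => [|j IH]; first by rewrite mul1mx.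
 by rewrite exprS mxM -mulmxA; apply: VS; exact: VL.
have EV g : exps [set X | X \in L] g -> exps [set X | X \in L] (invmx g).
 case=> X /= XL ->; exists (- X); first by rewrite /= rpredN.
 by rewrite invmx_expm //; exact: Ln.
have key g : gens (exps [set X | X \in L]) g -> (g - 1%:M) ^+ n = 0.
 move=> gg; have Ug : U g.
  apply: (gens_ind EU EV _ _ gg) => [|x _ _ [X XL ->] Ux]; last by apply: UM => //; exact: UE.
  exact: U1.
 have kill k v : (k <= n)%N -> V (n - k)%N ((g - 1%:M) ^+ k *m v).
  elim: k => [|k IH] kn; first by rewrite mul1mx subn0.
  rewrite exprS mxM -mulmxA; apply: Ug; rewrite subnSK //; exact: IH (ltnW kn).
 apply/row_matrixP => i; apply/rowP => j; rewrite !mxE.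
 have := kill n (delta_mx j 0) (leqnn n); rewrite subnn => /V0.
 by rewrite -colE => /colP /(_ i); rewrite !mxE.
have EU' : gens (exps [set X | X \in L]) `<=` @GLset F n by case: sE.
move=> g zg; apply/matrixP => i j; rewrite [RHS]mxE.
apply: (zcl_regular (f := fun g => ((g - 1%:M) ^+ n) i j) EU') zg => [|a /key ->]; last by rewrite mxE.
move: i j; have sG := @subGL F n.
have r1 i j : regular_on (@GLset F n) (fun g => (g - 1%:M) i j).
 apply: (@regular_eq _ _ _ (fun g => g i j + - (1%:M : 'M_n) i j)); first by move=> h _; rewrite !mxE.
 by apply: regularD => //; [exact: regular_entry|exact: regular_const].
suff rk k i j : regular_on (@GLset F n) (fun g => ((g - 1%:M) ^+ k) i j) by [].
elim: k i j => [|k IH] i j; first exact: regular_const.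
apply: (@regular_eq _ _ _ (fun g => ((g - 1%:M) *m (g - 1%:M) ^+ k) i j)).
 by move=> h _; rewrite exprS.
exact: regular_mulmx.
Qed.

(** The radical of the trace form is a conjugation-stable Lie algebra of nilpotent matrices. Were it
    nonzero, its exponentials would generate a dense subgroup by simplicity and G would be
    unipotent, which contradicts the diagonalizable element [t] different from 1. *)
Lemma trace_nondeg G X : simple_algebraic_group G ->
 (exists t P d, [/\ G t, t != 1%:M, P \in unitmx & t = cdiag P d]) ->
 Lie G X -> (forall Y, Lie G Y -> \tr (X *m Y) = 0) -> X = 0.
Proof.
move=> simG [t [P [d [Gt t1 Pu tE]]]] LX trX; apply/eqP/negPn/negP => X0.
have [[sG cG] _ _ _] := simG; have [GU _ GM GV] := sG.
have [L HL] : exists L : {vspace 'M[F]_n}, forall Z, Z \in L <->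
  (Lie G Z /\ forall Y, Lie G Y -> \tr (Z *m Y) = 0).
 apply: sub_vspace.
 - by split; [exact: Lie0|move=> Y _; rewrite mul0mx linear0].
 - move=> u v [Lu tu] [Lv tv]; split; first exact: LieD.
  by move=> Y LY; rewrite mulmxDl linearD /= tu // tv // addr0.
 - move=> c u [Lu tu]; split; first exact: LieZ.
  by move=> Y LY; rewrite -scalemxAl linearZ /= tu // mulr0.
have Ln : {in L, forall Z, nilp Z} by move=> Z /HL [LZ tZ]; exact: rad_nilp tZ.
have LA g Z : G g -> Z \in L -> g *m Z *m invmx g \in L.
 move=> Gg /HL [LZ tZ]; apply/HL; split; first exact: Lie_conj.
 move=> Y LY; rewrite -!mulmxA mxtrace_mulC.
 have := tZ _ (Lie_conj sG (GV _ Gg) LY); rewrite invmxK => E.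
 by rewrite -E; congr (\tr _); rewrite !mulmxA.
have Lb : {in L &, forall Y Z, brk Y Z \in L}.
 move=> Y Z YL ZL; apply: brk_mem; first exact: Ln.
 move=> c; rewrite -invmx_expm; last by apply: nilpZ; exact: Ln.
 apply: LA => //; apply: expm_Lie => //; last by apply: nilpZ; exact: Ln.
 by apply: LieZ; have /HL [] := YL.
have E := @simple_exps G [set Z | Z \in L] simG.
have {}E : zcl (gens (exps [set Z | Z \in L])) = G.
 apply: E => [Z|c Z|Z|g Z|].
 - exact: Ln.
 - by move=> /= ZL; exact: rpredZ.
 - by move=> /= /HL [].
 - by move=> Gg /=; exact: LA.
 - by exists X => //=; apply/HL.
have := rad_unipotent Lb Ln (g := t); rewrite E => /(_ Gt).
rewrite tE -(cdiag1 Pu) -scaleN1r cdiagZ cdiagD.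
have -> k e : cdiag P e ^+ k = cdiag P (fun i => e i ^+ k).
 elim: k => [|k IH]; first by rewrite cdiag1.
 by rewrite exprS IH mxM cdiagM //; apply: eq_cdiag => i; rewrite exprS.
rewrite -(cdiag0 P) => /(cdiag_inj Pu) H; case/eqP: t1; rewrite tE -(cdiag1 Pu).
apply: eq_cdiag => i; have /eqP := H i; rewrite expf_eq0 => /andP [_].
by rewrite mulr1 subr_eq0 => /eqP.
Qed.

End Simple.

(** * Tori: coordinates, weights and maximality *)

Section Torus.
Variables (F : numClosedFieldType) (n : nat).

Definition tor (P : 'M[F]_n) r (M : 'I_n -> 'I_r -> int) (x : 'I_r -> F) :=
 cdiag P (fun i => monom x (M i)).

Definition torset P r (M : 'I_n -> 'I_r -> int) : set 'M[F]_n :=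
 [set g | exists2 x, (forall l, x l != 0) & g = tor P M x].

(** The number 2 has infinite multiplicative order, so the value of a one-parameter group at 2
    determines its exponents; 2 serves as a generic point from here on. *)
Lemma int2_eq (z z' : int) : (2%:R : F) ^ z = 2%:R ^ z' -> z = z'.
Proof.
move=> E; have two0 := two_neq0 F.
have E1 : (2%:R : F) ^ (z - z') = 1 by rewrite expfzDr // E -expfzDr // subrr expr0z.
suff : z - z' = 0 by move/eqP; rewrite subr_eq0 => /eqP.
have H k : (2%:R : F) ^+ k.+1 != 1.
 by rewrite -natrX (eqr_nat F _ 1) -(expn0 2) eqn_exp2l.
move: (z - z') E1 => [[|k]|k] //= /eqP; first by rewrite (negPf (H k)).
by rewrite NegzE -exprnN invr_eq1 (negPf (H k)).
Qed.

(** Functional calculus: the transition matrix between two diagonalizations of the same matrix links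
    only equal eigenvalues, so they stay equal when one function is applied to both lists of
    eigenvalues. *)
Lemma cdiag_fun (P P' : 'M[F]_n) (a b a' b' : 'I_n -> F) : P \in unitmx -> P' \in unitmx ->
 cdiag P a = cdiag P' b -> (forall i j, a i = b j -> a' i = b' j) -> cdiag P a' = cdiag P' b'.
Proof.
move=> Pu Pu' E ab.
pose W := P *m invmx P'.
have H d e : cdiag P d = cdiag P' e <-> diag_mx (\row_i d i) *m W = W *m diag_mx (\row_i e i).
 rewrite /cdiag /W; split=> [h|h].
  have := congr1 (fun A => P *m A *m invmx P') h.
  by rewrite !mulmxA mulmxV // mul1mx mulmxK.
 have := congr1 (fun A => invmx P *m A *m P') h.
 by rewrite !mulmxA mulVmx // mul1mx mulmxKV.
apply/H/matrixP => i j; have /matrixP/(_ i j) := (H a b).1 E.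
rewrite !mul_diag_mx !mul_mx_diag [LHS]mxE [RHS]mxE ![(\row__ _) _ _]mxE => e1.
rewrite [LHS]mxE [RHS]mxE ![(\row__ _) _ _]mxE.
have [->|w0] := eqVneq (W i j) 0; first by rewrite mulr0 mul0r.
rewrite mulrC; congr (_ * _); apply: ab; apply: (mulIf w0); by rewrite e1 mulrC.
Qed.

Lemma diag_group_coord r (d : 'M[F]_r) : diagonal_group d ->
 (forall l, d l l != 0) /\ d = diag_mx (\row_l d l l).
Proof.
move=> [du /is_diag_mxP dd].
have E : d = diag_mx (\row_l d l l).
 apply/matrixP => i j; rewrite diag_mxE mxE; have [->|ij] := eqVneq i j; first by [].
 by rewrite mulr0n dd.
split=> // l; by move: du; rewrite unitmxE {1}E det_diag unitfE => /prodf_neq0 /(_ l isT); rewrite mxE.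
Qed.

Lemma diag_group_mk r (x : 'I_r -> F) : (forall l, x l != 0) ->
 diagonal_group (diag_mx (\row_l x l)).
Proof.
move=> x0; split; last exact: diag_mx_is_diag.
by rewrite unitmxE det_diag unitfE; apply/prodf_neq0 => l _; rewrite mxE.
Qed.

Lemma diag_mx_mul r (x y : 'I_r -> F) :
 diag_mx (\row_l x l) *m diag_mx (\row_l y l) = diag_mx (\row_l (x l * y l)).
Proof. by rewrite mulmx_diag; congr diag_mx; apply/rowP => l; rewrite !mxE. Qed.
Lemma diag_mx1 r : diag_mx (\row_(l < r) (1 : F)) = 1%:M.
Proof. by rewrite -diag_const_mx; congr diag_mx; apply/rowP => l; rewrite !mxE. Qed.

Section Mk.
Variables (P : 'M[F]_n) (r : nat) (M : 'I_n -> 'I_r -> int) (u : 'I_r -> 'I_n -> int).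
Hypotheses (Pu : P \in unitmx) (dual : forall k l, \sum_i u k i * M i l = (k == l)%:Z).

(** An integer power of a diagonal entry; for negative exponents it is read from [invmx g], so that
    it is regular on the whole of GL_n. *)
Let ent (g : 'M[F]_n) (i : 'I_n) (z : int) : F :=
 match z with
 | Posz k => (P *m g *m invmx P) i i ^+ k
 | Negz k => (P *m invmx g *m invmx P) i i ^+ k.+1
 end.

Let entE d i z : (forall i, d i != 0) -> ent (cdiag P d) i z = d i ^ z.
Proof.
move=> d0; case: z => k; rewrite /ent.
 by rewrite cdiag_conjE // eqxx.
have [_ ->] := cdiag_unit Pu d0.
by rewrite cdiag_conjE // eqxx mulr1n exprVn NegzE -exprnN.
Qed.

Let ent_regular i z : regular_on (@GLset F n) (fun g => ent g i z).
Proof.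
have sG := @subGL F n.
case: z => k; apply: regularX; apply: regular_mulmxr => //; apply: regular_mulmxl => //.
 by move=> *; exact: regular_entry.
by move=> *; exact: regular_invmx.
Qed.

Lemma tor_unit x : (forall l, x l != 0) -> tor P M x \in unitmx.
Proof.
move=> x0; by case: (cdiag_unit (d := fun i => monom x (M i)) Pu) => // i; exact: monom_neq0.
Qed.

Lemma torM x y : tor P M (fun l => x l * y l) = tor P M x *m tor P M y.
Proof. by rewrite /tor cdiagM //; apply: eq_cdiag => i; rewrite monomM. Qed.
Lemma tor1 : tor P M (fun=> 1) = 1%:M.
Proof. by rewrite /tor -(cdiag1 Pu); apply: eq_cdiag => i; rewrite monom1. Qed.

Lemma torset_subgroup : subgroup (torset P M).
Proof.
split.
- by move=> g [x x0 ->]; exact: tor_unit.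
- by exists (fun=> 1) => [l|]; [exact: oner_neq0|rewrite tor1].
- move=> g h [x x0 ->] [y y0 ->]; exists (fun l => x l * y l); last by rewrite torM.
 by move=> l; rewrite mulf_neq0.
- move=> g [x x0 ->]; exists (fun l => (x l)^-1); first by move=> l; rewrite invr_neq0.
 apply: invmx_uniq; rewrite -torM -tor1; congr tor; apply/funext => l.
 by rewrite mulfV.
Qed.

Let fo (g : 'M[F]_n) : 'M[F]_r := diag_mx (\row_l \prod_i ent g i (u l i)).
Let fi (d : 'M[F]_r) : 'M[F]_n := tor P M (fun l => d l l).

Let prod_dual (x : 'I_r -> F) l : (forall l, x l != 0) -> \prod_i monom x (M i) ^ u l i = x l.
Proof.
move=> x0; under eq_bigr do rewrite -monomMz.
have E k : \sum_i M i k * u l i = (l == k)%:Z.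
 by rewrite -dual; apply: eq_bigr => i _; rewrite mulrC.
rewrite -monom_sum // /monom (bigD1 l) //= E eqxx expr1z big1 ?mulr1 // => k.
by rewrite E eq_sym => /negPf ->; rewrite expr0z.
Qed.

Let fo_tor x : (forall l, x l != 0) -> fo (tor P M x) = diag_mx (\row_l x l).
Proof.
move=> x0; rewrite /fo; congr diag_mx; apply/rowP => l; rewrite !mxE.
rewrite -[RHS]prod_dual //; apply: eq_bigr => i _; rewrite entE // => j; exact: monom_neq0.
Qed.

Let fi_diag x : fi (diag_mx (\row_l x l)) = tor P M x.
Proof.
rewrite /fi; congr tor; apply/funext => l; by rewrite diag_mxE mxE eqxx.
Qed.

(** By [dual] the parameter x_l is recovered as the product of the W_kk^(u_lk). The equations say
    that off-diagonal entries vanish and that every diagonal entry is the prescribed monomial in the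
    recovered parameters. *)
Lemma torset_closed : zariski_closed (torset P M).
Proof.
pose Fam : set ('M[F]_n -> F) := [set f | (exists i j, i != j /\ f = fun g => (P *m g *m invmx P) i j) \/
 (exists i, f = fun g => (P *m g *m invmx P) i i - \prod_k ent g k (\sum_l u l k * M i l))].
have -> : torset P M = [set g | g \in unitmx /\ forall f, Fam f -> f g = 0].
 apply/seteqP; split=> g.
  move=> [x x0 ->]; split; first exact: tor_unit.
  move=> f [[i [j [ij ->]]]|[i ->]]; first by rewrite cdiag_conjE // (negPf ij).
  rewrite cdiag_conjE // eqxx mulr1n; apply/eqP; rewrite subr_eq0; apply/eqP.
  transitivity (\prod_k monom x (M k) ^ (\sum_l u l k * M i l)); last first.
   by apply: eq_bigr => k _; rewrite entE // => j; exact: monom_neq0.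
  transitivity (\prod_l (\prod_k monom x (M k) ^ u l k) ^ M i l).
   by apply: eq_bigr => l _; rewrite prod_dual.
  transitivity (\prod_l \prod_k monom x (M k) ^ (u l k * M i l)).
   apply: eq_bigr => l _; elim/big_rec2: _ => [|k y z _ <-]; first by rewrite exp1rz.
   by rewrite expfzMl exprz_exp.
  rewrite exchange_big; apply: eq_bigr => k _; rewrite prodf_exprz //.
  exact: monom_neq0.
 case=> gu H; pose W := P *m g *m invmx P.
 have WE : W = diag_mx (\row_i W i i).
  apply/matrixP => i j; rewrite diag_mxE [(\row__ _) _ _]mxE; have [->//|ij] := eqVneq i j.
  by rewrite mulr0n; apply: (H (fun g => (P *m g *m invmx P) i j)); left; exists i, j.
 have gE : g = cdiag P (fun i => W i i).
  by rewrite /cdiag -WE /W !mulmxA mulVmx // mul1mx mulmxKV.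
 have W0 i : W i i != 0.
  have : diag_mx (\row_i W i i) \in unitmx.
   by rewrite -WE !unitmx_mul Pu gu unitmx_inv.
  by rewrite unitmxE det_diag unitfE => /prodf_neq0 /(_ i isT); rewrite mxE.
 exists (fun l => \prod_k W k k ^ u l k).
  by move=> l; apply/prodf_neq0 => k _; rewrite expfz_neq0.
 rewrite {1}gE /tor; apply: eq_cdiag => i.
 have := H (fun g => (P *m g *m invmx P) i i - \prod_k ent g k (\sum_l u l k * M i l)).
 move=> /(_ (or_intror (ex_intro _ i erefl))) /eqP; rewrite subr_eq0 => /eqP ->.
 rewrite {1}gE; under eq_bigr do rewrite entE //.
 rewrite /monom; transitivity (\prod_l \prod_k W k k ^ (u l k * M i l)).
  by rewrite exchange_big; apply: eq_bigr => k _; rewrite prodf_exprz.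
 apply: eq_bigr => l _; elim/big_rec2: _ => [|k y z _ ->]; first by rewrite exp1rz.
 by rewrite expfzMl exprz_exp.
apply: closed_regular => f [[i [j [ij ->]]]|[i ->]]; have sG := @subGL F n.
 apply: regular_mulmxr => //; apply: regular_mulmxl => // *; exact: regular_entry.
apply: (@regular_eq _ _ _ (fun g => (P *m g *m invmx P) i i + -1 * \prod_k ent g k (\sum_l u l k * M i l))).
 by move=> g _; rewrite mulN1r.
apply: regularD => //.
 apply: regular_mulmxr => //; apply: regular_mulmxl => // *; exact: regular_entry.
by apply: regularZ; apply: regular_prod => k; exact: ent_regular.
Qed.

Lemma torset_torus : torus (torset P M).
Proof.
split; first by split; [exact: torset_subgroup|exact: torset_closed].
exists r, fo, fi.
have TU : torset P M `<=` @GLset F n by have [] := torset_subgroup.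
have DU : @diagonal_group F r `<=` @GLset F r by move=> d [].
split.
- split.
 + move=> i j; have [<-|ij] := eqVneq i j; last first.
   apply: (@regular_eq _ _ _ (fun=> 0)); last exact: regular_const.
   by move=> g _; rewrite diag_mxE (negPf ij).
  apply: (@regular_eq _ _ _ (fun g => \prod_k ent g k (u i k))).
   by move=> g _; rewrite diag_mxE eqxx mxE.
  apply: (regular_sub TU); apply: regular_prod => k; exact: (ent_regular k (u i k)).
 + by rewrite -tor1 fo_tor ?diag_mx1 // => l; exact: oner_neq0.
 + move=> g h [x x0 ->] [y y0 ->]; rewrite -torM !fo_tor ?diag_mx_mul // => l.
  by rewrite mulf_neq0.
- split.
 + move=> i j.
  pose et (d : 'M[F]_r) l (z : int) := match z with Posz k => d l l ^+ k | Negz k => invmx d l l ^+ k.+1 end.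
  have etE d l z : diagonal_group d -> et d l z = d l l ^ z.
   move=> /diag_group_coord [d0 dE]; case: z => k //=.
   suff -> : invmx d l l = (d l l)^-1 by rewrite exprVn NegzE -exprnN.
   rewrite {1}dE (@invmx_uniq _ _ _ (diag_mx (\row_l (d l l)^-1))); last first.
    rewrite diag_mx_mul -diag_mx1; congr diag_mx; apply/rowP => k'; rewrite !mxE.
    by rewrite mulfV.
   by rewrite diag_mxE eqxx mxE.
  have ret l z : regular_on (@GLset F r) (fun d => et d l z).
   have sG := @subGL F r.
   case: z => k; apply: regularX; [exact: regular_entry|exact: regular_invmx].
  apply: (@regular_eq _ _ _ (fun d => (invmx P *m diag_mx (\row_k \prod_l et d l (M k l)) *m P) i j)).
   move=> d Dd; congr ((_ *m diag_mx _ *m _) i j); apply/rowP => k; rewrite !mxE.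
   by apply: eq_bigr => l _; rewrite etE.
  apply: (regular_sub DU); have sG := @subGL F r.
  apply: regular_mulmxr => //; apply: regular_mulmxl => // k l.
  have [<-|kl] := eqVneq k l; last first.
   apply: (@regular_eq _ _ _ (fun=> 0)); last exact: regular_const.
   by move=> g _; rewrite diag_mxE (negPf kl).
  apply: (@regular_eq _ _ _ (fun d => \prod_l et d l (M k l))).
   by move=> d _; rewrite diag_mxE eqxx mxE.
  exact: regular_prod.
 + rewrite /fi -[RHS]tor1; congr tor; apply/funext => l; by rewrite mxE eqxx.
 + move=> d e /diag_group_coord [d0 ->] /diag_group_coord [e0 ->].
  by rewrite diag_mx_mul !fi_diag torM.
- move=> t [x x0 ->]; rewrite fo_tor // fi_diag; split=> //; exact: diag_group_mk.
- move=> d /diag_group_coord [d0 ->]; rewrite fi_diag; split; last by rewrite fo_tor.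
 by exists (fun l => d l l).
Qed.

End Mk.

Lemma meval_mmap (N : nat) (lq : 'M[{mpoly F[N]}]_n) (p : {mpoly F[n * n]}) v :
 (mmap (@mpolyC N F) (fun k => mxvec lq 0 k) p).@[v] = mxeval p (map_mx (meval v) lq).
Proof.
rewrite /mxeval /mmap raddf_sum /= [RHS]mevalE; apply: eq_bigr => m _.
rewrite rmorphM /= mevalC; congr (_ * _).
rewrite /mmap1 rmorph_prod /=; apply: eq_bigr => k _.
rewrite rmorphXn /=; congr (_ ^+ _).
by case/mxvec_indexP: k => i j; rewrite !mxvecE [RHS]mxE.
Qed.

Lemma cdiag_mpoly (P : 'M[F]_n) (p : {mpoly F[n * n]}) :
 exists q : {mpoly F[n]}, forall d, mxeval p (cdiag P d) = q.@[d].
Proof.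
pose C := map_mx (@mpolyC n F).
exists (mmap (@mpolyC n F) (fun k => mxvec (C n n (invmx P) *m diag_mx (\row_i 'X_i) *m C n n P) 0 k) p).
move=> d; rewrite meval_mmap; congr mxeval; rewrite !map_mxM map_diag_mx /cdiag.
have E (M : 'M[F]_n) : map_mx (meval d) (C n n M) = M.
 by apply/matrixP => i j; rewrite !mxE mevalC.
rewrite !E; congr (_ *m diag_mx _ *m _); apply/rowP => i; by rewrite !mxE /= mevalXU.
Qed.

Lemma det_cdiag (P : 'M[F]_n) d : P \in unitmx -> \det (cdiag P d) = \prod_i d i.
Proof.
move=> Pu; rewrite /cdiag !det_mulmx mulrAC -det_mulmx mulVmx // det1 mul1r det_diag.
by apply: eq_bigr => i _; rewrite mxE.
Qed.

(** The isomorphism with a diagonal group provides commuting one-parameter groups; their derivatives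
    and the additional integral matrix are diagonalized in one basis. The family [u], a left inverse
    of the weights [m], records that the coordinates of the torus are monomials in its weights. *)
Lemma torus_diag (T : set 'M[F]_n) (Q0 : 'M[F]_n) (z0 : 'I_n -> int) : torus T ->
 Q0 \in unitmx ->
 (forall t, T t -> t *m cdiag Q0 (fun i => (z0 i)%:~R) = cdiag Q0 (fun i => (z0 i)%:~R) *m t) ->
 exists P r (m : 'I_n -> 'I_r -> int) (z : 'I_n -> int) (u : 'I_r -> 'I_n -> int),
 [/\ P \in unitmx, T = torset P m,
   cdiag Q0 (fun i => (z0 i)%:~R) = cdiag P (fun i => (z i)%:~R) &
   forall k l, \sum_i u k i * m i l = (k == l)%:Z].
Proof.
move=> [[sT cT] [r [f [f' [[fr f1 fM] [f'r f'1 f'M] fT f'D]]]]] Q0u TQ0.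
pose D (x : 'I_r -> F) := diag_mx (\row_l x l).
pose e l c := fun k : 'I_r => if k == l then c else 1 : F.
have e0 l c : c != 0 -> forall k, e l c k != 0.
 by move=> c0 k; rewrite /e; case: ifP => // _; exact: oner_neq0.
have Dg x : (forall l, x l != 0) -> diagonal_group (D x) by exact: diag_group_mk.
pose g l c := f' (D (e l c)).
have gM l c d : c != 0 -> d != 0 -> g l (c * d) = g l c *m g l d.
 move=> c0 d0; rewrite /g -f'M; [|exact: Dg (e0 _ _ _)|exact: Dg (e0 _ _ _)].
 rewrite /D diag_mx_mul; congr (f' (diag_mx _)); apply/rowP => k; rewrite !mxE /e.
 by case: ifP; rewrite ?mulr1.
have g1 l : g l 1 = 1%:M.
 rewrite /g (_ : D _ = 1%:M) // /D -diag_mx1; congr diag_mx; apply/rowP => k.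
 by rewrite !mxE /e; case: ifP.
have gL l i j : exists (p : {poly F}) (k : nat), forall c, c != 0 -> g l c i j = p.[c] / c ^+ k.
 have [p [k H]] := f'r i j.
 have He a b : exists q : {poly F}, forall c, D (e l c) a b = q.[c].
  rewrite /D /e; have [<-|ab] := eqVneq a b; last first.
   by exists 0 => c; rewrite diag_mxE (negPf ab) horner0.
  case: (eqVneq a l) => al; last by exists 1 => c; rewrite diag_mxE eqxx mxE (negPf al) hornerC.
  by exists 'X => c; rewrite diag_mxE eqxx mxE al eqxx hornerX.
 have [q qE] := curve_poly p He.
 exists q, k => c c0; rewrite /g H ?qE; last exact: Dg (e0 _ _ c0).
 congr (_ / _ ^+ _); rewrite det_diag (bigD1 l) //= big1 ?mulr1.
  by rewrite mxE /e eqxx.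
 by move=> k' /negPf kl; rewrite mxE /e kl.
have gTl l c : c != 0 -> T (g l c) by move=> c0; exact: (f'D _ (Dg _ (e0 l c c0))).1.
have gcomm l c k d : c != 0 -> d != 0 -> g l c *m g k d = g k d *m g l c.
 move=> c0 d0; rewrite /g -!f'M; try exact: Dg (e0 _ _ _).
 by congr f'; rewrite /D !diag_mx_mul; congr diag_mx; apply/rowP => a; rewrite !mxE mulrC.
have [Pl [zl Hl]] : exists Pl zl, forall l : 'I_r, Pl l \in unitmx /\
  forall c, c != 0 -> g l c = cdiag (Pl l) (fun i => c ^ zl l i).
 have h l := laurent_hom (gM l) (g1 l) (gL l).
 exists (fun l => projT1 (cid (h l))), (fun l => projT1 (cid (projT2 (cid (h l))))) => l.
 exact: (projT2 (cid (projT2 (cid (h l))))).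
pose Yc l := cdiag (Pl l) (fun i => (zl l i)%:~R).
have two0 := two_neq0 F.
(* Commuting with the value at 2 is enough to commute with the derivative, as 2^z determines z. *)
have cY Z l : Z *m g l 2%:R = g l 2%:R *m Z -> Z *m Yc l = Yc l *m Z.
 have [Pu E] := Hl l; rewrite E // => /(comm_replica Pu); apply=> i j /int2_eq.
 by move=> ->.
pose Y (l : 'I_r.+1) := if unlift ord_max l is Some l' then Yc l' else cdiag Q0 (fun i => (z0 i)%:~R).
have Yd l : exists P (d : 'I_n -> F), P \in unitmx /\ Y l = cdiag P d.
 rewrite /Y; case: unlift => [l'|]; last by exists Q0, (fun i => (z0 i)%:~R).
 by exists (Pl l'), (fun i => (zl l' i)%:~R); split=> //; case: (Hl l').
have Yint l : exists P (d : 'I_n -> int), P \in unitmx /\ Y l = cdiag P (fun i => (d i)%:~R).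
 rewrite /Y; case: unlift => [l'|]; last by exists Q0, z0.
 by exists (Pl l'), (zl l'); split=> //; case: (Hl l').
have YcYc l l' : Yc l *m Yc l' = Yc l' *m Yc l.
 apply: (cY); apply/esym; apply: (cY); exact: gcomm.
have Ycomm l l' : Y l *m Y l' = Y l' *m Y l.
 rewrite /Y; case: unlift => [a|]; case: unlift => [b|] //.
  by apply/esym; apply: (cY); apply/esym; apply: TQ0; exact: gTl.
 by apply: (cY); apply/esym; apply: TQ0; exact: gTl.
have [P [Pu [d Hd]]] := cdiag_family Yd Ycomm.
(* The product of the factors x - d1_k over the integral spectrum kills the matrix, so every
   eigenvalue in the common basis is one of the integers d1_k. *)
have dint l i : exists z : int, d l i = z%:~R.
 have [P1 [d1 [P1u E]]] := Yint l.
 apply: contrapT => /forallNP H.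
 have : cdiag P (fun i => \prod_k (d l i - (d1 k)%:~R)) = 0.
  rewrite -(cdiag0 P1); apply: (@cdiag_fun P P1 (d l) (fun i => (d1 i)%:~R) _ _ Pu P1u).
   by rewrite -Hd -E.
  by move=> a b ->; rewrite (bigD1 b) //= subrr mul0r.
 rewrite -(cdiag0 P) => /(cdiag_inj Pu) /(_ i) /eqP; rewrite prodf_seq_eq0 => /hasP [k _].
 by rewrite subr_eq0 => /eqP /H.
pose dz l i := projT1 (cid (dint l i)).
have dzE l i : d l i = (dz l i)%:~R := projT2 (cid (dint l i)).
pose m i l := dz (lift ord_max l) i.
have gE l c : c != 0 -> g l c = cdiag P (fun i => c ^ m i l).
 move=> c0; have [Plu E] := Hl l; rewrite E //.
 apply: (@cdiag_fun (Pl l) P (fun i => (zl l i)%:~R) (fun i => (m i l)%:~R) _ _ Plu Pu).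
  rewrite -/(Yc l); have := Hd (lift ord_max l); rewrite {1}/Y liftK => ->.
  by apply: eq_cdiag => i; rewrite dzE.
 by move=> i j /eqP; rewrite eqr_int => /eqP ->.
have f'E x : (forall l, x l != 0) -> f' (D x) = tor P m x.
 move=> x0.
 have H (s : seq 'I_r) : uniq s -> f' (D (fun l => if l \in s then x l else 1)) =
   cdiag P (fun i => \prod_(l <- s) x l ^ m i l).
  elim: s => [|a s IH] /=.
   move=> _; rewrite (_ : D _ = 1%:M) ?f'1.
    by rewrite -(cdiag1 Pu); apply: eq_cdiag => i; rewrite big_nil.
   by rewrite /D -diag_mx1; congr diag_mx; apply/rowP => l; rewrite !mxE.
  case/andP => as_ us.
  have -> : D (fun l => if l \in a :: s then x l else 1) =
    D (e a (x a)) *m D (fun l => if l \in s then x l else 1).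
   rewrite /D diag_mx_mul; congr diag_mx; apply/rowP => l; rewrite !mxE inE /e.
   have [->|la] := eqVneq l a; first by rewrite (negPf as_) mulr1.
   by rewrite mul1r.
  rewrite f'M; [|exact: Dg (e0 _ _ (x0 a))|apply: Dg]; last first.
   by move=> l; case: ifP => // _; exact: oner_neq0.
  rewrite IH // -/(g a (x a)) gE // cdiagM //; apply: eq_cdiag => i.
  by rewrite big_cons.
 have := H (index_enum 'I_r) (index_enum_uniq _); rewrite /tor => <-.
 by congr (f' (diag_mx _)); apply/rowP => l; rewrite !mxE mem_index_enum.
have TE : T = torset P m.
 apply/seteqP; split=> t.
  move=> Tt; have [Dt tE] := fT t Tt; have [t0 E] := diag_group_coord Dt.
  exists (fun l => f t l l) => //; by rewrite -f'E // -{1}tE {1}E.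
 by move=> [x x0 ->]; rewrite -f'E //; exact: (f'D _ (Dg _ x0)).1.
(* The k-th coordinate of [f] is regular, so on the torus x_k times a power of the determinant is a
   combination of products of weights. By independence of characters one of these products has
   exactly that exponent; the power [a] of the determinant is taken off again in j_i - a. *)
have uex k : exists u : 'I_n -> int, forall l, \sum_i u i * m i l = (k == l)%:Z.
 have [p [a H]] := fr k k.
 have [q qE] := cdiag_mpoly P p.
 pose kap l : int := (k == l)%:Z + \sum_i (m i l) * a%:Z.
 pose ex (o : option 'X_{1..n}) (l : 'I_r) : int := if o is Some j then \sum_i m i l * (j i)%:Z else kap l.
 pose co (o : option 'X_{1..n}) : F := if o is Some j then q@_j else -1.
 have Hx x : (forall l, x l != 0) -> \sum_(o <- None :: map Some (msupp q)) co o * monom x (ex o) = 0.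
  move=> x0; rewrite big_cons big_map.
  have Tx : T (tor P m x) by rewrite TE; exists x.
  have := H _ Tx; have := (f'D _ (Dg _ x0)).2; rewrite f'E // => ->.
  rewrite diag_mxE eqxx mxE mulr1n /tor qE det_cdiag // => E.
  have pr0 : (\prod_i monom x (m i)) ^+ a != 0.
   by rewrite expf_neq0 //; apply/prodf_neq0 => i _; exact: monom_neq0.
  have {}E : q.@[fun i => monom x (m i)] = x k * (\prod_i monom x (m i)) ^+ a.
   by rewrite E divfK.
  have -> : \sum_(j <- msupp q) co (Some j) * monom x (ex (Some j)) = q.@[fun i => monom x (m i)].
   rewrite mevalE; apply: eq_bigr => j _; congr (_ * _).
   rewrite /ex (monom_sum _ (fun i l => m i l * (j i)%:Z)) //.
   by apply: eq_bigr => i _; rewrite monomMz.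
  rewrite E /= /kap mulN1r monomD // (monom_sum _ (fun i l => m i l * a%:Z)) //.
  have -> : monom x (fun l => (k == l)%:Z) = x k.
   rewrite /monom (bigD1 k) //= eqxx expr1z big1 ?mulr1 // => l.
   by rewrite eq_sym => /negPf ->; rewrite expr0z.
  rewrite -prodrXl (eq_bigr (fun i => monom x (m i) ^+ a)) ?addNr //.
  by move=> i _; rewrite monomMz.
 have := laurentn Hx kap; rewrite big_cons.
 have -> : [forall l, ex None l == kap l] by apply/forallP.
 move=> E; have [j js /forallP Ej] : exists2 j, j \in msupp q & [forall l, ex (Some j) l == kap l].
  apply: contrapT => /forall2NP Hn; move: E; rewrite big_map big_seq_cond big1 /=.
   by rewrite addr0 => /eqP; rewrite oppr_eq0 oner_eq0.
  by move=> j /andP [js Ej]; case: (Hn j) => [//|/negP]; rewrite Ej.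
 exists (fun i => (j i)%:Z - a%:Z) => l.
 have /eqP := Ej l; rewrite /ex /kap => E2.
 under eq_bigr do rewrite mulrBl.
 rewrite sumrB (eq_bigr (fun i => m i l * (j i)%:Z)); last by move=> i _; rewrite mulrC.
 rewrite E2 (eq_bigr (fun i => m i l * a%:Z) (F1 := fun i => a%:Z * m i l)) ?addrK //.
 by move=> i _; rewrite mulrC.
exists P, r, m, (dz ord_max), (fun k => projT1 (cid (uex k))); split=> //.
 have := Hd ord_max; rewrite {1}/Y unlift_none => ->.
 by apply: eq_cdiag => i; rewrite dzE.
by move=> k l; exact: (projT2 (cid (uex k))).
Qed.

End Torus.

(** [d] is the least positive integer combination of the z_i; a nonzero remainder modulo [d] would
    be a smaller one, so [d] divides every z_i. *)
Lemma bezout_fun n (z : 'I_n -> int) : (exists i, z i != 0) ->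
 exists (d : int) (w z' : 'I_n -> int), [/\ d != 0, forall i, z i = d * z' i & \sum_i w i * z' i = 1].
Proof.
move=> [i0 zi0].
pose Q (d : nat) := `[< (0 < d)%N /\ exists w : 'I_n -> int, \sum_i w i * z i = d%:Z >].
have ex : exists d, Q d.
 exists `|z i0|%N; apply/asboolP; split; first by rewrite absz_gt0.
 exists (fun i => if i == i0 then sgz (z i0) else 0).
 rewrite (bigD1 i0) //= eqxx big1 ?addr0; first by rewrite abszEsg.
 by move=> i /negPf ->; rewrite mul0r.
case: (ex_minnP ex) => d /asboolP [d0 [w wE]] dmin.
have dn0 : d%:Z != 0 :> int by rewrite eqz_nat -lt0n.
have dvd i : (z i %% d%:Z)%Z = 0.
 apply/eqP/negPn/negP => r0.
 have rge := modz_ge0 (z i) dn0.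
 have rlt := ltz_mod (z i) dn0.
 have : Q `|(z i %% d%:Z)%Z|%N.
  apply/asboolP; split; first by rewrite absz_gt0.
  exists (fun k => (if k == i then 1 else 0) - (z i %/ d%:Z)%Z * w k).
  rewrite gez0_abs //.
  rewrite (eq_bigr (fun k => (if k == i then 1 else 0) * z k - (z i %/ d%:Z)%Z * (w k * z k))); last first.
   by move=> k _; rewrite mulrBl mulrA.
  rewrite sumrB -mulr_sumr wE (bigD1 i) //= eqxx mul1r big1 ?addr0; last first.
   by move=> k /negPf ->; rewrite mul0r.
  by rewrite /modz.
 by move=> /dmin; rewrite -lez_nat gez0_abs // => h; move: rlt; rewrite ltNge => /negP; apply.
exists d%:Z, w, (fun i => (z i %/ d%:Z)%Z); split=> //.
 by move=> i; rewrite {1}(divz_eq (z i) d%:Z) dvd addr0 mulrC.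
apply: (mulfI dn0); rewrite mulr1 -[RHS]wE mulr_sumr; apply: eq_bigr => i _.
by rewrite {2}(divz_eq (z i) d%:Z) dvd addr0; ring.
Qed.

Section MaxTorus.
Variables (F : numClosedFieldType) (n : nat).
Implicit Types (G T : set 'M[F]_n).

Lemma root_int (c : F) (d : int) : c != 0 -> d != 0 -> exists2 e : F, e != 0 & e ^ d = c.
Proof.
move=> c0 d0; pose k := `|d|%N; have k0 : (0 < k)%N by rewrite absz_gt0.
pose e := if 0 <= d then c else c^-1.
have e0 : e != 0 by rewrite /e; case: ifP => _ //; rewrite invr_eq0.
exists (k.-root e); first by rewrite rootC_eq0.
have := rootCK k0 e; rewrite /k /e; case: (d) => m /=; first by move=> E; exact: E.
by rewrite NegzE -exprnN => ->; rewrite invrK.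
Qed.

Lemma monom_cst r (c : F) (k : 'I_r -> int) z : c != 0 -> monom (fun l => c ^ k l) z = c ^ (\sum_l k l * z l).
Proof.
move=> c0; rewrite /monom -prodf_exprz //; apply: eq_bigr => l _.
by rewrite exprz_exp.
Qed.

(** If the one-parameter group left T, adjoining it would give a larger torus inside [G]. To present
    that group with independent coordinates, the component along T is removed and the rest made
    primitive. *)
Lemma max_torus_contains G T (Q : 'M[F]_n) (z : 'I_n -> int) : subgroup G -> maximal_torus G T ->
 Q \in unitmx -> (forall c, c != 0 -> G (cdiag Q (fun i => c ^ z i))) ->
 (forall t, T t -> t *m cdiag Q (fun i => 2%:R ^ z i) = cdiag Q (fun i => 2%:R ^ z i) *m t) ->
 forall c, c != 0 -> T (cdiag Q (fun i => c ^ z i)).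
Proof.
move=> sG [Tt TG Tmax] Qu GQ comm.
have comm' t : T t -> t *m cdiag Q (fun i => (z i)%:~R) = cdiag Q (fun i => (z i)%:~R) *m t.
 by move=> Tt'; apply: comm_replica (comm t Tt') => // i j /int2_eq ->.
have [P [r [m [z0 [u [Pu TE QE dual]]]]]] := torus_diag Tt Qu comm'.
have QE' c : cdiag Q (fun i => c ^ z i) = cdiag P (fun i => c ^ z0 i).
 apply: (@cdiag_fun F n Q P (fun i => (z i)%:~R) (fun i => (z0 i)%:~R)) => // i j /eqP.
 by rewrite eqr_int => /eqP ->.
pose el j := \sum_i u j i * z0 i.
(* The exponents with their T-component removed: [z1] is orthogonal to every dual vector [u k]. When
   it vanishes, the group already lies in T. *)
pose z1 i := z0 i - \sum_j el j * m i j.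
have uz1 k : \sum_i u k i * z1 i = 0.
 rewrite (eq_bigr (fun i => u k i * z0 i - \sum_j el j * (u k i * m i j))); last first.
  by move=> i _; rewrite /z1 mulrBr mulr_sumr; congr (_ - _); apply: eq_bigr => j _; ring.
 rewrite sumrB exchange_big /=.
 under [X in _ - X]eq_bigr do rewrite -mulr_sumr dual.
 apply/eqP; rewrite subr_eq0; apply/eqP; rewrite [RHS](bigD1 k) //= eqxx mulr1 [X in _ + X]big1 ?addr0 // => j.
 by rewrite eq_sym => /negPf ->; rewrite mulr0.
have z0E c : c != 0 -> cdiag P (fun i => c ^ z0 i) = tor P m (fun j => c ^ el j) *m cdiag P (fun i => c ^ z1 i).
 move=> c0; rewrite /tor cdiagM //; apply: eq_cdiag => i.
 by rewrite monom_cst // -expfzDr // /z1 addrC subrK.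
have [z10|/existsNP [i0 /eqP zi0]] := pselect (forall i, z1 i = 0).
 move=> c c0; rewrite QE' z0E // (_ : cdiag P _ = 1%:M).
  by rewrite mulmx1 TE; exists (fun j => c ^ el j) => // l; rewrite expfz_neq0.
 by rewrite -(cdiag1 Pu); apply: eq_cdiag => i; rewrite z10.
have [d [w [z2 [d0 z12 wz]]]] := bezout_fun (ex_intro _ i0 zi0).
have uz2 k : \sum_i u k i * z2 i = 0.
 apply: (mulfI d0); rewrite mulr0; apply: etrans (uz1 k); rewrite mulr_sumr; apply: eq_bigr => i _.
 by rewrite z12; ring.
(* The Bezout vector is corrected to be orthogonal to the weights of T while still pairing to 1 with
   [z2], so that [m2] and [u2] are dual families of rank r + 1. *)
pose w' i := w i - \sum_l (\sum_k w k * m k l) * u l i.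
have wm j : \sum_i w' i * m i j = 0.
 rewrite (eq_bigr (fun i => w i * m i j - \sum_l (\sum_k w k * m k l) * (u l i * m i j))); last first.
  by move=> i _; rewrite /w' mulrBl mulr_suml; congr (_ - _); apply: eq_bigr => l _; ring.
 rewrite sumrB exchange_big /=.
 under [X in _ - X]eq_bigr do rewrite -mulr_sumr dual.
 apply/eqP; rewrite subr_eq0; apply/eqP; rewrite [RHS](bigD1 j) //= eqxx mulr1 [X in _ + X]big1 ?addr0 // => l /negPf ->.
 by rewrite mulr0.
have wz2 : \sum_i w' i * z2 i = 1.
 rewrite (eq_bigr (fun i => w i * z2 i - \sum_l (\sum_k w k * m k l) * (u l i * z2 i))); last first.
  by move=> i _; rewrite /w' mulrBl mulr_suml; congr (_ - _); apply: eq_bigr => l _; ring.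
 rewrite sumrB exchange_big /= wz big1 ?subr0 // => l _.
 by rewrite -mulr_sumr uz2 mulr0.
pose m2 (i : 'I_n) (l : 'I_r.+1) := if unlift ord_max l is Some l' then m i l' else z2 i.
pose u2 (l : 'I_r.+1) := if unlift ord_max l is Some l' then u l' else w'.
have dual2 k l : \sum_i u2 k i * m2 i l = (k == l)%:Z.
 rewrite /u2 /m2; case: (unliftP ord_max k) => [k'|] ->; case: (unliftP ord_max l) => [l'|] ->;
  rewrite ?dual ?uz2 ?wm ?wz2 ?eqxx //.
 - by rewrite (inj_eq (@lift_inj _ _)).
 - by rewrite eq_sym (negPf (neq_lift _ _)).
 - by rewrite (negPf (neq_lift _ _)).
have tor2E x : (forall l, x l != 0) ->
  tor P m2 x = tor P m (fun l => x (lift ord_max l)) *m cdiag P (fun i => x ord_max ^ z2 i).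
 move=> x0; rewrite /tor cdiagM //; apply: eq_cdiag => i.
 rewrite /monom (bigD1 ord_max) //= /m2 unlift_none mulrC; congr (_ * _).
 rewrite (eq_bigl (fun l => l != ord_max)) // (reindex_omap (lift ord_max) (unlift ord_max)) /=; last first.
  by move=> l; case: (unliftP ord_max l) => [l' ->|->]; rewrite ?eqxx.
 rewrite (eq_bigl predT); last by move=> l; rewrite /= liftK eqxx eq_sym neq_lift.
 by apply: eq_bigr => l _; rewrite liftK.
have sG' := sG; case: sG => _ _ GM GV.
have T2 : torset P m2 = T.
 apply: Tmax.
 - exact: torset_torus Pu dual2.
 - rewrite TE => t [x x0 ->].
  exists (fun l => if unlift ord_max l is Some l' then x l' else 1).
   by move=> l; case: unlift => [l'|]; [exact: x0|exact: oner_neq0].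
  rewrite tor2E; last by move=> l; case: unlift => [l'|]; [exact: x0|exact: oner_neq0].
  rewrite unlift_none (_ : cdiag P _ = 1%:M) ?mulmx1; last first.
   by rewrite -(cdiag1 Pu); apply: eq_cdiag => i; rewrite exp1rz.
  by congr tor; apply/funext => l; rewrite liftK.
 - move=> t [x x0 ->]; rewrite tor2E //; apply: (GM).
   by apply: (TG); rewrite TE; exists (fun l => x (lift ord_max l)).
  (* What is known to lie in [G] is the group with exponents z1 = d z2, so a d-th root of the last
     coordinate is taken. *)
  have [e e0 eE] := root_int (x0 ord_max) d0.
  have -> : cdiag P (fun i => x ord_max ^ z2 i) = cdiag P (fun i => e ^ z1 i).
   by apply: eq_cdiag => i; rewrite -eE exprz_exp z12.
  have tu : tor P m (fun j => e ^ el j) \in unitmx.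
   by apply: tor_unit => // l; rewrite expfz_neq0.
  have -> : cdiag P (fun i => e ^ z1 i) = invmx (tor P m (fun j => e ^ el j)) *m cdiag P (fun i => e ^ z0 i).
   by rewrite z0E // mulmxA mulVmx // mul1mx.
  apply: (GM); last by rewrite -QE'; exact: GQ.
  by apply: (GV); apply: (TG); rewrite TE; exists (fun j => e ^ el j) => // l; rewrite expfz_neq0.
have two0 := two_neq0 F.
(* The point with last coordinate 2 and all others 1 cannot lie in T: pairing its exponents with w'
   would give 2 = 1. *)
exfalso.
have : torset P m2 (tor P m2 (fun l => if l == ord_max then 2%:R else 1)).
 eexists; last reflexivity.
 by move=> l /=; case: ifP => _ //; exact: oner_neq0.
rewrite T2 TE => -[x x0]; rewrite tor2E; last by move=> l; case: ifP => // _; exact: oner_neq0.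
rewrite eqxx (_ : tor P m _ = 1%:M) ?mul1mx; last first.
 rewrite -(tor1 m Pu); congr tor; apply/funext => l.
 by rewrite eq_sym (negPf (neq_lift _ _)).
move=> /(cdiag_inj Pu) E.
have : \prod_i (2%:R : F) ^ (z2 i * w' i) = \prod_i monom x (fun l => m i l * w' i).
 by apply: eq_bigr => i _; rewrite -exprz_exp E monomMz.
rewrite prodf_exprz // (eq_bigr (fun i => w' i * z2 i)); last by move=> *; rewrite mulrC.
rewrite wz2 expr1z -monom_sum // (_ : monom x _ = 1); last first.
 rewrite -(monom0 x); congr monom; apply/funext => l; rewrite -[RHS](wm l).
 by apply: eq_bigr => i _; rewrite mulrC.
by move/eqP; rewrite (eqr_nat F 2 1).
Qed.

End MaxTorus.

Lemma nilp_graded (F : fieldType) n (W : 'M[F]_n) (N : 'I_n -> int) (d : int) : d != 0 ->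
 (forall i j, W i j != 0 -> N i - N j = d) -> nilp W.
Proof.
move=> d0 H.
have Hk k i j : (W ^+ k) i j != 0 -> N i - N j = k%:Z * d.
 elim: k i j => [|k IH] i j; first by rewrite mxX0 mxE; case: (eqVneq i j) => [-> _|_]; rewrite ?eqxx // subrr mul0r.
 rewrite exprS mxM mxE => h.
 have [l] : exists l, W i l * (W ^+ k) l j != 0.
  apply: contrapT => /forallNP h'; case/eqP: h; apply: big1 => l _.
  by apply/eqP/negPn/negP; exact: h'.
 rewrite mulf_eq0 negb_or => /andP [/H e1 /IH e2].
 by rewrite -(subrK (N l) (N i)) e1 -addrA e2 intS mulrDl mul1r.
pose B := (\sum_i `|N i|)%N.
apply: (nilpP (K := (B + B).+1)); apply/matrixP => i j; rewrite [RHS]mxE.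
apply/eqP/negPn/negP => /Hk E.
have b k : (`|N k| <= B)%N by rewrite /B (bigD1 k) //= leq_addr.
have := b i; have := b j; have d1 : (0 < `|d|)%N by rewrite absz_gt0.
have : (`|(N i - N j)%R| <= `|N i| + `|N j|)%N by lia.
by rewrite E abszM /=; nia.
Qed.

(** * The root space decomposition *)

Section Weights.
Variables (F : numClosedFieldType) (n : nat) (G T : set 'M[F]_n) (I : finType) (alpha : I -> 'M[F]_n -> F) (i0 : I).

Lemma dpD p (g X Y : 'M[F]_n) : dp p g (X + Y) = dp p g X + dp p g Y.
Proof.
rewrite /dp -big_split; apply: eq_bigr => k _ /=.
by case/mxvec_indexP: k => i j; rewrite !mxvecE mxE mulrDl.
Qed.

Lemma dpZ p (g X : 'M[F]_n) c : dp p g (c *: X) = c * dp p g X.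
Proof.
rewrite /dp mulr_sumr; apply: eq_bigr => k _ /=.
by case/mxvec_indexP: k => i j; rewrite !mxvecE mxE mulrA.
Qed.

Lemma dp_sum p (g : 'M[F]_n) (J : Type) (s : seq J) (X : J -> 'M[F]_n) :
 dp p g (\sum_(j <- s) X j) = \sum_(j <- s) dp p g (X j).
Proof.
elim/big_rec2: _ => [|j x y _ E]; last by rewrite dpD E.
by rewrite -(scale0r 0) dpZ mul0r.
Qed.

Definition wt (c : I -> int) : set 'M[F]_n :=
 [set X | Lie G X /\ forall t, T t -> t *m X = comb alpha c t *: (X *m t)].

Hypotheses (Gs : simple_algebraic_group G) (Tm : maximal_torus G T) (Rb : root_base G T alpha).

Lemma simple_group : subgroup G. Proof. by case: Gs => [[]]. Qed.
Lemma simple_closed : zariski_closed G. Proof. by case: Gs => [[]]. Qed.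
Lemma T_subG : T `<=` G. Proof. by case: Tm. Qed.
Lemma T_subgroup : subgroup T. Proof. by case: Tm => [[[]]]. Qed.

Lemma torus_form : exists P r (m : 'I_n -> 'I_r -> int) (u : 'I_r -> 'I_n -> int),
 [/\ P \in unitmx, T = torset P m & forall k l, \sum_i u k i * m i l = (k == l)%:Z].
Proof.
have [|t _|P [r [m [_ [u [Pu TE _ d]]]]]] := @torus_diag F n T 1%:M (fun=> 0) _ (unitmx1 _ _).
- by case: Tm.
- by rewrite (cdiag0 1%:M) mulmx0 mul0mx.
by exists P, r, m, u.
Qed.

Lemma root_neq0 i t : T t -> alpha i t != 0.
Proof.
move=> Tt; have [rt _ _] := Rb; have [[_ a1 aM] _ _] := rt i.
have [TU _ _ TV] := T_subgroup; apply/eqP => a0.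
have := aM t (invmx t) Tt (TV _ Tt); rewrite mulmxV ?TU // a1 a0 mul0r => /eqP.
by rewrite oner_eq0.
Qed.

Lemma comb_neq0 c t : T t -> comb alpha c t != 0.
Proof. by move=> Tt; apply/prodf_neq0 => i _; rewrite expfz_neq0 // root_neq0. Qed.
Lemma combD c d t : T t -> comb alpha (fun i => c i + d i) t = comb alpha c t * comb alpha d t.
Proof. by move=> Tt; rewrite -big_split; apply: eq_bigr => i _; rewrite expfzDr // root_neq0. Qed.
Lemma combN c t : comb alpha (fun i => - c i) t = (comb alpha c t)^-1.
Proof. by rewrite /comb -prodfV; apply: eq_bigr => i _; rewrite invr_expz. Qed.
Lemma comb0 t : comb alpha (fun=> 0) t = 1.
Proof. by rewrite /comb big1 // => i _; rewrite expr0z. Qed.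

Lemma comb_inj c d : (forall t, T t -> comb alpha c t = comb alpha d t) -> forall i, c i = d i.
Proof.
move=> E i; have [_ ind _] := Rb; apply/eqP; rewrite -subr_eq0; apply/eqP.
apply: (ind (fun i => c i - d i)) => t Tt; rewrite combD // combN E // mulfV //; exact: comb_neq0.
Qed.

Lemma eq_wt c d X : (forall i, c i = d i) -> wt c X -> wt d X.
Proof. by move=> /funext ->. Qed.

Lemma wt_lin c a X Y : wt c X -> wt c Y -> wt c (a *: X + Y).
Proof.
move=> [LX HX] [LY HY]; split; first by apply: LieD => //; exact: LieZ.
move=> t Tt; rewrite mulmxDr -scalemxAr HX // HY // mulmxDl -scalemxAl scalerDr.
by rewrite !scalerA mulrC.
Qed.

Lemma wtZ c a X : wt c X -> wt c (a *: X).
Proof.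
move=> wX; have := wt_lin a wX (Y := 0); rewrite addr0; apply.
by split=> [|t _]; [exact: Lie0|rewrite mulmx0 mul0mx scaler0].
Qed.

Lemma wtB c X Y : wt c X -> wt c Y -> wt c (X - Y).
Proof. by move=> wX wY; rewrite addrC -scaleN1r; exact: wt_lin. Qed.

Lemma tor_entry (P : 'M[F]_n) r (m : 'I_n -> 'I_r -> int) x (X : 'M[F]_n) i j : P \in unitmx ->
 (P *m (tor P m x *m X) *m invmx P) i j = monom x (m i) * (P *m X *m invmx P) i j.
Proof.
by move=> Pu; rewrite mulmxA mul_cdiag // -!mulmxA mul_diag_mx [LHS]mxE [(\row__ _) _ _]mxE mulmxA.
Qed.

Lemma tor_entryr (P : 'M[F]_n) r (m : 'I_n -> 'I_r -> int) x (X : 'M[F]_n) i j : P \in unitmx ->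
 (P *m (X *m tor P m x) *m invmx P) i j = (P *m X *m invmx P) i j * monom x (m j).
Proof.
move=> Pu; rewrite /tor /cdiag !mulmxA mulmxK //.
by rewrite mul_mx_diag [LHS]mxE [(\row__ _) _ _]mxE.
Qed.

Lemma entry_ext P (X Y : 'M[F]_n) : P \in unitmx ->
 (forall i j, (P *m X *m invmx P) i j = (P *m Y *m invmx P) i j) -> X = Y.
Proof.
move=> Pu /matrixP E; have := congr1 (fun A => invmx P *m A *m P) E.
by rewrite !mulmxA mulVmx // !mul1mx !mulmxKV.
Qed.

(** [chi0] is any function. An entry (i, j) at which [X] is nonzero shows that on T it agrees with
    the i-th diagonal entry divided by the j-th, and that is a regular character. *)
Lemma wt_char X : X != 0 -> Lie G X -> forall chi0 : 'M[F]_n -> F,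
 (forall t, T t -> t *m X = chi0 t *: (X *m t)) -> (exists2 t, T t & chi0 t != 1) ->
 exists chi, is_root G T chi /\ forall t, T t -> chi t = chi0 t.
Proof.
move=> X0 LX chi0 HX [t0 Tt0 t01].
have [P [r [m [u [Pu TE dual]]]]] := torus_form.
have [i [j Wij]] : exists i j, (P *m X *m invmx P) i j != 0.
 apply: contrapT => H; move/negP: X0; apply; apply/eqP; apply: (entry_ext Pu) => i j.
 by rewrite mulmx0 mul0mx [RHS]mxE; apply/eqP/negPn/negP => h; apply: H; exists i, j.
pose chi (t : 'M[F]_n) := (P *m t *m invmx P) i i * (P *m invmx t *m invmx P) j j.
have chiE x : (forall l, x l != 0) -> chi (tor P m x) = monom x (m i) / monom x (m j).
 move=> x0; rewrite /chi.
 have [|_ ->] := cdiag_unit (d := fun i => monom x (m i)) Pu _.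
  by move=> k; exact: monom_neq0.
 by rewrite !cdiag_conjE // !eqxx.
have chi0E t : T t -> chi t = chi0 t.
 rewrite TE => -[x x0 ->]; rewrite chiE //.
 have := HX (tor P m x); rewrite TE => /(_ (ex_intro2 _ _ x x0 erefl)) E.
 have := congr1 (fun A => (P *m A *m invmx P) i j) E.
 rewrite tor_entry // -scalemxAr -scalemxAl [X in _ = X -> _]mxE tor_entryr // => E2.
 apply: (mulIf Wij); rewrite mulrAC E2; have := monom_neq0 (m j) x0 => mj0.
 by field.
exists chi; split=> //; split.
- have TU : T `<=` @GLset F n by have [] := T_subgroup.
 split.
 + apply: (regular_sub TU); have sG := @subGL F n; apply: regularM.
   apply: regular_mulmxr => //; apply: regular_mulmxl => // *; exact: regular_entry.
  by apply: regular_mulmxr => //; apply: regular_mulmxl => // *; exact: regular_invmx.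
 + by rewrite /chi invmx1 mulmx1 mulmxV // !mxE !eqxx mulr1.
 + move=> s t; rewrite TE => -[x x0 ->] [y y0 ->].
  rewrite -torM // !chiE //; last by move=> l; rewrite mulf_neq0.
  by rewrite !monomM invfM; ring.
- by exists t0; rewrite ?chi0E.
- exists X; split=> // t Tt; have [TU _ _ _] := T_subgroup.
 by rewrite HX // chi0E // -scalemxAl mulmxK ?TU.
Qed.

Lemma wt_root c X : X != 0 -> wt c X -> (exists i, c i != 0) ->
 (exists chi, is_root G T chi /\ forall t, T t -> chi t = comb alpha c t) /\
 ((forall i, 0 <= c i) \/ (forall i, c i <= 0)).
Proof.
move=> X0 [LX HX] [i ci].
have [_ ind all] := Rb.
have [chi [rchi chiE]] : exists chi, is_root G T chi /\ forall t, T t -> chi t = comb alpha c t.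
 apply: (wt_char X0 LX HX); apply: contrapT => /forall2NP H.
 have E : c i = 0 by apply: ind => t Tt; have [//|/negP/negPn/eqP] := H t.
 by rewrite E eqxx in ci.
split; first by exists chi.
have [d [dE sd]] := all _ rchi.
have -> : c = d by apply/funext; apply: comb_inj => t Tt; rewrite -dE // chiE.
exact: sd.
Qed.

(** Entries of [X] are grouped by the character through which T acts on them. A linear equation of
    the Lie algebra holds for all t X t^-1, and independence of characters makes it hold for each
    group separately. *)
Lemma Lie_decomp X : Lie G X -> exists2 s : seq 'M[F]_n,
 (forall Y, Y \in s -> exists c, wt c Y) & X = \sum_(Y <- s) Y.
Proof.
move=> LX; have [P [r [m [u [Pu TE dual]]]]] := torus_form.
pose key (p : 'I_n * 'I_n) : {ffun 'I_r -> int} := [ffun l => m p.1 l - m p.2 l].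
pose W := P *m X *m invmx P.
pose Xk (k : {ffun 'I_r -> int}) : 'M[F]_n := invmx P *m (\matrix_(i, j) (if key (i, j) == k then W i j else 0)) *m P.
have WX k i j : (P *m Xk k *m invmx P) i j = if key (i, j) == k then W i j else 0.
 by rewrite /Xk !mulmxA mulmxK // mulmxV // mul1mx mxE.
pose s := undup [seq key p | p <- enum {: 'I_n * 'I_n}].
have ks i j : key (i, j) \in s by rewrite mem_undup; apply: map_f; rewrite mem_enum.
have us : uniq s := undup_uniq _.
have keyM (x : 'I_r -> F) i j : (forall l, x l != 0) -> monom x (m i) = monom x (key (i, j)) * monom x (m j).
 by move=> x0; rewrite -monomD //; congr monom; apply/funext => l; rewrite ffunE /= subrK.
have torX x k : (forall l, x l != 0) -> tor P m x *m Xk k = monom x k *: (Xk k *m tor P m x).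
 move=> x0; apply: (entry_ext Pu) => i j; rewrite tor_entry //.
 rewrite -scalemxAr -scalemxAl [RHS]mxE tor_entryr // WX.
 by have [<-|_] := eqVneq; rewrite ?(mul0r, mulr0) // (keyM x i j) //; ring.
have XE : X = \sum_(k <- s) Xk k.
 apply: (entry_ext Pu) => i j; rewrite mulmx_sumr mulmx_suml summxE.
 rewrite (eq_bigr (fun k => if key (i, j) == k then W i j else 0)) => [|k _]; last exact: WX.
 rewrite (bigD1_seq (key (i, j))) ?ks //= eqxx big1 ?addr0 // => k.
 by rewrite eq_sym => /negPf ->.
have LXk k : k \in s -> Lie G (Xk k).
 move=> kks; apply/LieP => p vp.
 have H x : (forall l, x l != 0) -> \sum_(k <- s) dp p 1%:M (Xk k) * monom x k = 0.
  move=> x0; have Tx : T (tor P m x) by rewrite TE; exists x.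
  have tu := tor_unit m Pu x0.
  have := Lie_conj simple_group (T_subG Tx) LX; rewrite LieP => /(_ p vp).
  rewrite {1}XE mulmx_sumr mulmx_suml dp_sum => {2}<-.
  apply: eq_bigr => k' _; rewrite torX // -scalemxAl mulmxK // dpZ mulrC.
  by [].
 have := laurentn H k; rewrite (big_rem k) //=.
 have -> : [forall l, k l == k l] by apply/forallP.
 rewrite big_seq_cond big1 ?addr0 // => k' /andP []; rewrite mem_rem_uniq // inE.
 move=> /andP [kk' _] /forallP E; case/eqP: kk'; apply/ffunP => l; exact/eqP.
exists [seq Xk k | k <- s]; last by rewrite big_map.
move=> _ /mapP [k kks ->].
have [Xk0|Xk0] := eqVneq (Xk k) 0.
 by exists (fun=> 0); rewrite Xk0; split=> [|t _]; [exact: Lie0|rewrite mulmx0 mul0mx scaler0].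
have [k0|/forallPn [l kl]] := boolP [forall l, k l == 0].
 exists (fun=> 0); split; first exact: LXk.
 move=> t; rewrite comb0 TE => -[x x0 ->]; rewrite torX //.
 rewrite (_ : monom x k = 1) // -(monom0 x); congr monom; apply/funext => l.
 by apply/eqP; exact: (forallP k0).
have [i [j kij]] : exists i j, key (i, j) = k.
 move: kks; rewrite mem_undup => /mapP [[i j] _ ->]; by exists i, j.
pose chi0 (t : 'M[F]_n) := (P *m t *m invmx P) i i / (P *m t *m invmx P) j j.
have chi0E x : (forall l, x l != 0) -> chi0 (tor P m x) = monom x k.
 move=> x0; rewrite /chi0 !cdiag_conjE // !eqxx !mulr1n (keyM x i j) // kij mulfK //.
 exact: monom_neq0.
have two0 := two_neq0 F.
have [||chi [rchi chiE]] := wt_char Xk0 (LXk _ kks) (chi0 := chi0).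
- by move=> t; rewrite TE => -[x x0 ->]; rewrite torX // chi0E.
- pose x l' : F := if l' == l then 2%:R else 1.
 have x0 l' : x l' != 0 by rewrite /x; case: ifP => _ //; exact: oner_neq0.
 exists (tor P m x); first by rewrite TE; exists x.
 rewrite chi0E // /monom (bigD1 l) //= big1 => [|l' /negPf ll']; last by rewrite /x ll' exp1rz.
 rewrite mulr1 /x eqxx; apply/eqP => E; case/eqP: kl; apply: (@int2_eq F).
 by rewrite E expr0z.
have [_ _ all] := Rb; have [c [cE _]] := all _ rchi.
exists c; split; first exact: LXk.
move=> t Tt; rewrite -cE // chiE //; move: Tt; rewrite TE => -[x x0 ->].
by rewrite torX // chi0E.
Qed.

Notation comb := (comb alpha).
Let sG := simple_group.
Let sT := T_subgroup.
Let TG := T_subG.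

Lemma T_unit t : T t -> t \in unitmx. Proof. by case: sT => H _ _ _; exact: H. Qed.

Lemma nz_T (c : I -> int) i : c i != 0 -> exists2 t, T t & comb c t != 1.
Proof.
move=> ci; apply: contrapT => /forall2NP H; case/eqP: ci.
apply: (comb_inj (c := c) (d := fun=> 0)) => t Tt; rewrite comb0.
by have [//|/negP/negPn/eqP] := H t.
Qed.

(** Some coordinate of T acts nontrivially on [X]; grading the weight basis by that coordinate makes
    [X] homogeneous of nonzero degree. *)
Lemma wt_nilp c i X : c i != 0 -> wt c X -> nilp X.
Proof.
move=> ci [LX HX]; have [P [r [m [u [Pu TE dual]]]]] := torus_form.
pose W := P *m X *m invmx P.
have XE : X = invmx P *m W *m invmx (invmx P).
 by rewrite invmxK /W !mulmxA mulVmx // mul1mx mulmxKV.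
suff nW : nilp W by rewrite XE; apply: nilpJ nW; rewrite unitmx_inv.
have HW x a b : (forall l, x l != 0) -> W a b != 0 ->
  monom x (m a) = comb c (tor P m x) * monom x (m b).
 move=> x0 Wab; have := HX (tor P m x); rewrite TE => /(_ (ex_intro2 _ _ x x0 erefl)) E.
 have := congr1 (fun A => (P *m A *m invmx P) a b) E.
 rewrite tor_entry // -scalemxAr -scalemxAl [X in _ = X -> _]mxE tor_entryr // -/W => E2.
 by apply: (mulIf Wab); rewrite E2; ring.
have [t Tt tc] := nz_T ci.
have [W0|/eqP W0] := pselect (W = 0); first by rewrite W0; exact: nilp0.
have [a [b Wab]] : exists a b, W a b != 0.
 apply: contrapT => H; case/eqP: W0; apply/matrixP => a b; rewrite [RHS]mxE.
 by apply/eqP/negPn/negP => h; apply: H; exists a, b.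
have [l ml] : exists l, m a l != m b l.
 apply: contrapT => /forallNP H; move: Tt tc; rewrite TE => -[x x0 ->] /eqP; apply.
 have := HW x a b x0 Wab; rewrite (_ : m a = m b); last first.
  by apply/funext => l; apply/eqP/negPn/negP; exact: H.
 by move=> E; apply: (mulIf (monom_neq0 (m b) x0)); rewrite -E mul1r.
have two0 := two_neq0 F.
apply: (@nilp_graded F n W (fun i => m i l) (m a l - m b l)); first by rewrite subr_eq0.
move=> i' j' Wij.
pose x l' : F := if l' == l then 2%:R else 1.
have x0 l' : x l' != 0 by rewrite /x; case: ifP => _ //; exact: oner_neq0.
have xm k : monom x k = 2%:R ^ k l.
 rewrite /monom (bigD1 l) //= big1 => [|l' /negPf ll']; last by rewrite /x ll' exp1rz.
 by rewrite mulr1 /x eqxx.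
have := HW x i' j' x0 Wij; have := HW x a b x0 Wab; rewrite !xm => E1 E2.
apply: (@int2_eq F); rewrite !expfzDr // E1 E2 -!mulrA -!expfzDr // !subrr.
by [].
Qed.

Lemma wt_exp c i a X : c i != 0 -> wt c X -> G (expm (a *: X)).
Proof.
move=> ci wX; apply: expm_Lie => //; first exact: simple_closed.
 by apply: LieZ; case: wX.
by apply: nilpZ; exact: wt_nilp ci wX.
Qed.

Lemma wt_brk c d i X Y : c i != 0 -> wt c X -> wt d Y -> wt (fun i => c i + d i) (brk X Y).
Proof.
move=> ci wX wY; split.
 have [L LE] := Lie_vspace G; apply/LE; apply: brk_mem; first exact: wt_nilp ci wX.
 move=> a; apply/LE.
 rewrite -invmx_expm; last by apply: nilpZ; exact: wt_nilp ci wX.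
 by apply: Lie_conj => //; [exact: wt_exp ci wX|case: wY].
move=> t Tt; rewrite combD // /brk mulmxBr mulmxBl scalerBr.
case: wX wY => _ /(_ _ Tt) HX [_ /(_ _ Tt) HY]; rewrite !mulmxA HX HY.
rewrite -!scalemxAl -!mulmxA HX HY -!scalemxAr !scalerA; congr (_ - _).
by rewrite mulrC.
Qed.

Lemma wt0P X : wt (fun=> 0) X <-> Lie G X /\ forall t, T t -> t *m X = X *m t.
Proof.
split=> -[LX HX]; split=> // t Tt; rewrite HX //.
 by rewrite comb0 scale1r.
by rewrite comb0 scale1r.
Qed.

Lemma T_diag t : T t -> exists P d, P \in unitmx /\ t = cdiag P d.
Proof.
have [P [r [m [u [Pu TE dual]]]]] := torus_form.
by rewrite TE => -[x x0 ->]; exists P, (fun i => monom x (m i)).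
Qed.

Lemma comm_cochar Q (z : 'I_n -> int) Z : Q \in unitmx -> (forall c, c != 0 -> T (cdiag Q (fun i => c ^ z i))) ->
 (forall t, T t -> t *m Z = Z *m t) -> Z *m cdiag Q (fun i => (z i)%:~R) = cdiag Q (fun i => (z i)%:~R) *m Z.
Proof.
move=> Qu TQ HZ; have two0 := two_neq0 F.
have := HZ _ (TQ _ two0) => /esym; apply: comm_replica => // i j /int2_eq -> //.
Qed.

(** The replicas of [X] commute with T, so by maximality their one-parameter groups lie in T. Hence
    the semisimple part commutes with everything that T commutes with. *)
Lemma g0_jordan X : Lie G X -> (forall t, T t -> t *m X = X *m t) ->
 exists Q lam N r (mu : 'I_r -> F) (z : 'I_n -> 'I_r -> int),
 [/\ [/\ Q \in unitmx, nilp N, X = cdiag Q lam + N & Lie G N],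
   (forall i, lam i = \sum_j (z i j)%:~R * mu j),
   int_free r mu,
   (forall j c, c != 0 -> T (cdiag Q (fun i => c ^ z i j))) &
   (forall t, T t -> t *m N = N *m t) /\
   (forall Z, (forall t, T t -> t *m Z = Z *m t) -> Z *m cdiag Q lam = cdiag Q lam *m Z)].
Proof.
move=> LX cX; have [Q [lam [N [r [mu [z [[Qu nN XE LN] lamE ind GQ comm]]]]]]] := jordan_Lie sG simple_closed LX.
have TQ j c : c != 0 -> T (cdiag Q (fun i => c ^ z i j)).
 apply: (@max_torus_contains F n G T Q (fun i => z i j)) => //; first by move=> ? /GQ.
 move=> t Tt; have [h _] := comm t (cX t Tt); apply: comm_replica h => // i i' E.
 by rewrite (lam_z lamE ind E).
exists Q, lam, N, r, mu, z; split=> //; split.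
 by move=> t /cX /comm [].
move=> Z cZ.
have -> : cdiag Q lam = \sum_j mu j *: cdiag Q (fun i => (z i j)%:~R).
 rewrite (eq_bigr (fun j => cdiag Q (fun i => mu j * (z i j)%:~R))); last by move=> j _; rewrite cdiagZ.
 rewrite cdiag_sum; apply: eq_cdiag => i; rewrite lamE; apply: eq_bigr => j _; exact: mulrC.
rewrite mulmx_sumr mulmx_suml; apply: eq_bigr => j _.
by rewrite -scalemxAl -scalemxAr comm_cochar // => c; exact: TQ.
Qed.

(** For the trace form [N] is orthogonal to the root spaces because T acts on them nontrivially, and
    to the centralizer of T by [NM] and the Jordan decomposition there; nondegeneracy gives N =
    0. *)
Lemma g0_nilp0 N : Lie G N -> (forall t, T t -> t *m N = N *m t) -> nilp N -> N = 0.
Proof.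
move=> LN cN nN; apply: (trace_nondeg Gs) => //.
 have [rt _ _] := Rb; have [[_ a1 _] [t Tt at1] _] := rt i0.
 have [P [d [Pu tE]]] := T_diag Tt; exists t, P, d; split=> //; first exact: TG.
 by apply: contra_neq at1 => ->.
move=> Y /Lie_decomp [s Hs ->]; rewrite mulmx_sumr raddf_sum big_seq big1 //= => {}Y /Hs [c [LY HY]].
have [[t Tt ct]|/forall2NP H] := pselect (exists2 t, T t & comb c t != 1).
 have E : \tr (N *m Y) = comb c t * \tr (N *m Y).
  transitivity (\tr (t *m (N *m Y) *m invmx t)); first by rewrite [RHS]mxtrace_mulC mulKmx // T_unit.
  by rewrite mulmxA cN // -(mulmxA N) HY // -scalemxAr -scalemxAl mxtraceZ mulmxA mulmxK ?T_unit.
 have : (1 - comb c t) * \tr (N *m Y) = 0 by rewrite mulrBl mul1r -E subrr.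
 by move/eqP; rewrite mulf_eq0 subr_eq0 eq_sym (negPf ct) => /eqP.
have cY t : T t -> t *m Y = Y *m t.
 by move=> Tt; rewrite HY //; have [//|/negP/negPn/eqP ->] := H t; rewrite scale1r.
have SN Q lam (A : 'M[F]_n) : A *m cdiag Q lam = cdiag Q lam *m A -> nilp A -> \tr (cdiag Q lam *m A) = 0.
 by move=> h nA; apply: nilp_tr; apply: nilp_mul_comm.
(* Polarization: 2 tr(NM) = tr((N + M)^2), although N + M is not known to be nilpotent. Its
   semisimple part S commutes with N, M and the nilpotent part, so tr(S (N + M)) = 0, whence tr(S^2)
   = 0 and the square has trace 0. *)
have NM M : Lie G M -> (forall t, T t -> t *m M = M *m t) -> nilp M -> \tr (N *m M) = 0.
 move=> LM cM nM; pose Z := N + M.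
 have cZ t : T t -> t *m Z = Z *m t by move=> Tt; rewrite mulmxDr mulmxDl cN // cM.
 have [Q [lam [M' [r [mu [z [[Qu nM' ZE LM'] lamE ind TQ [cM' cS]]]]]]]] := g0_jordan (LieD LN LM : Lie G Z) cZ.
 have tNM : \tr (Z *m Z) = \tr (N *m M) *+ 2.
  rewrite mulmxDr !mulmxDl !raddfD /= (nilp_tr (N := N *m N)) ?(nilp_tr (N := M *m M)); try exact: nilp_mul_comm.
  by rewrite add0r addr0 [\tr (M *m N)]mxtrace_mulC.
 have tSM' : \tr (cdiag Q lam *m M') = 0 by apply: SN => //; exact: cS.
 have tSS : \tr (cdiag Q lam *m cdiag Q lam) = 0.
  have : \tr (cdiag Q lam *m Z) = 0.
   by rewrite mulmxDr raddfD /= !SN ?addr0 //; exact: cS.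
  by rewrite ZE mulmxDr raddfD /= tSM' addr0.
 move: tNM; rewrite ZE mulmxDr !mulmxDl !raddfD /= tSS tSM' [\tr (M' *m _)]mxtrace_mulC tSM'.
 rewrite (nilp_tr (N := M' *m M')); last exact: nilp_mul_comm.
 by rewrite !addr0 => /esym/eqP; rewrite mulrn_eq0 /= => /eqP.
have [Q [lam [M [r [mu [z [[Qu nM YE LM] lamE ind TQ [cM cS]]]]]]]] := g0_jordan LY cY.
by rewrite YE mulmxDr raddfD /= [\tr (N *m M)]NM // addr0 mxtrace_mulC SN //; exact: cS.
Qed.

Lemma g0_form X : wt (fun=> 0) X ->
 exists Q lam r (mu : 'I_r -> F) (z : 'I_n -> 'I_r -> int),
 [/\ Q \in unitmx, X = cdiag Q lam, (forall i, lam i = \sum_j (z i j)%:~R * mu j),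
   int_free r mu &
   (forall j c, c != 0 -> T (cdiag Q (fun i => c ^ z i j)))].
Proof.
move=> /wt0P [LX cX].
have [Q [lam [N [r [mu [z [[Qu nN XE LN] lamE ind TQ [cN _]]]]]]]] := g0_jordan LX cX.
exists Q, lam, r, mu, z; split=> //.
by rewrite XE (g0_nilp0 LN cN nN) addr0.
Qed.

Lemma cochar_act Q (z : 'I_n -> int) c Y : Q \in unitmx -> (forall x, x != 0 -> T (cdiag Q (fun i => x ^ z i))) ->
 wt c Y -> Y != 0 -> exists k : int, brk (cdiag Q (fun i => (z i)%:~R)) Y = k%:~R *: Y /\
  comb c (cdiag Q (fun i => 2%:R ^ z i)) = 2%:R ^ k.
Proof.
move=> Qu TQ [_ HY] Y0; have two0 := two_neq0 F.
pose W := Q *m Y *m invmx Q.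
have L d A i j : (Q *m (cdiag Q d *m A) *m invmx Q) i j = d i * (Q *m A *m invmx Q) i j.
 by rewrite mulmxA mul_cdiag // -!mulmxA mul_diag_mx [LHS]mxE [(\row__ _) _ _]mxE mulmxA.
have R d A i j : (Q *m (A *m cdiag Q d) *m invmx Q) i j = (Q *m A *m invmx Q) i j * d j.
 by rewrite /cdiag !mulmxA mulmxK // mul_mx_diag [LHS]mxE [(\row__ _) _ _]mxE.
have E := HY _ (TQ _ two0).
have E1 i j : W i j != 0 -> 2%:R ^ z i = comb c (cdiag Q (fun i => 2%:R ^ z i)) * 2%:R ^ z j.
 move=> Wij; have := congr1 (fun A => (Q *m A *m invmx Q) i j) E.
 rewrite L -scalemxAr -scalemxAl [X in _ = X -> _]mxE R -/W => E2.
 by apply: (mulIf Wij); rewrite E2; ring.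
have [a [b Wab]] : exists a b, W a b != 0.
 apply: contrapT => H; case/eqP: Y0; apply: (entry_ext Qu) => a b; rewrite mulmx0 mul0mx [RHS]mxE.
 by apply/eqP/negPn/negP => h; apply: H; exists a, b.
have kE i j : W i j != 0 -> comb c (cdiag Q (fun i => 2%:R ^ z i)) = 2%:R ^ (z i - z j).
 by move=> /E1 e; rewrite expfzDr // e -mulrA -expfzDr // subrr expr0z mulr1.
exists (z a - z b); split; last exact: kE.
apply: (entry_ext Qu) => i j.
rewrite /brk mulmxBr mulmxBl [LHS]mxE [(- (_ *m _ *m _)) _ _]mxE L R.
rewrite -scalemxAr -scalemxAl [RHS]mxE -/W.
have [->|Wij] := eqVneq (W i j) 0; first by rewrite !(mulr0, mul0r) subr0.
have -> : z a - z b = z i - z j by apply: (@int2_eq F); rewrite -(kE _ _ Wab) (kE _ _ Wij).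
by rewrite intrB; ring.
Qed.

End Weights.

(** * The differential of a representation, through its graph *)

Section BlockDiag.
Variables (F : numFieldType) (n d : nat).
Definition bd (X : 'M[F]_n) (A : 'M[F]_d) : 'M[F]_(n + d) := block_mx X 0 0 A.

Lemma bdM X Y A B : bd X A *m bd Y B = bd (X *m Y) (A *m B).
Proof. by rewrite /bd mulmx_block !(mulmx0, mul0mx, addr0, add0r). Qed.
Lemma bdD X Y A B : bd X A + bd Y B = bd (X + Y) (A + B).
Proof. by rewrite /bd add_block_mx !addr0. Qed.
Lemma bdZ c X A : c *: bd X A = bd (c *: X) (c *: A).
Proof. by rewrite /bd scale_block_mx !scaler0. Qed.
Lemma bd1 : bd 1%:M 1%:M = 1%:M. Proof. by rewrite /bd -scalar_mx_block. Qed.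
Lemma bd0 : bd 0 0 = 0. Proof. by rewrite /bd block_mx0. Qed.
Lemma bd_unit X A : bd X A \in unitmx = (X \in unitmx) && (A \in unitmx).
Proof. exact: block_diag_mx_unit. Qed.
Lemma bd_inv X A : X \in unitmx -> A \in unitmx -> invmx (bd X A) = bd (invmx X) (invmx A).
Proof. by move=> Xu Au; rewrite /bd invmx_block_diag // block_diag_mx_unit Xu. Qed.
Lemma bdX X A k : bd X A ^+ k = bd (X ^+ k) (A ^+ k).
Proof. by elim: k => [|k IH]; rewrite ?mxX0 ?bd1 // !exprS !mxM IH bdM. Qed.
Lemma bd_nilp X A : nilp X -> nilp A -> nilp (bd X A).
Proof.
move=> nX nA; rewrite /nilp bdX (nilp_ge nX) ?leq_addr // (nilp_ge nA) ?leq_addl //; exact: bd0.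
Qed.
Lemma bd_expm X A : nilp X -> nilp A -> expm (bd X A) = bd (expm X) (expm A).
Proof.
move=> nX nA; rewrite (expmE (K := n + d) nX) ?leq_addr // (expmE (K := n + d) nA) ?leq_addl //.
rewrite /expm (eq_bigr (fun k : 'I_(n + d) => bd ((k`!%:R)^-1 *: X ^+ k) ((k`!%:R)^-1 *: A ^+ k))).
 by elim/big_rec3: _ => [|i x y z _ ->]; rewrite ?bd0 ?bdD.
by move=> k _; rewrite bdX bdZ.
Qed.
Lemma bd_brk X Y A B : brk (bd X A) (bd Y B) = bd (brk X Y) (brk A B).
Proof. by rewrite /brk !bdM -!scaleN1r bdZ bdD. Qed.
Lemma bd_cdiag Q P (z : 'I_n -> F) (y : 'I_d -> F) : Q \in unitmx -> P \in unitmx ->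
 bd (cdiag Q z) (cdiag P y) = cdiag (bd Q P) (fun i => match split i with inl a => z a | inr b => y b end).
Proof.
move=> Qu Pu; rewrite /cdiag bd_inv //.
have -> : diag_mx (\row_i match split i with inl a => z a | inr b => y b end) =
  bd (diag_mx (\row_i z i)) (diag_mx (\row_i y i)).
 rewrite /bd -diag_mx_row; congr diag_mx; apply/rowP => i; rewrite !mxE.
 by case: (split i) => a; rewrite mxE.
by rewrite !bdM.
Qed.
End BlockDiag.

(** The polynomials det exp(cX) and det exp(-cX) are inverse to each other, hence constant. This
    removes the determinant denominators of a rational representation along unipotent one-parameter
    groups. *)
Lemma det_expm (F : numClosedFieldType) n (X : 'M[F]_n) : nilp X -> \det (expm X) = 1.
Proof.
move=> nX; have [P PE] := curve_poly (\det (mxvar F n)) (fun i j => expm_poly X i j).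
have {}PE c : P.[c] = \det (expm (c *: X)) by rewrite PE mxeval_det.
have E : P * (P \Po (- 'X)) = 1.
 apply: poly_ext => c; rewrite hornerM horner_comp !hornerE !PE -det_mulmx -expmZD // subrr.
 by rewrite scale0r expm0 det1.
have [P0 R0] : P != 0 /\ P \Po (- 'X) != 0.
 by apply/andP; rewrite -negb_or -mulf_eq0 E oner_eq0.
have : (size P <= 1)%N.
 have h : (size P + size (P \Po (- 'X))).-1 = 1%N by rewrite -size_mul // E size_poly1.
 by move: P0 R0 h; rewrite -!size_poly_gt0; move: (size P) (size _) => a b; lia.
move/size1_polyC => PC; have := PE 0; rewrite PC hornerC scale0r expm0 det1 => P1.
by have := PE 1; rewrite PC hornerC P1 scale1r.
Qed.

Section Graph.
Variables (F : numClosedFieldType) (n d : nat) (S : set 'M[F]_n) (rho : 'M[F]_n -> 'M[F]_d).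
Hypotheses (sS : subgroup S) (hr : algebraic_hom S rho).

Let K : set 'M[F]_(n + d) := [set h | exists2 g, S g & h = bd g (rho g)].
Let rM g h : S g -> S h -> rho (g *m h) = rho g *m rho h.
Proof. by case: hr => _ _; exact. Qed.
Let r1 : rho 1%:M = 1%:M. Proof. by case: hr. Qed.

Lemma rho_inv g : S g -> rho g \in unitmx /\ invmx (rho g) = rho (invmx g).
Proof.
move=> Sg; case: sS => SU _ _ SV; have E : rho g *m rho (invmx g) = 1%:M.
 by rewrite -rM ?mulmxV ?r1 ?SU //; exact: SV.
by split; [have /mulmx1_unit [] := E|exact: invmx_uniq].
Qed.

Lemma graph_subgroup : subgroup K.
Proof.
case: (sS) => SU S1 SM SV; split.
- move=> _ [g Sg ->]; rewrite bd_unit SU //=; by case: (rho_inv Sg).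
- by exists 1%:M; rewrite // r1 bd1.
- by move=> _ _ [g Sg ->] [h Sh ->]; exists (g *m h); [exact: SM|rewrite bdM rM].
- move=> _ [g Sg ->]; exists (invmx g); first exact: SV.
 by have [ru <-] := rho_inv Sg; rewrite bd_inv ?SU.
Qed.

(** The differential as a relation: the pair is tangent to the graph of [rho]. What is known of Lie
    algebras of groups, on brackets and one-parameter groups, then applies to the graph. *)
Definition drho (X : 'M[F]_n) (A : 'M[F]_d) : Prop := Lie K (bd X A).

Lemma drhoZ c X A : drho X A -> drho (c *: X) (c *: A).
Proof. by rewrite /drho -bdZ; exact: LieZ. Qed.

Lemma drho_fun X A B : drho X A -> drho X B -> A = B.
Proof.
move=> XA XB; have L0 : Lie K (bd 0 (A - B)).
 rewrite (_ : bd _ _ = bd X A + (-1) *: bd X B); last by rewrite bdZ bdD !scaleN1r subrr.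
 by apply: LieD => //; exact: LieZ.
suff E : A - B = 0 by rewrite -(subrK B A) E add0r.
apply/matrixP => i j; rewrite [RHS]mxE.
case: hr => /(_ i j) [p [e pE]] _ _.
pose lq : 'M[{mpoly F[(n + d) * (n + d)]}]_n := \matrix_(a, b) mxvar F (n + d) (lshift d a) (lshift d b).
(* The equation A_ij det(g)^e = p(g) of the graph; its derivative at 1 in the direction (0, A - B)
   is the entry (A - B)_ij. *)
pose P := mxvar F (n + d) (rshift n i) (rshift n j) * (\det lq) ^+ e - mmap (@mpolyC _ F) (fun k => mxvec lq 0 k) p.
have PE g A' : mxeval P (bd g A') = A' i j * \det g ^+ e - mxeval p g.
 have lqE : map_mx (meval (fun k => mxvec (bd g A') 0 k)) lq = g.
  by apply/matrixP => a b; rewrite !mxE mevalXU mxvecE /bd block_mxEul.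
 rewrite /P -scaleN1r mxevalD mxevalZ mulN1r mxevalM mxevalX mxeval_var.
 rewrite {1}/mxeval -det_map_mx lqE [X in _ - X]/mxeval meval_mmap lqE.
 by rewrite /bd block_mxEdr.
have vP : vanishes_on K P.
 move=> _ [g Sg ->]; rewrite PE pE // divfK ?subrr //; apply: expf_neq0.
 by case: sS => SU _ _ _; apply: (det_neq0 (S := S)) => // x /SU.
have := L0; rewrite LieP => /(_ P vP).
rewrite -(dp_unique (P := ((A - B) i j)%:P * 'X + ((1%:M : 'M[F]_d) i j - mxeval p 1%:M)%:P)).
 by rewrite derivD derivC addr0 derivM derivC derivX mul0r add0r mulr1 hornerC.
move=> c; rewrite -bd1 bdZ bdD PE scaler0 addr0 det1 expr1n mulr1.
have -> : (1%:M + c *: (A - B)) i j = (1%:M : 'M[F]_d) i j + c * (A - B) i j.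
 by rewrite mxE; congr (_ + _); rewrite mxE.
by rewrite hornerD hornerMX !hornerC addrA [c * _]mulrC [(A - B) i j * c + _]addrC.
Qed.

Lemma drho_exp X A : nilp X -> nilp A -> (forall c, S (expm (c *: X))) ->
 (forall c, rho (expm (c *: X)) = expm (c *: A)) -> drho X A.
Proof.
move=> nX nA SX E; apply: Lie_expm; first exact: bd_nilp.
move=> c; exists (expm (c *: X)) => //.
by rewrite bdZ bd_expm ?E //; exact: nilpZ.
Qed.

(** Thanks to [det_expm], c -> rho(exp(cX)) is a polynomial homomorphism from the additive group,
    hence an exponential. *)
Lemma drho_exists X : nilp X -> (forall c, S (expm (c *: X))) ->
 exists2 A, nilp A & (forall c, rho (expm (c *: X)) = expm (c *: A)).
Proof.
move=> nX SX.
have [||i j|A [nA AE]] := @additive_hom_expm F d (fun c => rho (expm (c *: X))).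
- by move=> c c'; rewrite expmZD // rM.
- by rewrite scale0r expm0 r1.
- case: hr => /(_ i j) [p [e pE]] _ _.
 have [q qE] := curve_poly p (fun i j => expm_poly X i j).
 exists q => c; rewrite pE // qE det_expm ?expr1n ?divr1 //; exact: nilpZ.
- by exists A.
Qed.

Lemma drho_brk X Y A B : nilp X -> nilp A -> (forall c, S (expm (c *: X))) ->
 (forall c, rho (expm (c *: X)) = expm (c *: A)) -> drho Y B -> drho (brk X Y) (brk A B).
Proof.
move=> nX nA SX E YB; rewrite /drho -bd_brk.
have [L LE] := Lie_vspace K; apply/LE; apply: brk_mem; first exact: bd_nilp.
move=> c; apply/LE.
have nXA : nilp (c *: bd X A) by apply: nilpZ; exact: bd_nilp.
rewrite -invmx_expm //; apply: Lie_conj => //; first exact: graph_subgroup.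
exists (expm (c *: X)) => //.
by rewrite bdZ bd_expm ?E //; exact: nilpZ.
Qed.

Lemma drho_cochar Q P (z : 'I_n -> int) (y : 'I_d -> int) : Q \in unitmx -> P \in unitmx ->
 (forall c, c != 0 -> S (cdiag Q (fun i => c ^ z i))) ->
 (forall c, c != 0 -> rho (cdiag Q (fun i => c ^ z i)) = cdiag P (fun i => c ^ y i)) ->
 drho (cdiag Q (fun i => (z i)%:~R)) (cdiag P (fun i => (y i)%:~R)).
Proof.
move=> Qu Pu SQ E; rewrite /drho bd_cdiag //.
pose w (i : 'I_(n + d)) : int := match split i with inl a => z a | inr b => y b end.
have -> : cdiag (bd Q P) (fun i => match split i with inl a => (z a)%:~R | inr b => (y b)%:~R end) =
  cdiag (bd Q P) (fun i => (w i)%:~R : F).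
 by apply: eq_cdiag => i; rewrite /w; case: (split i).
apply: int_diag_Lie; first by rewrite bd_unit Qu.
move=> c c0; exists (cdiag Q (fun i => c ^ z i)); first exact: SQ.
rewrite E // bd_cdiag //; apply: eq_cdiag => i; by rewrite /w; case: (split i).
Qed.

Lemma rho_cochar Q (z : 'I_n -> int) : Q \in unitmx -> (forall c, c != 0 -> S (cdiag Q (fun i => c ^ z i))) ->
 exists P (y : 'I_d -> int), P \in unitmx /\
  forall c, c != 0 -> rho (cdiag Q (fun i => c ^ z i)) = cdiag P (fun i => c ^ y i).
Proof.
move=> Qu SQ; apply: laurent_hom.
- move=> a b a0 b0; rewrite -rM; [|exact: SQ..].
 by rewrite cdiagM //; congr rho; apply: eq_cdiag => i; rewrite expfzMl.
- by rewrite (_ : cdiag _ _ = 1%:M) ?r1 // -(cdiag1 Qu); apply: eq_cdiag => i; rewrite exp1rz.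
move=> i j; case: hr => /(_ i j) [p [e pE]] _ _.
have [q qE] := cdiag_mpoly Q p.
pose k (m : 'X_{1..n}) : int := \sum_i z i * (m i)%:Z - (\sum_i z i) * e%:Z.
have [N HN] := seq_int_bound (msupp q) k.
exists (\sum_(m <- msupp q) q@_m *: 'X^(absz (k m + N%:Z)%R)), N => c c0.
rewrite pE; last exact: SQ.
rewrite qE det_cdiag // prodf_exprz // mevalE horner_sum !mulr_suml big_seq [RHS]big_seq.
apply: eq_bigr => m /HN kN; rewrite hornerZ hornerXn -!mulrA; congr (_ * _).
rewrite -[c ^+ absz _]/(c ^ (absz _)%:Z) gez0_abs // expfzDr // mulfK ?expf_neq0 //.
rewrite /k expfzDr // -invr_expz -exprz_exp; congr (_ / _).
by rewrite -prodf_exprz //; apply: eq_bigr => l _; rewrite -exprz_exp.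
Qed.
End Graph.

(** * Rank one subgroups and sl_2 strings *)

Lemma comm_mul3 (R : pzRingType) n (t a b : 'M[R]_n) : t *m a = a *m t -> t *m b = b *m t ->
 t *m (a *m b *m a) = a *m b *m a *m t.
Proof. by move=> ta tb; rewrite !mulmxA ta -(mulmxA a t) tb mulmxA -(mulmxA _ t) ta mulmxA. Qed.

(** All that a coroot provides, in matrix terms: root vectors for chi and its opposite, the
    derivative of the coroot as their bracket, the Weyl element exp(X) exp(-Y) exp(X) with its
    action on T, and the fact that a subgroup containing both root subgroups contains the coroot. *)
Definition sl2_triple (F : numClosedFieldType) n (G T : set 'M[F]_n) chi gamma (X Y Q : 'M[F]_n) (z : 'I_n -> int) : Prop :=
 [/\ [/\ nilp X, X != 0, Lie G X & forall t, T t -> t *m X = chi t *: (X *m t)],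
   [/\ nilp Y, Y != 0, Lie G Y & forall t, T t -> t *m Y = (chi t)^-1 *: (Y *m t)],
   [/\ Q \in unitmx, forall c, c != 0 -> gamma c = cdiag Q (fun i => c ^ z i), brk X Y = cdiag Q (fun i => (z i)%:~R) &
     forall c, c != 0 -> chi (gamma c) = c ^+ 2],
   (forall t, T t -> (expm X *m expm (- Y) *m expm X) *m t = gamma (chi t)^-1 *m t *m (expm X *m expm (- Y) *m expm X)) &
   [/\ root_hom G T chi (fun c => expm (c *: X)), root_hom G T (fun t => (chi t)^-1) (fun c => expm (c *: Y)) &
    forall S, subgroup S -> (forall c, S (expm (c *: X))) -> (forall c, S (expm (c *: Y))) -> forall c, c != 0 -> S (gamma c)]].

Section SL2.
Variable F : numClosedFieldType.
Let e01 : 'M[F]_2 := delta_mx 0 1.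
Let e10 : 'M[F]_2 := delta_mx 1 0.
Definition dg (c : F) : 'M[F]_2 := c *: delta_mx 0 0 + c^-1 *: delta_mx 1 1.

Lemma mx2_ext (A B : 'M[F]_2) : A 0 0 = B 0 0 -> A 0 1 = B 0 1 -> A 1 0 = B 1 0 -> A 1 1 = B 1 1 -> A = B.
Proof.
move=> h00 h01 h10 h11; apply/matrixP => i j.
have O (k : 'I_2) : k = 0 \/ k = 1 by case: k => [[|[|k]] kP] //; [left|right]; apply/val_inj.
by case: (O i) (O j) => -> [] ->.
Qed.

Lemma mul2E (A B : 'M[F]_2) i j : (A *m B) i j = A i 0 * B 0 j + A i 1 * B 1 j.
Proof. by rewrite mxE !big_ord_recl big_ord0 addr0; congr (_ + A i _ * B _ j); apply/val_inj. Qed.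

Lemma det2E (A : 'M[F]_2) : \det A = A 0 0 * A 1 1 - A 0 1 * A 1 0.
Proof.
rewrite (expand_det_row _ 0) !big_ord_recl big_ord0 addr0 /cofactor !det_mx11 !mxE /=.
by rewrite expr0 mul1r expr1 mulN1r mulrN; congr (_ * A _ _ - A _ _ * A _ _); apply/val_inj.
Qed.

Lemma SL2_subgroup : subgroup (@SL2 F).
Proof.
split.
- by move=> g; rewrite /SL2 /= unitmxE => ->; exact: unitr1.
- by rewrite /SL2 /= det1.
- by move=> g h; rewrite /SL2 /= det_mulmx => -> ->; rewrite mulr1.
- by move=> g; rewrite /SL2 /= det_inv => ->; rewrite invr1.
Qed.

Lemma SL2_u c : SL2 (1%:M + c *: e01 : 'M[F]_2).
Proof. by rewrite /SL2 /= det2E !mxE /=; ring. Qed.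
Lemma SL2_v c : SL2 (1%:M + c *: e10 : 'M[F]_2).
Proof. by rewrite /SL2 /= det2E !mxE /=; ring. Qed.
Lemma SL2_d c : c != 0 -> SL2 (dg c).
Proof. by move=> c0; rewrite /SL2 /= det2E !mxE /=; field. Qed.
Lemma e01_nilp : nilp e01.
Proof. by rewrite /nilp exprS expr1 mxM; apply: mx2_ext; rewrite mul2E !mxE /=; ring. Qed.
Lemma e10_nilp : nilp e10.
Proof. by rewrite /nilp exprS expr1 mxM; apply: mx2_ext; rewrite mul2E !mxE /=; ring. Qed.
Lemma expm2 (X : 'M[F]_2) : expm X = 1%:M + X.
Proof. by rewrite /expm !big_ord_recl big_ord0 addr0 /= fact0 invr1 !scale1r mxX0 expr1. Qed.

Let zd (i : 'I_2) : int := if i == 0 then 1 else -1.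

Lemma dg_cdiag c : dg c = cdiag 1%:M (fun i => c ^ zd i).
Proof.
rewrite /cdiag invmx1 mul1mx mulmx1; apply: mx2_ext; rewrite !mxE /= ?mulr0 ?addr0 ?add0r ?mulr1 //.
Qed.

Lemma eq_root_hom n (G T : set 'M[F]_n) chi u v : u =1 v -> root_hom G T chi u -> root_hom G T chi v.
Proof. by move=> /funext ->. Qed.

Section Data.
Variables (n : nat) (G T : set 'M[F]_n) (chi : 'M[F]_n -> F) (gamma : F -> 'M[F]_n).
Hypotheses (sG : subgroup G) (sT : subgroup T) (TG : T `<=` G) (Tab : forall s t, T s -> T t -> s *m t = t *m s)
 (chiM : forall s t, T s -> T t -> chi (s *m t) = chi s * chi t) (chi0 : forall t, T t -> chi t != 0).

Lemma root_hom_exp (chi' : 'M[F]_n -> F) u : root_hom G T chi' u -> exists X,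
 [/\ nilp X, X != 0, Lie G X, (forall c, u c = expm (c *: X)) & forall t, T t -> t *m X = chi' t *: (X *m t)].
Proof.
move=> [uG uD uP uI uT].
have u0 : u 0 = 1%:M.
 have U := (let: And4 U _ _ _ := sG in U) _ (uG 0).
 have := uD 0 0; rewrite addr0 => /(congr1 (fun A => A *m invmx (u 0))).
 by rewrite mulmxK // mulmxV.
have [X [nX uE]] := additive_hom_expm uD u0 uP.
exists X; split=> //.
- apply/eqP => X0; have := uI 0 1; rewrite !uE X0 !scaler0 => /(_ erefl) /eqP.
 by rewrite eq_sym oner_eq0.
- by apply: Lie_expm => // c; rewrite -uE.
- move=> t Tt; have tu : t \in unitmx by case: sT => H _ _ _; exact: H.
 have : t *m X *m invmx t = chi' t *: X.
  apply: expm_inj; [exact: nilpJ|exact: nilpZ|] => c.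
  rewrite scalemxAl scalemxAr expmJ // -uE uT // uE scalerA.
  by rewrite mulrC.
 by move/(congr1 (fun A => A *m t)); rewrite mulmxKV // -scalemxAl.
Qed.

Lemma sl2_data : is_coroot G T chi gamma -> exists X Y Q z, sl2_triple G T chi gamma X Y Q z.
Proof.
move=> [[gT gM gL] [phi [hphi phiG rX rY gE]]].
have [X [nX X0 LX XE XT]] := root_hom_exp rX.
have [Y [nY Y0 LY YE YT]] := root_hom_exp rY.
have pM g h : SL2 g -> SL2 h -> phi (g *m h) = phi g *m phi h by case: hphi => _ _; exact.
have p1 : phi 1%:M = 1%:M by case: hphi.
have g1 : gamma 1 = 1%:M.
 rewrite gE ?oner_neq0 // -p1; congr phi; apply: mx2_ext; rewrite !mxE /= ?invr1; ring.
have [Q [z [Qu Qz]]] := laurent_hom gM g1 gL.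
have EX c : expm (c *: e01) = 1%:M + c *: e01 by rewrite expm2.
have EY c : expm (c *: e10) = 1%:M + c *: e10 by rewrite expm2.
have dX : drho (@SL2 F) phi e01 X.
 apply: drho_exp => //; [exact: e01_nilp| |]; move=> c; rewrite EX //; exact: SL2_u.
have dY : drho (@SL2 F) phi e10 Y.
 apply: drho_exp => //; [exact: e10_nilp| |]; move=> c; rewrite EY //; exact: SL2_v.
have dXY : drho (@SL2 F) phi (brk e01 e10) (brk X Y).
 apply: (drho_brk SL2_subgroup hphi e01_nilp nX) => // c; rewrite EX //; exact: SL2_u.
have dH : drho (@SL2 F) phi (brk e01 e10) (cdiag Q (fun i => (z i)%:~R)).
 have -> : brk e01 e10 = cdiag 1%:M (fun i => (zd i)%:~R).
  rewrite /cdiag invmx1 mul1mx mulmx1 /brk; apply: mx2_ext; rewrite [LHS]mxE [(- _ : 'M_2) _ _]mxE !mul2E !mxE /=;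
   rewrite ?mulr1n ?mulr0n /zd /=; ring.
 apply: drho_cochar => //; first exact: unitmx1.
  by move=> c c0; rewrite -dg_cdiag; exact: SL2_d.
 by move=> c c0; rewrite -dg_cdiag -gE // Qz.
(* Both matrices are the differential of [phi] at the same element diag(1, -1) of sl_2. *)
have XYE := drho_fun SL2_subgroup hphi dXY dH.
have gX c x : c != 0 -> gamma c *m expm (x *: X) = expm ((c ^+ 2 * x) *: X) *m gamma c.
 move=> c0; rewrite gE // -!XE -!pM //; try exact: SL2_u; try exact: SL2_d.
 congr phi; apply: mx2_ext; rewrite !mul2E !mxE /=; by field.
have chi2 c : c != 0 -> chi (gamma c) = c ^+ 2.
 move=> c0; have Tg := gT _ c0; case: (rX) => _ _ _ uI uT.
 have := uT (gamma c) 1 Tg; rewrite XE gX // -XE mulmxK; first by move/uI; rewrite !mulr1.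
 by case: sT => H _ _ _; exact: H.
pose n0 := expm X *m expm (- Y) *m expm X.
pose w : 'M[F]_2 := (1%:M + 1 *: e01) *m (1%:M + (-1) *: e10) *m (1%:M + 1 *: e01).
have SM : forall a b, SL2 a -> SL2 b -> SL2 (a *m b : 'M[F]_2) by case: SL2_subgroup.
have n0E : n0 = phi w.
 rewrite /w !pM; try exact: SM; try exact: SL2_u; try exact: SL2_v.
 2: by apply: (SM); [exact: SL2_u|exact: SL2_v].
 by rewrite !XE YE !scale1r scaleN1r.
have Sw : SL2 w.
 by apply: (SM); [apply: (SM); [exact: SL2_u|exact: SL2_v]|exact: SL2_u].
have wE : w = e01 - e10.
 by rewrite /w; apply: mx2_ext; rewrite !mul2E !mxE /=; ring.
have n0g c : c != 0 -> n0 *m gamma c = gamma c^-1 *m n0.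
 move=> c0; have c0' : c^-1 != 0 by rewrite invr_eq0.
 rewrite n0E !gE // -!pM //; try exact: SL2_d.
 congr phi; rewrite invrK wE; apply: mx2_ext; rewrite !mul2E !mxE /=; by field.
exists X, Y, Q, z; split=> //.
- rewrite -/n0 => t Tt.
 (* A square root of chi(t) splits t as gamma(s) tau with chi(tau) = 1; tau commutes with the Weyl
    element, which inverts gamma(s). *)
 pose s := sqrtC (chi t); have s2 : s ^+ 2 = chi t by rewrite /s sqrtCK.
 have s0 : s != 0 by rewrite -sqrf_eq0 s2 chi0.
 have s0' : s^-1 != 0 by rewrite invr_eq0.
 have [TU T1 TM TV] := sT.
 pose tau := gamma s^-1 *m t.
 have Ttau : T tau by apply: (TM) => //; exact: gT.
 have tE : t = gamma s *m tau.
  by rewrite /tau mulmxA -gM // mulfV // g1 mul1mx.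
 have ctau : chi tau = 1.
  rewrite /tau chiM //; last exact: gT.
  by rewrite chi2 // exprVn s2 mulVf // chi0.
 have tX : tau *m expm X = expm X *m tau.
  case: rX => _ _ _ _ /(_ tau 1 Ttau); rewrite !XE ctau !mulr1 !scale1r.
  move=> /(congr1 (fun A => A *m tau)); rewrite mulmxKV ?TU //.
 have tY : tau *m expm (- Y) = expm (- Y) *m tau.
  case: rY => _ _ _ _ /(_ tau (-1) Ttau); rewrite !YE ctau invr1 mul1r !scaleN1r.
  move=> /(congr1 (fun A => A *m tau)); rewrite mulmxKV ?TU //.
 have tn : tau *m n0 = n0 *m tau.
  exact: comm_mul3.
 rewrite {1}tE (mulmxA n0 (gamma s) tau) n0g // -(mulmxA (gamma s^-1) n0 tau) -tn (mulmxA (gamma s^-1) tau n0); congr (_ *m _).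
 rewrite /tau mulmxA -gM //; congr (gamma _ *m _).
 by rewrite -invfM -s2.
- split.
 + exact: eq_root_hom rX.
 + by apply: eq_root_hom rY.
 + move=> S sS SX SY c c0; rewrite gE //.
  have [SU _ SM' SV] := sS.
  have c0' : c^-1 != 0 by rewrite invr_eq0.
  (* The classical elements w(a) of SL_2, products of unitriangular matrices; diag(c, 1/c) is w(c)
     w(-1). *)
  pose wc (a : F) := (1%:M + a *: e01) *m (1%:M + (- a^-1) *: e10) *m (1%:M + a *: e01).
  have wcS a : SL2 (wc a) by apply: (SM); [apply: (SM); [exact: SL2_u|exact: SL2_v]|exact: SL2_u].
  have Swc a : S (phi (wc a)).
   rewrite /wc !pM; try exact: SL2_u; try exact: SL2_v.
   2: by apply: (SM); [exact: SL2_u|exact: SL2_v].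
   by rewrite !XE YE; apply: (SM') => //; apply: (SM').
  have wcE a : a != 0 -> wc a = a *: e01 - a^-1 *: e10.
   by move=> a0; rewrite /wc; apply: mx2_ext; rewrite !mul2E !mxE /=; field.
  have -> : c *: delta_mx 0 0 + c^-1 *: delta_mx 1 1 = wc c *m wc (-1).
   rewrite !wcE ?oppr_eq0 ?oner_eq0 // invrN invr1; apply: mx2_ext; rewrite !mul2E !mxE /=; ring.
  by rewrite pM //; apply: (SM').
Qed.
End Data.
End SL2.

Section StringLemma.
Variables (F : numClosedFieldType) (n : nat) (E Y H : 'M[F]_n).
Hypotheses (nE : nilp E) (EY : brk E Y = H) (HE : brk H E = 2%:R *: E).

(** The sum of m + 2i over i < j: up to sign, the scalar by which Y sends the j-th vector of the
    string back to the previous one. *)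
Fixpoint strb (m j : nat) : nat := if j is j'.+1 then (strb m j' + m + 2 * j')%N else 0.

(** The vectors v_j obtained by applying ad(E) j times to Z satisfy [Y, v_(j+1)] = -b v_j with b
    positive, because m > 0. Nilpotency of ad(E) kills some v_j, and the vanishing travels down to
    Z. *)
Lemma string_zero (m : nat) (Z : 'M[F]_n) : (0 < m)%N -> brk H Z = m%:R *: Z ->
 brk E (brk Y Z) = 0 -> Z = 0.
Proof.
move=> m0 HZ EYZ; pose v j := iter j (brk E) Z.
have Hv j : brk H (v j) = (m + 2 * j)%:R *: v j.
 elim: j => [|j IH]; first by rewrite /v /= muln0 addn0.
 have -> : v j.+1 = brk E (v j) by [].
 have : brk (brk H E) (v j) = brk H (brk E (v j)) - brk E (brk H (v j)) by exact: brk_jacobi.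
 rewrite HE IH brkZl brkZ => /eqP; rewrite eq_sym subr_eq -scalerDl => /eqP ->.
 by congr (_ *: _); rewrite -natrD; congr (_%:R); lia.
have P j : brk E (brk Y (v j)) = - ((strb m j)%:R *: v j) /\ brk Y (v j.+1) = - ((strb m j.+1)%:R *: v j).
 have Q' j' : brk E (brk Y (v j')) = - ((strb m j')%:R *: v j') -> brk Y (v j'.+1) = - ((strb m j'.+1)%:R *: v j').
  move=> h; have : brk (brk E Y) (v j') = brk E (brk Y (v j')) - brk Y (brk E (v j')) by exact: brk_jacobi.
  rewrite EY Hv h => /eqP; rewrite eq_sym subr_eq addrC -subr_eq => /eqP.
  rewrite -[brk E (v j')]/(v j'.+1) => <-.
  by rewrite -opprD -scalerDl -natrD /= addnA.
 elim: j => [|j [IH1 IH2]]; first by split; [rewrite /= scale0r oppr0|apply: Q'; rewrite /= scale0r oppr0].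
 have h : brk E (brk Y (v j.+1)) = - ((strb m j.+1)%:R *: v j.+1).
  by rewrite IH2 -scaleN1r !brkZ scaleN1r.
 by split=> //; exact: Q'.
have vz : v (n + n)%N = 0 by exact: ad_nilp.
have down j : v j.+1 = 0 -> v j = 0.
 move=> vj; have [_] := P j; rewrite vj /brk mulmx0 mul0mx subrr => /eqP; rewrite eq_sym oppr_eq0 scaler_eq0.
 by rewrite pnatr_eq0 /=; case/orP => [|/eqP //]; rewrite !addn_eq0 -!andbA => /and3P [_ /eqP]; lia.
elim: (n + n)%N vz => [|k IH] //; by move=> /down.
Qed.
End StringLemma.

Lemma conj_weight (F : fieldType) n (N t t' Z : 'M[F]_n) a : N \in unitmx -> t *m N = N *m t' ->
 t' *m Z = a *: (Z *m t') -> t *m (N *m Z *m invmx N) = a *: (N *m Z *m invmx N *m t).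
Proof.
move=> Nu tN HZ; have NtV : t' *m invmx N = invmx N *m t.
 by rewrite -[t' in LHS](mulKmx Nu) -tN mulmxA mulmxK.
rewrite !mulmxA tN -(mulmxA N) HZ -scalemxAr -scalemxAl; congr (_ *: _).
by rewrite -!mulmxA NtV.
Qed.

Definition UB (F : numFieldType) n (J : Type) (X Y : J -> 'M[F]_n) (b : pred J) : set 'M[F]_n :=
 [set g | exists j c, b j /\ (g = expm (c *: X j) \/ g = expm (c *: Y j))].

Section UB.
Variables (F : numFieldType) (n : nat) (J : Type) (X Y : J -> 'M[F]_n) (b : pred J).
Hypotheses (nX : forall j, nilp (X j)) (nY : forall j, nilp (Y j)).

Lemma UB_GL : UB X Y b `<=` @GLset F n.
Proof. by move=> _ [j [c [_ [|] ->]]]; apply: expm_unit; exact: nilpZ. Qed.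

Lemma UB_subgroup : subgroup (gens (UB X Y b)).
Proof. exact: gens_subgroup UB_GL. Qed.

Lemma in_UB j c : b j -> gens (UB X Y b) (expm (c *: X j)) /\ gens (UB X Y b) (expm (c *: Y j)).
Proof. by move=> bj; split; apply: sub_gens; exists j, c; split=> //; [left|right]. Qed.

Lemma UB_inv g : UB X Y b g -> UB X Y b (invmx g).
Proof.
move=> [j [c [bj [] ->]]]; rewrite invmx_expm -?scaleNr; try exact: nilpZ.
 by exists j, (- c); split; [|left].
by exists j, (- c); split; [|right].
Qed.

Lemma UB_sub S : (forall j c, b j -> S (expm (c *: X j)) /\ S (expm (c *: Y j))) -> UB X Y b `<=` S.
Proof. by move=> h g [j [c [/(h j c) [h1 h2] [] ->]]]. Qed.

End UB.

(** * Reflections, multiplicity one, and generation by simple root subgroups *)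

Section Roots.
Variables (F : numClosedFieldType) (n : nat) (G T : set 'M[F]_n) (I : finType) (alpha : I -> 'M[F]_n -> F) (i0 : I).
Hypotheses (Gs : simple_algebraic_group G) (Tm : maximal_torus G T) (Rb : root_base G T alpha).
Notation wt := (wt G T alpha).
Notation comb := (comb alpha).
Variables (alphav : I -> F -> 'M[F]_n) (C : I -> I -> int) (X Y Q : I -> 'M[F]_n) (z : I -> 'I_n -> int).
Hypotheses (Coch : forall i c, c != 0 -> T (alphav i c))
 (D : forall i, sl2_triple G T (alpha i) (alphav i) (X i) (Y i) (Q i) (z i))
 (Ca : forall i j, pairing (alpha i) (alphav j) (C i j)) (C2 : forall i, C i i = 2)
 (Csym : forall i j, C i j = C j i).

Let sG := simple_group Gs.
Let sT := T_subgroup Tm.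
Let TG := T_subG Tm.

Definition ei (i : I) : I -> int := fun j => (j == i)%:Z.
Definition pr (c : I -> int) i : int := \sum_j c j * C j i.
Definition refl i (c : I -> int) : I -> int := fun j => c j - pr c i * ei i j.
Definition qf (c : I -> int) : int := \sum_i c i * pr c i.
Definition Nw i := expm (X i) *m expm (- Y i) *m expm (X i).
Definition Hi i := cdiag (Q i) (fun a => (z i a)%:~R).

Lemma comb_ei i t : comb (ei i) t = alpha i t.
Proof.
rewrite /comb (bigD1 i) //= /ei eqxx expr1z big1 ?mulr1 // => j /negPf ->.
by rewrite expr0z.
Qed.

Lemma comb_kei k i t : comb (fun j => k * ei i j) t = alpha i t ^ k.
Proof.
rewrite /comb (bigD1 i) //= /ei eqxx mulr1 big1 ?mulr1 // => j /negPf ->.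
by rewrite mulr0 expr0z.
Qed.

Lemma comb_av c i x : x != 0 -> comb c (alphav i x) = x ^ pr c i.
Proof.
move=> x0; rewrite /comb /pr -prodf_exprz //; apply: eq_bigr => j _.
by rewrite (Ca j i x0) exprz_exp mulrC.
Qed.

Lemma wtX i : wt (ei i) (X i).
Proof. by have [[_ _ L E] _ _ _ _] := D i; split=> // t Tt; rewrite comb_ei E. Qed.
Lemma wtY i : wt (fun j => - ei i j) (Y i).
Proof. by have [_ [_ _ L E] _ _ _] := D i; split=> // t Tt; rewrite combN comb_ei E. Qed.

Lemma Xnilp i : nilp (X i). Proof. by have [[]] := D i. Qed.
Lemma Ynilp i : nilp (Y i). Proof. by have [_ []] := D i. Qed.
Lemma X_neq0 i : X i != 0. Proof. by have [[]] := D i. Qed.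
Lemma Y_neq0 i : Y i != 0. Proof. by have [_ []] := D i. Qed.
Lemma brkXY i : brk (X i) (Y i) = Hi i. Proof. by have [_ _ []] := D i. Qed.
Lemma avE i c : c != 0 -> alphav i c = cdiag (Q i) (fun a => c ^ z i a).
Proof. by have [_ _ [_ E _ _] _ _] := D i; exact: E. Qed.
Lemma Qunit i : Q i \in unitmx. Proof. by have [_ _ []] := D i. Qed.

Lemma adH c i Z : wt c Z -> brk (Hi i) Z = (pr c i)%:~R *: Z.
Proof.
move=> wZ; have [->|Z0] := eqVneq Z 0; first by rewrite /brk mulmx0 mul0mx subrr scaler0.
have [||k [-> E]] := cochar_act (Q := Q i) (z := z i) _ _ wZ Z0; first exact: Qunit.
 by move=> x x0; rewrite -avE //; exact: Coch.
suff -> : k = pr c i by [].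
have two0 := two_neq0 F.
by apply: (@int2_eq F); rewrite -E -avE // comb_av.
Qed.

Lemma pr_ei i j : pr (ei i) j = C i j.
Proof.
rewrite /pr (bigD1 i) //= /ei eqxx mul1r big1 ?addr0 // => k /negPf ->.
by rewrite mul0r.
Qed.

Lemma pr_lin a b c d i : pr (fun j => a * c j + b * d j) i = a * pr c i + b * pr d i.
Proof.
rewrite /pr !mulr_sumr -big_split; apply: eq_bigr => j _ /=; ring.
Qed.

Lemma prZ a c i : pr (fun j => a * c j) i = a * pr c i.
Proof. by rewrite /pr mulr_sumr; apply: eq_bigr => j _; rewrite mulrA. Qed.
Lemma brkHX i : brk (Hi i) (X i) = 2%:R *: X i.
Proof. by rewrite (adH i (wtX i)) pr_ei C2. Qed.

Lemma eiE i : ei i i != 0. Proof. by rewrite /ei eqxx. Qed.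

Lemma no_mult2 i (k : nat) Z : wt (fun j => k.+2%:Z * ei i j) Z ->
 (forall Z', wt (fun j => k.+1%:Z * ei i j) Z' -> brk (X i) Z' = 0) -> Z = 0.
Proof.
move=> wZ H; apply: (@string_zero F n (X i) (Y i) (Hi i) (Xnilp i) (brkXY i) (brkHX i) (2 * k.+2)) => //.
 rewrite (adH i wZ) prZ pr_ei C2; congr (_ *: _).
 by rewrite [RHS]pmulrn; congr (_%:~R); lia.
apply: H; apply: (eq_wt (c := fun j => - ei i j + k.+2%:Z * ei i j)); last first.
 apply: (wt_brk Gs Tm Rb (i := i)) wZ => //; last exact: wtY.
 by rewrite oppr_eq0 eiE.
by move=> j; rewrite [k.+2%:Z]intS; ring.
Qed.

(** A multiple of X_i is subtracted from [Z] so that y = [Y_i, Z'] also centralizes X_i. Then y has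
    trace 0 against all its own replicas, so y = 0, and the string lemma gives Z' = 0. *)
Lemma one_dim i Z : wt (ei i) Z -> exists a, Z = a *: X i.
Proof.
move=> wZ.
have Nei : - ei i i != 0 by rewrite oppr_eq0 eiE.
have w0 V : wt (ei i) V -> wt (fun=> 0) (brk (Y i) V).
 move=> wV; apply: (eq_wt (c := fun j => - ei i j + ei i j)); first by move=> j; rewrite addNr.
 exact: (wt_brk Gs Tm Rb (i := i) Nei (wtY i) wV).
have [a aE] : exists a, brk (brk (Y i) Z) (X i) = a *: X i.
 have [Q' [lam [r [mu [z' [Qu XE lamE ind TQ]]]]]] := g0_form i0 Gs Tm Rb (w0 _ wZ).
 have h j := cochar_act Qu (fun x => @TQ j x) (wtX i) (X_neq0 i).
 exists (\sum_j mu j * (projT1 (cid (h j)))%:~R).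
 have -> : brk (Y i) Z = \sum_j mu j *: cdiag Q' (fun i => (z' i j)%:~R).
  rewrite XE (eq_bigr (fun j => cdiag Q' (fun i => mu j * (z' i j)%:~R))); last by move=> j _; rewrite cdiagZ.
  rewrite cdiag_sum; apply: eq_cdiag => k; rewrite lamE; apply: eq_bigr => j _; exact: mulrC.
 rewrite scaler_suml /brk mulmx_suml mulmx_sumr -sumrB; apply: eq_bigr => j _.
 have [E _] := projT2 (cid (h j)); rewrite -scalerA -E /brk scalerBr.
 by rewrite -scalemxAl -scalemxAr.
(* As [Y, X] = -H and [H, X] = 2X, this is the coefficient for which [[Y, Z - bX], X] = 0. *)
pose b := - (a / 2%:R); pose Z' := Z - b *: X i.
have two0 := two_neq0 F.
have wZ' : wt (ei i) Z' by apply: wtB => //; apply: wtZ; exact: wtX.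
pose y := brk (Y i) Z'.
have yX : brk y (X i) = 0.
 rewrite /y /Z' -scaleNr brkD brkZ brkDl brkZl aE [brk (Y i) (X i)]brkC brkXY.
 rewrite -[- Hi i]scaleN1r brkZl brkHX !scalerA -scalerDl.
 by rewrite (_ : _ + _ = 0) ?scale0r // /b; field.
have y0 : y = 0.
 have [Q' [lam [r [mu [z' [Qu yE lamE ind TQ]]]]]] := g0_form i0 Gs Tm Rb (w0 _ wZ').
 rewrite -/y in yE.
 have h j := cochar_act Qu (fun x => @TQ j x) (wtX i) (X_neq0 i).
 pose k j := projT1 (cid (h j)).
 have kE j : brk (cdiag Q' (fun i => (z' i j)%:~R)) (X i) = (k j)%:~R *: X i /\
   comb (ei i) (cdiag Q' (fun i => 2%:R ^ z' i j)) = 2%:R ^ k j := projT2 (cid (h j)).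
 have ysum : y = \sum_j mu j *: cdiag Q' (fun i => (z' i j)%:~R).
  rewrite yE (eq_bigr (fun j => cdiag Q' (fun i => mu j * (z' i j)%:~R))); last by move=> j _; rewrite cdiagZ.
  rewrite cdiag_sum; apply: eq_cdiag => l; rewrite lamE; apply: eq_bigr => j _; exact: mulrC.
 have k0 j : k j = 0.
  apply: ind j; move: yX; rewrite ysum /brk mulmx_suml mulmx_sumr -sumrB.
  rewrite (eq_bigr (fun j => ((k j)%:~R * mu j) *: X i)).
   rewrite -scaler_suml => /eqP; rewrite scaler_eq0 (negPf (X_neq0 i)) orbF => /eqP //.
  by move=> j _; rewrite -scalemxAl -scalemxAr -scalerBr -/(brk _ _) (kE j).1 scalerA mulrC.
 (* tr([Y, Z'] D_j) = tr(Y [Z', D_j]), and D_j acts on Z' by the same integer as on X_i, which is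
    0. *)
 have tr0 j : \tr (y *m cdiag Q' (fun i => (z' i j)%:~R)) = 0.
  set Dj := cdiag _ _.
  have Zj : brk Dj Z' = 0.
   have [->|Z0] := eqVneq Z' 0; first by rewrite /brk mulmx0 mul0mx subrr.
   have [k' [-> E]] := cochar_act Qu (fun x => @TQ j x) wZ' Z0.
   suff -> : k' = k j by rewrite k0 scale0r.
   by apply: (@int2_eq F); rewrite -E (kE j).2.
  rewrite /y /brk mulmxBl raddfB /= -(mulmxA (Y i)) -(mulmxA Z') (mxtrace_mulC Z') -(mulmxA (Y i) Dj Z').
  by move/eqP: Zj; rewrite subr_eq0 => /eqP ->; rewrite subrr.
 rewrite yE -(cdiag0 Q'); apply: eq_cdiag; apply: (replica_tr0 lamE ind) => j.
 have := tr0 j; rewrite yE cdiagM // tr_cdiag_mul //.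
exists b; apply/eqP; rewrite -subr_eq0; apply/eqP.
apply: (@string_zero F n (X i) (Y i) (Hi i) (Xnilp i) (brkXY i) (brkHX i) 2) => //.
 by rewrite -/Z' (adH i wZ') pr_ei C2.
by rewrite -/Z' -/y y0 /brk mulmx0 mul0mx subrr.
Qed.

Lemma no_mult i (k : nat) Z : wt (fun j => k.+2%:Z * ei i j) Z -> Z = 0.
Proof.
elim: k Z => [|k IH] Z wZ; apply: (no_mult2 wZ) => Z'.
 move=> wZ'; have [|a ->] := @one_dim i Z'; first by apply: eq_wt wZ' => j; rewrite mul1r.
 by rewrite brkZ /brk subrr scaler0.
by move=> /IH ->; rewrite /brk mulmx0 mul0mx subrr.
Qed.

Lemma av_inv i x : x != 0 -> alphav i x *m alphav i x^-1 = 1%:M.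
Proof.
move=> x0; rewrite !avE ?invr_eq0 // cdiagM ?Qunit // -(cdiag1 (Qunit i)).
by apply: eq_cdiag => a; rewrite -expfzMl mulfV // exp1rz.
Qed.

Lemma combM c s t : T s -> T t -> comb c (s *m t) = comb c s * comb c t.
Proof.
move=> Ts Tt; rewrite /comb -big_split; apply: eq_bigr => i _ /=.
have [rt _ _] := Rb; have [[_ _ aM] _ _] := rt i.
by rewrite aM // expfzMl.
Qed.

Lemma expX_G i a : G (expm (a *: X i)).
Proof. by apply: (wt_exp Gs Tm Rb (i := i)) (wtX i); exact: eiE. Qed.
Lemma expY_G i a : G (expm (a *: Y i)).
Proof. by apply: (wt_exp Gs Tm Rb (i := i)) (wtY i); rewrite oppr_eq0 eiE. Qed.

Lemma Nw_sub S i : subgroup S -> (forall a, S (expm (a *: X i))) -> (forall a, S (expm (a *: Y i))) -> S (Nw i).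
Proof.
move=> [_ _ SM _] SX SY; rewrite /Nw -[X i]scale1r -scaleN1r.
by apply: (SM) => //; apply: (SM).
Qed.

Lemma Nw_G i : G (Nw i).
Proof. by apply: Nw_sub => // a; [exact: expX_G|exact: expY_G]. Qed.

(** Conjugation by the Weyl element turns the action of t into that of gamma(1/alpha_i(t)) t, and on
    the extra factor the weight [c] takes the value alpha_i(t)^(-pr c i). *)
Lemma Nw_wt i c Z : wt c Z -> wt (refl i c) (Nw i *m Z *m invmx (Nw i)).
Proof.
move=> [LZ HZ]; have [GU _ _ _] := sG; have Nu := GU _ (Nw_G i).
split; first by apply: Lie_conj => //; exact: Nw_G.
move=> t Tt; have [TU _ TM TV] := sT.
have at0 := root_neq0 Tm Rb i Tt.
pose t' := alphav i (alpha i t)^-1 *m t.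
have Tt' : T t' by apply: TM => //; apply: Coch; rewrite invr_eq0.
have [_ _ [_ _ _ chi2] Nt _] := D i.
have at' : alpha i t' = (alpha i t)^-1.
 have [rt _ _] := Rb; have [[_ _ aM] _ _] := rt i.
 rewrite /t' aM //; last by apply: Coch; rewrite invr_eq0.
 by rewrite chi2 ?invr_eq0 // expr2 -mulrA mulVf // mulr1.
have tN : t *m Nw i = Nw i *m t'.
 by rewrite (Nt t' Tt') -/(Nw i) at' invrK /t' (mulmxA (alphav i _)) av_inv // mul1mx.
rewrite (conj_weight Nu tN (HZ _ Tt')); congr (_ *: _).
have av : T (alphav i (alpha i t)^-1) by apply: Coch; rewrite invr_eq0.
rewrite /t' combM // comb_av ?invr_eq0 // /refl.
have -> : comb (fun j => c j - pr c i * ei i j) t = comb c t * comb (fun j => - pr c i * ei i j) t.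
 by rewrite -(combD Tm Rb) //; congr comb; apply/funext => j; rewrite mulNr.
by rewrite comb_kei -exprz_inv mulrC.
Qed.

Hypothesis Cpos : forall c : I -> int, (exists i, c i != 0) -> 0 < qf c.

Lemma pr_refl i c j : pr (refl i c) j = pr c j - pr c i * C i j.
Proof.
have := pr_lin 1 (- pr c i) c (ei i) j; rewrite mul1r pr_ei mulNr => <-.
by congr pr; apply/funext => k; rewrite /refl mul1r mulNr.
Qed.

Lemma qf_refl i c : qf (refl i c) = qf c.
Proof.
rewrite /qf (eq_bigr (fun j => c j * pr c j - pr c i * (c j * C j i) - pr c i * (ei i j * (pr c j - pr c i * C i j)))).
 rewrite !sumrB -!mulr_sumr -/(pr c i) [X in _ - _ * X](bigD1 i) //= /ei eqxx C2.
 rewrite [X in _ - _ * (_ + X)]big1 => [|j /negPf ->]; last by rewrite mul0r.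
 rewrite mul1r addr0; ring.
by move=> j _; rewrite pr_refl /refl (Csym j i); ring.
Qed.

Lemma qf_ei i : qf (ei i) = 2.
Proof.
rewrite /qf (bigD1 i) //= big1 ?addr0 => [|j /negPf h]; first by rewrite pr_ei /ei eqxx C2.
by rewrite /ei h mul0r.
Qed.

Definition ht (c : I -> int) : nat := \sum_i `|c i|%N.

(** Positivity of the form gives an index i with c_i (c, alpha_i) > 0, and reflecting in alpha_i
    shortens c until a simple root is reached. Only reflections with index in [J] occur, so every
    root space supported on [J] is conjugate, inside the group generated by [J], to that of a simple
    root: it is a line and the root has norm 2. *)
Lemma descent (J : pred I) m c : (ht c <= m)%N -> (exists i, c i != 0) ->
 (exists Z, Z != 0 /\ wt c Z) -> (forall i, c i != 0 -> J i) ->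
 qf c = 2 /\ exists g i, [/\ J i, (forall S, subgroup S -> (forall j, J j -> S (Nw j)) -> S g) &
  forall Z, wt c Z -> exists a, Z = a *: (g *m X i *m invmx g)].
Proof.
have wN := Nw_wt.
have NG := Nw_G.
have [GU _ _ _] := sG.
elim: m c => [|m IH] c hc cn0 [Z [Z0 wZ]] cJ.
 have [i ci] := cn0; move: hc; rewrite leqn0 sum_nat_eq0 => /forallP /(_ i) /=.
 by rewrite absz_eq0 (negPf ci).
have Nu i : Nw i \in unitmx := GU _ (NG i).
have Nuj i : invmx (Nw i) \in unitmx by rewrite unitmx_inv.
have NZ0 i V : V != 0 -> Nw i *m V *m invmx (Nw i) != 0.
 apply: contra_neq => E; rewrite -(mulKmx (Nu i) V) -[Nw i *m V](mulmxKV (Nu i)) E.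
 by rewrite mul0mx mulmx0.
have back i V a g k : Nw i *m V *m invmx (Nw i) = a *: (g *m X k *m invmx g) -> g \in unitmx ->
  V = a *: ((invmx (Nw i) *m g) *m X k *m invmx (invmx (Nw i) *m g)).
 move=> E gu; rewrite -(mulKmx (Nu i) V) -[Nw i *m V](mulmxKV (Nu i)) E.
 have -> : invmx (invmx (Nw i) *m g) = invmx g *m Nw i.
  apply: invmx_uniq; rewrite -mulmxA (mulmxA g) mulmxV // mul1mx mulVmx //.
 by rewrite -scalemxAl -scalemxAr !mulmxA.
have [i cpi] : exists i, 0 < c i * pr c i.
 apply: contrapT => /forallNP H; have := Cpos cn0; rewrite ltNge => /negP; apply.
 by apply: sumr_le0 => i _; rewrite leNgt; apply/negP; exact: H.
have ci : c i != 0 by apply: contraTneq cpi => ->; rewrite mul0r ltxx.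
have Ji := cJ i ci.
have [/existsP [j /andP [ji cj]]|/existsPn H] := boolP [exists j, (j != i) && (c j != 0)].
- have wZ' := wN i c Z wZ; have Z'0 := NZ0 i Z Z0.
 have rj k : k != i -> refl i c k = c k by move=> /negPf ki; rewrite /refl /ei ki mulr0 subr0.
 have ri : refl i c i = c i - pr c i by rewrite /refl /ei eqxx mulr1.
 have c'n0 : exists i', refl i c i' != 0 by exists j; rewrite rj.
 have [_ sc] := wt_root Tm Rb Z0 wZ cn0.
 have [_ sc'] := wt_root Tm Rb Z'0 wZ' c'n0.
 (* Another coefficient c_j is unchanged and roots have coefficients of one sign, so c_i - (c,
    alpha_i) cannot pass to the sign opposite to c_i and is smaller in absolute value. *)
 have hi : (`|refl i c i| < `|c i|)%N.
  have cj' := rj j ji; rewrite ri.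
  case: sc => sc; case: sc' => sc'; have := sc i; have := sc j; have := sc' i; have := sc' j;
   rewrite ri cj'; move: cpi ci cj; move: (c i) (pr c i) (c j) => a b d; nia.
 have [||||q2 [g [i' [Ji' gS gZ]]]] := IH (refl i c).
 + rewrite -ltnS; apply: leq_trans hc; rewrite /ht (bigD1 i) //= [X in (_ < X)%N](bigD1 i) //=.
  by rewrite (eq_bigr (fun k => `|c k|%N)) ?ltn_add2r // => k ki; rewrite rj.
 + exact: c'n0.
 + by exists (Nw i *m Z *m invmx (Nw i)).
 + move=> k; have [->//|ki] := eqVneq k i; by rewrite rj //; exact: cJ.
 split; first by rewrite -(qf_refl i).
 exists (invmx (Nw i) *m g), i'; split=> //.
  move=> S sS SN; case: (sS) => _ _ SM SV; apply: (SM); last exact: gS.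
  by apply: SV; exact: SN.
 move=> V wV; have [a aE] := gZ _ (wN i c V wV); exists a; apply: back aE _.
 by apply: GU; apply: gS => // k _; exact: NG.
(* Here c is a multiple of alpha_i. [no_mult] excludes coefficients of absolute value above 1, and
   one reflection brings -alpha_i to alpha_i. *)
have cE k : c k = c i * ei i k.
 have [->|ki] := eqVneq k i; first by rewrite /ei eqxx mulr1.
 by have := H k; rewrite ki /= negbK /ei (negPf ki) mulr0 => /eqP.
have pc : pr c i = c i * 2.
 by rewrite (_ : c = fun k => c i * ei i k) ?prZ ?pr_ei ?C2 //; [rewrite /ei eqxx mulr1|apply/funext].
have rE k : refl i c k = - c i * ei i k by rewrite /refl cE pc; ring.
have no k V : wt (fun j => k.+2%:Z * ei i j) V -> V = 0 := @no_mult i k V.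
have one V : wt (ei i) V -> exists a, V = a *: X i := @one_dim i V.
case E : (c i) ci => [[|[|k]]|[|k]] // _.
- have cei : c = ei i by apply/funext => k; rewrite cE E mul1r.
 split; first by rewrite cei qf_ei.
 exists 1%:M, i; split=> //; first by move=> S [].
 by move=> V; rewrite cei => /one [a ->]; exists a; rewrite invmx1 mul1mx mulmx1.
- by move: Z0; rewrite (no k Z) ?eqxx //; apply: eq_wt wZ => l; rewrite cE E.
- have rei : refl i c = ei i by apply/funext => k; rewrite rE E /= mul1r.
 split; first by rewrite -(qf_refl i) rei qf_ei.
 exists (invmx (Nw i)), i; split=> //.
  by move=> S [_ _ _ SV] SN; apply: SV; exact: SN.
 move=> V /(wN i); rewrite rei => /one [a aE]; exists a.
 rewrite -[invmx (Nw i)]mulmx1; apply: back; last exact: unitmx1.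
 by rewrite invmx1 mul1mx mulmx1.
- have := NZ0 i Z Z0; rewrite (no k (Nw i *m Z *m invmx (Nw i))) ?eqxx //; apply: eq_wt (wN i c Z wZ) => l.
 by rewrite rE E.
Qed.

Lemma root_gen (J : pred I) c Z S : (exists i, c i != 0) -> wt c Z -> (forall i, c i != 0 -> J i) ->
 subgroup S -> (forall i a, J i -> S (expm (a *: X i)) /\ S (expm (a *: Y i))) -> S (expm Z).
Proof.
move=> cn0 wZ cJ sS SXY.
have [->|Z0] := eqVneq Z 0; first by rewrite expm0; case: sS.
have [_ [g [i [Ji gS gZ]]]] := descent (leqnn _) cn0 (ex_intro _ Z (conj Z0 wZ)) cJ.
have [a ->] := gZ Z wZ.
have Sg : S g.
 apply: gS => // j Jj; apply: Nw_sub => // b; by have [] := SXY j b Jj.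
case: (sS) => SU _ SM SV.
rewrite scalemxAl scalemxAr expmJ ?SU //; apply: (SM); last exact: SV.
by apply: (SM) => //; have [] := SXY i a Ji.
Qed.

Notation Uset := (UB X Y xpredT).

Let nzset : set 'M[F]_n := [set V | exists c, (exists i, c i != 0) /\ wt c V].

Lemma nz_U V : nzset V -> gens Uset (expm V).
Proof.
move=> [c [cn0 wV]]; apply: (@root_gen xpredT c) => //; first exact: UB_subgroup _ Xnilp Ynilp.
by move=> i a _; exact: in_UB.
Qed.

Let R_nilp V : nzset V -> nilp V.
Proof. move=> [c [[i ci] wV]]; exact: (wt_nilp Tm Rb ci wV). Qed.

(** The closed group generated by T and the root exponentials has every tangent vector of [G], hence
    contains the exponentials of all tangent nilpotents, and these generate a dense subgroup by
    simplicity. *)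
Lemma zcl_T_exps : zcl (gens (T `|` exps nzset)) = G.
Proof.
pose B := T `|` exps nzset.
have [GU _ _ _] := sG.
have BG : B `<=` G.
 move=> g [/TG //|[V [c [[i ci] wV]] ->]].
 by rewrite -[V]scale1r; exact: (wt_exp Gs Tm Rb _ ci wV).
have BGL : B `<=` @GLset F n by move=> g /BG /GU.
have sB : subgroup (gens B) by exact: gens_subgroup.
have BK : gens B `<=` zcl (gens B) by apply: sub_zcl; case: sB.
have KG : zcl (gens B) `<=` G.
 apply: zcl_min; first exact: simple_closed Gs.
 exact: gens_min.
have LK V : Lie G V -> Lie (zcl (gens B)) V.
 move=> /(Lie_decomp Gs Tm Rb) [s Hs ->]; rewrite big_seq; apply: Lie_sum => W Ws.
 have [c wW] := Hs _ Ws.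
 have [/existsP [i ci]|/existsPn h] := boolP [exists i, c i != 0].
  apply: Lie_expm; first exact: (wt_nilp Tm Rb ci wW).
  move=> a; apply: BK; apply: sub_gens; right; exists (a *: W) => //.
  by exists c; split; [exists i|exact: wtZ].
 have {wW} : wt (fun=> 0) W by apply: eq_wt wW => i; have := h i; rewrite negbK => /eqP.
 move=> /(g0_form i0 Gs Tm Rb) [Q' [lam [r [mu [z' [Qu WE lamE ind TQ]]]]]].
 have -> : W = \sum_j mu j *: cdiag Q' (fun i => (z' i j)%:~R).
  rewrite WE (eq_bigr (fun j => cdiag Q' (fun i => mu j * (z' i j)%:~R))); last by move=> j _; rewrite cdiagZ.
  rewrite cdiag_sum; apply: eq_cdiag => l; rewrite lamE; apply: eq_bigr => j _; exact: mulrC.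
 apply: Lie_sum => j _; apply: LieZ; apply: int_diag_Lie => // x x0.
 by apply: BK; apply: sub_gens; left; exact: TQ.
apply/seteqP; split=> // g Gg.
pose Qn : set 'M[F]_n := [set V | nilp V /\ Lie G V].
have E : zcl (gens (exps Qn)) = G.
 apply: simple_exps => //.
 - by move=> V [].
 - by move=> a V [nV LV]; split; [exact: nilpZ|exact: LieZ].
 - by move=> V [].
 - by move=> h V Gh [nV LV]; split; [apply: nilpJ => //; exact: GU|exact: Lie_conj].
 - exists (X i0); last by exact: (X_neq0 i0).
  by split; [exact: (Xnilp i0)|case: (wtX i0)].
have sK : subgroup (zcl (gens B)) by exact: zcl_subgroup.
suff : zcl (gens (exps Qn)) `<=` zcl (gens B) by apply; rewrite E.
apply: zcl_min; first exact: zcl_closed.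
apply: gens_min => // _ [V [nV LV] ->].
by apply: expm_Lie => //; [exact: zcl_closed|exact: LK].
Qed.

(** The root exponentials alone generate a group normalized by T and by itself; its closure is
    normalized by the dense subgroup of [zcl_T_exps], hence by [G]. It is connected and nontrivial,
    so simplicity applies. *)
Lemma zcl_U : zcl (gens Uset) = G.
Proof.
have [GU _ _ _] := sG.
have sU : subgroup (gens Uset) by exact: UB_subgroup _ Xnilp Ynilp.
have Egen : gens (exps nzset) = gens Uset.
 apply/seteqP; split.
  by apply: gens_min => // _ [V RV ->]; exact: nz_U.
 apply: gens_min; first by apply: gens_subgroup; exact: (exps_unit R_nilp).
 apply: UB_sub => i a _; split; apply: sub_gens; eexists; try reflexivity.
  by exists (ei i); split; [exists i; exact: eiE|apply: wtZ; exact: (wtX i)].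
 by exists (fun j => - ei i j); split; [exists i; rewrite oppr_eq0 eiE|apply: wtZ; exact: (wtY i)].
pose N := zcl (gens Uset).
have sN : subgroup N by exact: zcl_subgroup.
have cN : zariski_connected N.
 rewrite /N -Egen; apply: exps_connected => // a V [c [cn0 wV]]; exists c; split=> //.
 exact: wtZ.
have NG : N `<=` G.
 apply: zcl_min; first exact: simple_closed Gs.
 by apply: gens_min => //; apply: UB_sub => i a _; split; [exact: expX_G|exact: expY_G].
have EV g : exps nzset g -> exps nzset (invmx g).
 move=> [V zV ->]; rewrite invmx_expm; last exact: R_nilp.
 by case: zV => c [cn0 wV]; exists (- V) => //; exists c; rewrite -scaleN1r; split=> //; exact: wtZ.
have normT t : T t -> forall x, gens Uset x -> gens Uset (t *m x *m invmx t).
 move=> Tt x; have tu : t \in unitmx by apply: GU; exact: TG.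
 have [_ U1 UM _] := sU; rewrite -{1}Egen.
 apply: (gens_ind (P := fun x => gens Uset (t *m x *m invmx t)) (exps_unit R_nilp) EV).
  by rewrite mulmx1 mulmxV.
 move=> g _ _ [V [c [cn0 wV]] ->] Sg.
 rewrite (_ : _ *m _ = (t *m g *m invmx t) *m (t *m expm V *m invmx t)); last by rewrite !mulmxA mulmxKV.
 apply: (UM) => //; rewrite -expmJ //; apply: nz_U; exists c; split=> //.
 have [_ HV] := wV; rewrite HV // -scalemxAl mulmxK //; exact: wtZ.
have normU x y : gens Uset x -> gens Uset y -> gens Uset (x *m y *m invmx x).
 by move=> Ux Uy; case: sU => _ _ UM UV; apply: (UM); [exact: UM|exact: UV].
have UGL : gens Uset `<=` @GLset F n by case: sU.
have TEU : T `|` exps nzset `<=` @GLset F n.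
 by move=> h [/TG /GU //|[V /R_nilp nV ->]]; exact: expm_unit.
have normB g : gens (T `|` exps nzset) g -> forall x, N x -> N (g *m x *m invmx g).
 move=> Bg; have [BU _ _ _] := gens_subgroup TEU.
 apply: (normal_zcl UGL) => [x|]; last exact: BU; move: g Bg x.
 apply: (gens_ind TEU) => [g [Tg|/EV]|x|h g Bh Bg Hh x Ux]; [|by right|by rewrite invmx1 mul1mx mulmx1|].
  by left; case: sT => _ _ _; exact.
 have gu := TEU _ Bg; rewrite (_ : invmx (h *m g) = invmx g *m invmx h); last first.
  by apply: invmx_uniq; rewrite mulmxA mulmxK // mulmxV // BU.
 have -> : h *m g *m x *m (invmx g *m invmx h) = h *m (g *m x *m invmx g) *m invmx h by rewrite !mulmxA.
 apply: Hh; case: Bg => [Tg|[V RV ->]]; first exact: normT.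
 by apply: normU => //; exact: nz_U.
have normG g x : G g -> N x -> N (g *m x *m invmx g).
 move=> Gg Nx; have gu := GU _ Gg.
 have xu : x \in unitmx by case: sN => H _ _ _; exact: H.
 split; first by rewrite !unitmx_mul gu xu unitmx_inv.
 move=> p vp; have vN := zcl_vanish vp.
 have rg : regular_on (@GLset F n) (fun g => mxeval p (g *m x *m invmx g)).
  have sGL := @subGL F n.
  apply: (regular_meval sGL p (f := fun k g => mxvec (g *m x *m invmx g) 0 k)) => k.
  case/mxvec_indexP: k => i j.
  apply: (regular_eq (f := fun g => (g *m x *m invmx g) i j)); first by move=> ? _; rewrite mxvecE.
  apply: regular_mulmx => // a b; last exact: regular_invmx.
  by apply: regular_mulmxr => // *; exact: regular_entry.
 move: Gg; rewrite -zcl_T_exps => /(zcl_regular _ rg); apply.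
  by case: (gens_subgroup TEU).
 by move=> a /normB Na; apply: vN; exact: Na.
case: (Gs) => _ _ _ /(_ N) [] //.
 by split=> //; exact: zcl_closed.
move=> N1; exfalso; have /eqP := X_neq0 i0; apply.
apply: expm_inj; [exact: (Xnilp i0)|exact: nilp0|] => a.
rewrite scaler0 expm0.
have : N (expm (a *: X i0)) by apply: sub_zcl => //; by have [] := in_UB X Y (b := xpredT) (j := i0) a isT.
by rewrite N1.
Qed.

End Roots.

(** * Combinatorics of E6 and of A5 x A1 inside it *)

Definition Cl (i j : nat) : int := nth 0 (nth [::]
 [:: [::  2;  0; -1;  0;  0;  0];
   [::  0;  2;  0; -1;  0;  0];
   [:: -1;  0;  2; -1;  0;  0];
   [::  0; -1; -1;  2; -1;  0];
   [::  0;  0;  0; -1;  2; -1];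
   [::  0;  0;  0;  0; -1;  2]] i) j.
Definition C6 (i j : 'I_6) : int := E6_cartan i j.

Lemma C6E i j : C6 i j = Cl i j. Proof. by rewrite /C6 mxE. Qed.

Lemma ord6_ind (P : 'I_6 -> Prop) :
 P (inord 0) -> P (inord 1) -> P (inord 2) -> P (inord 3) -> P (inord 4) -> P (inord 5) -> forall i, P i.
Proof.
move=> p0 p1 p2 p3 p4 p5 i; rewrite -(inord_val i); case: i => [[|[|[|[|[|[|m]]]]]] h] //.
Qed.

Lemma C6_sym i j : C6 i j = C6 j i.
Proof. by rewrite !C6E; elim/ord6_ind: i; elim/ord6_ind: j; rewrite !inordK. Qed.
Lemma C6_2 i : C6 i i = 2.
Proof. by rewrite C6E; elim/ord6_ind: i; rewrite inordK. Qed.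

Lemma sum6 (V : nmodType) (f : 'I_6 -> V) :
 \sum_i f i = f (inord 0) + (f (inord 1) + (f (inord 2) + (f (inord 3) + (f (inord 4) + f (inord 5))))).
Proof.
rewrite !big_ord_recl big_ord0 addr0.
by do 5?[congr (f _ + _); first by apply/val_inj; rewrite /= inordK]; congr (f _); apply/val_inj; rewrite /= inordK.
Qed.

(** Completion of squares along the three arms of the diagram, from the tips towards the branch
    node. *)
Lemma qf6E (c : 'I_6 -> int) : 6%:Z * qf C6 c =
 3%:Z * (2%:Z * c (inord 0) - c (inord 2)) ^+ 2 + (3%:Z * c (inord 2) - 2%:Z * c (inord 3)) ^+ 2 +
 3%:Z * (2%:Z * c (inord 5) - c (inord 4)) ^+ 2 + (3%:Z * c (inord 4) - 2%:Z * c (inord 3)) ^+ 2 +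
 3%:Z * (2%:Z * c (inord 1) - c (inord 3)) ^+ 2 + c (inord 3) ^+ 2.
Proof.
rewrite /qf /pr sum6 !sum6 !C6E !inordK // /Cl /=.
move: (c _) (c _) (c _) (c _) (c _) (c _) => a b d e f g; lia.
Qed.

Lemma C6_pos c : (exists i, c i != 0) -> 0 < qf C6 c.
Proof.
move=> [i ci]; rewrite ltNge; apply/negP => q0; case/eqP: ci.
have z (x : int) : x ^+ 2 = 0 -> x = 0 by move/eqP; rewrite sqrf_eq0 => /eqP.
have six (s1 s2 s3 s4 s5 s6 q : int) : 0 <= s1 -> 0 <= s2 -> 0 <= s3 -> 0 <= s4 -> 0 <= s5 -> 0 <= s6 ->
  6%:Z * q = 3%:Z * s1 + s2 + 3%:Z * s3 + s4 + 3%:Z * s5 + s6 -> q <= 0 ->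
  [/\ s1 = 0, s2 = 0, s3 = 0, s4 = 0 & s5 = 0 /\ s6 = 0].
 by move=> *; split; [lia..|split; lia].
have [/z z1 /z z2 /z z3 /z z4 [/z z5 /z z6]] := six _ _ _ _ _ _ _ (sqr_ge0 _) (sqr_ge0 _) (sqr_ge0 _) (sqr_ge0 _)
 (sqr_ge0 _) (sqr_ge0 _) (qf6E c) q0.
move: z1 z2 z3 z4 z5 z6; elim/ord6_ind: i.
all: move: (c (inord 0)) (c (inord 1)) (c (inord 2)) (c (inord 3)) (c (inord 4)) (c (inord 5)) => c0 c1 c2 c3 c4 c5; clear; lia.
Qed.

Definition cnt (s : seq nat) : 'I_6 -> int := fun j => (count_mem (val j) s)%:Z.
Definition sumC (s : seq nat) (j : nat) : int := foldr (fun i a => Cl i j + a) 0 s.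

Lemma pr_cnt s j : all (fun i => (i < 6)%N) s -> pr C6 (cnt s) j = sumC s j.
Proof.
elim: s => [|i s IH] /=; first by move=> _; rewrite /pr big1 // => k _; rewrite mul0r.
case/andP => i6 /IH <-; rewrite -(inordK i6) -C6E -(pr_ei C6 (inord i) j).
have := pr_lin C6 1 1 (ei (inord i)) (cnt s) j; rewrite !mul1r => <-.
congr pr; apply/funext => k; rewrite /cnt /ei /= !mul1r PoszD; congr (Posz (nat_of_bool _) + _).
by rewrite inordK // eq_sym -val_eqE /= inordK.
Qed.

Lemma qfD c i (s : int) : qf C6 (fun j => c j + s * ei i j) = qf C6 c + 2 * s * pr C6 c i + 2 * s * s.
Proof.
have P j : pr C6 (fun j => c j + s * ei i j) j = pr C6 c j + s * C6 i j.
 rewrite -(pr_ei C6 i j); have := pr_lin C6 1 s c (ei i) j; rewrite mul1r => <-.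
 by congr pr; apply/funext => k; rewrite mul1r.
rewrite /qf (eq_bigr (fun j => c j * pr C6 c j + s * (c j * C6 j i) + s * (ei i j * (pr C6 c j + s * C6 i j)))); last first.
 by move=> j _; rewrite P (C6_sym i j); ring.
rewrite !big_split -!mulr_sumr /= -/(pr C6 c i).
have -> : \sum_j ei i j * (pr C6 c j + s * C6 i j) = pr C6 c i + s * 2.
 rewrite (bigD1 i) //= big1 => [|j /negPf h]; first by rewrite /ei eqxx mul1r addr0 C6_2.
 by rewrite /ei h mul0r.
ring.
Qed.

(** Each simple root of the path must pair to -1 with the sum accumulated so far; adding it then
    gives a root again. *)
Fixpoint chkp (s p : seq nat) : bool :=
 if p is i :: p' then [&& (i < 6)%N, sumC s i == -1 & chkp (i :: s) p'] else true.

Definition nest (F : numClosedFieldType) n (Z : 'I_6 -> 'M[F]_n) p A := foldl (fun A i => brk (Z (inord i)) A) A p.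

Lemma cnt_cons i s j : (i < 6)%N -> cnt (i :: s) j = cnt s j + ei (inord i) j.
Proof. by move=> i6; rewrite /cnt /ei /= addrC -val_eqE /= inordK // eq_sym. Qed.

(** A path of simple roots from alpha_6 up to the highest root. Indices count from 0, and the
    starting node 5 is left out. *)
Definition thp : seq nat := [:: 4; 3; 2; 1; 3; 4; 0; 2; 3; 1]%N.
Definition bc (j : 'I_6) : 'I_6 -> int := fun i => E6_beta_coords j i.

Lemma bc_max : bc ord_max = cnt (rev thp ++ [:: 5%N]).
Proof. by apply/funext; apply: ord6_ind; rewrite /bc mxE /cnt /= !inordK. Qed.

(** The node of E6 that carries beta_(j+1) on the A5 chain, which runs from alpha_6 to alpha_1. *)
Definition sj (j : 'I_6) : 'I_6 := inord (nth 0 [:: 5; 4; 3; 2; 0; 1]%N j).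
Definition CB (i j : 'I_6) : int :=
 if (i == ord_max) || (j == ord_max) then (if i == j then 2 else 0) else C6 (sj i) (sj j).

Lemma ord_max6 : (ord_max : 'I_6) = inord 5. Proof. by apply/val_inj; rewrite /= inordK. Qed.

Lemma bc_lt j : j != ord_max -> bc j = ei (sj j).
Proof.
rewrite ord_max6 => jm; apply/funext => i; rewrite /bc mxE /ei /sj -val_eqE /=.
by move: jm; elim/ord6_ind: j; rewrite -val_eqE /= ?inordK // => _; elim/ord6_ind: i; rewrite !inordK.
Qed.

Lemma sj_inj i j : sj i = sj j -> i = j.
Proof.
move/(congr1 val); rewrite /sj /= => E; apply: val_inj; move: E.
by elim/ord6_ind: i; elim/ord6_ind: j; rewrite !inordK.
Qed.

Lemma sj_surj i : i != inord 1 -> exists2 j, j != ord_max & i = sj j.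
Proof.
rewrite ord_max6 => h.
have H k : (k < 5)%N -> sj (inord k) = i -> exists2 j, j != inord 5 & i = sj j.
 by move=> k5 E; exists (inord k) => //; rewrite -val_eqE /= !inordK; lia.
have S k : (k < 6)%N -> sj (inord k) = inord (nth 0 [:: 5; 4; 3; 2; 0; 1]%N k) by move=> k6; rewrite /sj inordK.
move: h H; elim/ord6_ind: i => h H; last by apply: (H 0%N); rewrite ?S.
- by apply: (H 4%N); rewrite ?S.
- by rewrite eqxx in h.
- by apply: (H 3%N); rewrite ?S.
- by apply: (H 2%N); rewrite ?S.
- by apply: (H 1%N); rewrite ?S.
Qed.

Lemma pr_bc_max i : i != inord 1 -> pr C6 (bc ord_max) i = 0.
Proof.
move=> h; rewrite bc_max pr_cnt //.
by move: h; elim/ord6_ind: i; rewrite -val_eqE /= ?inordK.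
Qed.

Lemma sj_neq j : j != ord_max -> sj j != inord 1.
Proof.
by rewrite ord_max6 /sj -!val_eqE /=; elim/ord6_ind: j; rewrite !inordK.
Qed.

Lemma qf_bc_max : qf C6 (bc ord_max) = 2.
Proof.
have E := qf6E (bc ord_max); move: E; rewrite /bc !mxE /= !inordK //= => E.
by apply: (mulfI (x := 6%:Z)) => //; rewrite E.
Qed.

(** On the span of the beta_j the form splits into the A5 part, a sum of squares of consecutive
    differences, and the A1 part. *)
Lemma qf_comb m : qf C6 (fun i => \sum_j m j * bc j i) =
 m (inord 0) ^+ 2 + (m (inord 0) - m (inord 1)) ^+ 2 + (m (inord 1) - m (inord 2)) ^+ 2 +
 (m (inord 2) - m (inord 3)) ^+ 2 + (m (inord 3) - m (inord 4)) ^+ 2 + m (inord 4) ^+ 2 + 2 * m ord_max ^+ 2.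
Proof.
apply: (mulfI (x := 6%:Z)) => //; rewrite qf6E !sum6 ord_max6 /bc !mxE !inordK //=.
move: (m _) (m _) (m _) (m _) (m _) (m _) => a b c d e f; ring.
Qed.

(** A nonzero m_6 already exhausts norm 2 through the term 2 m_6^2, so such a root is beta_6 or its
    opposite. *)
Lemma root_comb m : qf C6 (fun i => \sum_j m j * bc j i) = 2 -> m ord_max != 0 ->
 (forall j, j != ord_max -> m j = 0) /\ (m ord_max = 1 \/ m ord_max = -1).
Proof.
rewrite qf_comb; move=> E h.
have z (x : int) : x ^+ 2 = 0 -> x = 0 by move/eqP; rewrite sqrf_eq0 => /eqP.
have six (s1 s2 s3 s4 s5 s6 q : int) : 0 <= s1 -> 0 <= s2 -> 0 <= s3 -> 0 <= s4 -> 0 <= s5 -> 0 <= s6 ->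
  s1 + s2 + s3 + s4 + s5 + s6 + 2 * q = 2 -> 1 <= q ->
  [/\ s1 = 0, s2 = 0, s3 = 0, s4 = 0 & [/\ s5 = 0, s6 = 0 & q = 1]].
 move=> h1 h2 h3 h4 h5 h6 e hq.
 have q1 : q = 1 by apply/eqP; rewrite eq_le; apply/andP; split; lra.
 by split; [..|split] => //; apply/eqP; rewrite eq_le; apply/andP; split; lra.
have q1 : 1 <= m ord_max ^+ 2.
 by rewrite -gtz0_ge1 lt_def sqr_ge0 sqrf_eq0 h.
have [/z z1 /z z2 /z z3 /z z4 [/z z5 /z z6 z7]] := six _ _ _ _ _ _ _ (sqr_ge0 _) (sqr_ge0 _) (sqr_ge0 _) (sqr_ge0 _)
 (sqr_ge0 _) (sqr_ge0 _) E q1.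
split; last first.
 by move/eqP: z7; rewrite sqrf_eq1 => /orP [/eqP|/eqP]; [left|right].
move=> j; rewrite ord_max6; move: z1 z2 z3 z4 z5 z6; elim/ord6_ind: j; rewrite ?eqxx //;
 move: (m (inord 0)) (m (inord 1)) (m (inord 2)) (m (inord 3)) (m (inord 4)) => a b c d e; clear; lia.
Qed.

Lemma prN c i : pr C6 (fun l => - c l) i = - pr C6 c i.
Proof.
have := prZ C6 (-1) c i; rewrite mulN1r => <-; congr pr.
by apply/funext => l; rewrite mulN1r.
Qed.

Lemma qfN c : qf C6 (fun l => - c l) = qf C6 c.
Proof. by rewrite /qf; apply: eq_bigr => l _; rewrite prN mulrNN. Qed.

(** * Root vectors and generators of the subgroup A5 A1 *)

Section Beta.
Variables (F : numClosedFieldType) (n : nat) (G T : set 'M[F]_n) (alpha : 'I_6 -> 'M[F]_n -> F).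
Hypotheses (Gs : simple_algebraic_group G) (Tm : maximal_torus G T) (Rb : root_base G T alpha).
Notation wt := (wt G T alpha).
Notation comb := (comb alpha).
Variables (alphav betav : 'I_6 -> F -> 'M[F]_n) (X Y Q : 'I_6 -> 'M[F]_n) (z : 'I_6 -> 'I_n -> int)
 (XB YB QB : 'I_6 -> 'M[F]_n) (zB : 'I_6 -> 'I_n -> int).
Hypotheses (Coch : forall i c, c != 0 -> T (alphav i c))
 (D : forall i, sl2_triple G T (alpha i) (alphav i) (X i) (Y i) (Q i) (z i))
 (Ca : forall i j, pairing (alpha i) (alphav j) (C6 i j)) (CochB : forall i c, c != 0 -> T (betav i c))
 (DB : forall j, sl2_triple G T (E6_beta alpha j) (betav j) (XB j) (YB j) (QB j) (zB j)).
Notation pr := (pr C6).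
Notation qf := (qf C6).
Notation H_ := (Hi Q z).
Notation HB := (Hi QB zB).

Let sG := simple_group Gs.
Let sT := T_subgroup Tm.

Lemma root_conj c Z : (exists i, c i != 0) -> Z != 0 -> wt c Z ->
 qf c = 2 /\ exists g i, forall Z', wt c Z' -> exists a, Z' = a *: (g *m X i *m invmx g).
Proof.
move=> cn0 Z0 wZ; have [q [g [i [_ _ gZ]]]] := descent (inord 0) Gs Tm Rb Coch D Ca C6_2 C6_sym C6_pos
 (J := xpredT) (leqnn _) cn0 (ex_intro _ Z (conj Z0 wZ)) (fun _ _ => isT).
by split=> //; exists g, i.
Qed.

Lemma nonroot c Z : wt c Z -> qf c != 2 -> qf c != 0 -> Z = 0.
Proof.
move=> wZ q2 q0; apply/eqP/negPn/negP => Z0.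
have cn0 : exists i, c i != 0.
 apply: contrapT => /forallNP h; case/eqP: q0; rewrite /qf big1 // => i _.
 by have /negP/negPn/eqP -> := h i; rewrite mul0r.
by have [q _] := root_conj cn0 Z0 wZ; rewrite q eqxx in q2.
Qed.

Lemma root_line c Z Z' : (exists i, c i != 0) -> wt c Z -> wt c Z' -> Z' != 0 -> exists a, Z = a *: Z'.
Proof.
move=> cn0 wZ wZ' Z'0.
have [_ [g [i gZ]]] := root_conj cn0 Z'0 wZ'.
have [a ->] := gZ _ wZ; have [b E] := gZ _ wZ'.
have b0 : b != 0 by apply: contraNneq Z'0 => b0; rewrite E b0 scale0r.
by exists (a / b); rewrite E scalerA divfK.
Qed.

Section Nest.
Variables (Z W : 'I_6 -> 'M[F]_n) (s : int).
Hypotheses (s2 : s * s = 1) (wZ : forall i, wt (fun j => s * ei i j) (Z i)) (wW : forall i, wt (fun j => - s * ei i j) (W i))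
 (bZW : forall i, brk (Z i) (W i) = s%:~R *: H_ i) (Z0 : forall i, Z i != 0).

(** As (c, alpha_i) = -1, the weight c - alpha_i has norm 6 and is no root, so the opposite vector
    [W i] kills [A]; by the Jacobi identity it brings [Z_i, A] back to a nonzero multiple of [A].
    The sign [s] treats raising and lowering vectors together. *)
Lemma step c i A : wt (fun j => s * c j) A -> A != 0 -> qf c = 2 -> pr c i = -1 ->
 [/\ wt (fun j => s * (c j + ei i j)) (brk (Z i) A), brk (Z i) A != 0 & qf (fun j => c j + ei i j) = 2].
Proof.
move=> wA A0 q2 p1; have s0 : s != 0 by apply: contra_eq_neq s2 => ->.
have qN d : qf (fun j => s * d j) = qf d.
 by apply: eq_bigr => j _; rewrite prZ mulrACA s2 mul1r.
have h : brk (W i) A = 0.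
 have w : wt (fun j => s * (c j + (-1) * ei i j)) (brk (W i) A).
  apply: (eq_wt (c := fun j => - s * ei i j + s * c j)); first by move=> j; ring.
  by apply: (wt_brk Gs Tm Rb (i := i)) (wW i) wA; rewrite mulf_neq0 ?oppr_eq0 ?eiE.
 by apply: (nonroot w); rewrite qN qfD q2 p1.
split.
- apply: (eq_wt (c := fun j => s * ei i j + s * c j)); first by move=> j; ring.
 by apply: (wt_brk Gs Tm Rb (i := i)) (wZ i) wA; rewrite mulf_neq0 ?eiE.
- apply: contraNneq A0 => E; have := brk_jacobi (Z i) (W i) A.
 rewrite h E bZW brkZl (adH Coch D Ca i wA) prZ p1 scalerA -intrM mulrA s2 mul1r /brk !(mulmx0, mul0mx) !subrr.
 by rewrite scaleN1r => /eqP; rewrite oppr_eq0.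
- have -> : (fun j => c j + ei i j) = (fun j => c j + 1 * ei i j) by apply/funext => j; rewrite mul1r.
 by rewrite qfD q2 p1.
Qed.

Lemma nest_wt p t A : all (fun i => (i < 6)%N) t -> wt (fun j => s * cnt t j) A -> A != 0 -> qf (cnt t) = 2 -> chkp t p ->
 wt (fun j => s * cnt (rev p ++ t) j) (nest Z p A) /\ nest Z p A != 0.
Proof.
elim: p t A => [|i p IH] t A //= tall wA A0 q2 /and3P [i6 /eqP s1 ch].
have [|wA' A'0 q2'] := step (i := inord i) wA A0 q2; first by rewrite pr_cnt // inordK.
have E : (fun j => cnt t j + ei (inord i) j) = cnt (i :: t) by apply/funext => j; rewrite cnt_cons.
rewrite E in q2'; rewrite rev_cons cat_rcons; apply: IH => //=; first by rewrite i6.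
by rewrite -E.
Qed.

Lemma nest_theta : wt (fun i => s * bc ord_max i) (nest Z thp (Z (inord 5))) /\ nest Z thp (Z (inord 5)) != 0.
Proof.
have E : ei (inord 5 : 'I_6) = cnt [:: 5%N].
 by apply/funext => j; rewrite cnt_cons // /cnt add0r.
by rewrite bc_max; apply: nest_wt => //; rewrite -E // (qf_ei C6_2).
Qed.
End Nest.

Lemma wtXB j : wt (bc j) (XB j).
Proof. by have [[_ _ L E] _ _ _ _] := DB j; split. Qed.
Lemma wtYB j : wt (fun i => - bc j i) (YB j).
Proof. by have [_ [_ _ L E] _ _ _] := DB j; split=> // t Tt; rewrite combN E. Qed.
Lemma XB_neq0 j : XB j != 0. Proof. by have [[]] := DB j. Qed.
Lemma YB_neq0 j : YB j != 0. Proof. by have [_ []] := DB j. Qed.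
Lemma XB_nilp j : nilp (XB j). Proof. by have [[]] := DB j. Qed.
Lemma YB_nilp j : nilp (YB j). Proof. by have [_ []] := DB j. Qed.
Lemma brkXYB j : brk (XB j) (YB j) = HB j. Proof. by have [_ _ []] := DB j. Qed.

Lemma bc_neq0 j : exists i, bc j i != 0.
Proof.
have [->|h] := eqVneq j ord_max; last by exists (sj j); rewrite bc_lt // eiE.
by exists (inord 1); rewrite /bc mxE inordK.
Qed.

Lemma bcN_neq0 j : exists i, - bc j i != 0.
Proof. by have [i h] := bc_neq0 j; exists i; rewrite oppr_eq0. Qed.
Lemma nz_scal (a : F) (A B : 'M[F]_n) : A = a *: B -> A != 0 -> a != 0.
Proof. by move=> -> ; apply: contraNneq => ->; rewrite scale0r. Qed.

Lemma XB_scale j : j != ord_max -> exists2 a, a != 0 & XB j = a *: X (sj j).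
Proof.
move=> jm; have w := wtXB j; have w' := wtX D (sj j); rewrite -bc_lt // in w'.
have [a E] := root_line (bc_neq0 j) w w' (X_neq0 D _).
by exists a => //; apply: nz_scal E (XB_neq0 j).
Qed.

Lemma YB_scale j : j != ord_max -> exists2 a, a != 0 & YB j = a *: Y (sj j).
Proof.
move=> jm; have w := wtYB j; have w' := wtY D (sj j); rewrite -bc_lt // in w'.
have [a E] := root_line (bcN_neq0 j) w w' (Y_neq0 D _).
by exists a => //; apply: nz_scal E (YB_neq0 j).
Qed.

(** It expresses the highest root vector through simple ones by the same brackets as in the
    27-dimensional model, which is what makes the two comparable. *)
Lemma XB_nest : exists2 a, a != 0 & nest X thp (X (inord 5)) = a *: XB ord_max.
Proof.
have [|||w w0] := nest_theta (Z := X) (W := Y) (s := 1) erefl _ _ _ (X_neq0 D).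
- by move=> i; apply: eq_wt (wtX D i) => j; rewrite mul1r.
- by move=> i; apply: eq_wt (wtY D i) => j; rewrite mulN1r.
- by move=> i; rewrite scale1r (brkXY D).
have [a E] := root_line (bc_neq0 _) (eq_wt (fun=> mul1r _) w) (wtXB ord_max) (XB_neq0 _).
by exists a => //; apply: nz_scal E w0.
Qed.

Lemma YB_nest : exists2 a, a != 0 & nest Y thp (Y (inord 5)) = a *: YB ord_max.
Proof.
have [|||w w0] := nest_theta (Z := Y) (W := X) (s := -1) erefl _ _ _ (Y_neq0 D).
- by move=> i; apply: eq_wt (wtY D i) => j; rewrite mulN1r.
- by move=> i; apply: eq_wt (wtX D i) => j; rewrite opprK mul1r.
- by move=> i; rewrite brkC (brkXY D) scaleN1r.
have [a E] := root_line (bcN_neq0 _) (eq_wt (fun=> mulN1r _) w) (wtYB ord_max) (YB_neq0 _).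
by exists a => //; apply: nz_scal E w0.
Qed.

(** The difference of beta_i and beta_j is no root: beta_6 is orthogonal to the A5 chain, which
    gives norm 4, and a difference of two distinct simple roots has coefficients of both signs. *)
Lemma XBYB_0 i j : i != j -> brk (XB i) (YB j) = 0.
Proof.
move=> ij; have [k bk] := bc_neq0 i.
have w := wt_brk Gs Tm Rb bk (wtXB i) (wtYB j).
have Z0 c s : qf c = 2 -> s != inord 1 -> c = bc ord_max -> qf (fun j => c j + -1 * ei s j) = 4.
 by move=> q2 sn cE; rewrite qfD q2 cE pr_bc_max.
have [im|im] := eqVneq i ord_max.
 have jm : j != ord_max by rewrite -im eq_sym.
 have q4 : qf (fun l => bc i l - bc j l) = 4.
  rewrite -(Z0 (bc ord_max) (sj j) qf_bc_max (sj_neq jm) erefl) im (bc_lt jm); congr qf.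
  by apply/funext => l; rewrite mulN1r.
 by apply: (nonroot w); rewrite q4.
have [jm|jm] := eqVneq j ord_max.
 have q4 : qf (fun l => bc i l - bc j l) = 4.
  rewrite -qfN -(Z0 (bc ord_max) (sj i) qf_bc_max (sj_neq im) erefl) jm (bc_lt im); congr qf.
  by apply/funext => l; rewrite mulN1r opprB.
 by apply: (nonroot w); rewrite q4.
apply/eqP/negPn/negP => Z1.
have sij : (sj i == sj j) = false.
 by apply/eqP => /sj_inj E; rewrite E eqxx in ij.
have sji : (sj j == sj i) = false by rewrite eq_sym.
have [|_ []] := wt_root Tm Rb Z1 w.
- by exists (sj i); rewrite !bc_lt // /ei eqxx sij.
- by move=> /(_ (sj j)); rewrite !bc_lt // /ei eqxx sji.
- by move=> /(_ (sj i)); rewrite !bc_lt // /ei eqxx sij.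
Qed.

Lemma XBXB_0 j : j != ord_max -> brk (XB ord_max) (XB j) = 0 /\ brk (YB ord_max) (YB j) = 0.
Proof.
move=> jm; have q4 : qf (fun l => bc ord_max l + bc j l) = 4.
 have := qfD (bc ord_max) (sj j) 1; rewrite qf_bc_max (pr_bc_max (sj_neq jm)) => E.
 rewrite -[RHS]E (bc_lt jm); congr qf; by apply/funext => l; rewrite mul1r.
split.
 have [k bk] := bc_neq0 ord_max.
 by apply: (nonroot (wt_brk Gs Tm Rb bk (wtXB _) (wtXB j))); rewrite q4.
have [k bk] := bcN_neq0 ord_max.
have q4' : qf (fun l => - bc ord_max l + - bc j l) = 4.
 by rewrite -q4 -qfN; congr qf; apply/funext => l; rewrite opprD !opprK.
by apply: (nonroot (wt_brk Gs Tm Rb bk (wtYB _) (wtYB j))); rewrite q4'.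
Qed.

Lemma QB_unit j : QB j \in unitmx. Proof. by have [_ _ []] := DB j. Qed.

Lemma HB_self j : brk (HB j) (XB j) = 2%:R *: XB j /\ brk (HB j) (YB j) = - 2%:R *: YB j.
Proof.
have [_ _ [_ E _ chi2] _ _] := DB j.
have TQ x : x != 0 -> T (cdiag (QB j) (fun i => x ^ zB j i)) by move=> x0; rewrite -E //; exact: CochB.
have two0 := two_neq0 F.
have [k [-> Ek]] := cochar_act (QB_unit j) TQ (wtXB j) (XB_neq0 j).
have [k' [-> Ek']] := cochar_act (QB_unit j) TQ (wtYB j) (YB_neq0 j).
have e1 : comb (bc j) (betav j 2%:R) = 2%:R ^ (2 : int) by exact: chi2.
have -> : k = 2 by apply: (@int2_eq F); rewrite -Ek -E.
have -> : k' = -2.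
 apply: (@int2_eq F); rewrite -Ek' -E // combN e1.
 by rewrite -invr_expz.
by split=> //; congr (_ *: _); rewrite -[-2]/(- (2 : int)) mulrNz.
Qed.

(** The root vectors for beta_j are multiples aX and bY of the simple ones; since both coroots act
    by 2 on the root space, ab = 1. *)
Lemma HB_lt j : j != ord_max -> HB j = H_ (sj j).
Proof.
move=> jm; have [a a0 Ea] := XB_scale jm; have [b b0 Eb] := YB_scale jm.
have E : HB j = (a * b) *: H_ (sj j).
 by rewrite -brkXYB Ea Eb brkZl brkZ scalerA (brkXY D).
have [h _] := HB_self j; move: h.
rewrite E brkZl (adH Coch D Ca _ (wtXB j)) bc_lt // pr_ei C6_2 scalerA => /eqP.
rewrite -subr_eq0 -scalerBl scaler_eq0 (negPf (XB_neq0 j)) orbF => /eqP h.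
have two0 := two_neq0 F.
suff -> : a * b = 1 by rewrite scale1r.
by apply: (mulIf two0); rewrite mul1r; apply/eqP; rewrite -subr_eq0; apply/eqP.
Qed.

Lemma HB_act i j : brk (HB i) (XB j) = (CB i j)%:~R *: XB j /\ brk (HB i) (YB j) = - (CB i j)%:~R *: YB j.
Proof.
rewrite /CB; have [im|im] := eqVneq i ord_max; have [jm|jm] := eqVneq j ord_max.
- by rewrite im jm eqxx; exact: HB_self.
- rewrite im eq_sym (negPf jm) oppr0 !scale0r -brkXYB !brk_jacobi.
 have [h1 h2] := XBXB_0 jm.
 have h3 : brk (YB ord_max) (XB j) = 0 by rewrite brkC XBYB_0 ?oppr0.
 have h4 : brk (XB ord_max) (YB j) = 0 by rewrite XBYB_0 // eq_sym.
 by rewrite h1 h2 h3 h4 /brk !(mulmx0, mul0mx) !subrr.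
- rewrite jm (negPf im) oppr0 !scale0r HB_lt // !(adH Coch D Ca _ (wtXB _)) !(adH Coch D Ca _ (wtYB _)).
 by rewrite prN (pr_bc_max (sj_neq im)) oppr0 !scale0r.
- rewrite HB_lt // !(adH Coch D Ca _ (wtXB _)) !(adH Coch D Ca _ (wtYB _)) !bc_lt // pr_ei C6_sym; split=> //.
 by rewrite prN pr_ei C6_sym mulrNz.
Qed.

Let SUB J : subgroup (gens (UB XB YB J)). Proof. exact: UB_subgroup XB_nilp YB_nilp. Qed.

Lemma root_hom_ext chi chi' u : (forall t, T t -> chi t = chi' t) ->
 root_hom G T chi u -> root_hom G T chi' u.
Proof. by move=> E [h1 h2 h3 h4 h5]; split=> // t c Tt; rewrite h5 // E. Qed.

Lemma comb_comb (I : finType) (b : I -> 'I_6 -> int) m t : T t ->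
 Defs.comb (fun k => comb (b k)) m t = comb (fun i => \sum_k m k * b k i) t.
Proof.
move=> Tt; rewrite /Defs.comb.
transitivity (\prod_k \prod_i alpha i t ^ (m k * b k i)).
 apply: eq_bigr => k _; elim/big_rec2: _ => [|i x y _ <-]; first by rewrite exp1rz.
 by rewrite expfzMl exprz_exp [b k i * _]mulrC.
rewrite exchange_big; apply: eq_bigr => i _; rewrite prodf_exprz //.
exact: (root_neq0 Tm Rb i Tt).
Qed.

(** An element of a root subgroup is the exponential of a weight vector, so containment reduces to
    exponentials of weight vectors whose weight lies in the span of [b]. *)
Lemma subsys_sub (I : finType) (b : I -> 'I_6 -> int) S : subgroup S ->
 (forall c Z, (exists i, c i != 0) -> Z != 0 -> wt c Z -> (exists m, forall i, c i = \sum_k m k * b k i) -> S (expm Z)) ->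
 subsystem_group G T (fun k => comb (b k)) `<=` S.
Proof.
move=> sS H; apply: gens_min => // g [chi [m [rchi chiE [u [x [ru ->]]]]]].
have [Z [nZ Z0 LZ uE ZT]] := root_hom_exp sG sT ru.
have chiE' t : T t -> chi t = comb (fun i => \sum_k m k * b k i) t.
 by move=> Tt; rewrite chiE // comb_comb.
have wZ : wt (fun i => \sum_k m k * b k i) Z by split=> // t Tt; rewrite ZT // chiE'.
rewrite uE; have [->|x0] := eqVneq x 0; first by rewrite scale0r expm0; case: sS.
apply: (H (fun i => \sum_k m k * b k i)).
- apply: contrapT => /forallNP h; case: rchi => _ [t Tt /eqP t1] _; apply: t1.
 rewrite chiE' // -(comb0 alpha t); congr comb; apply/funext => i.
 by have /negP/negPn/eqP := h i.
- by rewrite scaler_eq0 negb_or x0.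
- exact: wtZ.
- by exists m.
Qed.

Lemma subsys_in (I : finType) (b : I -> 'I_6 -> int) j m : (forall i, bc j i = \sum_k m k * b k i) ->
 forall c, subsystem_group G T (fun k => comb (b k)) (expm (c *: XB j)) /\
  subsystem_group G T (fun k => comb (b k)) (expm (c *: YB j)).
Proof.
move=> E c; have [_ _ _ _ [rX rY _]] := DB j; split; apply: sub_gens.
 have [[chi [rchi chiE]] _] := wt_root Tm Rb (XB_neq0 j) (wtXB j) (bc_neq0 j).
 exists chi, m; split=> //.
  by move=> t Tt; rewrite chiE // comb_comb //; congr comb; apply/funext.
 exists (fun c => expm (c *: XB j)), c; split=> //; apply: root_hom_ext rX => t Tt.
 by rewrite chiE.
have [[chi [rchi chiE]] _] := wt_root Tm Rb (YB_neq0 j) (wtYB j) (bcN_neq0 j).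
exists chi, (fun k => - m k); split=> //.
 move=> t Tt; rewrite chiE // comb_comb //; congr comb; apply/funext => i.
 by rewrite E -sumrN; apply: eq_bigr => k _; rewrite mulNr.
exists (fun c => expm (c *: YB j)), c; split=> //; apply: root_hom_ext rY => t Tt.
by rewrite chiE // combN.
Qed.

(** A root without alpha_2 is supported on the nodes of the A5 chain, to which [root_gen] is applied
    with their simple root vectors. *)
Lemma A5_root_in S c Z : subgroup S -> (forall j a, j != ord_max -> S (expm (a *: XB j)) /\ S (expm (a *: YB j))) ->
 (exists i, c i != 0) -> wt c Z -> c (inord 1) = 0 -> S (expm Z).
Proof.
move=> sS SB cn0 wZ c1.
apply: (root_gen (inord 0) Gs Tm Rb Coch D Ca C6_2 C6_sym C6_pos (J := fun i => i != inord 1) cn0 wZ) => //.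
 by move=> i; apply: contraNneq => ->; rewrite c1.
move=> i a i1; have [j jm ->] := sj_surj i1.
have [x x0 Ex] := XB_scale jm; have [y y0 Ey] := YB_scale jm.
split.
 by have [h _] := SB j (a / x) jm; move: h; rewrite Ex scalerA divfK.
by have [_ h] := SB j (a / y) jm; move: h; rewrite Ey scalerA divfK.
Qed.

Lemma theta_in S c Z s : subgroup S -> (forall a, S (expm (a *: XB ord_max)) /\ S (expm (a *: YB ord_max))) ->
 wt c Z -> (s = 1 \/ s = -1) -> (forall i, c i = s * bc ord_max i) -> S (expm Z).
Proof.
move=> sS SB wZ [] -> cE.
 have w : wt (bc ord_max) Z by apply: eq_wt wZ => i; rewrite cE mul1r.
 have [a ->] := root_line (bc_neq0 _) w (wtXB ord_max) (XB_neq0 _).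
 by have [] := SB a.
have w : wt (fun i => - bc ord_max i) Z by apply: eq_wt wZ => i; rewrite cE mulN1r.
have [a ->] := root_line (bcN_neq0 _) w (wtYB ord_max) (YB_neq0 _).
by have [] := SB a.
Qed.

Lemma A5_gens : A5_factor G T alpha = gens (UB XB YB (fun j => j != ord_max)).
Proof.
apply/seteqP; split.
 apply: (subsys_sub (b := fun k : 'I_5 => bc (lift ord_max k))).
  exact: SUB.
 move=> c Z cn0 Z0 wZ [m cE]; apply: (A5_root_in _ _ cn0 wZ).
 - exact: SUB.
 - by move=> j a jm; exact: in_UB.
 - rewrite cE big1 // => k _; have h : lift ord_max k != ord_max by rewrite eq_sym neq_lift.
  by rewrite bc_lt // /ei eq_sym (negPf (sj_neq h)) mulr0.
apply: gens_min.
 by apply: gens_subgroup => g [chi [m [rchi _ [u [x [[uG _ _ _ _] ->]]]]]]; case: sG => GU _ _ _; exact: GU.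
move=> g [j [c [jm h]]].
have E i : bc j i = \sum_(k < 5) (if lift ord_max k == j then 1 else 0) * bc (lift ord_max k) i.
 case: (unliftP ord_max j) jm => [k ->|->] jm; last by rewrite eqxx in jm.
 rewrite (bigD1 k) //= eqxx mul1r big1 ?addr0 // => k' k'k.
 by rewrite (inj_eq (@lift_inj _ _)) (negPf k'k) mul0r.
have [h1 h2] := subsys_in (b := fun k : 'I_5 => bc (lift ord_max k)) E c.
by case: h => ->.
Qed.

Lemma A1_gens : A1_factor G T alpha = gens (UB XB YB (fun j => j == ord_max)).
Proof.
apply/seteqP; split.
 apply: (subsys_sub (b := fun k : 'I_1 => bc ord_max)).
  exact: SUB.
 move=> c Z cn0 Z0 wZ [m cE].
 have {}cE i : c i = m 0 * bc ord_max i by rewrite cE big_ord1.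
 have [q _] := root_conj cn0 Z0 wZ.
 have m1 : m 0 = 1 \/ m 0 = -1.
  have E : c = fun i => \sum_j (if j == ord_max then m 0 else 0) * bc j i.
   apply/funext => i; rewrite cE (bigD1 ord_max) //= ?eqxx big1 ?addr0 // => k /negPf ->.
   by rewrite mul0r.
  have [||_] := root_comb (m := fun j => if j == ord_max then m 0 else 0); rewrite -?E ?eqxx //.
  by apply/eqP => m0; move: q; rewrite /qf big1 // => i _; rewrite cE m0 !mul0r.
 apply: (theta_in _ _ wZ m1 cE); first exact: SUB.
 by move=> a; apply: in_UB.
apply: gens_min.
 by apply: gens_subgroup => g [chi [m [rchi _ [u [x [[uG _ _ _ _] ->]]]]]]; case: sG => GU _ _ _; exact: GU.
move=> g [j [c [/eqP -> h]]].
have E i : bc ord_max i = \sum_(k < 1) 1 * bc ord_max i by rewrite big_ord1 mul1r.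
have [h1 h2] := subsys_in (b := fun k : 'I_1 => bc ord_max) E c.
by case: h => ->.
Qed.

(** A root in the span of the beta_j either has no beta_6, hence no alpha_2, or is plus or minus
    beta_6 by [root_comb]. *)
Lemma H_gens : A5A1_subgroup G T alpha = gens (T `|` UB XB YB xpredT).
Proof.
have GL : T `|` UB XB YB xpredT `<=` @GLset F n.
 by move=> g [Tg|/(UB_GL XB_nilp YB_nilp) //]; case: sT => TU _ _ _; exact: TU.
have sH : subgroup (gens (T `|` UB XB YB xpredT)) by exact: gens_subgroup.
apply/seteqP; split.
 apply: gens_min => // g [Tg|]; first by apply: sub_gens; left.
 apply: (subsys_sub (b := bc)) => // c Z cn0 Z0 wZ [m cE].
 have SB a j : gens (T `|` UB XB YB xpredT) (expm (a *: XB j)) /\ gens (T `|` UB XB YB xpredT) (expm (a *: YB j)).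
  by split; apply: sub_gens; right; exists j, a; split=> //; [left|right].
 have [q _] := root_conj cn0 Z0 wZ.
 have [m5|m5] := eqVneq (m ord_max) 0.
  apply: (A5_root_in _ _ cn0 wZ) => //.
  rewrite cE big1 // => k _; have [->|h] := eqVneq k ord_max; first by rewrite m5 mul0r.
  by rewrite bc_lt // /ei eq_sym (negPf (sj_neq h)) mulr0.
 have [|mj m1] := root_comb (m := m) _ m5.
  by rewrite -q; congr qf; apply/funext => i; rewrite cE.
 apply: (theta_in _ _ wZ m1) => // i.
 rewrite cE (bigD1 ord_max) //= big1 ?addr0 // => k /mj ->.
 by rewrite mul0r.
have BL : T `|` subsystem_group G T (E6_beta alpha) `<=` @GLset F n.
 move=> g [Tg|]; first by case: sT => TU _ _ _; exact: TU.
 case: (gens_subgroup (B := [set g | exists chi (m : 'I_6 -> int),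
    [/\ is_root G T chi, forall t, T t -> chi t = Defs.comb (E6_beta alpha) m t &
      root_subgroup G T chi g]]) _); last by move=> h _ _ _; exact: h.
 by move=> h [chi [m [rchi _ [u [x [[uG _ _ _ _] ->]]]]]]; case: sG => GU _ _ _; exact: GU.
apply: gens_min; first exact: gens_subgroup.
move=> g [Tg|[j [c [_ h]]]]; apply: sub_gens; [by left|right].
have E i : bc j i = \sum_k (if k == j then 1 else 0) * bc k i.
 rewrite (bigD1 j) //= eqxx mul1r big1 ?addr0 // => k /negPf ->.
 by rewrite mul0r.
have [h1 h2] := subsys_in (b := bc) E c.
by case: h => ->.
Qed.

(** For distinct nodes alpha_i - alpha_j has norm 4 - 2 C_ij, at least 4, so it is no root. *)
Lemma XY_0 i j : brk (X i) (Y j) = if i == j then H_ i else 0.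
Proof.
case: eqP => [<-|/eqP ij]; first exact: (brkXY D).
have wX := wtX D i; have wY := wtY D j.
have h1 : exists i0, ei i i0 != 0 by exists i; rewrite /ei eqxx.
case: h1 => i0 h1; have w := wt_brk Gs Tm Rb h1 wX wY.
have q : qf (fun l => ei i l + - ei j l) = 4 - 2 * C6 i j.
 have -> : (fun l => ei i l + - ei j l) = (fun l => ei i l + (-1) * ei j l).
  by apply/funext => l; rewrite mulN1r.
 rewrite qfD (qf_ei C6_2) pr_ei; lia.
have Cle : C6 i j <= 0.
 move: ij; rewrite C6E -val_eqE /=; case: i {wX h1 w q} => -[|[|[|[|[|[|i]]]]]] // hi; by case: j {wY} => -[|[|[|[|[|[|j]]]]]].
apply: (nonroot w); rewrite q; apply/eqP; lia.
Qed.
Lemma HX_6 i j : brk (H_ i) (X j) = (C6 i j)%:~R *: X j.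
Proof. by rewrite (adH Coch D Ca i (wtX D j)) pr_ei C6_sym. Qed.
Lemma HY_6 i j : brk (H_ i) (Y j) = - (C6 i j)%:~R *: Y j.
Proof. by rewrite (adH Coch D Ca i (wtY D j)) prN pr_ei C6_sym rmorphN. Qed.
Lemma G_UB : G `<=` zcl (gens (UB X Y xpredT)).
Proof. by rewrite (zcl_U (inord 0) Gs Tm Rb Coch D Ca C6_2 C6_sym C6_pos). Qed.
End Beta.

(** * Highest weight modules in terms of operators *)

Section HighestWeight.
Variables (F : numClosedFieldType) (J : finType) (V : lmodType F)
 (E Fo H : J -> {linear V -> V}) (cm : J -> J -> F) (r mu : J -> F) (v : V).
Hypotheses (EF : forall i j u, E i (Fo j u) = Fo j (E i u) + (if i == j then H i u else 0))
 (HF : forall i j u, H i (Fo j u) = Fo j (H i u) - cm i j *: Fo j u) (rc : forall j, \sum_i r i * cm i j = 1)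
 (v0 : v != 0) (Ev : forall i, E i v = 0) (Hv : forall i, H i v = mu i *: v).

Lemma lZ (A : {linear V -> V}) a u : A (a *: u) = a *: A u.
Proof. exact: linearZZ. Qed.

Definition linP (U : V -> Prop) := U 0 /\ forall a u w, U u -> U w -> U (a *: u + w).
Definition irrP := forall U : V -> Prop, linP U -> (forall j u, U u -> U (E j u)) ->
 (forall j u, U u -> U (Fo j u)) -> (exists2 u, U u & u != 0) -> forall u, U u.

Lemma linP_Z U a u : linP U -> U u -> U (a *: u).
Proof. by move=> [U0 UL] Uu; rewrite -[_ *: _]addr0; exact: UL. Qed.
Lemma linP_D U u w : linP U -> U u -> U w -> U (u + w).
Proof. by move=> [U0 UL] Uu Uw; rewrite -[u]scale1r; exact: UL. Qed.

Definition grad u : V := \sum_i r i *: H i u.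
Definition top := \sum_i r i * mu i.
(** It vanishes on vectors l levels below [v] for the grading [grad], which each [Fo j] lowers by 1
    because of [rc]. *)
Definition K (l : nat) u : V := grad u - (top - l%:R) *: u.

Lemma grad_lin a u w : grad (a *: u + w) = a *: grad u + grad w.
Proof.
rewrite /grad scaler_sumr -big_split; apply: eq_bigr => i _ /=.
by rewrite linearP scalerDr !scalerA mulrC.
Qed.
Lemma K_lin l a u w : K l (a *: u + w) = a *: K l u + K l w.
Proof.
rewrite /K grad_lin !scalerDr !scalerN !scalerA opprD addrACA; congr (_ + _ + _).
by rewrite mulrC.
Qed.
Lemma K0 l : K l 0 = 0.
Proof. by have := K_lin l (-1) 0 0; rewrite scaler0 addr0 => E0; rewrite /K /grad big1 ?scaler0 ?subrr // => i _; rewrite linear0 scaler0. Qed.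
Lemma KE l u : K l u = - (top - l%:R) *: u + grad u.
Proof. by rewrite /K scaleNr addrC. Qed.
Lemma K_comm l k u : K l (K k u) = K k (K l u).
Proof.
rewrite [K k u]KE [K l u]KE !K_lin !KE !scalerDr !scalerA -!addrA [- (top - l%:R) * _]mulrC.
by congr (_ + _); rewrite addrCA.
Qed.

Lemma grad_v : grad v = top *: v.
Proof. by rewrite /grad /top scaler_suml; apply: eq_bigr => i _; rewrite Hv scalerA. Qed.
Lemma K_v l : K l v = l%:R *: v.
Proof. by rewrite /K grad_v -scalerBl; congr (_ *: _); ring. Qed.
Lemma grad_F j u : grad (Fo j u) = Fo j (grad u) - Fo j u.
Proof.
rewrite /grad (eq_bigr (fun i => Fo j (r i *: H i u) - (r i * cm i j) *: Fo j u)); last first.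
 by move=> i _; rewrite HF scalerBr scalerA (lZ (Fo j)).
by rewrite sumrB -linear_sum -scaler_suml rc scale1r.
Qed.
Lemma K_F l j u : K l.+1 (Fo j u) = Fo j (K l u).
Proof.
rewrite /K grad_F linearB (lZ (Fo j)) -addrA; congr (_ + _).
rewrite -opprD -[X in - (X + _)]scale1r -scalerDl; congr (- (_ *: _)).
by rewrite -natr1; ring.
Qed.

Definition Ks (s : seq nat) u := foldr K u s.
Lemma Ks_lin s a u w : Ks s (a *: u + w) = a *: Ks s u + Ks s w.
Proof. by elim: s => //= l s ->; rewrite K_lin. Qed.
Lemma Ks0 s : Ks s 0 = 0.
Proof. by elim: s => //= l s ->; rewrite K0. Qed.
Lemma Ks_K l s u : Ks s (K l u) = K l (Ks s u).
Proof. by elim: s => //= k s ->; rewrite K_comm. Qed.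
Lemma Ks_comm s t u : Ks s (Ks t u) = Ks t (Ks s u).
Proof. by elim: t => //= l t IH; rewrite Ks_K IH. Qed.
Lemma Ks_v s : Ks s v = (\prod_(l <- s) l%:R) *: v.
Proof.
elim: s => [|l s IH] /=; first by rewrite big_nil scale1r.
have := K_lin l (\prod_(l <- s) l%:R) v 0; rewrite !addr0 K0 addr0 IH => ->.
by rewrite K_v scalerA big_cons mulrC.
Qed.
Lemma Ks_F s j u : Ks (map S s) (Fo j u) = Fo j (Ks s u).
Proof. by elim: s => //= l s ->; rewrite K_F. Qed.

(** Having no component on the level of [v], expressed by an annihilating product of operators K_l
    with l > 0. No diagonalizability of the grading is presupposed. *)
Definition low u := exists2 s : seq nat, 0%N \notin s & Ks s u = 0.

Lemma low_lin : linP low.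
Proof.
split; first by exists [::].
move=> a u w [s s0 su] [t t0 tw]; exists (s ++ t); first by rewrite mem_cat negb_or s0.
have Z q c x : Ks q (c *: x) = c *: Ks q x by rewrite -[c *: x]addr0 Ks_lin Ks0 addr0.
by rewrite /Ks foldr_cat -/(Ks t _) -/(Ks s _) Ks_lin tw addr0 Z Ks_comm su Ks0 scaler0.
Qed.
Lemma low_v a : low (a *: v) -> a = 0.
Proof.
move=> [s s0]; rewrite -[_ *: v]addr0 Ks_lin Ks0 addr0 Ks_v scalerA => /eqP.
rewrite scaler_eq0 (negPf v0) orbF mulf_eq0 => /orP [/eqP //|].
rewrite prodf_seq_eq0 => /hasP [l ls]; rewrite /= pnatr_eq0 => /eqP l0.
by move: s0; rewrite -l0 ls.
Qed.
Lemma low_F j a u : low u -> low (Fo j (a *: v + u)).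
Proof.
move=> [s s0 su]; exists (map S (0%N :: s)).
 by rewrite /= in_cons /=; apply/mapP => -[].
rewrite Ks_F /= Ks_lin su addr0 Ks_v.
by rewrite -[X in K _ X]addr0 K_lin K0 addr0 -[X in K _ X]addr0 K_lin K0 addr0 K_v scale0r !scaler0 linear0.
Qed.
Lemma low_Fs j u : low u -> low (Fo j u).
Proof. by move=> lu; rewrite -[u]add0r -(scale0r v); exact: low_F. Qed.
Lemma low_grad_stable (A : {linear V -> V}) : (forall u, grad (A u) = A (grad u)) -> forall u, low u -> low (A u).
Proof.
move=> GA u [s s0 su]; exists s => //.
have KA l w : K l (A w) = A (K l w) by rewrite /K GA linearB (lZ A).
have : Ks s (A u) = A (Ks s u) by elim: (s) => //= l s' ->; rewrite KA.
by rewrite su linear0.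
Qed.

Inductive gen (P : V -> Prop) : V -> Prop :=
| gen_v u : P u -> gen P u
| gen_0 : gen P 0
| gen_lin a u w : gen P u -> gen P w -> gen P (a *: u + w)
| gen_F j u : gen P u -> gen P (Fo j u).

Lemma gen_linP P : linP (gen P). Proof. by split; [exact: gen_0|exact: gen_lin]. Qed.

Lemma gen_min (P U : V -> Prop) : linP U -> (forall j u, U u -> U (Fo j u)) -> (forall u, P u -> U u) ->
 forall u, gen P u -> U u.
Proof. by move=> [U0 UL] UF PU u; elim=> //; [move=> *; exact: UL|move=> *; exact: UF]. Qed.

Section GenP.
Variable P : V -> Prop.
Hypotheses (PH : forall i u, P u -> gen P (H i u)) (PE : forall i u, P u -> E i u = 0).

Lemma gen_H i u : gen P u -> gen P (H i u).
Proof.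
elim=> [w Pw||a u' w _ h _ h'|j u' gu IH].
- exact: PH.
- by rewrite linear0; exact: gen_0.
- by rewrite linearP; exact: gen_lin.
- by rewrite HF -scaleNr addrC; apply: gen_lin; exact: gen_F.
Qed.

Lemma gen_E i u : gen P u -> gen P (E i u).
Proof.
elim=> [w Pw||a u' w _ h _ h'|j u' gu IH].
- by rewrite PE //; exact: gen_0.
- by rewrite linear0; exact: gen_0.
- by rewrite linearP; exact: gen_lin.
- rewrite EF; apply: linP_D; [exact: gen_linP|exact: gen_F|].
 by case: ifP => _; [exact: gen_H|exact: gen_0].
Qed.

Lemma irr_genP : irrP -> (exists2 u, P u & u != 0) -> forall u, gen P u.
Proof.
move=> irr [u Pu u0]; apply: irr; [exact: gen_linP|by move=> j w; exact: gen_E|by move=> j w; exact: gen_F|].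
by exists u => //; exact: gen_v.
Qed.
End GenP.

Notation genv := (gen (fun u => u = v)).

Lemma irr_gen : irrP -> forall u, genv u.
Proof.
move=> irr; apply: irr_genP => //; last by exists v.
 by move=> i u ->; rewrite Hv; apply: linP_Z; [exact: gen_linP|exact: gen_v].
by move=> i u ->.
Qed.

Lemma gen_split u : genv u -> exists a u', u = a *: v + u' /\ low u'.
Proof.
have [l0 lL] := low_lin.
elim=> [w ->||a u1 w _ [b [u1' [-> h1]]] _ [c [w' [-> h2]]]|j u1 _ [b [u1' [-> h1]]]].
- by exists 1, 0; rewrite scale1r addr0.
- by exists 0, 0; rewrite scale0r addr0.
- exists (a * b + c), (a *: u1' + w'); split; last exact: lL.
 by rewrite scalerDr scalerA scalerDl addrACA.
- by exists 0, (Fo j (b *: v + u1')); rewrite scale0r add0r; split=> //; exact: low_F.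
Qed.

Hypothesis HH : forall i j u, H i (H j u) = H j (H i u).

(** Up to a multiple of [v], a primitive vector is low. Low primitive vectors, if not all zero,
    would generate the irreducible module by lowering operators, which keep vectors low, and then
    [v] itself would be low. *)
Lemma prim_uniq : irrP -> (forall i j u, H i (E j u) = E j (H i u) + cm i j *: E j u) ->
 forall u, (forall i, E i u = 0) -> exists a, u = a *: v.
Proof.
move=> irr HE u Eu.
have [a [u' [uE lu']]] := gen_split (irr_gen irr u).
suff u'0 : u' = 0 by exists a; rewrite uE u'0 addr0.
apply/eqP/negPn/negP => u'n0.
have Eu' i : E i u' = 0.
 have := Eu i; rewrite uE linearP Ev scaler0 add0r => -> //.
pose P w := low w /\ forall i, E i w = 0.
have PH i w : P w -> P (H i w).
 move=> [lw Ew]; split; last first.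
  by move=> j; have := HE i j w; rewrite Ew linear0 scaler0 addr0 => <-.
 apply: low_grad_stable lw => x; rewrite /grad linear_sum; apply: eq_bigr => k _.
 by rewrite lZ HH.
have lv : low v.
 apply: (gen_min low_lin low_Fs) (irr_genP (P := P) _ _ irr _ v).
 - by move=> w [].
 - by move=> i w Pw; apply: gen_v; exact: PH.
 - by move=> i w [].
 - by exists u'.
have := @low_v 1; rewrite scale1r => /(_ lv) /eqP; by rewrite oner_eq0.
Qed.

End HighestWeight.

Import VectorInternalTheory.

Lemma annih_mx (F : numClosedFieldType) n (A : 'M[F]_n) : exists s : seq F, \prod_(x <- s) (A - x%:M) = 0.
Proof.
case: n A => [A|n A]; first by exists [::]; exact: mx_n0.
have [s Hs] := closed_field_poly_normal (char_poly A); exists s.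
rewrite (monicP (char_poly_monic A)) scale1r in Hs.
have := Cayley_Hamilton A; rewrite Hs rmorph_prod /= => <-.
by apply: eq_bigr => x _; rewrite rmorphB /= horner_mx_X horner_mx_C.
Qed.

Section Eig.
Variables (F : numClosedFieldType).

Definition fac (V : lmodType F) (f : V -> V) s u := foldr (fun x u => f u - x *: u) u s.

Lemma annih (V : vectType F) (f : {linear V -> V}) : exists s, forall u, fac f s u = 0.
Proof.
pose g : 'rV[F]_(dim V) -> 'rV[F]_(dim V) := v2r \o f \o r2v.
have gl : linear g by move=> a u w; rewrite /g /= !linearP.
pose gL := GRing.isLinear.Build _ _ _ _ _ gl.
pose gg : {linear 'rV[F]_(dim V) -> 'rV[F]_(dim V)} := HB.pack g gL.
pose A := lin1_mx gg.
have AE u : v2r (f u) = v2r u *m A by rewrite mul_rV_lin1 /= /g /= v2rK.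
have [s0 Hs] := annih_mx A; exists (rev s0) => u; apply: (can_inj v2rK); rewrite linear0.
have H s : v2r (fac f (rev s) u) = v2r u *m \prod_(x <- s) (A - x%:M).
 elim/last_ind: s => [|s x IH]; first by rewrite big_nil mulmx1.
 rewrite rev_rcons /= linearB linearZ /= AE IH -cats1 big_cat big_seq1 /=.
 by rewrite mxM !mulmxBr mul_mx_scalar -scalemxAr mulmxA.
by rewrite H Hs mulmx0.
Qed.

Lemma eig_in (V : lmodType F) (f : {linear V -> V}) s (U : V -> Prop) : linP U -> (forall u, U u -> U (f u)) ->
 (forall u, fac f s u = 0) -> (exists2 u, U u & u != 0) -> exists x u, [/\ U u, u != 0 & f u = x *: u].
Proof.
move=> lU fU + [u Uu u0]; move/(_ u).
elim: s => [|x s IH] /=; first by move=> u00; rewrite u00 eqxx in u0.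
have [E0|w0] := eqVneq (fac f s u) 0; first by move=> _; exact: IH E0.
move=> /eqP; rewrite subr_eq0 => /eqP E; exists x, (fac f s u); split=> //.
have UB a w : U w -> U (f w - a *: w).
 by move=> Uw; rewrite addrC -scaleNr; case: (lU) => _; apply=> //; exact: fU.
by elim: (s) => //= y s' IH'; exact: UB.
Qed.

Lemma eigs_in (V : lmodType F) (J : eqType) (f : J -> {linear V -> V}) (js : seq J) (U : V -> Prop) : linP U ->
 (forall j u, U u -> U (f j u)) -> (forall j, exists s, forall u, fac (f j) s u = 0) ->
 (forall i j u, f i (f j u) = f j (f i u)) -> (exists2 u, U u & u != 0) ->
 exists m u, [/\ U u, u != 0 & forall j, j \in js -> f j u = m j *: u].
Proof.
move=> lU fU an cm ex; elim: js => [|j js [m [u0 [Uu0 u00 H]]]].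
 by case: ex => u Uu u0; exists (fun=> 0), u.
pose U' w := U w /\ forall j, j \in js -> f j w = m j *: w.
have [s Hs] := an j.
have [||//||x [u [[Uu Hu] u0' E]]] := @eig_in V (f j) s U'.
- split; first by split=> [|k _]; [case: lU|rewrite linear0 scaler0].
 move=> a w1 w2 [U1 H1] [U2 H2]; split; first by case: lU => _; apply.
 by move=> k kj; rewrite linearP H1 // H2 // scalerDr !scalerA mulrC.
- move=> w [Uw Hw]; split; first exact: fU.
 by move=> k kj; rewrite cm Hw // lZ.
- by exists u0.
exists (fun k => if k == j then x else m k), u; split=> // k; rewrite inE.
by have [->//|kj] := eqVneq k j; move=> /= /Hu.
Qed.
End Eig.

Section Prim.
Variables (F : numClosedFieldType) (J : finType) (V : lmodType F)
 (E H : J -> {linear V -> V}) (cm : J -> J -> F) (r : J -> F).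
Hypotheses (HE : forall i j u, H i (E j u) = E j (H i u) + cm i j *: E j u) (rc : forall j, \sum_i r i * cm i j = 1).

(** Raising operators increase eigenvalues of the grading by 1, and these are finitely many since a
    polynomial annihilates the grading; so the climb ends at a vector killed by all of them. *)
Lemma exists_prim (U : V -> Prop) : linP U -> (forall j u, U u -> U (E j u)) -> (forall j u, U u -> U (H j u)) ->
 (exists s, forall u, fac (grad H r) s u = 0) -> (exists2 u, U u & u != 0) ->
 exists2 u, U u /\ u != 0 & forall j, E j u = 0.
Proof.
move=> lU UE UH [s Hs] ex.
have gl : linear (grad H r) by move=> a u w; exact: grad_lin.
pose gL := GRing.isLinear.Build _ _ _ _ _ gl.
pose gg : {linear V -> V} := HB.pack (grad H r) gL.
have Ug u : U u -> U (grad H r u).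
 move=> Uu; rewrite /grad; elim/big_rec: _ => [|i x _ Ux]; first by case: lU.
 by case: (lU) => _; apply=> //; exact: UH.
have [x [u0 [Uu0 u00 Eu0]]] := @eig_in F V gg s U lU Ug Hs ex.
apply: contrapT => no.
have climb (m : nat) : exists u, [/\ U u, u != 0 & grad H r u = (x + m%:R) *: u].
 elim: m => [|m [u [Uu un0 Eu]]]; first by exists u0; rewrite addr0.
 have [j Ej] : exists j, E j u != 0.
  apply: contrapT => /forallNP h; apply: no; exists u => // j.
  by apply/eqP/negPn/negP; exact: h.
 exists (E j u); split=> //; first exact: UE.
 rewrite /grad (eq_bigr (fun i => E j (r i *: H i u) + (r i * cm i j) *: E j u)).
  rewrite big_split -linear_sum -/(grad H r u) -scaler_suml rc scale1r Eu lZ /=.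
  by rewrite -natr1 addrA [in RHS]scalerDl scale1r.
 by move=> i _; rewrite HE scalerDr scalerA lZ.
have ins (m : nat) : x + m%:R \in s.
 have [u [Uu un0 Eu]] := climb m; have := Hs u.
 have -> : fac (grad H r) s u = (\prod_(y <- s) (x + m%:R - y)) *: u.
  elim: (s) => [|y s' IH] /=; first by rewrite big_nil scale1r.
  rewrite IH -[_ *: u]addr0 grad_lin -/(grad H r 0) Eu big_cons.
  have -> : grad H r 0 = 0 by rewrite /grad big1 // => i _; rewrite linear0 scaler0.
  by rewrite !addr0 !scalerA -scalerBl; congr (_ *: _); ring.
 move/eqP; rewrite scaler_eq0 (negPf un0) orbF prodf_seq_eq0 => /hasP [y ys] /=.
 by rewrite subr_eq0 => /eqP ->.
pose t := [seq x + m%:R | m <- iota 0 (size s).+1].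
suff : (size t <= size s)%N by rewrite size_map size_iota ltnn.
apply: uniq_leq_size.
 by rewrite map_inj_uniq ?iota_uniq // => a b /addrI /eqP; rewrite eqr_nat => /eqP.
by move=> _ /mapP [m _ ->]; exact: ins.
Qed.
End Prim.

(** * Embedding an irreducible module by its highest weight vector *)

Section Psi.
Variables (F : numClosedFieldType) (J : finType) (V W : lmodType F)
 (E1 F1 H1 : J -> {linear V -> V}) (E2 F2 H2 : J -> {linear W -> W})
 (cm : J -> J -> F) (r mu : J -> F) (v1 : V) (v2 : W).
Hypotheses (EF1 : forall i j u, E1 i (F1 j u) = F1 j (E1 i u) + (if i == j then H1 i u else 0))
 (HF1 : forall i j u, H1 i (F1 j u) = F1 j (H1 i u) - cm i j *: F1 j u)
 (EF2 : forall i j u, E2 i (F2 j u) = F2 j (E2 i u) + (if i == j then H2 i u else 0))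
 (HF2 : forall i j u, H2 i (F2 j u) = F2 j (H2 i u) - cm i j *: F2 j u) (rc : forall j, \sum_i r i * cm i j = 1)
 (v10 : v1 != 0) (v20 : v2 != 0) (Ev1 : forall i, E1 i v1 = 0) (Hv1 : forall i, H1 i v1 = mu i *: v1)
 (Ev2 : forall i, E2 i v2 = 0) (Hv2 : forall i, H2 i v2 = mu i *: v2) (irr : irrP E1 F1).
Variables (form : W -> W -> F) (s s' : J -> F).
Hypotheses (fl : forall a u u' w, form (a *: u + u') w = a * form u w + form u' w)
 (fr : forall a u u' w, form w (a *: u + u') = a^* * form w u + form w u') (fpos : forall u, form u u = 0 -> u = 0)
 (fF : forall j u w, form u (F2 j w) = s j * form (E2 j u) w)
 (fF' : forall j u w, form (F2 j u) w = s' j * form u (E2 j w)).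

Lemma form0l w : form 0 w = 0.
Proof. by have := fl (-1) 0 0 w; rewrite scaler0 addr0 mulN1r addNr. Qed.
Lemma form0r w : form w 0 = 0.
Proof. by have := fr (-1) 0 0 w; rewrite scaler0 addr0 rmorphN1 mulN1r addNr. Qed.

(** The graph of the desired homomorphism, generated from the pair of highest weight vectors by
    lowering operators only. *)
Inductive Rel : V -> W -> Prop :=
| Rel_v : Rel v1 v2
| Rel_0 : Rel 0 0
| Rel_lin a u w u' w' : Rel u w -> Rel u' w' -> Rel (a *: u + u') (a *: w + w')
| Rel_F j u w : Rel u w -> Rel (F1 j u) (F2 j w).

Lemma Rel_D u w u' w' : Rel u w -> Rel u' w' -> Rel (u + u') (w + w').
Proof. by move=> h h'; rewrite -[u]scale1r -[w]scale1r; exact: Rel_lin. Qed.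

Lemma Rel_H i u w : Rel u w -> Rel (H1 i u) (H2 i w).
Proof.
elim=> [||a x y x' y' _ h _ h'|j x y h IH].
- rewrite Hv1 Hv2 -[_ *: v1]addr0 -[_ *: v2]addr0; apply: Rel_lin; [exact: Rel_v|exact: Rel_0].
- rewrite !linear0; exact: Rel_0.
- by rewrite !linearP; exact: Rel_lin.
- rewrite HF1 HF2 -!scaleNr ![_ + - _ *: _]addrC; apply: Rel_lin; exact: Rel_F.
Qed.

Lemma Rel_E i u w : Rel u w -> Rel (E1 i u) (E2 i w).
Proof.
elim=> [||a x y x' y' _ h _ h'|j x y h IH].
- rewrite Ev1 Ev2; exact: Rel_0.
- rewrite !linear0; exact: Rel_0.
- by rewrite !linearP; exact: Rel_lin.
- rewrite EF1 EF2; apply: Rel_D; first exact: Rel_F.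
 by case: ifP => _; [exact: Rel_H|exact: Rel_0].
Qed.

Lemma Rel_split u w : Rel u w -> exists a u', [/\ u = a *: v1 + u', low H1 r mu u' & form w v2 = a * form v2 v2].
Proof.
have [l0 lL] := low_lin H1 r mu.
elim=> [||a x y x' y' _ [b [z [-> lz E]]] _ [c [z' [-> lz' E']]]|j x y h [b [z [-> lz Ey]]]].
- by exists 1, 0; rewrite scale1r addr0 mul1r.
- by exists 0, 0; rewrite scale0r addr0 form0l mul0r.
- exists (a * b + c), (a *: z + z'); split; last by rewrite fl E E'; ring.
  by rewrite scalerDr scalerA scalerDl addrACA.
 exact: lL.
- exists 0, (F1 j (b *: v1 + z)); rewrite scale0r add0r; split=> //.
  exact: (low_F HF1 rc Hv1).
 by rewrite fF' Ev2 form0r mulr0 mul0r.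
Qed.

(** Induction on the second pair: lowering operators cross the form as raising operators, and at the
    top the pairing of w with [v2] vanishes because 0 has no component along [v1]. Positivity of the
    form then makes the graph single-valued. *)
Lemma Rel_0w w w0 u0 : Rel u0 w0 -> Rel 0 w -> form w w0 = 0.
Proof.
move=> h; elim: h w => [||a x y x' y' _ IH _ IH'|j x y _ IH] w R0.
- have [a [u' [E lu' ->]]] := Rel_split R0.
 have -> : a = 0; last by rewrite mul0r.
 apply/eqP; rewrite -oppr_eq0; apply/eqP; apply: (low_v v10 Hv1).
 have -> : - a *: v1 = u'.
  by move/eqP: E; rewrite eq_sym addrC addr_eq0 scaleNr => /eqP.
 exact: lu'.
- exact: form0r.
- by rewrite fr IH // IH' // mulr0 addr0.
- by rewrite fF IH ?mulr0 //; have := Rel_E j R0; rewrite linear0.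
Qed.

Lemma Rel_inj2 w : Rel 0 w -> w = 0.
Proof. by move=> R0; apply: fpos; exact: (Rel_0w R0). Qed.

Lemma Rel_total u : exists w, Rel u w.
Proof.
apply: (irr (U := fun u => exists w, Rel u w)).
- split; first by exists 0; exact: Rel_0.
 by move=> a x x' [w h] [w' h']; exists (a *: w + w'); exact: Rel_lin.
- by move=> j x [w h]; exists (E2 j w); exact: Rel_E.
- by move=> j x [w h]; exists (F2 j w); exact: Rel_F.
- by exists v1 => //; exists v2; exact: Rel_v.
Qed.

Lemma Rel_fun u w w' : Rel u w -> Rel u w' -> w = w'.
Proof.
move=> h h'; apply/eqP; rewrite -subr_eq0; apply/eqP; apply: Rel_inj2.
have := Rel_lin (-1) h' h; by rewrite !scaleN1r addNr addrC.
Qed.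

Lemma Rel_inj1 u : Rel u 0 -> u = 0.
Proof.
move=> R0; apply: contrapT => u0.
have all : forall x, Rel x 0.
 apply: (irr (U := fun x => Rel x 0)).
 - split; first exact: Rel_0.
  by move=> a x x' h h'; have := Rel_lin a h h'; rewrite scaler0 addr0.
 - by move=> j x h; have := Rel_E j h; rewrite linear0.
 - by move=> j x h; have := Rel_F j h; rewrite linear0.
 - by exists u => //; apply/eqP.
by have /eqP := Rel_fun Rel_v (all v1); rewrite (negPf v20).
Qed.

Lemma psi_exists : exists psi : {linear V -> W},
 [/\ psi v1 = v2, forall u, psi u = 0 -> u = 0,
   forall j u, psi (E1 j u) = E2 j (psi u), forall j u, psi (F1 j u) = F2 j (psi u) &
   forall P : W -> Prop, linP P -> P v2 -> (forall j w, P w -> P (F2 j w)) -> forall u, P (psi u)].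
Proof.
pose f u := projT1 (cid (Rel_total u)).
have fR u : Rel u (f u) := projT2 (cid (Rel_total u)).
have gl : linear f by move=> a u w; apply: Rel_fun (fR _) _; exact: Rel_lin.
pose gL := GRing.isLinear.Build _ _ _ _ _ gl.
pose gg : {linear V -> W} := HB.pack f gL.
exists gg; split=> /=.
- exact: Rel_fun (fR _) Rel_v.
- by move=> u E; apply: Rel_inj1; rewrite -E; exact: fR.
- by move=> j u; apply: Rel_fun (fR _) _; exact: Rel_E.
- by move=> j u; apply: Rel_fun (fR _) _; exact: Rel_F.
- move=> P [P0 PL] Pv PF u; have := fR u; elim=> //; first by move=> *; exact: PL.
 by move=> *; exact: PF.
Qed.
End Psi.

(** * Outer tensor products *)

Section Tens.
Variables (F : numClosedFieldType) (dA dB : nat).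

(** The tensor product is modelled on matrices of size dA by dB, the pure tensor of v and w being v
    w^T; this is the action of X on the first factor plus Y on the second. *)
Definition tensf (X : 'M[F]_dA) (Y : 'M[F]_dB) (u : 'M[F]_(dA, dB)) := X *m u + u *m Y^T.
Lemma tensf_linear X Y : linear (tensf X Y).
Proof.
move=> a u w; rewrite /tensf mulmxDr mulmxDl -scalemxAr -scalemxAl scalerDr.
by rewrite addrACA.
Qed.
HB.instance Definition _ X Y := GRing.isLinear.Build _ _ _ _ _ (tensf_linear X Y).
Definition tens X Y : {linear 'M[F]_(dA, dB) -> 'M[F]_(dA, dB)} := tensf X Y.
Lemma tensE X Y u : tens X Y u = X *m u + u *m Y^T. Proof. by []. Qed.

Lemma tens_comm X Y X' Y' u : tens X Y (tens X' Y' u) = tens X' Y' (tens X Y u) + tens (brk X X') (brk Y Y') u.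
Proof.
have trB : (brk Y Y')^T = Y'^T *m Y^T - Y^T *m Y'^T by rewrite /brk linearB /= !trmx_mul.
rewrite !tensE trB /brk (mulmxDr X) (mulmxDr X') !(mulmxDl (_ *m u)) !mulmxBl mulmxBr !mulmxA.
move: (X *m X' *m u) (X' *m X *m u) (X *m u *m Y'^T) (X' *m u *m Y^T) (u *m Y'^T *m Y^T) (u *m Y^T *m Y'^T) => a b c d e g.
by apply/matrixP => i j; rewrite !mxE; ring.
Qed.
End Tens.

Section TensIrr.
Variables (F : numClosedFieldType) (J : finType) (dA dB : nat) (b : pred J)
 (EA FA HA : J -> 'M[F]_dA) (EB FB HB : J -> 'M[F]_dB)
 (cm : J -> J -> F) (r muA muB : J -> F) (vA : 'cV[F]_dA) (vB : 'cV[F]_dB).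
Definition mop d (X : J -> 'M[F]_d) j : {linear 'cV[F]_d -> 'cV[F]_d} := mulmx (X j).
Hypotheses (zA : forall j, b j -> [/\ EA j = 0, FA j = 0 & HA j = 0])
 (zB : forall j, ~~ b j -> [/\ EB j = 0, FB j = 0 & HB j = 0])
 (efA : forall i j, brk (EA i) (FA j) = if i == j then HA i else 0)
 (hfA : forall i j, brk (HA i) (FA j) = - cm i j *: FA j) (heA : forall i j, brk (HA i) (EA j) = cm i j *: EA j)
 (hhA : forall i j, brk (HA i) (HA j) = 0) (efB : forall i j, brk (EB i) (FB j) = if i == j then HB i else 0)
 (hfB : forall i j, brk (HB i) (FB j) = - cm i j *: FB j) (heB : forall i j, brk (HB i) (EB j) = cm i j *: EB j)
 (hhB : forall i j, brk (HB i) (HB j) = 0) (rc : forall j, \sum_i r i * cm i j = 1) (vA0 : vA != 0) (vB0 : vB != 0)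
 (EvA : forall j, EA j *m vA = 0) (EvB : forall j, EB j *m vB = 0) (HvA : forall j, HA j *m vA = muA j *: vA)
 (HvB : forall j, HB j *m vB = muB j *: vB) (irrA : irrP (mop EA) (mop FA)) (irrB : irrP (mop EB) (mop FB)).

Definition top_ (X : J -> 'M[F]_dA) (Y : J -> 'M[F]_dB) j := tens (X j) (Y j).
Notation E := (top_ EA EB).
Notation Fo := (top_ FA FB).
Notation H := (top_ HA HB).

Lemma tens00 u : tens (0 : 'M[F]_dA) (0 : 'M[F]_dB) u = 0.
Proof. by rewrite tensE mul0mx trmx0 mulmx0 addr0. Qed.
Lemma tensZ a X Y (u : 'M[F]_(dA, dB)) : tens (a *: X) (a *: Y) u = a *: tens X Y u.
Proof. by rewrite !tensE linearZ /= -scalemxAl -scalemxAr scalerDr. Qed.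
Lemma tEF i j u : E i (Fo j u) = Fo j (E i u) + (if i == j then H i u else 0).
Proof. by rewrite /top_ tens_comm efA efB; congr (_ + _); case: ifP; rewrite ?tens00. Qed.
Lemma tHF i j u : H i (Fo j u) = Fo j (H i u) - cm i j *: Fo j u.
Proof. by rewrite /top_ tens_comm hfA hfB tensZ scaleNr. Qed.
Lemma tHE i j u : H i (E j u) = E j (H i u) + cm i j *: E j u.
Proof. by rewrite /top_ tens_comm heA heB tensZ. Qed.

Lemma mEF d (e f h : J -> 'M[F]_d) : (forall i j, brk (e i) (f j) = if i == j then h i else 0) ->
 forall i j u, mop e i (mop f j u) = mop f j (mop e i u) + (if i == j then mop h i u else 0).
Proof.
move=> ef i j u; rewrite /mop /=; have /eqP := ef i j; rewrite /brk subr_eq => /eqP E1.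
rewrite !mulmxA E1 mulmxDl addrC; congr (_ + _); by case: ifP; rewrite ?mul0mx.
Qed.
Lemma mHF d (h f : J -> 'M[F]_d) : (forall i j, brk (h i) (f j) = - cm i j *: f j) ->
 forall i j u, mop h i (mop f j u) = mop f j (mop h i u) - cm i j *: mop f j u.
Proof.
move=> ef i j u; rewrite /mop /=; have /eqP := ef i j; rewrite /brk subr_eq => /eqP E1.
by rewrite !mulmxA E1 mulmxDl addrC scaleNr mulNmx scalemxAl.
Qed.
Lemma mHE d (h f : J -> 'M[F]_d) : (forall i j, brk (h i) (f j) = cm i j *: f j) ->
 forall i j u, mop h i (mop f j u) = mop f j (mop h i u) + cm i j *: mop f j u.
Proof.
move=> ef i j u; rewrite /mop /=; have /eqP := ef i j; rewrite /brk subr_eq => /eqP E1.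
by rewrite !mulmxA E1 mulmxDl addrC scalemxAl.
Qed.
Lemma mHH d (h : J -> 'M[F]_d) : (forall i j, brk (h i) (h j) = 0) ->
 forall i j u, mop h i (mop h j u) = mop h j (mop h i u).
Proof.
move=> ef i j u; rewrite /mop /=; have /eqP := ef i j; rewrite /brk subr_eq0 => /eqP E1.
by rewrite !mulmxA E1.
Qed.

Lemma primA u : (forall j, EA j *m u = 0) -> exists a, u = a *: vA.
Proof.
exact: (prim_uniq (mEF efA) (mHF hfA) rc vA0 EvA HvA (mHH hhA) irrA (mHE heA)).
Qed.
Lemma primB u : (forall j, EB j *m u = 0) -> exists a, u = a *: vB.
Proof.
exact: (prim_uniq (mEF efB) (mHF hfB) rc vB0 EvB HvB (mHH hhB) irrB (mHE heB)).
Qed.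

Lemma linP_sum (V : lmodType F) (U : V -> Prop) (K : Type) (s : seq K) (f : K -> V) : linP U -> (forall k, U (f k)) -> U (\sum_(k <- s) f k).
Proof.
move=> lU Uf; elim/big_rec: _ => [|k x _ Ux]; first by case: lU.
exact: linP_D.
Qed.

(** A nonzero stable subspace contains a primitive vector. Read as a matrix, its columns are killed
    by the raising operators of the first factor and its rows by those of the second, so uniqueness
    in each factor makes it a multiple of vA vB^T, which generates everything. *)
Lemma tens_irr : irrP E Fo.
Proof.
move=> U lU UE UF ex u.
have UH j w : U w -> U (H j w).
 move=> Uw; have E1 := tEF j j w; rewrite eqxx in E1.
 have -> : H j w = -1 *: Fo j (E j w) + E j (Fo j w) by rewrite E1 scaleN1r addKr.
  case: (lU) => _; apply; first exact/UF/UE.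
 exact/UE/UF.
have [p [Up p0] Ep] : exists2 p, U p /\ p != 0 & forall j, E j p = 0.
 apply: (exists_prim tHE rc lU UE UH _ ex).
 have gl : linear (grad H r) by move=> a x w; exact: grad_lin.
 pose gL := GRing.isLinear.Build _ _ _ _ _ gl.
 pose gg : {linear 'M[F]_(dA, dB) -> 'M[F]_(dA, dB)} := HB.pack (grad H r) gL.
 exact: (annih gg).
have EpA j : EA j *m p = 0.
 have := Ep j; rewrite /top_ tensE; case: (boolP (b j)) => [/zA [-> _ _]|/zB [-> _ _]]; first by rewrite mul0mx.
 by rewrite trmx0 mulmx0 addr0.
have EpB j : p *m (EB j)^T = 0 by have := Ep j; rewrite /top_ tensE EpA add0r.
have [q pE] : exists q : 'rV[F]_dB, p = vA *m q.
 have h k : exists a, col k p = a *: vA by apply: primA => j; rewrite colE mulmxA EpA mul0mx.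
 exists (\row_k projT1 (cid (h k))); apply/matrixP => i k.
 have /matrixP /(_ i 0) := projT2 (cid (h k)); rewrite !mxE => ->.
 by rewrite big_ord1 !mxE mulrC.
have [c qE] : exists c, q^T = c *: vB.
 apply: primB => j; apply: trmx_inj; rewrite trmx_mul trmxK trmx0.
 have := EpB j; rewrite pE -mulmxA => h.
 have [i vi] : exists i, vA i 0 != 0.
  apply: contrapT => hn; case/eqP: vA0; apply/matrixP => i j'; rewrite [RHS]mxE ord1.
  by apply/eqP/negPn/negP => h'; apply: hn; exists i.
 apply/matrixP => i' k; have /matrixP /(_ i k) := h; rewrite mxE big_ord1 [RHS]mxE ord1 => /eqP.
 by rewrite mulf_eq0 (negPf vi) [i']ord1 [RHS]mxE => /eqP.
have c0 : c != 0.
 apply: contraNneq p0 => c0; rewrite pE -[q]trmxK qE c0 scale0r trmx0 mulmx0.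
 by [].
have UvAvB : U (vA *m vB^T).
 have -> : vA *m vB^T = c^-1 *: p.
  by rewrite pE -[q]trmxK qE linearZ /= -scalemxAr scalerA mulVf // scale1r.
 exact: linP_Z.
have l1 (w : 'cV[F]_dB) : linP (fun a : 'cV[F]_dA => U (a *m w^T)).
 split; first by rewrite mul0mx; case: lU.
 by move=> a x y Ux Uy; rewrite mulmxDl -scalemxAl; case: (lU) => _; apply.
have U1 a : U (a *m vB^T).
 apply: (irrA (U := fun a => U (a *m vB^T))) => //.
 - by move=> j x /(UE j); rewrite /top_ tensE -(mulmxA x) -trmx_mul EvB trmx0 mulmx0 addr0 mulmxA.
 - move=> j x /(UF j); rewrite /top_ tensE; case: (boolP (b j)) => [/zA [_ f0 _] _|/zB [_ -> _]].
   by rewrite /mop /= f0 mul0mx mul0mx; case: lU.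
  by rewrite trmx0 mulmx0 addr0 mulmxA.
 - by exists vA.
have U2 (q' : 'cV[F]_dB) (a : 'cV[F]_dA) : U (a *m q'^T).
 move: a; apply: (irrB (U := fun q' => forall a : 'cV[F]_dA, U (a *m q'^T))) => //.
 - split; first by move=> a; rewrite trmx0 mulmx0; case: lU.
  by move=> x y w Uy Uw a; rewrite linearP /= mulmxDr -scalemxAr; case: (lU) => _; apply.
 - move=> j x Ux a; have := UE j _ (Ux a); rewrite /top_ tensE /mop /=.
  case: (boolP (b j)) => [/zA [-> _ _]|/zB [-> _ _] _].
   by rewrite mul0mx add0r -mulmxA -trmx_mul.
  by rewrite mul0mx trmx0 mulmx0; case: lU.
 - move=> j x Ux a; have := UF j _ (Ux a); rewrite /top_ tensE /mop /=.
  case: (boolP (b j)) => [/zA [_ -> _]|/zB [_ -> _] _].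
   by rewrite mul0mx add0r -mulmxA -trmx_mul.
  by rewrite mul0mx trmx0 mulmx0; case: lU.
 - by exists vB.
have -> : u = \sum_k col k u *m (delta_mx k 0 : 'cV[F]_dB)^T.
 rewrite -[LHS]mulmx1 -(mulmx1 u); apply/matrixP => i j; rewrite summxE mulmx1 (bigD1 j) //= big1 => [|k kj].
  by rewrite mulmx1 mxE big_ord1 !mxE !eqxx mulr1 addr0.
 by rewrite mxE big_ord1 !mxE eqxx eq_sym (negPf kj) mulr0.
exact: linP_sum.
Qed.

Lemma tens_vec : [/\ vA *m vB^T != 0, forall j, E j (vA *m vB^T) = 0 &
  forall j, H j (vA *m vB^T) = (muA j + muB j) *: (vA *m vB^T)].
Proof.
split.
- have ex d (x : 'cV[F]_d) : x != 0 -> exists i, x i 0 != 0.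
  move=> x0; apply: contrapT => hn; case/eqP: x0; apply/matrixP => i j'; rewrite [RHS]mxE ord1.
  by apply/eqP/negPn/negP => h'; apply: hn; exists i.
 have [i ai] := ex _ _ vA0; have [j bj] := ex _ _ vB0.
 apply/eqP => /matrixP /(_ i j); rewrite mxE big_ord1 !mxE => /eqP.
 by rewrite mulf_eq0 (negPf ai) (negPf bj).
- by move=> j; rewrite /top_ tensE mulmxA EvA mul0mx -mulmxA -trmx_mul EvB trmx0 mulmx0 addr0.
- move=> j; rewrite /top_ tensE mulmxA HvA -mulmxA -trmx_mul HvB linearZ /=.
 by rewrite -scalemxAl -scalemxAr -scalerDl.
Qed.
End TensIrr.

(** * Derivations of the polynomial ring and the Fischer form *)

Section PolyRep.
Variables (F : numClosedFieldType) (N : nat).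
Notation P := {mpoly F[N]}.
Implicit Types (A B : 'M[F]_N) (p q : P) (y : 'cV[F]_N).

Definition lf y : P := \sum_a y a 0 *: 'X_a.
(** The derivation extending the action y -> A y on linear forms, so that powers of linear forms
    move with the points of the cone. *)
Definition Df A p : P := \sum_b lf (col b A) * p^`M(b).

Lemma lf_lin a y y' : lf (a *: y + y') = a *: lf y + lf y'.
Proof.
rewrite /lf scaler_sumr -big_split; apply: eq_bigr => i _ /=.
by rewrite !mxE scalerDl scalerA.
Qed.
Lemma lf0 : lf 0 = 0.
Proof. by rewrite /lf big1 // => i _; rewrite mxE scale0r. Qed.
Lemma lfZ a y : lf (a *: y) = a *: lf y.
Proof. by rewrite -[a *: y]addr0 lf_lin lf0 addr0. Qed.
Lemma lfD y y' : lf (y + y') = lf y + lf y'.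
Proof. by rewrite -[y]scale1r lf_lin !scale1r. Qed.
Lemma lf_sum (I : Type) (s : seq I) (f : I -> 'cV[F]_N) : lf (\sum_(i <- s) f i) = \sum_(i <- s) lf (f i).
Proof. by elim/big_rec2: _ => [|i x z _ <-]; rewrite ?lf0 ?lfD. Qed.
Lemma lf_delta a : lf (delta_mx a 0) = 'X_a.
Proof.
rewrite /lf (bigD1 a) //= mxE !eqxx scale1r big1 ?addr0 // => i /negPf ia.
by rewrite mxE ia scale0r.
Qed.

Lemma Df_linear A : linear (Df A).
Proof.
move=> a u w; rewrite /Df scaler_sumr -big_split; apply: eq_bigr => b _ /=.
by rewrite mderivD mderivZ mulrDr scalerAr.
Qed.
HB.instance Definition _ A := GRing.isLinear.Build _ _ _ _ _ (Df_linear A).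
Definition D A : {linear P -> P} := Df A.

Lemma D_lin a A B p : D (a *: A + B) p = a *: D A p + D B p.
Proof.
rewrite /D /= /Df scaler_sumr -big_split; apply: eq_bigr => b _ /=.
by rewrite linearP lf_lin mulrDl scalerAl.
Qed.
Lemma D_0 p : D 0 p = 0.
Proof. by rewrite /D /= /Df big1 // => b _; rewrite col0 lf0 mul0r. Qed.
Lemma D_Z a A p : D (a *: A) p = a *: D A p.
Proof. by rewrite -[a *: A]addr0 D_lin D_0 addr0. Qed.
Lemma DM A p q : D A (p * q) = D A p * q + p * D A q.
Proof.
rewrite /D /= /Df mulr_suml mulr_sumr -big_split; apply: eq_bigr => b _ /=.
by rewrite mderivM; ring.
Qed.
Lemma D1 A : D A 1 = 0.
Proof.
have := DM A 1 1; rewrite !mulr1 mul1r => /eqP; rewrite -subr_eq0 opprD addNKr oppr_eq0.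
by move/eqP.
Qed.
Lemma deriv_lf y b : (lf y)^`M(b) = (y b 0)%:MP.
Proof.
rewrite /lf raddf_sum /= (bigD1 b) //= big1 => [|i ib].
 rewrite mderivZ mderivX mnm1E eqxx scale1r addr0.
 rewrite (_ : (U_(b) - U_(b))%MM = 0%MM) ?mpolyX0 -?mul_mpolyC ?mulr1 //.
 by apply/mnmP => i; rewrite mnmBE mnm0E subnn.
by rewrite mderivZ mderivX mnm1E (negPf ib) scale0r scaler0.
Qed.

Lemma D_lf A y : D A (lf y) = lf (A *m y).
Proof.
rewrite /D /= /Df (eq_bigr (fun b => y b 0 *: lf (col b A))); last first.
 by move=> b _; rewrite deriv_lf mulrC mul_mpolyC.
have -> : A *m y = \sum_b y b 0 *: col b A.
 apply/matrixP => i j; rewrite mxE summxE; apply: eq_bigr => b _.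
 by rewrite !mxE ord1 mulrC.
by rewrite lf_sum; apply: eq_bigr => b _; rewrite lfZ.
Qed.

(** The second-order parts of the two compositions agree; only the first-order parts, given by AB
    and BA, differ. *)
Lemma D_comm A B p : D A (D B p) = D B (D A p) + D (A *m B - B *m A) p.
Proof.
pose S A B := \sum_b \sum_d lf (col b A) * lf (col d B) * p^`M(d)^`M(b).
have H X Y : D X (D Y p) = D (X *m Y) p + S X Y.
 rewrite {1}/D /= {1}/Df /D /= /Df /S.
 rewrite (eq_bigr (fun b => \sum_d (lf (col b X) * (Y b d)%:MP * p^`M(d) + lf (col b X) * lf (col d Y) * p^`M(d)^`M(b)))).
  rewrite (eq_bigr (fun b => \sum_d lf (col b X) * (Y b d)%:MP * p^`M(d) + \sum_d lf (col b X) * lf (col d Y) * p^`M(d)^`M(b))); last first.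
   by move=> b _; rewrite big_split.
  rewrite big_split /=; congr (_ + _); rewrite exchange_big /=; apply: eq_bigr => d _.
  rewrite -mulr_suml; congr (_ * _).
  rewrite (_ : col d (X *m Y) = \sum_b Y b d *: col b X).
   by rewrite lf_sum; apply: eq_bigr => b _; rewrite lfZ mulrC mul_mpolyC.
  apply/matrixP => i j; rewrite !mxE summxE; apply: eq_bigr => b _.
  by rewrite !mxE mulrC.
 move=> b _; rewrite raddf_sum mulr_sumr; apply: eq_bigr => d _ /=.
 by rewrite mderivM deriv_lf mxE; ring.
have SS : S A B = S B A.
 rewrite /S exchange_big; apply: eq_bigr => d _; apply: eq_bigr => b _.
 by rewrite mderiv_comm; ring.
have -> : A *m B - B *m A = -1 *: (B *m A) + A *m B by rewrite scaleN1r addrC.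
rewrite !H SS D_lin scaleN1r; move: (D _ p) (D _ p) (S _ _) => x z w.
by rewrite [RHS]addrACA subrr add0r addrC.
Qed.

Lemma D_pow A p k : D A (p ^+ k) = (k%:R : F) *: (p ^+ k.-1 * D A p).
Proof.
elim: k => [|[|k] IH]; first by rewrite expr0 D1 scale0r.
 by rewrite expr1 expr0 mul1r scale1r.
rewrite exprS DM IH /= -scalerAr mulrA -exprS [D A p * _]mulrC -[k.+2%:R]natr1 scalerDl scale1r.
by rewrite addrC.
Qed.

Definition quad (Q : 'M[F]_N) : P := \sum_b lf (col b Q) * 'X_b.
Lemma quadZ a Q : quad (a *: Q) = a *: quad Q.
Proof. by rewrite /quad scaler_sumr; apply: eq_bigr => b _; rewrite linearZ lfZ scalerAl. Qed.
Lemma D_quad A Q : D A (quad Q) = quad (A *m Q + Q *m A^T).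
Proof.
rewrite /quad raddf_sum /= (eq_bigr (fun b => lf (col b (A *m Q)) * 'X_b + lf (col b Q) * lf (col b A))); last first.
 move=> b _; rewrite DM D_lf; congr (_ * _ + _ * _); first by rewrite !colE mulmxA.
 by rewrite -lf_delta D_lf colE.
rewrite [RHS](eq_bigr (fun b => lf (col b (A *m Q)) * 'X_b + lf (col b (Q *m A^T)) * 'X_b)); last first.
 by move=> b _; rewrite linearD lfD mulrDl.
rewrite !big_split /=; congr (_ + _).
rewrite (eq_bigr (fun b => \sum_a A a b *: (lf (col b Q) * 'X_a))); last first.
 by move=> b _; rewrite [lf (col b A)]/lf mulr_sumr; apply: eq_bigr => a _; rewrite mxE scalerAr.
rewrite exchange_big /=; apply: eq_bigr => a _.
rewrite (_ : col a (Q *m A^T) = \sum_b A a b *: col b Q).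
 by rewrite lf_sum mulr_suml; apply: eq_bigr => b _; rewrite lfZ scalerAl.
by apply/matrixP => i j; rewrite !mxE summxE; apply: eq_bigr => b _; rewrite !mxE mulrC.
Qed.

(* If A^2 y = 0 then (y + Ay)^k = exp(A) y^k. *)
Lemma exp_pow (R : P -> Prop) A y k : linP R -> (forall p, R p -> R (D A p)) -> A *m (A *m y) = 0 ->
 R (lf y ^+ k) -> R (lf (y + A *m y) ^+ k).
Proof.
move=> lR RD AA Ry; rewrite lfD.
have H j : (j <= k)%N -> R (lf y ^+ (k - j) * lf (A *m y) ^+ j).
 elim: j => [|j IH] jk; first by rewrite subn0 expr0 mulr1.
 have := RD _ (IH (ltnW jk)); rewrite DM !D_pow !D_lf AA lf0 mulr0 scaler0 mulr0 addr0 => h.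
 have kj : ((k - j)%:R : F) != 0 by rewrite pnatr_eq0 subn_eq0 -ltnNge.
 have := linP_Z ((k - j)%:R)^-1 lR h.
 rewrite -!scalerAl scalerA mulVf // scale1r -mulrA -exprS subnS.
 by [].
rewrite exprDn; apply: linP_sum => // -[j jk] /=; rewrite -scaler_nat; apply: linP_Z => //.
exact: H.
Qed.

Definition fct (m : 'X_{1..N}) : F := \prod_i ((m i)`!)%:R.
(** The Fischer inner product: thanks to the factorials, multiplication by a variable is adjoint to
    the partial derivative, and pairing a form of degree k with l^k evaluates it at l, up to k! and
    conjugations. *)
Definition form p q : F := \sum_(m <- msupp p) fct m * p@_m * (q@_m)^*.

Lemma form_sup s p q : uniq s -> {subset msupp p <= s} -> form p q = \sum_(m <- s) fct m * p@_m * (q@_m)^*.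
Proof.
move=> us ps; rewrite /form [RHS](bigID (mem (msupp p))) /= [X in _ + X]big1 ?addr0; last first.
 by move=> m; rewrite mcoeff_msupp negbK => /eqP ->; rewrite mulr0 mul0r.
rewrite -[RHS]big_filter; apply: perm_big; apply: uniq_perm; [exact: msupp_uniq|exact: filter_uniq|].
by move=> m; rewrite mem_filter /=; case: (boolP (m \in msupp p)) => // /ps ->.
Qed.

Lemma form_l a p p' q : form (a *: p + p') q = a * form p q + form p' q.
Proof.
pose s := undup (msupp p ++ msupp p' ++ msupp (a *: p + p')).
have us : uniq s := undup_uniq _.
rewrite !(form_sup (s := s)) // => [||m|m]; try by move=> hm; rewrite mem_undup !mem_cat hm ?orbT.
rewrite mulr_sumr -big_split; apply: eq_bigr => m _ /=.
by rewrite mcoeffD mcoeffZ; ring.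
all: by move=> m hm; rewrite mem_undup !mem_cat hm ?orbT.
Qed.

Lemma form_r a p p' q : form q (a *: p + p') = a^* * form q p + form q p'.
Proof.
rewrite /form mulr_sumr -big_split; apply: eq_bigr => m _ /=.
by rewrite mcoeffD mcoeffZ rmorphD rmorphM /=; ring.
Qed.

Lemma fct_gt0 m : 0 < fct m.
Proof. by apply: prodr_gt0 => i _; rewrite ltr0n fact_gt0. Qed.

Lemma form_pos p : form p p = 0 -> p = 0.
Proof.
move=> /eqP; rewrite /form psumr_eq0; last first.
 by move=> m _; rewrite -mulrA; apply: mulr_ge0; [exact: ltW (fct_gt0 m)|exact: mul_conjC_ge0].
move=> /allP H; apply/mpolyP => m; rewrite mcoeff0; apply: contrapT => /eqP pm.
have /H /= : m \in msupp p by rewrite mcoeff_msupp.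
by rewrite -mulrA mulf_eq0 mul_conjC_eq0 (negPf pm) gt_eqF ?fct_gt0.
Qed.

Lemma fct_conj m : (fct m)^* = fct m.
Proof. by rewrite /fct rmorph_prod; apply: eq_bigr => i _; rewrite rmorph_nat. Qed.

Lemma form_sym p q : form q p = (form p q)^*.
Proof.
pose s := undup (msupp p ++ msupp q).
have us : uniq s := undup_uniq _.
have sp : {subset msupp p <= s} by move=> m hm; rewrite mem_undup mem_cat hm.
have sq : {subset msupp q <= s} by move=> m hm; rewrite mem_undup mem_cat hm orbT.
rewrite (form_sup _ us sq) (form_sup _ us sp) rmorph_sum; apply: eq_bigr => m _.
by rewrite !rmorphM /= fct_conj conjCK; ring.
Qed.

Lemma fct_U m b : fct (m + U_(b))%MM = fct m * (m b).+1%:R.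
Proof.
rewrite /fct (bigD1 b) //= [in RHS](bigD1 b) //= mnmDE mnm1E eqxx addn1 factS natrM.
rewrite (eq_bigr (fun i => ((m i)`!)%:R)); first by ring.
by move=> i ib; rewrite mnmDE mnm1E eq_sym (negPf ib) addn0.
Qed.

Lemma coef_Xq b q m : ('X_b * q)@_m = if (0 < m b)%N then q@_(m - U_(b)) else 0.
Proof.
case: ifP => mb.
 have E : m = (U_(b) + (m - U_(b)))%MM.
  by apply/mnmP => i; rewrite mnmDE mnmBE mnm1E; case: eqVneq => [<-|] /=; lia.
 by rewrite {1}E mulrC mcoeffMX.
apply: memN_msupp_eq0; apply/negP; rewrite mulrC (perm_mem (msuppMX q U_(b))) => /mapP [m' _ E].
by move: mb; rewrite E mnmDE mnm1E eqxx.
Qed.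

(** Monomials of [p] divisible by x_b correspond to those of its derivative by lowering one
    exponent; the factor m_b produced by differentiation is the quotient of the two factorial
    weights. *)
Lemma form_deriv b p q : form (p^`M(b)) q = form p ('X_b * q).
Proof.
pose s := [seq (m - U_(b))%MM | m <- filter (fun m : 'X_{1..N} => (0 < m b)%N) (msupp p)].
have sub (m : 'X_{1..N}) : (0 < m b)%N -> (m - U_(b) + U_(b))%MM = m.
 move=> mb; apply/mnmP => i; rewrite mnmDE mnmBE mnm1E; case: eqVneq => [<-|] /=; lia.
have us : uniq s.
 rewrite map_inj_in_uniq; first by apply: filter_uniq; exact: msupp_uniq.
 move=> m m'; rewrite !mem_filter => /andP [mb _] /andP [mb' _] E.
 by rewrite -(sub m mb) -(sub m' mb') E.
rewrite (form_sup (s := s)) //; last first.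
 move=> m; rewrite mcoeff_msupp mcoeff_deriv => h; apply/mapP; exists (m + U_(b))%MM.
  rewrite mem_filter mnmDE mnm1E eqxx addn1 /= mcoeff_msupp.
  by apply: contraNneq h => ->; rewrite mul0rn.
 by apply/mnmP => i; rewrite mnmBE mnmDE addnK.
rewrite /s big_map big_filter /form [RHS](bigID (fun m : 'X_{1..N} => (0 < m b)%N)) /= [X in _ + X]big1 ?addr0; last first.
 by move=> m /negPf mb; rewrite coef_Xq mb conjC0 mulr0.
apply: eq_bigr => m mb; rewrite coef_Xq mb mcoeff_deriv sub // -[in RHS](sub m mb) fct_U -mulr_natr.
have -> : ((m - U_(b))%MM b).+1 = m b by rewrite mnmBE mnm1E eqxx; lia.
rewrite sub //; ring.
Qed.

Lemma form_X b p q : form ('X_b * p) q = form p (q^`M(b)).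
Proof. by rewrite form_sym -form_deriv -form_sym. Qed.

Lemma form_0l q : form 0 q = 0. Proof. by rewrite /form msupp0 big_nil. Qed.
Lemma form_Zl a p q : form (a *: p) q = a * form p q.
Proof. by rewrite -[_ *: _]addr0 form_l form_0l addr0. Qed.
Lemma form_suml (I : Type) (s : seq I) (f : I -> P) q : form (\sum_(i <- s) f i) q = \sum_(i <- s) form (f i) q.
Proof. by elim: s => [|i s IH]; rewrite ?big_nil ?form_0l // !big_cons -[f i]scale1r form_l mul1r IH scale1r. Qed.
Lemma form_0r q : form q 0 = 0. Proof. by rewrite form_sym form_0l conjC0. Qed.
Lemma form_Zr a p q : form q (a *: p) = a^* * form q p.
Proof. by rewrite -[_ *: _]addr0 form_r form_0r addr0. Qed.
Lemma form_sumr (I : Type) (s : seq I) (f : I -> P) q : form q (\sum_(i <- s) f i) = \sum_(i <- s) form q (f i).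
Proof. by elim: s => [|i s IH]; rewrite ?big_nil ?form_0r // !big_cons -[f i]scale1r form_r conjC1 mul1r IH scale1r. Qed.

Lemma form_D A p q : form (D A p) q = form p (D (map_mx Num.conj A)^T q).
Proof.
have E B r : D B r = \sum_b \sum_a B a b *: ('X_a * r^`M(b)).
 rewrite /D /= /Df; apply: eq_bigr => b _; rewrite /lf mulr_suml; apply: eq_bigr => a _.
 by rewrite mxE scalerAl.
rewrite !E form_suml form_sumr.
transitivity (\sum_b \sum_a form (A a b *: ('X_a * p^`M(b))) q).
 by apply: eq_bigr => b _; rewrite form_suml.
transitivity (\sum_b \sum_a form p ((map_mx Num.conj A)^T a b *: ('X_a * q^`M(b)))); last first.
 by apply: eq_bigr => b _; rewrite form_sumr.
rewrite exchange_big; apply: eq_bigr => b _; apply: eq_bigr => a _.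
by rewrite form_Zl form_Zr form_X form_deriv !mxE conjCK.
Qed.

Lemma coef_diag (h : 'I_N -> F) p m : (D (diag_mx (\row_i h i)) p)@_m = (\sum_i h i * (m i)%:R) * p@_m.
Proof.
rewrite /D /= /Df raddf_sum mulr_suml; apply: eq_bigr => b _ /=.
have -> : lf (col b (diag_mx (\row_i h i))) = h b *: 'X_b.
 rewrite /lf (bigD1 b) //= !mxE eqxx mulr1n big1 ?addr0 // => i ib.
 by rewrite !mxE (negPf ib) mulr0n scale0r.
rewrite -scalerAl mcoeffZ -mulrA; congr (_ * _).
rewrite coef_Xq; case: ifP => mb; last by move/negbT: mb; rewrite lt0n negbK => /eqP ->; rewrite mul0r.
rewrite mcoeff_deriv.
have -> : (m - U_(b) + U_(b))%MM = m.
 by apply/mnmP => i; rewrite mnmDE mnmBE mnm1E; case: eqVneq => [<-|] /=; lia.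
have -> : ((m - U_(b))%MM b).+1 = m b by rewrite mnmBE mnm1E eqxx; lia.
by rewrite mulr_natl.
Qed.

End PolyRep.

(* Row i lists the positions of the entries 1 of e_i in a weight basis of the 27-dimensional
 minuscule representation. *)
Definition posE : seq (seq (nat * nat)) :=
 [:: [:: (0, 1); (10, 12); (13, 15); (16, 17); (18, 19); (20, 21)]; [:: (3, 4); (5, 6); (7, 9); (18, 20); (19, 21); (22, 23)]; [:: (1, 2); (8, 10); (11, 13); (14, 16); (19, 22); (21, 23)]; [:: (2, 3); (6, 8); (9, 11); (16, 18); (17, 19); (23, 24)]; [:: (3, 5); (4, 6); (11, 14); (13, 16); (15, 17); (24, 25)]; [:: (5, 7); (6, 9); (8, 11); (10, 13); (12, 15); (25, 26)]]%N.
(* The 27 quadrics, each a signed sum of five products x_a x_b, that cut out the cone over the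
 highest weight orbit. *)
Definition posQ : seq (seq (nat * nat * bool)) :=
 let m a b c d e f g h i j := [:: (a, b, true); (c, d, false); (e, f, true); (g, h, false); (i, j, true)] in
 [:: m 0 12 1 10 2 8 3 6 4 5; m 0 15 1 13 2 11 3 9 4 7; m 0 17 1 16 2 14 5 9 6 7; m 0 19 1 18 3 14 5 11 7 8;
   m 0 21 1 20 4 14 6 11 8 9; m 0 22 2 18 3 16 5 13 7 10; m 0 23 2 20 4 16 6 13 9 10; m 1 22 2 19 3 17 5 15 7 12;
   m 1 23 2 21 4 17 6 15 9 12; m 0 24 3 20 4 18 8 13 10 11; m 1 24 3 21 4 19 8 15 11 12; m 0 25 5 20 6 18 8 16 10 14;
   m 2 24 3 23 4 22 10 15 12 13; m 1 25 5 21 6 19 8 17 12 14; m 0 26 7 20 9 18 11 16 13 14; m 2 25 5 23 6 22 10 17 12 16;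
   m 1 26 7 21 9 19 11 17 14 15; m 3 25 5 24 8 22 10 19 12 18; m 2 26 7 23 9 22 13 17 15 16; m 4 25 6 24 8 23 10 21 12 20;
   m 3 26 7 24 11 22 13 19 15 18; m 4 26 9 24 11 23 13 21 15 20; m 5 26 7 25 14 22 16 19 17 18; m 6 26 9 25 14 23 16 21 17 20;
   m 8 26 11 25 14 24 18 21 19 20; m 10 26 13 25 16 24 18 23 20 22; m 12 26 15 25 17 24 19 23 21 22]%N.
(* Bracket words in the simple lowering operators of A5 x A1, one per negative root. *)
Definition negw : seq (seq nat) := [:: [:: 0]; [:: 0; 1]; [:: 0; 1; 2]; [:: 0; 1; 2; 3]; [:: 0; 1; 2; 3; 4]; [:: 1]; [:: 1; 2]; [:: 1; 2; 3]; [:: 1; 2; 3; 4]; [:: 2]; [:: 2; 3]; [:: 2; 3; 4]; [:: 3]; [:: 3; 4]; [:: 4]; [:: 5]]%N.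
(* Us and Vs certify the identity of [borel_orbit_open]: a vector killed by the differentials
 at y0 of all quadrics lies in the span of the bL b y0. *)
Definition Us : seq (nat * nat * int) := [:: (1, 4, 1%Z); (3, 14, 1%Z); (3, 4, 1%Z); (4, 0, 1%Z); (7, 9, 1%Z); (8, 11, (-1)%Z); (9, 13, 1%Z); (10, 7, 1%Z); (11, 6, 1%Z); (12, 8, (-1)%Z); (13, 10, 1%Z); (14, 5, 1%Z); (16, 18, 1%Z); (17, 3, 1%Z); (18, 16, 1%Z); (19, 2, 1%Z); (20, 1, 1%Z); (21, 20, 1%Z)]%N.
Definition Vs : seq (nat * nat * int) := [:: (12, 0, 1%Z); (22, 5, 1%Z); (15, 1, 1%Z); (17, 2, 1%Z); (19, 3, 1%Z); (23, 6, 1%Z); (24, 9, 1%Z); (25, 11, 1%Z); (26, 14, 1%Z); (21, 4, 1%Z)]%N.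

(** * Integer matrices as lists, for certified computation *)

Definition lm := seq (seq int).
Definition ent (L : lm) (i j : nat) : int := nth 0 (nth [::] L i) j.
Definition mk (f : nat -> nat -> int) : lm := mkseq (fun i => mkseq (f i) 27) 27.
(** The matrices are sparse, so zero coefficients are skipped; the integer operations are named
    directly to keep evaluation by [vm_compute] cheap. *)
Definition rowmul (r : seq int) (B : lm) : seq int :=
 foldr (fun k acc => let a := nth 0 r k in
  match a with Posz 0 => acc
  | _ => let b := nth [::] B k in mkseq (fun j => intZmod.addz (intRing.mulz a (nth 0 b j)) (nth 0 acc j)) 27 end)
  (nseq 27 0) (iota 0 27).
Definition mulL (A B : lm) := mkseq (fun i => rowmul (nth [::] A i) B) 27.
Definition addL (A B : lm) := mk (fun i j => intZmod.addz (ent A i j) (ent B i j)).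
Definition scaL c (A : lm) := mk (fun i j => intRing.mulz c (ent A i j)).
Definition subL (A B : lm) := addL A (scaL (-1) B).
Definition trL (A : lm) := mk (fun i j => ent A j i).
Definition brL A B := subL (mulL A B) (mulL B A).
Definition spm (s : seq (nat * nat * int)) : lm :=
 mk (fun i j => foldr (fun t a => if (t.1.1 == i) && (t.1.2 == j) then intZmod.addz t.2 a else a) 0 s).
Definition zL : lm := mk (fun _ _ => 0).
Definition idL : lm := mk (fun i j => if i == j then 1 else 0).
Definition eqL (A B : lm) : bool := A == B.

Definition eL i := spm [seq (p, 1) | p <- nth [::] posE i].
Definition fL i := trL (eL i).
Definition nestL (Z : nat -> lm) p A := foldl (fun A i => brL (Z i) A) A p.
Definition thL := nestL eL thp (eL 5).
Definition ebL j := if j == 5 then thL else eL (nth 0 [:: 5; 4; 3; 2; 0; 1] j)%N.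
Definition fbL j := trL (ebL j).
Definition hL i := brL (eL i) (fL i).
Definition hbL j := brL (ebL j) (fbL j).
Definition QL l := spm (flatten [seq [:: (t.1.1, t.1.2, if t.2 then 1 else -1); (t.1.2, t.1.1, if t.2 then 1 else -1)] | t <- nth [::] posQ l]).
Fixpoint wL (w : seq nat) : lm :=
 match w with [::] => zL | [:: i] => fbL i | i :: w' => brL (fbL i) (wL w') end.
(* A point of the cone whose orbit under the negative Borel subalgebra of A5 x A1 is open. *)
Definition y0L : lm := spm [:: (0, 0, 1%Z); (4, 0, 1%Z); (14, 0, 1%Z); (21, 0, (-1)%Z)]%N.
Definition dL (i : nat) : lm := spm [:: (i, 0, 1%Z)]%N.
(** A basis of the negative Borel subalgebra of A5 x A1: 6 coroots, then 16 negative root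
    vectors. *)
Definition bL b : lm := if (b < 6)%N then hbL b else wL (nth [::] negw (b - 6)).
(** The quadratic form p2, twice x_4 x_14 - x_6 x_11 + x_8 x_9: a highest weight vector of weight
    lambda_4 for A5 x A1. *)
Definition P2L := spm [:: (4, 14, 1%Z); (14, 4, 1%Z); (6, 11, (-1)%Z); (11, 6, (-1)%Z); (8, 9, 1%Z); (9, 8, 1%Z)]%N.

Definition all6 (P : nat -> bool) := all P (iota 0 6).
Definition Qtab := [seq QL l | l <- iota 0 27].
Definition closedQ (tab : seq lm) X := let X' := trL X in all (fun l =>
  let R := addL (mulL X' (nth [::] tab l)) (mulL (nth [::] tab l) X) in
  eqL R zL || has (fun m => eqL R (nth [::] tab m) || eqL R (scaL (-1) (nth [::] tab m))) (iota 0 27)) (iota 0 27).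
(** The first 22 columns are the vectors bL_b y0, the remaining ones are zero by the default value
    of [nth]; in [KL] the rows are, up to the factor 2, the differentials at y0 of the quadrics. *)
Definition BL : lm := let t := [seq mulL (bL b) y0L | b <- iota 0 22] in mk (fun i c => ent (nth [::] t c) i 0).
Definition KL : lm := let t := [seq mulL (trL y0L) (QL l) | l <- iota 0 27] in mk (fun l j => ent (nth [::] t l) 0 j).
(** Values on the coroots of A5 x A1: w0 = lambda_5 + lambda_6 and w4 = lambda_2 belong to p3 and
    p1, w2 = lambda_4 to p2. The remaining coordinates of y0 have weights w14 = w2 - w4 and w21 = w2
    - w0, and these relations make the list of triples complete. *)
Definition w0 : seq int := [:: 0; 0; 0; 0; 1; 1].
Definition w4 : seq int := [:: 0; 1; 0; 0; 0; 0].
Definition w2 : seq int := [:: 0; 0; 0; 1; 0; 0].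
Definition w14 : seq int := [:: 0; -1; 0; 1; 0; 0].
Definition w21 : seq int := [:: 0; 0; 0; 1; -1; -1].
Fixpoint wfL (w : seq nat) : lm :=
 match w with [::] => zL | [:: i] => fL i | i :: w' => brL (fL i) (wfL w') end.
(* y0 = exp(mv2) exp(mv1) applied to the highest weight vector. *)
Definition mv1 : seq nat := [:: 1; 3; 2; 0]%N.
Definition mv2 : seq nat := [:: 4; 5; 3; 4; 1; 3; 2; 0]%N.

Lemma br_ef : all6 (fun i => all6 (fun j => eqL (brL (eL i) (fL j)) (if i == j then hL i else zL))).
Proof. by vm_compute. Qed.
Lemma br_hf : all6 (fun i => all6 (fun j => eqL (brL (hL i) (fL j)) (scaL (- Cl i j) (fL j)))).
Proof. by vm_compute. Qed.
Lemma nest_f : eqL (nestL fL thp (fL 5)) (fbL 5).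
Proof. by vm_compute. Qed.
Lemma quadrics_y0 : all (fun l => eqL (mulL (mulL (trL y0L) (QL l)) y0L) zL) (iota 0 27).
Proof. by vm_compute. Qed.
Lemma borel_orbit_open : eqL (addL (mulL BL (spm Us)) (mulL (spm Vs) KL)) idL.
Proof. by vm_compute. Qed.
Lemma hw_eb : all6 (fun j => eqL (addL (mulL (ebL j) P2L) (mulL P2L (trL (ebL j)))) zL
 && eqL (mulL (ebL j) (dL 0)) zL && eqL (mulL (ebL j) (dL 4)) zL).
Proof. by vm_compute. Qed.
Lemma hw_weights : all6 (fun j => let h := hbL j in [&& eqL (addL (mulL h P2L) (mulL P2L (trL h))) (scaL (nth 0 w2 j) P2L),
 eqL (mulL h (dL 0)) (scaL (nth 0 w0 j) (dL 0)), eqL (mulL h (dL 4)) (scaL (nth 0 w4 j) (dL 4)),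
 eqL h (mk (fun i k => if i == k then ent h i i else 0)), ent h 14 14 == nth 0 w14 j &
 ent h 21 21 == nth 0 w21 j]).
Proof. by vm_compute. Qed.
Lemma exp_path_y0 : [&& eqL (mulL (wfL mv1) (dL 0)) (dL 4), eqL (mulL (wfL mv1) (mulL (wfL mv1) (dL 0))) zL,
 eqL (addL (addL (dL 0) (dL 4)) (mulL (wfL mv2) (addL (dL 0) (dL 4)))) y0L &
 eqL (mulL (wfL mv2) (mulL (wfL mv2) (addL (dL 0) (dL 4)))) zL].
Proof. by vm_compute. Qed.
Lemma hw_vec0 : all6 (fun i => eqL (mulL (eL i) (dL 0)) zL && eqL (mulL (hL i) (dL 0)) (scaL (if i == 0%N then 1 else 0) (dL 0))).
Proof. by vm_compute. Qed.
Lemma quadrics_sym : all (fun l => eqL (trL (QL l)) (QL l)) (iota 0 27).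
Proof. by vm_compute. Qed.
Lemma quadrics_stable : let tab := Qtab in all6 (fun i => closedQ tab (eL i) && closedQ tab (fL i)).
Proof. by vm_compute. Qed.
Lemma P2_y0 : ent (mulL (mulL (trL y0L) P2L) y0L) 0 0 == 2.
Proof. by vm_compute. Qed.
Lemma br_hb_eb : all6 (fun j => eqL (brL (hbL j) (ebL j)) (scaL 2 (ebL j))).
Proof. by vm_compute. Qed.

(** * From integer tables to the cone over the highest weight orbit *)

Section Transfer.
Variable F : numClosedFieldType.
Definition toMx (L : lm) : 'M[F]_27 := \matrix_(i, j) (ent L i j)%:~R.

Lemma ent_mk f i j : (i < 27)%N -> (j < 27)%N -> ent (mk f) i j = f i j.
Proof. by move=> hi hj; rewrite /ent /mk nth_mkseq // nth_mkseq. Qed.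
Lemma toM_mk f : toMx (mk f) = \matrix_(i, j) (f i j)%:~R.
Proof. by apply/matrixP => i j; rewrite !mxE ent_mk. Qed.
Lemma toM_add A B : toMx (addL A B) = toMx A + toMx B.
Proof. by rewrite toM_mk; apply/matrixP => i j; rewrite !mxE; exact: intrD. Qed.
Lemma toM_sca c A : toMx (scaL c A) = c%:~R *: toMx A.
Proof. by rewrite toM_mk; apply/matrixP => i j; rewrite !mxE; exact: intrM. Qed.
Lemma toM_sub A B : toMx (subL A B) = toMx A - toMx B.
Proof. by rewrite /subL toM_add toM_sca mulrN1z scaleN1r. Qed.
Lemma toM_tr A : toMx (trL A) = (toMx A)^T.
Proof. by rewrite toM_mk; apply/matrixP => i j; rewrite !mxE. Qed.
Lemma toM_z : toMx zL = 0.
Proof. by rewrite toM_mk; apply/matrixP => i j; rewrite !mxE. Qed.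
Lemma toM_id : toMx idL = 1%:M.
Proof. by rewrite toM_mk; apply/matrixP => i j; rewrite !mxE -val_eqE /=; case: (_ == _ :> nat). Qed.
Lemma rowmulE r B j : (j < 27)%N -> nth 0 (rowmul r B) j = \sum_(k <- iota 0 27) nth 0 r k * ent B k j.
Proof.
move=> hj; rewrite /rowmul; elim: (iota 0 27) => [|k s IH]; first by rewrite big_nil -[foldr _ _ _]/(nseq 27 0) nth_nseq hj.
rewrite [foldr _ _ _]/=.
rewrite big_cons -IH; case: (nth 0 r k) => [[|a]|a]; first by rewrite mul0r add0r.
 by rewrite nth_mkseq.
by rewrite nth_mkseq.
Qed.
Lemma toM_mul A B : toMx (mulL A B) = toMx A *m toMx B.
Proof.
apply/matrixP => i j; rewrite !mxE /ent nth_mkseq // rowmulE //.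
rewrite (_ : iota 0 27 = index_iota 0 27) // big_mkord (raddf_sum (intmul (1 : F))) /=.
by apply: eq_bigr => k _; rewrite !mxE intrM.
Qed.
Lemma toM_br A B : toMx (brL A B) = brk (toMx A) (toMx B).
Proof. by rewrite /brL toM_sub !toM_mul. Qed.
Lemma eqL_toM A B : eqL A B -> toMx A = toMx B. Proof. by move=> /eqP ->. Qed.
Lemma eqL_unit A B C E : eqL (addL (mulL A B) (mulL C E)) idL -> toMx A *m toMx B + toMx C *m toMx E = 1%:M.
Proof. by move=> /eqL_toM; rewrite toM_id toM_add !toM_mul. Qed.
Lemma unit_ker (B U W K : 'M[F]_27) (u : 'cV_27) :
 B *m U + W *m K = 1%:M -> K *m u = 0 -> u = B *m (U *m u).
Proof.
move=> h Ku; rewrite -[LHS]mul1mx -h mulmxDl -(mulmxA W) Ku mulmx0 addr0.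
by rewrite mulmxA.
Qed.
Lemma nth_iota_map (f : nat -> lm) m i : (i < m)%N -> nth [::] [seq f b | b <- iota 0 m] i = f i.
Proof. by move=> h; rewrite (nth_map 0%N) ?size_iota // nth_iota. Qed.
Lemma nth_iota_map_out (f : nat -> lm) m i : ~~ (i < m)%N -> nth [::] [seq f b | b <- iota 0 m] i = [::].
Proof. by rewrite -leqNgt => h; rewrite nth_default // size_map size_iota. Qed.
Lemma ent_nil i j : ent [::] i j = 0. Proof. by rewrite /ent !nth_nil. Qed.
Lemma toM_conj A : map_mx Num.conj (toMx A) = toMx A.
Proof. by apply/matrixP => i j; rewrite !mxE rmorph_int. Qed.
Lemma all6P P : all6 P -> forall i : 'I_6, P i.
Proof. by move=> /allP H i; apply: H; rewrite mem_iota /=; case: i. Qed.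

Definition eM (i : 'I_6) := toMx (eL i).
Definition fM (i : 'I_6) := toMx (fL i).
Definition hM (i : 'I_6) := toMx (hL i).
Definition ebM (i : 'I_6) := toMx (ebL i).
Definition fbM (i : 'I_6) := toMx (fbL i).
Definition hbM (i : 'I_6) := toMx (hbL i).

Lemma brk_eM_fM i j : brk (eM i) (fM j) = if i == j then hM i else 0.
Proof.
rewrite -toM_br (eqL_toM (all6P (all6P br_ef i) j)) val_eqE.
by case: eqP => // _; exact: toM_z.
Qed.
Lemma brk_hM_fM i j : brk (hM i) (fM j) = - (C6 i j)%:~R *: fM j.
Proof. by rewrite -toM_br (eqL_toM (all6P (all6P br_hf i) j)) toM_sca C6E mulrNz. Qed.
Lemma fM_tr i : fM i = (eM i)^T. Proof. by rewrite -toM_tr. Qed.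
Lemma fbM_tr i : fbM i = (ebM i)^T. Proof. by rewrite -toM_tr. Qed.
Lemma brk_ebM i : brk (ebM i) (fbM i) = hbM i. Proof. by rewrite -toM_br. Qed.

Lemma toM_nest (Z : nat -> lm) p A : all (fun i => (i < 6)%N) p ->
 toMx (nestL Z p A) = nest (fun i : 'I_6 => toMx (Z i)) p (toMx A).
Proof.
by elim: p A => //= i p IH A /andP [i6 h]; rewrite IH // toM_br inordK.
Qed.
Lemma ebL5 : ebL 5 = nestL eL thp (eL 5). Proof. reflexivity. Qed.
Lemma ord_max5 : nat_of_ord (ord_max : 'I_6) = 5%N. Proof. by []. Qed.
Lemma nest_eM : nest eM thp (eM (inord 5)) = ebM ord_max.
Proof.
rewrite /ebM ord_max5 ebL5 /eM inordK //.
exact: (esym (@toM_nest eL thp (eL 5) isT)).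
Qed.
Lemma nest_fM : nest fM thp (fM (inord 5)) = fbM ord_max.
Proof.
rewrite /fbM ord_max5 -(eqL_toM nest_f) /fM inordK //.
exact: (esym (@toM_nest fL thp (fL 5) isT)).
Qed.
Lemma ebM_lt j : j != ord_max -> ebM j = eM (sj j).
Proof.
move=> jm; rewrite /ebM /eM /ebL -val_eqE /= in jm *; rewrite (negPf jm).
congr (toMx (eL _)); rewrite /sj inordK //.
by case: j jm => [[|[|[|[|[|[|j]]]]]] h].
Qed.
Lemma fbM_lt j : j != ord_max -> fbM j = fM (sj j).
Proof. by move=> jm; rewrite fbM_tr ebM_lt // fM_tr. Qed.
Lemma hbM_diag j : hbM j = diag_mx (\row_i (ent (hbL j) i i)%:~R).
Proof.
have /and5P [_ _ _ h _] := all6P hw_weights j; rewrite /hbM (eqL_toM h) toM_mk.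
apply/matrixP => i k; rewrite !mxE; case: (eqVneq i k) => [->|ik]; first by rewrite eqxx.
by rewrite val_eqE (negPf ik).
Qed.

Definition colL (L : lm) : 'cV[F]_27 := col 0 (toMx L).
Lemma yv_mul A L : colL (mulL A L) = toMx A *m colL L.
Proof. by rewrite /colL toM_mul !colE mulmxA. Qed.
Lemma yv_add A B : colL (addL A B) = colL A + colL B.
Proof. by rewrite /colL toM_add linearD. Qed.
Lemma yv_sca c A : colL (scaL c A) = c%:~R *: colL A.
Proof. by rewrite /colL toM_sca linearZ. Qed.
Lemma yv_eq A B : eqL A B -> colL A = colL B. Proof. by move=> /eqP ->. Qed.
Lemma yv_z : colL zL = 0. Proof. by rewrite /colL toM_z col0. Qed.
Lemma yv_d a : (a < 27)%N -> colL (dL a) = delta_mx (inord a) 0.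
Proof.
move=> ha; rewrite /colL /dL /spm toM_mk; apply/matrixP => i j; rewrite !mxE ord1 eqxx /= andbT andbT.
by rewrite -val_eqE /= inordK // eq_sym; case: eqP.
Qed.

Definition Qm (l : 'I_27) := toMx (QL l).
(** The infinitesimal stabilizer of the span of the quadrics. It stands in for the Lie algebra of
    E6, whose generators it contains, because it is visibly closed under brackets. *)
Definition inG (X : 'M[F]_27) := forall l, exists c : 'I_27 -> F, X^T *m Qm l + Qm l *m X = \sum_m c m *: Qm m.
Definition y0v := colL y0L.

Lemma allP27 P : all P (iota 0 27) -> forall i : 'I_27, P i.
Proof. by move=> /allP H i; apply: H; rewrite mem_iota /=; case: i. Qed.

Lemma inG_gen i : inG (eM i) /\ inG (fM i).
Proof.
have tabE l : (l < 27)%N -> nth [::] Qtab l = QL l.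
 by move=> hl; rewrite /Qtab (nth_map 0%N) ?size_iota // nth_iota.
have /andP [h1 h2] := @all6P (fun i => closedQ Qtab (eL i) && closedQ Qtab (fL i)) quadrics_stable i.
have H X : closedQ Qtab X -> inG (toMx X).
 rewrite /closedQ => /allP27 h l; have := h l; rewrite tabE //.
 have -> : (toMx X)^T *m Qm l + Qm l *m toMx X = toMx (addL (mulL (trL X) (QL l)) (mulL (QL l) X)).
  by rewrite toM_add !toM_mul toM_tr.
 case/orP => [/eqL_toM ->|/hasP [m]].
  by exists (fun=> 0); rewrite toM_z big1 // => m _; rewrite scale0r.
 rewrite mem_iota add0n => /andP [_ m27]; rewrite tabE // => /orP [] /eqL_toM ->.
  exists (fun k => (k == Ordinal m27)%:R); rewrite (bigD1 (Ordinal m27)) //= eqxx scale1r big1 ?addr0 //.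
  by move=> k /negPf ->; rewrite scale0r.
 exists (fun k => - (k == Ordinal m27)%:R); rewrite (bigD1 (Ordinal m27)) //= eqxx big1 ?addr0.
  by rewrite toM_sca mulrN1z.
 by move=> k /negPf ->; rewrite oppr0 scale0r.
by split; [exact: (H _ h1) | exact: (H _ h2)].
Qed.

Lemma inG_brk X Y : inG X -> inG Y -> inG (brk X Y).
Proof.
move=> gX gY l.
have S Z (c : 'I_27 -> F) : inG Z -> exists d : 'I_27 -> F, \sum_m c m *: (Z^T *m Qm m + Qm m *m Z) = \sum_m d m *: Qm m.
 move=> gZ; pose d m := projT1 (cid (gZ m)).
 have dE m : Z^T *m Qm m + Qm m *m Z = \sum_k d m k *: Qm k := projT2 (cid (gZ m)).
 exists (fun k => \sum_m c m * d m k).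
 under eq_bigr do rewrite dE scaler_sumr.
 rewrite exchange_big; apply: eq_bigr => k _; rewrite scaler_suml; apply: eq_bigr => m _.
 by rewrite scalerA.
have [cX EX] := gX l; have [cY EY] := gY l.
have [d1 E1] := S Y cX gY; have [d2 E2] := S X cY gX.
have act Z c : Z^T *m (\sum_m c m *: Qm m) + (\sum_m c m *: Qm m) *m Z = \sum_m c m *: (Z^T *m Qm m + Qm m *m Z).
 rewrite mulmx_sumr mulmx_suml -big_split; apply: eq_bigr => m _.
 by rewrite -scalemxAr -scalemxAl scalerDr.
exists (fun m => d1 m - d2 m).
under eq_bigr do rewrite scalerBl.
rewrite sumrB -E1 -E2 -!act -EX -EY.
have -> : (brk X Y)^T = Y^T *m X^T - X^T *m Y^T by rewrite /brk linearB /= !trmx_mul.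
rewrite /brk mulmxBl mulmxBr !(mulmxDr, mulmxDl) !mulmxA.
move: (Y^T *m X^T *m Qm l) (X^T *m Y^T *m Qm l) (Qm l *m X *m Y) (Qm l *m Y *m X) (Y^T *m Qm l *m X) (X^T *m Qm l *m Y) => a b c d e g.
by apply/matrixP => i j; rewrite !mxE; ring.
Qed.

(** The infinitesimal form of openness of the Borel orbit: preserving the quadrics, [X] moves y0 in
    a direction killed by all their differentials at y0, and [borel_orbit_open] writes such a
    direction through the Borel subalgebra. *)
Lemma stab X : inG X -> exists c : 'I_27 -> F,
 X *m y0v = \sum_(b : 'I_27 | (b < 22)%N) c b *: (toMx (bL b) *m y0v).
Proof.
move=> gX; pose u := X *m y0v.
have Ku : toMx KL *m u = 0.
 apply/matrixP => l j; rewrite [RHS]mxE.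
 have -> : (toMx KL *m u) l j = (y0v^T *m Qm l *m u) 0 j.
  rewrite !mxE; apply: eq_bigr => k _; congr (_ * _).
  have -> : (y0v^T *m Qm l) 0 k = toMx (mulL (trL y0L) (QL l)) 0 k.
   by rewrite toM_mul toM_tr !mxE; apply: eq_bigr => m _; rewrite !mxE.
  rewrite /KL toM_mk !mxE; congr (_%:~R); exact: (congr1 (fun t => ent t 0 k) (nth_iota_map (fun l => mulL (trL y0L) (QL l)) (ltn_ord l))).
 have [c E] := gX l.
 have q0 m : y0v^T *m Qm m *m y0v = 0.
  have := allP27 quadrics_y0 m => /eqL_toM; rewrite toM_z !toM_mul toM_tr => h.
  have -> : y0v = toMx y0L *m delta_mx 0 0 by rewrite -colE.
  transitivity ((delta_mx 0 0 : 'cV[F]_27)^T *m ((toMx y0L)^T *m Qm m *m toMx y0L) *m (delta_mx 0 0 : 'cV[F]_27)).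
   by rewrite trmx_mul !mulmxA.
  by rewrite h mulmx0 mul0mx.
 have sQ : (Qm l)^T = Qm l by rewrite -toM_tr (eqL_toM (allP27 quadrics_sym l)).
 (* All quadrics vanish at y0, hence so does this combination of them; by symmetry of Q_l its value
    is twice y0^T Q_l X y0. *)
 have : y0v^T *m (X^T *m Qm l + Qm l *m X) *m y0v = 0.
  rewrite E mulmx_sumr mulmx_suml big1 // => m _.
  by rewrite -scalemxAr -scalemxAl q0 scaler0.
 rewrite mulmxDr mulmxDl !mulmxA.
 have -> : y0v^T *m X^T *m Qm l *m y0v = (y0v^T *m Qm l *m X *m y0v)^T.
  by rewrite !trmx_mul trmxK sQ !mulmxA.
 move/matrixP => /(_ 0 0); rewrite !mxE -mulr2n => /eqP; rewrite mulrn_eq0 /= ord1 => /eqP h.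
 exact: h.
have uE : u = toMx BL *m (toMx (spm Us) *m u).
 have h6 := borel_orbit_open.
 exact: (unit_ker (eqL_unit h6) Ku).
pose c (b : 'I_27) := (toMx (spm Us) *m u) b 0.
exists c; rewrite -/u {1}uE.
have colB (b : 'I_27) : col b (toMx BL) = if (b < 22)%N then toMx (bL b) *m y0v else 0.
 rewrite /BL toM_mk; apply/matrixP => i j; rewrite [LHS]mxE [LHS]mxE; case: ifP => b22.
  rewrite -yv_mul mxE mxE; congr (_%:~R).
  by rewrite nth_iota_map.
 by rewrite (nth_iota_map_out _ (negbT b22)) ent_nil [RHS]mxE.
transitivity (\sum_b c b *: col b (toMx BL)).
 apply/matrixP => i j; rewrite mxE summxE; apply: eq_bigr => b _.
 by rewrite [RHS]mxE [X in _ = _ * X]mxE mulrC ord1.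
rewrite [RHS]big_mkcond; apply: eq_bigr => b _; rewrite colB.
by case: ifP => // _; rewrite scaler0.
Qed.

End Transfer.

Definition o4 : 'I_27 := inord 4.
Section Abs.
Variable F : numClosedFieldType.
Notation toM := (toMx F).
Notation yv := (colL F).
Lemma eqL_quad A B c : eqL (addL (mulL A B) (mulL B (trL A))) (scaL c B) ->
 toM A *m toM B + toM B *m (toM A)^T = c%:~R *: toM B.
Proof. by move=> /(eqL_toM F); rewrite toM_add !toM_mul toM_tr toM_sca. Qed.
Lemma eqL_quad0 A B : eqL (addL (mulL A B) (mulL B (trL A))) zL ->
 toM A *m toM B + toM B *m (toM A)^T = 0.
Proof. by move=> /(eqL_toM F); rewrite toM_add !toM_mul toM_tr toM_z. Qed.
Lemma eqL_col A B L : eqL (mulL A B) L -> toM A *m yv B = yv L.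
Proof. by move=> /(yv_eq F) <-; rewrite yv_mul. Qed.
Lemma eqL_col0 A B : eqL (mulL A B) zL -> toM A *m yv B = 0.
Proof. by move=> /eqL_col ->; rewrite yv_z. Qed.
Lemma eqL_colS A B c : eqL (mulL A B) (scaL c B) -> toM A *m yv B = c%:~R *: yv B.
Proof. by move=> /eqL_col ->; rewrite yv_sca. Qed.
Lemma eqL_col2 A B : eqL (mulL A (mulL A B)) zL -> toM A *m (toM A *m yv B) = 0.
Proof. by move=> /eqL_col0 <-; rewrite yv_mul. Qed.
Lemma eqL_colD A B C L : eqL (addL (addL B C) (mulL A (addL B C))) L ->
 yv B + yv C + toM A *m (yv B + yv C) = yv L.
Proof. by move=> /(yv_eq F) <-; rewrite !yv_add yv_mul yv_add. Qed.

Lemma yv0 : lf (yv (dL 0)) = 'X_0 :> {mpoly F[27]}.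
Proof.
rewrite yv_d // lf_delta (_ : inord 0 = 0) //.
by apply: val_inj; rewrite /= inordK.
Qed.
Lemma yv4 : lf (yv (dL 4)) = 'X_o4 :> {mpoly F[27]}.
Proof. by rewrite yv_d // lf_delta. Qed.
Lemma eb_P2 j : ebM F j *m toM P2L + toM P2L *m (ebM F j)^T = 0.
Proof. by have /andP [/andP [h _] _] := all6P hw_eb j; exact: (eqL_quad0 h). Qed.
Lemma eb_d0 j : ebM F j *m yv (dL 0) = 0.
Proof. by have /andP [/andP [_ h] _] := all6P hw_eb j; exact: (eqL_col0 h). Qed.
Lemma eb_d4 j : ebM F j *m yv (dL 4) = 0.
Proof. by have /andP [_ h] := all6P hw_eb j; exact: (eqL_col0 h). Qed.
Definition wt_ (w : seq int) (j : 'I_6) : F := (nth 0 w j)%:~R.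
Lemma hb_P2 j : hbM F j *m toM P2L + toM P2L *m (hbM F j)^T = wt_ w2 j *: toM P2L.
Proof. by have /and5P [h _ _ _ _] := all6P hw_weights j; exact: (eqL_quad h). Qed.
Lemma hb_d0 j : hbM F j *m yv (dL 0) = wt_ w0 j *: yv (dL 0).
Proof. by have /and5P [_ h _ _ _] := all6P hw_weights j; exact: (eqL_colS h). Qed.
Lemma hb_d4 j : hbM F j *m yv (dL 4) = wt_ w4 j *: yv (dL 4).
Proof. by have /and5P [_ _ h _ _] := all6P hw_weights j; exact: (eqL_colS h). Qed.

Definition h_ (j : 'I_6) (i : 'I_27) : F := (ent (hbL j) i i)%:~R.
Definition o14 : 'I_27 := inord 14.
Definition o21 : 'I_27 := inord 21.
Lemma ent_col A L c i : eqL (mulL A L) (scaL c L) -> yv L i 0 = 1 -> forall h, toM A = diag_mx (\row_i h i) -> h i = c%:~R.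
Proof.
move=> /eqL_colS e1 e2 h e3; move: e1; rewrite e3 => /(congr1 (fun u : 'cV[F]_27 => u i 0)).
by rewrite mul_diag_mx [LHS]mxE [RHS]mxE e2 mxE !mulr1.
Qed.
Lemma yvdE a (ha : (a < 27)%N) : yv (dL a) (inord a) 0 = 1.
Proof. by rewrite yv_d // mxE !eqxx. Qed.
Lemma h0 j : h_ j 0 = wt_ w0 j.
Proof.
have /and5P [_ h _ _ _] := all6P hw_weights j.
have e0 : (0 : 'I_27) = inord 0 by apply: val_inj; rewrite /= inordK.
by apply: (ent_col h) (hbM_diag F j); rewrite e0 yvdE.
Qed.
Lemma h4 j : h_ j o4 = wt_ w4 j.
Proof.
have /and5P [_ _ h _ _] := all6P hw_weights j.
by apply: (ent_col h) (hbM_diag F j); rewrite yvdE.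
Qed.
Lemma h14 j : h_ j o14 = wt_ w14 j.
Proof.
have /and5P [_ _ _ _ /andP [/eqP h _]] := all6P hw_weights j.
by rewrite /h_ inordK // h.
Qed.
Lemma h21 j : h_ j o21 = wt_ w21 j.
Proof.
have /and5P [_ _ _ _ /andP [_ /eqP h]] := all6P hw_weights j.
by rewrite /h_ inordK // h.
Qed.

Lemma hb_tr j : (hbM F j)^T = hbM F j.
Proof. by rewrite hbM_diag tr_diag_mx. Qed.
Lemma inG_nest X p : (forall i, inG (X i)) -> forall A : 'M[F]_27, inG A -> inG (nest X p A).
Proof.
move=> hX; elim: p => [|i p IH] A hA //=; apply: IH.
exact: inG_brk.
Qed.
Lemma inG_eb j : inG (ebM F j) /\ inG (fbM F j).
Proof.
have [->|jm] := eqVneq j ord_max; last by rewrite ebM_lt // fbM_lt //; exact: inG_gen.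
rewrite -nest_eM -nest_fM; split.
 apply: inG_nest => [i|]; first exact: (inG_gen F i).1.
 exact: (inG_gen F (inord 5)).1.
apply: inG_nest => [i|]; first exact: (inG_gen F i).2.
exact: (inG_gen F (inord 5)).2.
Qed.
Lemma inG_hb j : inG (hbM F j).
Proof. by rewrite -brk_ebM; apply: inG_brk; [exact: (inG_eb j).1 | exact: (inG_eb j).2]. Qed.

(** The negative Borel subalgebra by iterated brackets of coroots and lowering operators, the form
    in which orthogonality is proved by induction. *)
Inductive isB : 'M[F]_27 -> Prop :=
| isB_h j : isB (hbM F j)
| isB_f j : isB (fbM F j)
| isB_brk X Y : isB X -> isB Y -> isB (brk X Y).
Lemma inG_isB X : isB X -> inG X.
Proof.
by elim=> [j|j|Y Z _ gY _ gZ]; [exact: inG_hb | exact: (inG_eb j).2 | exact: inG_brk].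
Qed.
Lemma isB_w w : w != [::] -> all (fun i => (i < 6)%N) w -> isB (toM (wL w)).
Proof.
elim: w => [|i w IH] // _ /= /andP [i6 aw].
case: w IH aw => [|i' w] IH aw; first exact: (isB_f (Ordinal i6)).
rewrite toM_br.
by apply: isB_brk; [exact: (isB_f (Ordinal i6)) | exact: IH].
Qed.
Lemma negw_ok : all (fun w => (w != [::]) && all (fun i => (i < 6)%N) w) negw.
Proof. by vm_compute. Qed.
Lemma isB_bL b : (b < 22)%N -> isB (toM (bL b)).
Proof.
move=> b22; rewrite /bL; case: ifP => b6; first exact: (isB_h (Ordinal b6)).
have hs : (b - 6 < size negw)%N.
 have -> : size negw = 16%N by vm_compute.
 lia.
have /andP [h1 h2] := allP negw_ok _ (mem_nth [::] hs).
exact: isB_w.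
Qed.
End Abs.

(** * Primitive vectors in an irreducible space of polynomials containing x_0^k *)

Section Core.
Variables (F : numClosedFieldType) (k : nat).
Notation toM := (toMx F).
Notation yv := (colL F).
Notation P := {mpoly F[27]}.
Notation y0 := (y0v F).
Variable R : P -> Prop.
Hypotheses (linR : linP R) (RE : forall i p, R p -> R (D (eM F i) p)) (RF : forall i p, R p -> R (D (fM F i) p)).
Hypothesis Rirr : forall U : P -> Prop, linP U -> (forall i p, U p -> U (D (eM F i) p)) ->
 (forall i p, U p -> U (D (fM F i) p)) -> (exists u, [/\ R u, U u & u != 0]) -> forall p, R p -> U p.
Hypothesis R0 : R ('X_0 ^+ k).

Lemma D_brk A B (p : P) : D (brk A B) p = D A (D B p) - D B (D A p).
Proof. by rewrite D_comm /brk addrAC subrr add0r. Qed.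
Lemma linP_B U (u w : P) : linP U -> U u -> U w -> U (u - w).
Proof. by move=> [_ l] hu hw; rewrite -scaleN1r addrC; exact: l. Qed.
Lemma R_brk A B : (forall p, R p -> R (D A p)) -> (forall p, R p -> R (D B p)) ->
 forall p, R p -> R (D (brk A B) p).
Proof. by move=> a b p hp; rewrite D_brk; apply: linP_B => //; auto. Qed.
Lemma R_wf w : all (fun i => (i < 6)%N) w -> forall p, R p -> R (D (toM (wfL w)) p).
Proof.
elim: w => [|i w IH] /=; first by move=> _ p _; rewrite toM_z D_0; exact: linR.1.
move=> /andP [i6 aw]; case: w IH aw => [|i' w] IH aw; first by move=> p; exact: (RF (Ordinal i6)).
rewrite toM_br.
by apply: R_brk; [exact: (RF (Ordinal i6)) | exact: IH].
Qed.
Definition l0k : P := lf y0 ^+ k.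
(** Two exponentials of lowering elements move the highest weight vector to y0; each element kills
    the current vector when applied twice, so [exp_pow] carries x_0^k to l0^k inside [R]. *)
Lemma l0k_in : R l0k.
Proof.
have /and4P [e1 e2 e3 e4] := exp_path_y0.
have step w y z : all (fun i => (i < 6)%N) w -> toM (wfL w) *m (toM (wfL w) *m y) = 0 ->
  y + toM (wfL w) *m y = z -> R (lf y ^+ k) -> R (lf z ^+ k).
 move=> aw h <-; move: (R_wf aw) h; move: (toM (wfL w)) => A hA h.
 exact: exp_pow.
have h3 := eqL_colD F e3; rewrite -yv_add in h3.
apply: (step mv2 _ _ isT (eqL_col2 F e4) h3).
have h1 : yv (dL 0) + toM (wfL mv1) *m yv (dL 0) = yv (addL (dL 0) (dL 4)).
 by rewrite (eqL_col F e1) yv_add.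
apply: (step mv1 _ _ isT (eqL_col2 F e2) h1).
by rewrite yv0; exact: R0.
Qed.

Inductive NN : P -> Prop :=
| NN_l : NN l0k
| NN_0 : NN 0
| NN_lin a p q : NN p -> NN q -> NN (a *: p + q)
| NN_D X p : isB X -> NN p -> NN (D X p).
Lemma NN_linP : linP NN.
Proof. by split; [exact: NN_0 | exact: NN_lin]. Qed.
(** On l0^k an element X acts as k l0^(k-1) times the linear form of X y0, which [stab] rewrites
    through the Borel subalgebra. Further down, X Y q = Y X q + [X, Y] q reduces to the same
    statement for q. *)
Lemma NN_stab p : NN p -> forall X, inG X -> NN (D X p).
Proof.
elim=> [X gX|X gX|a u w _ IHu _ IHw X gX|Y q bY Nq IH X gX]; last first.
- rewrite D_comm -/(brk X Y); apply: (linP_D NN_linP); first by apply: NN_D => //; exact: IH.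
 by apply: IH; apply: inG_brk => //; exact: inG_isB.
- by rewrite linearP; apply: NN_lin; [exact: IHu | exact: IHw].
- by rewrite linear0; exact: NN_0.
have [c E] := stab gX.
have -> : D X l0k = \sum_(b : 'I_27 | (b < 22)%N) c b *: D (toM (bL b)) l0k.
 rewrite {1}/l0k D_pow D_lf E -big_filter lf_sum big_filter mulr_sumr scaler_sumr.
 apply: eq_bigr => b _; rewrite lfZ /l0k D_pow D_lf -scalerAr !scalerA.
 by rewrite mulrC.
elim/big_ind: _ => [|u w|b b22]; first exact: NN_0.
 exact: (linP_D NN_linP).
by apply: (linP_Z _ NN_linP); apply: NN_D NN_l; exact: isB_bL.
Qed.
Lemma y0_0 : y0 0 0 = 1.
Proof. by rewrite /y0v /colL mxE /toMx mxE; have -> : ent y0L (0%R : 'I_27) (0%R : 'I_27) = 1 by vm_compute. Qed.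
Lemma lfk_neq0 (y : 'cV[F]_27) d : y 0 0 = 1 -> lf y ^+ d != 0 :> P.
Proof.
move=> y1; apply: expf_neq0; apply/eqP => h.
have := deriv_lf y 0; rewrite h raddf0 y1 => /(congr1 (fun p : P => p@_0%MM)).
by rewrite mcoeff0 mcoeffC eqxx mulr1 => /eqP; rewrite eq_sym oner_eq0.
Qed.
Lemma R_NN p : R p -> NN p.
Proof.
apply: Rirr; first exact: NN_linP.
- by move=> i q /NN_stab; apply; exact: (inG_gen F i).1.
- by move=> i q /NN_stab; apply; exact: (inG_gen F i).2.
by exists l0k; split; [exact: l0k_in | exact: NN_l | apply: lfk_neq0; exact: y0_0].
Qed.

Section Prim.
Variables (g : P) (mu : 'I_6 -> F).
Hypotheses (Rg : R g) (Eg : forall j, D (ebM F j) g = 0) (Hg : forall j, D (hbM F j) g = mu j *: g).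

(** Coroots are self-adjoint and scale [g], and the adjoint of a lowering operator is a raising
    operator, which kills [g]. *)
Lemma form_isB X : isB X -> forall p, form g p = 0 -> form g (D X p) = 0.
Proof.
elim=> [j|j|{}X Y _ IHX _ IHY] p gp.
- by have := form_D (hbM F j) g p; rewrite toM_conj hb_tr Hg form_Zl gp mulr0 => <-.
- by have := form_D (ebM F j) g p; rewrite toM_conj -fbM_tr Eg form_0l => <-.
- rewrite D_brk -scaleN1r addrC form_r; rewrite (IHX _ (IHY _ gp)) (IHY _ (IHX _ gp)).
 by rewrite mulr0 addr0.
Qed.
Lemma prim_zero : form g l0k = 0 -> g = 0.
Proof.
move=> h; apply: form_pos.
have H p : NN p -> form g p = 0.
 elim=> [//||a u w _ hu _ hw|X q bX _ hq]; first exact: form_0r.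
  by rewrite form_r hu hw mulr0 addr0.
 exact: form_isB.
exact: (H g (R_NN Rg)).
Qed.

(** The operator x_i d/dx_i kills l0^k when y0 has no i-th coordinate, and it multiplies a monomial
    by its i-th exponent. *)
Lemma l0k_supp m i : (l0k@_m != 0) -> y0 i 0 = 0 -> m i = 0%N.
Proof.
move=> hm yi.
have := coef_diag (fun j => (j == i)%:R) l0k m.
have -> : D (diag_mx (\row_j (j == i)%:R)) l0k = 0.
 rewrite /l0k D_pow D_lf (_ : _ *m y0 = 0) ?lf0 ?mulr0 ?scaler0 //.
 apply/matrixP => a b; rewrite mul_diag_mx [LHS]mxE [RHS]mxE mxE (ord1 b); case: eqP => [->|_]; last by rewrite mul0r.
 by rewrite mul1r.
rewrite mcoeff0 => /esym/eqP; rewrite mulf_eq0 (negPf hm) orbF.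
rewrite (bigD1 i) //= eqxx mul1r big1 ?addr0 => [|j /negPf ->]; last by rewrite mul0r.
by rewrite pnatr_eq0 => /eqP.
Qed.
Lemma l0k_deg m : (l0k@_m != 0) -> (\sum_i m i = k)%N.
Proof.
move=> hm; have := coef_diag (fun=> 1) l0k m.
have -> : D (diag_mx (\row_j 1)) l0k = k%:R *: l0k.
 rewrite /l0k D_pow D_lf (_ : _ *m y0 = y0); first by case: (k) => [|d] /=; rewrite ?scale0r ?exprSr.
 by apply/matrixP => a b; rewrite mul_diag_mx !mxE mul1r.
rewrite mcoeffZ => /(mulIf hm) /eqP.
rewrite (eq_bigr (fun i => (m i)%:R)) => [|i _]; last by rewrite mul1r.
by rewrite -natr_sum eqr_nat eq_sym => /eqP.
Qed.
Lemma y0_out i : i != 0 -> i != o4 -> i != o14 -> i != o21 -> y0 i 0 = 0.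
Proof.
rewrite -!val_eqE /= !inordK // => h1 h2 h3 h4; rewrite /y0v /colL mxE /y0L /spm toM_mk mxE.
rewrite /= !andbT !(eq_sym _ (i : nat)).
by rewrite (negPf h1) (negPf h2) (negPf h3) (negPf h4).
Qed.

(** By [prim_zero] the vector [g] is not orthogonal to l0^k, so they share a monomial. Its exponents
    live on the coordinates 0, 4, 14, 21 and add up to k, and it has the weight of [g] because the
    coroots are diagonal. *)
Lemma prim_wt : g != 0 -> exists c0 c4 c14 c21 : nat, (c0 + c4 + c14 + c21)%N = k /\
 forall j, mu j = c0%:R * wt_ F w0 j + c4%:R * wt_ F w4 j + c14%:R * wt_ F w14 j + c21%:R * wt_ F w21 j.
Proof.
move=> g0; have : form g l0k != 0 by apply: contraNneq g0 => /prim_zero ->.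
have [/hasP [m mg hm] _|/hasPn h] := boolP (has (fun m => l0k@_m != 0) (msupp g)); last first.
 rewrite /form big_seq big1 ?eqxx // => m mg; have := h m mg; rewrite negbK => /eqP ->.
 by rewrite rmorph0 mulr0.
have s4 (f : 'I_27 -> F) : (forall i, m i = 0%N -> f i = 0) -> \sum_i f i = f 0 + f o4 + f o14 + f o21.
 move=> hf.
 have n1 : o4 != 0 by rewrite -val_eqE /= inordK.
 have n2 : o14 != 0 by rewrite -val_eqE /= inordK.
 have n3 : o21 != 0 by rewrite -val_eqE /= inordK.
 have n4 : o14 != o4 by rewrite -val_eqE /= !inordK.
 have n5 : o21 != o4 by rewrite -val_eqE /= !inordK.
 have n6 : o21 != o14 by rewrite -val_eqE /= !inordK.
 rewrite (bigD1 0) //= (bigD1 o4) //= (bigD1 o14) ?n2 ?n4 //= (bigD1 o21) ?n3 ?n5 ?n6 //= big1.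
  by rewrite addr0 !addrA.
 move=> i /andP [/andP [/andP [a b] c] d]; apply: hf; apply: l0k_supp hm _.
 exact: y0_out.
exists (m 0), (m o4), (m o14), (m o21); split.
 have := l0k_deg hm => /(congr1 (fun n => n%:R : F)); rewrite natr_sum s4 => [|i ->//].
 by rewrite -!natrD => /eqP; rewrite eqr_nat => /eqP.
move=> j.
have := coef_diag (h_ F j) g m; rewrite -hbM_diag Hg mcoeffZ => /(mulIf _) ->; last first.
 by rewrite mcoeff_msupp in mg.
rewrite s4 => [|i ->]; last by rewrite mulr0.
rewrite h0 h4 h14 h21 !(mulrC (wt_ _ _ _)); done.
Qed.
End Prim.

(** By [prim_zero], pairing with l0^k is an injective functional on the primitive vectors of a given
    weight. *)
Lemma prim_dep g g' mu : R g -> R g' -> g != 0 ->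
 (forall j, D (ebM F j) g = 0) -> (forall j, D (ebM F j) g' = 0) ->
 (forall j, D (hbM F j) g = mu j *: g) -> (forall j, D (hbM F j) g' = mu j *: g') ->
 exists a, g' = a *: g.
Proof.
move=> Rg Rg' g0 Eg Eg' Hg Hg'.
have f0 : form g l0k != 0 by apply: contraNneq g0 => /(prim_zero Rg Eg Hg) ->.
exists (form g' l0k / form g l0k); apply/eqP; rewrite -subr_eq0; apply/eqP.
rewrite addrC -scaleNr.
apply: (@prim_zero _ mu); first exact: linR.2.
- by move=> j; rewrite linearP Eg Eg' scaler0 addr0.
- by move=> j; rewrite linearP Hg Hg' scalerDr !scalerA mulrC.
by rewrite form_l mulNr divfK // addNr.
Qed.
End Core.

(** * The products p1^a1 p2^a2 p3^a3 *)

Section PVec.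
Variable F : numClosedFieldType.
Notation toM := (toMx F).
Notation yv := (colL F).
Notation P := {mpoly F[27]}.
Notation y0 := (y0v F).
Notation ld d := (lf y0 ^+ d : P).
Lemma form_Xl b d (q : P) : form (ld d.+1) ('X_b * q) = d.+1%:R * (y0 b 0) * form (ld d) q.
Proof.
rewrite -form_deriv.
have -> : (ld d.+1)^`M(b) = (d.+1%:R * y0 b 0) *: ld d; last by rewrite form_Zl.
elim: d => [|d IH]; first by rewrite expr1 deriv_lf expr0 mul1r -mul_mpolyC mulr1.
rewrite exprS mderivM IH deriv_lf -scalerAr -exprS mul_mpolyC -scalerDl.
by rewrite -{1}[y0 b 0]mul1r -mulrDl nat1r.
Qed.
Lemma form_Xn b d a (q : P) : y0 b 0 != 0 -> form (ld d) q != 0 -> form (ld (a + d)) ('X_b ^+ a * q) != 0.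
Proof.
move=> yb hq; elim: a => [|a IH]; first by rewrite mul1r.
by rewrite exprS -mulrA addSn form_Xl !mulf_neq0 ?pnatr_eq0.
Qed.
Lemma y0P2 : y0^T *m toM P2L *m y0 = 2%:M.
Proof.
have h := eqP P2_y0.
have -> : y0^T *m toM P2L *m y0 = (toM (mulL (mulL (trL y0L) P2L) y0L) 0 0)%:M.
 apply/matrixP => i j; rewrite !ord1 [RHS]mxE mulr1n !toM_mul toM_tr !mxE.
 apply: eq_bigr => a _; rewrite !mxE; congr (_ * _); apply: eq_bigr => b _; by rewrite !mxE.
by rewrite [X in X%:M]mxE h.
Qed.
(** Multiplication by p2 crosses the form as a second-order derivative of l0^(d+2), which produces
    the nonzero factor (d + 2)(d + 1) p2(y0), with p2(y0) = 2. *)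
Lemma form_Q d (q : P) : form (ld d) q != 0 -> form (ld d.+2) (quad (toM P2L) * q) != 0.
Proof.
move=> hq; rewrite /quad mulr_suml form_sumr.
rewrite (eq_bigr (fun b => \sum_a (d.+2%:R * d.+1%:R * form (ld d) q) * (y0 a 0 * toM P2L a b * y0 b 0))); last first.
 move=> b _; rewrite /lf !mulr_suml form_sumr; apply: eq_bigr => a _.
 rewrite -!scalerAl form_Zr -mulrA form_Xl form_Xl mxE /toMx mxE rmorph_int; ring.
under eq_bigr do rewrite -mulr_sumr.
rewrite -mulr_sumr mulf_neq0 // ?mulf_neq0 ?pnatr_eq0 //.
have := y0P2 => /matrixP /(_ 0 0); rewrite [RHS]mxE mulr1n mxE.
rewrite (eq_bigr (fun b => \sum_a y0 a 0 * toM P2L a b * y0 b 0)) => [->|b _].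
 by rewrite pnatr_eq0.
by rewrite mxE mulr_suml; apply: eq_bigr => a _; rewrite [y0^T _ _]mxE.
Qed.

Definition pvec a1 a2 a3 : P := 'X_o4 ^+ a1 * (quad (toM P2L) ^+ a2 * 'X_0 ^+ a3).
Lemma pvec_E j a1 a2 a3 : D (ebM F j) (pvec a1 a2 a3) = 0.
Proof.
rewrite /pvec !DM !D_pow -yv0 -yv4 !D_lf eb_d0 eb_d4 D_quad eb_P2 lf0.
have -> : quad 0 = 0 :> P by rewrite -(scale0r (0 : 'M[F]_27)) quadZ scale0r.
by rewrite !(mulr0, mul0r, scaler0, addr0).
Qed.
Lemma pvec_H j a1 a2 a3 : D (hbM F j) (pvec a1 a2 a3) =
 (a1%:R * wt_ F w4 j + a2%:R * wt_ F w2 j + a3%:R * wt_ F w0 j) *: pvec a1 a2 a3.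
Proof.
rewrite /pvec !DM !D_pow -yv0 -yv4 !D_lf hb_d0 hb_d4 D_quad hb_P2 !lfZ quadZ.
have E (x : P) c n : n%:R *: (x ^+ n.-1 * (c *: x)) = (n%:R * c) *: x ^+ n :> P.
 by rewrite -scalerAr scalerA; case: n => [|n] /=; rewrite ?mul0r ?scale0r // exprSr.
rewrite !E.
rewrite -!(scalerAl, scalerAr) -?scalerDr -?scalerDl.
by rewrite -scalerAr -scalerDl addrA.
Qed.
Lemma pvec_form a1 a2 a3 : form (ld (a1 + 2 * a2 + a3)) (pvec a1 a2 a3) != 0.
Proof.
rewrite -addnA; apply: form_Xn.
 rewrite /y0v /colL mxE /toMx mxE inordK //.
 by rewrite (_ : ent y0L 4 (0%R : 'I_27) = 1) ?oner_eq0 //; vm_compute.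
elim: a2 => [|a2 IH].
 rewrite mul1r muln0 add0n -['X_0 ^+ a3]mulr1 -[a3 in ld a3]addn0; apply: form_Xn.
  by rewrite y0_0 oner_eq0.
 by rewrite expr0; apply/eqP => /form_pos /eqP; rewrite oner_eq0.
by rewrite exprS -mulrA mulnS -addnA; apply: form_Q.
Qed.
End PVec.

(** On the string w_m = Y^m u one finds E w_(m+1) = (m + 1)(mu - m) w_m; the first m with w_(m+1) =
    0 gives mu = m. *)
Lemma sl2_nat (F : numClosedFieldType) n (E Y H : 'M[F]_n) (u : 'cV[F]_n) (mu : F) :
 nilp Y -> brk E Y = H -> brk H Y = - 2%:R *: Y -> E *m u = 0 -> H *m u = mu *: u -> u != 0 ->
 exists m : nat, mu = m%:R.
Proof.
move=> nY EY HY Eu Hu u0; pose w m := Y ^+ m *m u.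
have wS m : w m.+1 = Y *m w m by rewrite /w exprS mulmxA.
have Hw m : H *m w m = (mu - (2 * m)%:R) *: w m.
 elim: m => [|m IH]; first by rewrite /w expr0 mul1mx Hu subr0.
 have -> : H *m w m.+1 = brk H Y *m w m + Y *m (H *m w m).
  by rewrite wS /brk mulmxBl !mulmxA subrK.
 rewrite HY IH -scalemxAl -wS -scalemxAr -wS -scalerDl; congr (_ *: _).
 by rewrite mulnS natrD; ring.
have Ew m : E *m w m.+1 = (m.+1%:R * (mu - m%:R)) *: w m.
 elim: m => [|m IH].
  have -> : E *m w 1%N = brk E Y *m u + Y *m (E *m u) by rewrite wS /w expr0 mul1mx /brk mulmxBl !mulmxA subrK.
  by rewrite EY Eu mulmx0 addr0 Hu subr0 mul1r /w expr0 mul1mx.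
 have -> : E *m w m.+2 = brk E Y *m w m.+1 + Y *m (E *m w m.+1) by rewrite wS /brk mulmxBl !mulmxA subrK.
 rewrite EY Hw IH -scalemxAr -wS -scalerDl; congr (_ *: _).
 by rewrite natrM -(nat1r m.+1) -(nat1r m); ring.
have ex : exists m, w m == 0 by exists n; rewrite /w nY mul0mx.
have [[|m] /eqP wm min] := ex_minnP ex.
 by move: u0 wm; rewrite /w expr0 mul1mx => /eqP.
exists m; have := Ew m; rewrite wm mulmx0 => /esym/eqP; rewrite scaler_eq0 mulf_eq0 pnatr_eq0 /= subr_eq0.
by case/orP => [/eqP//|/min]; rewrite ltnn.
Qed.

Section Adj.
Variable F : numClosedFieldType.
Lemma eM_ct j : (map_mx Num.conj (eM F j))^T = fM F j. Proof. by rewrite toM_conj -fM_tr. Qed.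
Lemma fM_ct j : (map_mx Num.conj (fM F j))^T = eM F j.
Proof. by rewrite toM_conj -[toMx _ _]/(fM F j) fM_tr trmxK. Qed.
Lemma ebM_ct j : (map_mx Num.conj (ebM F j))^T = fbM F j. Proof. by rewrite toM_conj -fbM_tr. Qed.
Lemma fbM_ct j : (map_mx Num.conj (fbM F j))^T = ebM F j.
Proof. by rewrite toM_conj -[toMx _ _]/(fbM F j) fbM_tr trmxK. Qed.
Lemma hbM_ct j : (map_mx Num.conj (hbM F j))^T = hbM F j. Proof. by rewrite toM_conj hb_tr. Qed.
Lemma DZr A c (p : {mpoly F[27]}) : D A (c *: p) = c *: D A p. Proof. exact: linearZ. Qed.
Lemma brk_D A B (p : {mpoly F[27]}) c c' : c *: D A (c' *: D B p) - c' *: D B (c *: D A p) = (c * c') *: D (brk A B) p.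
Proof. by rewrite !DZr !scalerA (mulrC c') -scalerBr D_comm addrAC subrr add0r. Qed.
End Adj.

Definition wtT (F : numClosedFieldType) (a1 a2 a3 : nat) (j : 'I_6) : F :=
 a1%:R * wt_ F w4 j + a2%:R * wt_ F w2 j + a3%:R * wt_ F w0 j.

(** What the restriction argument takes from the module of G: a definite form exchanging raising and
    lowering operators up to scalars, a primitive vector for every triple, uniqueness of primitive
    vectors of a given weight, and the shape of their weights. *)
Definition branch_data (F : numClosedFieldType) (N : nat) (EB FB HB : 'I_6 -> 'M[F]_N) (k : nat) : Prop :=
 [/\ exists (form : 'cV[F]_N -> 'cV[F]_N -> F) (s s' : 'I_6 -> F),
    [/\ forall a u u' w, form (a *: u + u') w = a * form u w + form u' w,
      forall a u u' w, form w (a *: u + u') = a^* * form w u + form w u',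
      forall u, form u u = 0 -> u = 0 &
      forall j, [/\ s j != 0, s' j != 0,
       forall u w, form u (FB j *m w) = s j * form (EB j *m u) w,
       forall u w, form (FB j *m u) w = s' j * form u (EB j *m w) &
       forall u w, form (HB j *m u) w = form u (HB j *m w)]],
   forall a1 a2 a3, (a1 + 2 * a2 + a3)%N = k -> exists2 p : 'cV[F]_N, p != 0 &
    forall j, EB j *m p = 0 /\ HB j *m p = wtT F a1 a2 a3 j *: p,
   forall (mu : 'I_6 -> F) (p q : 'cV[F]_N), p != 0 -> (forall j, EB j *m p = 0 /\ HB j *m p = mu j *: p) ->
    (forall j, EB j *m q = 0 /\ HB j *m q = mu j *: q) -> exists a, q = a *: p &
   forall (mu : 'I_6 -> F) (p : 'cV[F]_N), p != 0 -> (forall j, EB j *m p = 0 /\ HB j *m p = mu j *: p) ->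
    exists c0 c4 c14 c21 : nat, (c0 + c4 + c14 + c21)%N = k /\
    forall j, mu j = c0%:R * wt_ F w0 j + c4%:R * wt_ F w4 j + c14%:R * wt_ F w14 j + c21%:R * wt_ F w21 j].

(** * Transfer to an arbitrary realization of the irreducible module *)

Section CoreV.
Variables (F : numClosedFieldType) (k N : nat) (EA FA HA EB FB HB : 'I_6 -> 'M[F]_N) (v : 'cV[F]_N).
Notation W := {mpoly F[27]}.
Hypotheses (efA : forall i j, brk (EA i) (FA j) = if i == j then HA i else 0)
 (hfA : forall i j, brk (HA i) (FA j) = - (C6 i j)%:~R *: FA j) (v0 : v != 0) (Ev : forall i, EA i *m v = 0)
 (Hv : forall i, HA i *m v = (if i == inord 0 then k%:R else 0) *: v) (irrA : irrP (mop EA) (mop FA))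
 (EB_s : forall j, j != ord_max -> exists2 a, a != 0 & EB j = a *: EA (sj j))
 (FB_s : forall j, j != ord_max -> exists2 a, a != 0 & FB j = a *: FA (sj j))
 (EB_n : exists2 a, a != 0 & nest EA thp (EA (inord 5)) = a *: EB ord_max)
 (FB_n : exists2 a, a != 0 & nest FA thp (FA (inord 5)) = a *: FB ord_max) (efB : forall j, brk (EB j) (FB j) = HB j)
 (heB : forall j, brk (HB j) (EB j) = 2%:R *: EB j).

(** Half the sum of the positive coroots of E6, on which every simple root takes the value 1. *)
Let r : 'I_6 -> F := fun i => (nth 0 [:: 8; 11; 15; 21; 15; 8] i)%N%:R.
Lemma rc6 (j : 'I_6) : \sum_i r i * (C6 i j)%:~R = 1.
Proof.
rewrite sum6 /r; elim/ord6_ind: j; rewrite !C6E !inordK //= /Cl /=; ring.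
Qed.
Lemma eM_d0 i : eM F i *m colL F (dL 0) = 0.
Proof. by have /andP [h _] := all6P hw_vec0 i; exact: (eqL_col0 F h). Qed.
Lemma hM_d0 i : hM F i *m colL F (dL 0) = (if i == inord 0 then 1 else 0) *: colL F (dL 0).
Proof.
have /andP [_ h] := all6P hw_vec0 i; rewrite [LHS](eqL_colS F h); congr (_ *: _).
by rewrite -val_eqE /= inordK //; case: eqP.
Qed.
Lemma D_brk' A B (p : W) : D (brk A B) p = D A (D B p) - D B (D A p).
Proof. by rewrite D_comm /brk addrAC subrr add0r. Qed.
Lemma D_brk2 A B (p : W) : D A (D B p) = D B (D A p) + D (brk A B) p.
Proof. by rewrite D_comm. Qed.

(** x_0^k has highest weight k omega_1, and the Fischer form exchanges e_i and f_i since f_i is the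
    real transpose of e_i; [psi_exists] then embeds the module into polynomials. *)
Lemma psi_E6 : exists psi : {linear 'cV[F]_N -> W}, [/\ psi v = 'X_0 ^+ k,
 forall u, psi u = 0 -> u = 0, forall j u, psi (EA j *m u) = D (eM F j) (psi u) &
 forall j u, psi (FA j *m u) = D (fM F j) (psi u)].
Proof.
have [||||||||||||psi [h1 h2 h3 h4 _]] := @psi_exists F 'I_6 'cV[F]_N W (mop EA) (mop FA) (mop HA)
 (fun j => D (eM F j)) (fun j => D (fM F j)) (fun j => D (hM F j)) (fun i j => (C6 i j)%:~R) r
 (fun i => if i == inord 0 then k%:R else 0) v ('X_0 ^+ k) _ _ _ _ rc6 v0 _ Ev Hv _ _ irrA (@form F 27) (fun=> 1) (fun=> 1).
- exact: mEF.
- exact: mHF.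
- move=> i j u; rewrite D_brk2 brk_eM_fM; case: (i == j) => //.
 by rewrite D_0.
- move=> i j u; rewrite D_brk2 brk_hM_fM; move: (fM F j) => A.
 by rewrite D_Z scaleNr.
- by rewrite -lf_delta; apply: lfk_neq0; rewrite mxE !eqxx.
- by move=> i; rewrite D_pow -yv0 D_lf eM_d0 lf0 mulr0 scaler0.
- move=> i; rewrite D_pow -yv0 D_lf hM_d0; case: eqP => _; last by rewrite !scale0r lf0 mulr0 scaler0.
 by rewrite scale1r; case: (k) => [|d] /=; rewrite ?scale0r ?exprSr.
- by move=> *; exact: form_l.
- by move=> *; exact: form_r.
- by move=> *; exact: form_pos.
- by move=> j u w; rewrite mul1r form_D eM_ct.
- by move=> j u w; rewrite mul1r form_D fM_ct.
by exists psi.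
Qed.

Lemma core : branch_data EB FB HB k.
Proof.
have [psi [psv psi0 psE psF]] := psi_E6.
have pZ a u : psi (a *: u) = a *: psi u by rewrite linearZ.
pose R w := exists u, w = psi u.
have linR : linP R.
 split; first by exists 0; rewrite linear0.
 by move=> a u w [x ->] [y ->]; exists (a *: x + y); rewrite linearP.
have psB A A' B B' : (forall u, psi (A *m u) = D A' (psi u)) -> (forall u, psi (B *m u) = D B' (psi u)) ->
  forall u, psi (brk A B *m u) = D (brk A' B') (psi u).
 move=> hA hB u; rewrite D_brk' /brk mulmxBl linearB /= -!mulmxA.
 by rewrite hA !hB hA.
have psN Z Z' : (forall i u, psi (Z i *m u) = D (Z' i) (psi u)) -> forall p A A', (forall u, psi (A *m u) = D A' (psi u)) ->
  forall u, psi (nest Z p A *m u) = D (nest Z' p A') (psi u).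
 move=> hZ; elim=> [|i p IH] A A' hA //=; apply: IH.
 exact: psB.
have EBx j : exists2 a, a != 0 & forall u, psi (EB j *m u) = a *: D (ebM F j) (psi u).
 have [->|jm] := eqVneq j ord_max.
  have [a a0 e] := EB_n; exists a^-1; rewrite ?invr_eq0 // => u.
  rewrite -nest_eM -(psN EA (eM F) psE thp (EA (inord 5)) (eM F (inord 5)) (psE _)).
  by rewrite e -scalemxAl pZ scalerA mulVf // scale1r.
 have [a a0 e] := EB_s jm; exists a => // u.
 by rewrite e -scalemxAl pZ psE ebM_lt.
have FBx j : exists2 a, a != 0 & forall u, psi (FB j *m u) = a *: D (fbM F j) (psi u).
 have [->|jm] := eqVneq j ord_max.
  have [a a0 e] := FB_n; exists a^-1; rewrite ?invr_eq0 // => u.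
  rewrite -nest_fM -(psN FA (fM F) psF thp (FA (inord 5)) (fM F (inord 5)) (psF _)).
  by rewrite e -scalemxAl pZ scalerA mulVf // scale1r.
 have [a a0 e] := FB_s jm; exists a => // u.
 by rewrite e -scalemxAl pZ psF fbM_lt.
(* Root vectors match only up to scalars a and b, so coroots match up to ab. Comparing [H, E] = 2E
   on both sides gives ab = 1, unless the raising operator vanishes on the image, and then both
   coroot operators are 0 there. *)
have psHB j u : psi (HB j *m u) = D (hbM F j) (psi u).
 have [a a0 ha] := EBx j; have [b b0 hb] := FBx j.
 have ab w : psi (HB j *m w) = (a * b) *: D (hbM F j) (psi w).
  by rewrite -efB /brk mulmxBl linearB -!mulmxA ha hb hb ha brk_D brk_ebM.
 have [ab1|ab1] := eqVneq (a * b) 1; first by rewrite ab ab1 scale1r.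
 have E0 w : D (ebM F j) (psi w) = 0.
  have /eqL_toM h2 := all6P br_hb_eb j.
  have h3 : brk (hbM F j) (ebM F j) = 2%:R *: ebM F j by rewrite -toM_br h2 toM_sca.
  have : psi (brk (HB j) (EB j) *m w) = (a * b * a) *: D (brk (hbM F j) (ebM F j)) (psi w).
   by rewrite /brk mulmxBl linearB -!mulmxA ab ha ha ab brk_D.
  rewrite heB -scalemxAl pZ ha h3 D_Z !scalerA => /eqP; rewrite -subr_eq0 -scalerBl scaler_eq0.
  case/orP => [|/eqP //]; rewrite (_ : _ - _ = 2%:R * a * (1 - a * b)); last by ring.
  by rewrite !mulf_eq0 pnatr_eq0 (negPf a0) /= subr_eq0 eq_sym (negPf ab1).
 rewrite ab -brk_ebM D_brk' E0 linear0 subr0.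
 have -> : D (fbM F j) (psi u) = psi (b^-1 *: (FB j *m u)) by rewrite pZ hb scalerA mulVf // scale1r.
 by rewrite E0 scaler0.
have RE i p : R p -> R (D (eM F i) p) by case=> u ->; exists (EA i *m u); rewrite psE.
have RF i p : R p -> R (D (fM F i) p) by case=> u ->; exists (FA i *m u); rewrite psF.
have R0 : R ('X_0 ^+ k) by exists v.
have Rirr (U : W -> Prop) : linP U -> (forall i p, U p -> U (D (eM F i) p)) ->
  (forall i p, U p -> U (D (fM F i) p)) -> (exists u, [/\ R u, U u & u != 0]) -> forall p, R p -> U p.
 move=> [U0 Ul] UE UF [_ [[u ->] Uu u0]] _ [w ->].
 apply: (irrA (U := fun u => U (psi u))).
 - split; first by rewrite linear0.
  by move=> a x y hx hy; rewrite linearP; exact: Ul.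
 - by move=> j x hx; rewrite psE; exact: UE.
 - by move=> j x hx; rewrite psF; exact: UF.
 - by exists u => //; apply: contraNneq u0 => ->; rewrite linear0.
have RB mu p : (forall j, EB j *m p = 0 /\ HB j *m p = mu j *: p) ->
  [/\ R (psi p), forall j, D (ebM F j) (psi p) = 0 & forall j, D (hbM F j) (psi p) = mu j *: psi p].
 move=> h; split; first by exists p.
  move=> j; have [a a0 ha] := EBx j; have := ha p; rewrite (h j).1 linear0 => /esym/eqP.
  by rewrite scaler_eq0 (negPf a0) => /eqP.
 by move=> j; rewrite -psHB (h j).2 pZ.
have psn p : p != 0 -> psi p != 0 by apply: contraNneq => /psi0 ->.
pose fV u w := form (psi u) (psi w).
have fl a u u' w : fV (a *: u + u') w = a * fV u w + fV u' w by rewrite /fV linearP form_l.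
have fr a u u' w : fV w (a *: u + u') = a^* * fV w u + fV w u' by rewrite /fV linearP form_r.
have fpos u : fV u u = 0 -> u = 0 by move=> /form_pos /psi0.
split.
- have cE := fun j => cid2 (EBx j); have cF := fun j => cid2 (FBx j).
 pose a j := projT1 (cE j); pose b j := projT1 (cF j).
 have a0 j : a j != 0 by rewrite /a; case: (cE j).
 have b0 j : b j != 0 by rewrite /b; case: (cF j).
 have ha j : forall u, psi (EB j *m u) = a j *: D (ebM F j) (psi u) by rewrite /a; case: (cE j).
 have hb j : forall u, psi (FB j *m u) = b j *: D (fbM F j) (psi u) by rewrite /b; case: (cF j).
 exists fV, (fun j => (b j)^* / a j), (fun j => b j / (a j)^*); split=> // j; split=> [||u w|u w|u w]; rewrite /fV.
 + by rewrite mulf_neq0 ?invr_eq0 ?conjC_eq0.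
 + by rewrite mulf_neq0 ?invr_eq0 ?conjC_eq0.
 + by rewrite ha hb form_Zr form_Zl mulrA divfK // [in RHS]form_D ebM_ct.
 + by rewrite ha hb form_Zr form_Zl mulrA divfK ?conjC_eq0 // form_D fbM_ct.
 + by rewrite !psHB form_D hbM_ct.
- move=> a1 a2 a3 ak; pose p := pvec F a1 a2 a3.
 (* The product p need not lie in the image of [psi]; g represents its orthogonal projection, found
    by inverting a Gram matrix. It is nonzero because l0^k lies in the image and pairs nontrivially
    with p. *)
 have [g gp] : exists g, forall u, fV u g = form (psi u) p.
  pose e (i : 'I_N) : 'cV[F]_N := delta_mx i 0.
  have ue (u : 'cV[F]_N) : u = \sum_i u i 0 *: e i.
   by apply/matrixP => i j; rewrite summxE (bigD1 i) //= !mxE !eqxx ord1 mulr1 big1 ?addr0 // => l /negPf il; rewrite !mxE eq_sym il mulr0.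
  pose Gm := \matrix_(i, j) fV (e i) (e j).
  have Gu : Gm \in unitmx.
   rewrite -row_free_unit -kermx_eq0; apply/eqP/row_matrixP => i; rewrite row0.
   set x := row i _; have xG : x *m Gm = 0 by apply/sub_kermxP; exact: row_sub.
   have : fV x^T x^T = 0.
    have H y : fV x^T y = 0.
     rewrite [y]ue; elim/big_rec: _ => [|j y' _ h]; first by rewrite /fV linear0 form_0r.
     rewrite fr h addr0.
     have -> : fV x^T (e j) = (x *m Gm) 0 j.
      rewrite [x^T]ue [RHS]mxE /fV raddf_sum /= form_suml; apply: eq_bigr => l _.
      by rewrite pZ form_Zl !mxE.
     by rewrite xG mxE mulr0.
    exact: H.
   by move=> /fpos /(congr1 trmx); rewrite trmxK trmx0.
  pose y := invmx Gm *m \col_i form (psi (e i)) p.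
  exists (map_mx Num.conj y) => u; rewrite [u]ue {1}/fV !raddf_sum /= !form_suml.
  apply: eq_bigr => i _; rewrite !pZ !form_Zl; congr (_ * _).
  have -> : form (psi (e i)) p = (Gm *m y) i 0 by rewrite /y mulKVmx // mxE.
  rewrite [X in form _ (GRing.Linear.sort psi X)]ue raddf_sum /= form_sumr mxE; apply: eq_bigr => j _.
  by rewrite pZ form_Zr !mxE conjCK mulrC.
 have fe u w : (forall x, fV x u = fV x w) -> u = w.
  move=> h; have hx x : fV x (u - w) = 0; last by apply/eqP; rewrite -subr_eq0; apply/eqP/fpos.
  by rewrite -(scaleN1r w) addrC fr h rmorphN rmorph1 mulN1r addNr.
 exists g.
  apply/eqP => g0; have := pvec_form F a1 a2 a3; rewrite ak -[_ ^+ k]/(l0k F k).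
  have [u ->] := l0k_in linR RF R0; rewrite -gp g0 /fV linear0 form_0r.
  by rewrite eqxx.
 move=> j; have [a a0 ha] := EBx j; have [b b0 hb] := FBx j; split.
  apply: fe => x; rewrite [RHS]/fV linear0 form_0r.
  rewrite /fV ha form_Zr.
  have := form_D (fbM F j) (psi x) (psi g); rewrite fbM_ct => <-.
  rewrite (_ : D (fbM F j) (psi x) = psi (b^-1 *: (FB j *m x))); last by rewrite pZ hb scalerA mulVf // scale1r.
  rewrite -/(fV _ _) gp pZ hb scalerA mulVf // scale1r form_D fbM_ct.
  by rewrite pvec_E form_0r mulr0.
 apply: fe => x; rewrite {1}/fV psHB.
 have := form_D (hbM F j) (psi x) (psi g); rewrite hbM_ct => <-.
 rewrite -psHB -/(fV _ _) gp psHB form_D hbM_ct pvec_H /fV pZ !form_Zr.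
 by rewrite -/(fV _ _) gp.
- move=> mu p q p0 /RB [Rp Ep Hp] /RB [Rq Eq Hq].
 have [a e] := prim_dep linR RF Rirr R0 Rp Rq (psn _ p0) Ep Eq Hp Hq.
 exists a; apply/eqP; rewrite -subr_eq0; apply/eqP/psi0.
 by rewrite linearB /= e pZ subrr.
- move=> mu p p0 /RB [Rp Ep Hp].
 exact: (prim_wt linR RF Rirr R0 Rp Ep Hp (psn _ p0)).
Qed.
End CoreV.

(** * Operators of a representation of a group containing root subgroups *)

Section RepOps.
Variables (F : numClosedFieldType) (n d : nat) (S : set 'M[F]_n) (rho : 'M[F]_n -> 'M[F]_d)
 (J : finType) (b : pred J) (X Y Q : J -> 'M[F]_n) (z : J -> 'I_n -> int) (C : J -> J -> int).
Hypotheses (sS : subgroup S) (hr : algebraic_hom S rho) (Xn : forall j, nilp (X j)) (Yn : forall j, nilp (Y j))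
 (XS : forall j c, b j -> S (expm (c *: X j))) (YS : forall j c, b j -> S (expm (c *: Y j)))
 (Qu : forall j, Q j \in unitmx) (QS : forall j c, b j -> c != 0 -> S (cdiag (Q j) (fun i => c ^ z j i))).
Notation Hg := (Hi Q z).
Hypotheses (XY : forall i j, brk (X i) (Y j) = if i == j then Hg i else 0)
 (HX : forall i j, brk (Hg i) (X j) = (C i j)%:~R *: X j) (HY : forall i j, brk (Hg i) (Y j) = - (C i j)%:~R *: Y j)
 (C0 : forall i j, b i != b j -> C i j = 0).

Lemma brk0l m (A : 'M[F]_m) : brk 0 A = 0. Proof. by rewrite /brk mul0mx mulmx0 subrr. Qed.
Lemma brk0r m (A : 'M[F]_m) : brk A 0 = 0. Proof. by rewrite /brk mul0mx mulmx0 subrr. Qed.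

Lemma cdiag_eig (P : 'M[F]_d) (y : 'I_d -> int) (v : 'cV[F]_d) (m : int) : P \in unitmx ->
 (forall c, c != 0 -> cdiag P (fun i => c ^ y i) *m v = c ^ m *: v) ->
 cdiag P (fun i => (y i)%:~R) *m v = m%:~R *: v.
Proof.
move=> Pu h; pose w := P *m v.
have hw i : w i 0 = 0 \/ y i = m.
 have [->|w0] := eqVneq (w i 0) 0; [by left | right].
 have n2 : (2%:R : F) != 0 by rewrite pnatr_eq0.
 have /(congr1 (fun u : 'cV[F]_d => (P *m u) i 0)) := h 2%:R n2.
 rewrite mulmxA mul_cdiag // -mulmxA -/w mul_diag_mx mxE mxE -scalemxAr -/w [RHS]mxE.
 by move=> /(mulIf w0) /int2_eq.
rewrite -[LHS](mulKmx Pu) -[RHS](mulKmx Pu); congr (_ *m _).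
rewrite mulmxA mul_cdiag // -mulmxA -/w mul_diag_mx -scalemxAr -/w; apply/matrixP => i j.
rewrite mxE [RHS]mxE mxE !ord1; case: (hw i) => [->|->//].
by rewrite !mulr0.
Qed.

(** Operators are set to 0 outside [b], so that modules of A5, of A1 and of the whole group are
    indexed by the same nodes. *)
Definition ops_triple (t : (J -> 'M[F]_d) * (J -> 'M[F]_d) * (J -> 'M[F]_d)) : Prop :=
 [/\ forall j, ~~ b j -> [/\ t.1.1 j = 0, t.1.2 j = 0 & t.2 j = 0],
   (forall i j, brk (t.1.1 i) (t.1.2 j) = if i == j then t.2 i else 0) /\
   (forall i j, brk (t.2 i) (t.1.2 j) = - (C i j)%:~R *: t.1.2 j),
   (forall i j, brk (t.2 i) (t.1.1 j) = (C i j)%:~R *: t.1.1 j) /\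
   (forall i j, brk (t.2 i) (t.2 j) = 0),
   forall j, b j -> [/\ nilp (t.1.1 j), nilp (t.1.2 j), forall c, rho (expm (c *: X j)) = expm (c *: t.1.1 j),
    forall c, rho (expm (c *: Y j)) = expm (c *: t.1.2 j) & drho S rho (X j) (t.1.1 j) /\ drho S rho (Y j) (t.1.2 j)] &
   forall j v (m : int), b j -> (forall c, c != 0 -> rho (cdiag (Q j) (fun i => c ^ z j i)) *m v = c ^ m *: v) ->
    t.2 j *m v = m%:~R *: v :> 'cV[F]_d].

(** Relations between root vectors pass to the operators because the differential is single-valued
    ([drho_fun]). Between an index in [b] and one outside they hold since the outer operators vanish
    and so do the constants, by [C0]. *)
Lemma rep_ops : exists t, ops_triple t.
Proof.
have ex (Z : J -> 'M[F]_n) : (forall j, nilp (Z j)) -> (forall j c, b j -> S (expm (c *: Z j))) ->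
  exists E : J -> 'M[F]_d, forall j, if b j then [/\ nilp (E j), forall c, rho (expm (c *: Z j)) = expm (c *: E j) & drho S rho (Z j) (E j)] else E j = 0.
 move=> Zn ZS.
 have H j : exists A : 'M[F]_d, if b j then [/\ nilp A, forall c, rho (expm (c *: Z j)) = expm (c *: A) & drho S rho (Z j) A] else A = 0.
  case bj: (b j); last by exists 0.
  have [A nA hA] := drho_exists hr (Zn j) (fun c => ZS j c bj).
  exists A; split=> //; apply: drho_exp => //.
  by move=> c; exact: ZS.
 by have [E hE] := choice H; exists E.
have [E hE] := ex X Xn XS; have [Fo hF] := ex Y Yn YS.
pose H j := brk (E j) (Fo j).
have E0 j : ~~ b j -> E j = 0 by move=> nb; have := hE j; rewrite (negPf nb).
have F0 j : ~~ b j -> Fo j = 0 by move=> nb; have := hF j; rewrite (negPf nb).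
have H0 j : ~~ b j -> H j = 0 by move=> nb; rewrite /H E0 // brk0l.
have dr A B A' : drho S rho A B -> drho S rho A' B -> True by [].
have dfun A B B' : drho S rho A B -> drho S rho A B' -> B = B' by apply: drho_fun.
have dX j : b j -> [/\ nilp (E j), forall c, rho (expm (c *: X j)) = expm (c *: E j) & drho S rho (X j) (E j)].
 by move=> bj; have := hE j; rewrite bj.
have dY j : b j -> [/\ nilp (Fo j), forall c, rho (expm (c *: Y j)) = expm (c *: Fo j) & drho S rho (Y j) (Fo j)].
 by move=> bj; have := hF j; rewrite bj.
have dXb j B B' : b j -> drho S rho B B' -> drho S rho (brk (X j) B) (brk (E j) B').
 by move=> bj h; have [h1 h2 h3] := dX j bj; apply: drho_brk => // c; exact: XS.
have dYb j B B' : b j -> drho S rho B B' -> drho S rho (brk (Y j) B) (brk (Fo j) B').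
 by move=> bj h; have [h1 h2 h3] := dY j bj; apply: drho_brk => // c; exact: YS.
have dH j : b j -> drho S rho (Hg j) (H j).
 move=> bj; have := dXb j _ _ bj (let: And3 _ _ h := dY j bj in h).
 by rewrite XY eqxx.
have d0 : drho S rho 0 0.
 have [j bj|nb] := pickP b; last first.
  rewrite /drho; have -> : bd 0 0 = 0 :> 'M[F]_(n + d) by rewrite bd0.
  exact: Lie0.
 by have := drhoZ 0 (dH j bj); rewrite !scale0r.
have ef i j : brk (E i) (Fo j) = if i == j then H i else 0.
 case: eqP => [<-//|/eqP ij].
 have [bi|nb] := boolP (b i); last by rewrite E0 // brk0l.
 have [bj|nb] := boolP (b j); last by rewrite F0 // brk0r.
 have := dXb i _ _ bi (let: And3 _ _ h := dY j bj in h).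
 by rewrite XY (negPf ij) => h; exact: (dfun _ _ _ h d0).
have hf i j : brk (H i) (Fo j) = - (C i j)%:~R *: Fo j.
 have [bi|nb] := boolP (b i); last first.
  have [bj|nbj] := boolP (b j); last by rewrite F0 // brk0r scaler0.
  by rewrite H0 // brk0l C0 ?oppr0 ?scale0r // (negPf nb) bj.
 have [bj|nb] := boolP (b j); last by rewrite F0 // brk0r scaler0.
 have [_ _ dYj] := dY j bj.
 have h := dYb j _ _ bj (dH i bi).
 rewrite brkC HY -scaleNr opprK in h; rewrite brkC -(dfun _ _ _ (drhoZ _ dYj) h).
 by rewrite -scaleNr.
have he i j : brk (H i) (E j) = (C i j)%:~R *: E j.
 have [bi|nb] := boolP (b i); last first.
  have [bj|nbj] := boolP (b j); last by rewrite E0 // brk0r scaler0.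
  by rewrite H0 // brk0l C0 ?scale0r // (negPf nb) bj.
 have [bj|nb] := boolP (b j); last by rewrite E0 // brk0r scaler0.
 have [_ _ dXj] := dX j bj.
 have h := dXb j _ _ bj (dH i bi).
 rewrite brkC HX -scaleNr in h; rewrite brkC -(dfun _ _ _ (drhoZ _ dXj) h).
 by rewrite -scaleNr opprK.
exists (E, Fo, H); split=> //=; first by move=> j nb; split; [exact: E0 | exact: F0 | exact: H0].
- split=> // i j; rewrite [X in brk _ X]/H brkC brk_jacobi.
 have h1 : brk (E j) (H i) = - ((C i j)%:~R *: E j) by rewrite brkC he.
 have h2 : brk (Fo j) (H i) = (C i j)%:~R *: Fo j by rewrite brkC hf scaleNr opprK.
 rewrite h2 brkZ h1 -scaleNr brkZ scaleNr [brk (Fo j) _]brkC scalerN opprK.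
 by rewrite subrr oppr0.
- move=> j bj; have [h1 h2 h3] := dX j bj; have [h4 h5 h6] := dY j bj.
 by split.
move=> j v m bj hv.
have [P [y [Pu hP]]] := rho_cochar hr (Qu j) (fun c => QS bj (c := c)).
have := drho_cochar (Qu j) Pu (fun c => QS bj (c := c)) hP => h.
rewrite (dfun _ _ _ (dH j bj) h); apply: cdiag_eig => // c c0.
by rewrite -hP // hv.
Qed.

Lemma expm_stab (A : 'M[F]_d) (U : 'cV[F]_d -> Prop) c u : linP U -> (forall u, U u -> U (A *m u)) ->
 U u -> U (expm (c *: A) *m u).
Proof.
move=> lU hA Uu; rewrite /expm mulmx_suml; apply: linP_sum => // k.
rewrite -scalemxAl exprZmx -scalemxAl; do 2 apply: linP_Z => //.
elim: (k : nat) => [|m IH]; first by rewrite expr0 mul1mx.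
by rewrite exprS -mulmxA; exact: hA.
Qed.

Section Irr.
Variables E Fo : J -> 'M[F]_d.
Hypotheses (En : forall j, ~~ b j -> E j = 0 /\ Fo j = 0)
 (Ee : forall j, b j -> (forall c, rho (expm (c *: X j)) = expm (c *: E j)) /\ (forall c, rho (expm (c *: Y j)) = expm (c *: Fo j))).

Let gS : gens (UB X Y b) `<=` S.
Proof. by apply: gens_min => //; apply: UB_sub => j c bj; split; [exact: XS | exact: YS]. Qed.

Lemma UB_ind (P : 'M[F]_n -> Prop) : P 1%:M -> (forall g h, S g -> S h -> P g -> P h -> P (g *m h)) ->
 (forall j c, b j -> P (expm (c *: X j)) /\ P (expm (c *: Y j))) -> forall g, gens (UB X Y b) g -> P g.
Proof.
move=> P1 PM PX; apply: (gens_ind (UB_GL Xn Yn) (UB_inv Xn Yn) P1) => g x gg ux Pg.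
by apply: PM => //; [exact: gS | apply: gS; exact: sub_gens | exact: (UB_sub PX)].
Qed.

(** A subspace stable under the operators is stable under their exponentials, hence under the dense
    subgroup these generate; stability is a closed condition, so it holds for all of [S]. *)
Lemma irr_ops : irreducible_rep S rho -> S `<=` zcl (gens (UB X Y b)) -> irrP (mop E) (mop Fo).
Proof.
move=> [d0 irr] hS U lU UE UF [u0 Uu0 u00].
have [rr r1 rM] := hr; have [Su S1 SM SV] := sS.
have [Uv hUv] : exists Uv : {vspace 'cV[F]_d}, forall u, u \in Uv <-> U u.
 apply: sub_vspace; first exact: lU.1.
  by move=> x y; exact: linP_D.
 by move=> c x; exact: linP_Z.
have stG g : gens (UB X Y b) g -> forall u, U u -> U (rho g *m u).
 apply: (UB_ind (P := fun g => forall u, U u -> U (rho g *m u))) => [u Uu|x y Sx Sy hx hy u Uu|j c bj].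
 - by rewrite r1 mul1mx.
 - by rewrite rM // -mulmxA; apply: hx; exact: hy.
 have [eX eY] := Ee bj; rewrite eX eY; split=> u Uu.
  by apply: (expm_stab c lU _ Uu) => w; exact: (UE j).
 by apply: (expm_stab c lU _ Uu) => w; exact: (UF j).
pose L u : 'cV[F]_d := u - projv Uv u.
(* A matrix with kernel U: stability of U becomes the equations K rho(g) u = 0, regular in g. *)
pose K : 'M[F]_d := \matrix_(i, j) L (delta_mx j 0) i 0.
have KL u : K *m u = L u.
 apply/matrixP => i j; rewrite !ord1 mxE.
 have {2}-> : u = \sum_k u k 0 *: delta_mx k 0.
  apply/matrixP => a c; rewrite summxE (bigD1 a) //= !mxE !eqxx ord1 mulr1 big1 ?addr0 // => l /negPf il.
  by rewrite !mxE eq_sym il mulr0.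
 have -> : L (\sum_k u k 0 *: delta_mx k 0) = \sum_k u k 0 *: L (delta_mx k 0).
  rewrite /L linear_sum -sumrB; apply: eq_bigr => k _.
  by rewrite linearZ /= scalerBr.
 by rewrite summxE; apply: eq_bigr => k _; rewrite !mxE mulrC.
have Kin u : (K *m u = 0) <-> U u.
 rewrite KL /L -hUv; split=> [/eqP|/projv_id ->]; last by rewrite subrr.
 by rewrite subr_eq0 => /eqP ->; exact: memv_proj.
have stS g u : S g -> u \in Uv -> rho g *m u \in Uv.
 move=> Sg /hUv Uu; apply/hUv/Kin/matrixP => i j; rewrite [RHS]mxE ord1.
 have reg : regular_on S (fun g => (K *m (rho g *m u)) i 0).
  have SU : S `<=` @GLset F n by move=> x /Su.
  apply: (regular_mulmxl SU) => a c.
  by apply: (regular_mulmxr SU); exact: rr.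
 have [p [e he]] := reg; rewrite he //.
 have -> : mxeval p g = 0; last by rewrite mul0r.
 apply: (zcl_vanish _ (hS _ Sg)) => x gx.
 have := he _ (gS gx); have /(Kin _) -> := stG x gx u Uu.
 rewrite mxE => /esym/eqP; rewrite mulf_eq0 invr_eq0 => /orP [/eqP //|].
 have := Su _ (gS gx); rewrite unitmxE unitfE => /negPf dx.
 by rewrite expf_eq0 dx andbF.
case: (irr Uv stS) => e u; last by apply/hUv; rewrite e memvf.
have := iffRL (hUv u0) Uu0; rewrite e memv0 => /eqP u00'.
by rewrite u00' eqxx in u00.
Qed.
End Irr.
End RepOps.

Section Vec.
Variable F : numClosedFieldType.
Definition vecm m n (u : 'M[F]_(m, n)) : 'cV[F]_(m * n) := \col_l u (mxtens_unindex l).1 (mxtens_unindex l).2.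
Lemma vecm_surj m n (x : 'cV[F]_(m * n)) : x = vecm (\matrix_(i, j) x (mxtens_index (i, j)) 0).
Proof. by apply/matrixP => l j; rewrite !mxE ord1 -surjective_pairing mxtens_unindexK. Qed.
Lemma tens_vecm m n (A : 'M[F]_m) (B : 'M[F]_n) (u : 'M[F]_(m, n)) : (A *t B) *m vecm u = vecm (A *m u *m B^T).
Proof.
apply/matrixP => l j; rewrite -[l]mxtens_unindexK; case: (mxtens_unindex l) => i i'.
rewrite mxE [RHS]mxE mxtens_indexK [(i, i').1]/= [(i, i').2]/= mxE.
rewrite (reindex (@mxtens_index m n)) /=; last first.
 by exists (@mxtens_unindex m n) => x _; [exact: mxtens_indexK | exact: mxtens_unindexK].
under [RHS]eq_bigr do rewrite mxE mulr_suml.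
rewrite [RHS]exchange_big pair_bigA; apply: eq_bigr => -[x y] _.
rewrite tensmxE [vecm _ _ _]mxE mxtens_indexK [(x, y).1]/= [(x, y).2]/= [B^T _ _]mxE.
by rewrite mulrAC.
Qed.
End Vec.

(** * Orthogonal decomposition into outer tensor products *)

Section Decomp.
Variables (F : numClosedFieldType) (k N : nat) (I : finType) (b1 b2 b3 : I -> nat) (EB FB HB : 'I_6 -> 'M[F]_N)
 (form : 'cV[F]_N -> 'cV[F]_N -> F) (s s' : 'I_6 -> F).
Hypotheses (fl : forall a u u' w, form (a *: u + u') w = a * form u w + form u' w)
 (fr : forall a u u' w, form w (a *: u + u') = a^* * form w u + form w u') (fpos : forall u, form u u = 0 -> u = 0).
Hypothesis fs : forall j, [/\ s j != 0, s' j != 0,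
       forall u w, form u (FB j *m w) = s j * form (EB j *m u) w,
       forall u w, form (FB j *m u) w = s' j * form u (EB j *m w) &
       forall u w, form (HB j *m u) w = form u (HB j *m w)].
Variable p : I -> 'cV[F]_N.
Hypotheses (p0 : forall a, p a != 0) (pE : forall a j, EB j *m p a = 0)
 (pH : forall a j, HB j *m p a = wtT F (b1 a) (b2 a) (b3 a) j *: p a).
Hypothesis puniq : forall (mu : 'I_6 -> F) (p q : 'cV[F]_N), p != 0 -> (forall j, EB j *m p = 0 /\ HB j *m p = mu j *: p) ->
    (forall j, EB j *m q = 0 /\ HB j *m q = mu j *: q) -> exists a, q = a *: p.
Hypothesis pwt : forall (mu : 'I_6 -> F) (p : 'cV[F]_N), p != 0 -> (forall j, EB j *m p = 0 /\ HB j *m p = mu j *: p) ->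
    exists c0 c4 c14 c21 : nat, (c0 + c4 + c14 + c21)%N = k /\
    forall j, mu j = c0%:R * wt_ F w0 j + c4%:R * wt_ F w4 j + c14%:R * wt_ F w14 j + c21%:R * wt_ F w21 j.
Hypothesis nF : forall j, nilp (FB j).
Notation C := (fun i j => (CB i j)%:~R : F).
Hypotheses (efB : forall i j, brk (EB i) (FB j) = if i == j then HB i else 0)
 (hfB : forall i j, brk (HB i) (FB j) = - C i j *: FB j) (heB : forall i j, brk (HB i) (EB j) = C i j *: EB j)
 (hhB : forall i j, brk (HB i) (HB j) = 0)
 (b_inj : forall a a', b1 a = b1 a' -> b2 a = b2 a' -> b3 a = b3 a' -> a = a')
 (b_surj : forall x y w, (x + 2 * y + w)%N = k -> exists a, [/\ b1 a = x, b2 a = y & b3 a = w]).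
Variables (dA dB : I -> nat) (XA YA ZA : forall a, 'I_6 -> 'M[F]_(dA a)) (XZ YZ ZZ : forall a, 'I_6 -> 'M[F]_(dB a))
 (vA : forall a, 'cV[F]_(dA a)) (vB : forall a, 'cV[F]_(dB a)) (muA muB : I -> 'I_6 -> F).
Hypotheses (zA : forall a j, j == ord_max -> [/\ XA a j = 0, YA a j = 0 & ZA a j = 0])
 (zB : forall a j, j != ord_max -> [/\ XZ a j = 0, YZ a j = 0 & ZZ a j = 0])
 (efA : forall a i j, brk (XA a i) (YA a j) = if i == j then ZA a i else 0)
 (hfA : forall a i j, brk (ZA a i) (YA a j) = - C i j *: YA a j)
 (heA : forall a i j, brk (ZA a i) (XA a j) = C i j *: XA a j) (hhA : forall a i j, brk (ZA a i) (ZA a j) = 0)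
 (efZ : forall a i j, brk (XZ a i) (YZ a j) = if i == j then ZZ a i else 0)
 (hfZ : forall a i j, brk (ZZ a i) (YZ a j) = - C i j *: YZ a j)
 (heZ : forall a i j, brk (ZZ a i) (XZ a j) = C i j *: XZ a j) (hhZ : forall a i j, brk (ZZ a i) (ZZ a j) = 0)
 (vA0 : forall a, vA a != 0) (vB0 : forall a, vB a != 0) (EvA : forall a j, XA a j *m vA a = 0)
 (EvB : forall a j, XZ a j *m vB a = 0) (HvA : forall a j, ZA a j *m vA a = muA a j *: vA a)
 (HvB : forall a j, ZZ a j *m vB a = muB a j *: vB a)
 (muAB : forall a j, muA a j + muB a j = wtT F (b1 a) (b2 a) (b3 a) j)
 (irrA : forall a, irrP (mop (XA a)) (mop (YA a))) (irrB : forall a, irrP (mop (XZ a)) (mop (YZ a))).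

(** Half the sum of the positive coroots of A5 x A1, in the numbering of the beta_j. *)
Let r : 'I_6 -> F := fun i => (nth 0 [:: 5; 8; 9; 8; 5; 1] i)%N%:R / 2%:R.
Lemma rcB (j : 'I_6) : \sum_i r i * (CB i j)%:~R = 1.
Proof.
have n2 : (2%:R : F) != 0 by rewrite pnatr_eq0.
rewrite sum6 /r.
elim/ord6_ind: j; rewrite /CB -!val_eqE /= !inordK //= /sj ?inordK //= ?C6E ?inordK //= /Cl /=; by field.
Qed.

Lemma wtT_0 a : wtT F (b1 a) (b2 a) (b3 a) (inord 1) = (b1 a)%:R /\
 wtT F (b1 a) (b2 a) (b3 a) (inord 3) = (b2 a)%:R /\ wtT F (b1 a) (b2 a) (b3 a) (inord 4) = (b3 a)%:R.
Proof. by rewrite /wtT /wt_ !inordK //= !(mulr0, mulr1, addr0, add0r). Qed.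
Lemma wtT_conj a1 a2 a3 j : (wtT F a1 a2 a3 j)^* = wtT F a1 a2 a3 j.
Proof. by rewrite /wtT /wt_ !rmorphD !rmorphM /= !rmorph_nat !rmorph_int. Qed.

Lemma psi_ex a : exists psi : {linear 'M[F]_(dA a, dB a) -> 'cV[F]_N},
 [/\ psi (vA a *m (vB a)^T) = p a, forall u, psi u = 0 -> u = 0,
   forall j u, psi (tens (XA a j) (XZ a j) u) = EB j *m psi u,
   forall j u, psi (tens (YA a j) (YZ a j) u) = FB j *m psi u &
   forall P : 'cV[F]_N -> Prop, linP P -> P (p a) -> (forall j w, P w -> P (FB j *m w)) -> forall u, P (psi u)].
Proof.
have [t1 t2 t3] := tens_vec (vA0 a) (vB0 a) (EvA a) (EvB a) (HvA a) (HvB a).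
have ir := tens_irr (zA a) (zB a) (@efA a) (@hfA a) (@heA a) (@hhA a) (@efZ a) (@hfZ a) (@heZ a) (@hhZ a)
 rcB (vA0 a) (vB0 a) (EvA a) (EvB a) (HvA a) (HvB a) (@irrA a) (@irrB a).
have t3' j : top_ (ZA a) (ZZ a) j (vA a *m (vB a)^T) = wtT F (b1 a) (b2 a) (b3 a) j *: (vA a *m (vB a)^T).
 by rewrite t3 muAB.
have f1 j u w : form u (mop FB j w) = s j * form (mop EB j u) w by have [_ _ h _ _] := fs j; exact: h.
have f2 j u w : form (mop FB j u) w = s' j * form u (mop EB j w) by have [_ _ _ h _] := fs j; exact: h.
have [psi [h1 h2 h3 h4 h5]] := psi_exists (tEF (@efA a) (@efZ a)) (tHF (@hfA a) (@hfZ a)) (mEF efB) (mHF hfB)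
 rcB t1 (p0 a) t2 t3' (pE a) (pH a) ir fl fr fpos f1 f2.
by exists psi; split.
Qed.
Let psi a := projT1 (cid (psi_ex a)).
Lemma psiP a : [/\ psi a (vA a *m (vB a)^T) = p a, forall u, psi a u = 0 -> u = 0,
   forall j u, psi a (tens (XA a j) (XZ a j) u) = EB j *m psi a u,
   forall j u, psi a (tens (YA a j) (YZ a j) u) = FB j *m psi a u &
   forall P : 'cV[F]_N -> Prop, linP P -> P (p a) -> (forall j w, P w -> P (FB j *m w)) -> forall u, P (psi a u)].
Proof. exact: (projT2 (cid (psi_ex a))). Qed.

Lemma form00 : (forall w, form 0 w = 0) * (forall w, form w 0 = 0).
Proof.
split=> w.
 by have := fl (-1) 0 0 w; rewrite scaler0 addr0 mulN1r addNr.
by have := fr (-1) 0 0 w; rewrite scaler0 addr0 rmorphN rmorph1 mulN1r addNr.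
Qed.
Lemma form_linl w : linP (fun u => form u w = 0).
Proof. by split=> [|a u u' h1 h2]; rewrite ?form00.1 // fl h1 h2 mulr0 addr0. Qed.
(** Primitive vectors of different weights are orthogonal, the coroots being self-adjoint with real
    eigenvalues. Lowering operators then cross the form as raising operators, which kill p_a' in the
    first induction and preserve the image of psi_a in the second. *)
Lemma psi_orth a a' x y : a != a' -> form (psi a x) (psi a' y) = 0.
Proof.
move=> aa.
have [_ _ hE hF ind] := psiP a; have [_ _ hE' hF' ind'] := psiP a'.
have pp : form (p a) (p a') = 0.
 apply/eqP; apply: contraNT aa => f0; apply/eqP.
 have h j : wtT F (b1 a) (b2 a) (b3 a) j = wtT F (b1 a') (b2 a') (b3 a') j.
  have [_ _ _ _ hh] := fs j; have := hh (p a) (p a'); rewrite !pH.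
  have := fl (wtT F (b1 a) (b2 a) (b3 a) j) (p a) 0 (p a'); rewrite addr0 => ->.
  have := fr (wtT F (b1 a') (b2 a') (b3 a') j) (p a') 0 (p a); rewrite addr0 => ->.
  by rewrite !form00 !addr0 wtT_conj => /(mulIf f0).
 have [e1 [e2 e3]] := wtT_0 a; have [e1' [e2' e3']] := wtT_0 a'.
 apply: b_inj; apply/eqP; rewrite -(eqr_nat F).
 - by rewrite -e1 -e1' h.
 - by rewrite -e2 -e2' h.
 - by rewrite -e3 -e3' h.
have pw z : form (psi a z) (p a') = 0.
 move: z; apply: (ind (fun w => form w (p a') = 0) (form_linl _) pp) => j w h.
 by have [_ _ _ hh _] := fs j; rewrite hh pE form00.2 mulr0.
move: y x; pose U w := forall x, form (psi a x) w = 0.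
suff H y : U (psi a' y) by move=> y x; exact: H.
apply: ind' => [||j w h x].
- by split=> [x|c u u' h1 h2 x]; rewrite ?form00.2 // fr h1 h2 mulr0 addr0.
- exact: pw.
by have [_ _ hh _ _] := fs j; rewrite hh -hE h mulr0.
Qed.

(** The orthogonal complement of the images is stable, so if nonzero it contains a primitive weight
    vector. Its weight belongs to a triple, and by uniqueness it is a multiple of some p_a, which
    lies in an image; definiteness excludes this. *)
Lemma psi_total u : (forall a x, form (psi a x) u = 0) -> u = 0.
Proof.
move=> hu; apply/eqP/negPn/negP => u0.
pose U u := forall a x, form (psi a x) u = 0.
have lU : linP U by split=> [a x|c w w' h1 h2 a x]; rewrite ?form00.2 // fr h1 h2 mulr0 addr0.
have UE j w : U w -> U (mop EB j w).
 move=> h a x; have [s0 s0' h1 h2 _] := fs j; have [_ _ _ hF _] := psiP a.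
 by apply/eqP; rewrite -(mulrI_eq0 _ (mulfI s0')) -h2 -hF h.
have UF j w : U w -> U (mop FB j w).
 move=> h a x; have [s0 s0' h1 h2 _] := fs j; have [_ _ hE _ _] := psiP a.
 by rewrite /mop /= h1 -hE h mulr0.
have UH j w : U w -> U (mop HB j w).
 move=> h; have := efB j j; rewrite eqxx => e.
 have -> : mop HB j w = -1 *: mop FB j (mop EB j w) + mop EB j (mop FB j w).
  by rewrite /mop /= -e /brk mulmxBl !mulmxA scaleN1r addrC.
 by apply: lU.2; [apply: UF; exact: UE | apply: UE; exact: UF].
have lK : linP (fun w => U w /\ forall j, EB j *m w = 0).
 split=> [|c w w' [h1 h2] [h3 h4]]; first by split; [exact: lU.1 | move=> j; rewrite mulmx0].
 split; first exact: lU.2.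
 by move=> j; rewrite mulmxDr -scalemxAr h2 h4 scaler0 addr0.
have [|w [Uw w0] Ew] := exists_prim (mHE heB) rcB lU UE UH _ (ex_intro2 _ _ u hu u0).
 have [t ht] := annih (mulmx (\sum_i r i *: HB i) : {linear 'cV[F]_N -> 'cV[F]_N}).
 exists t => x; rewrite (_ : grad (mop HB) r = mulmx (\sum_i r i *: HB i)); first exact: ht.
 apply/funext => y; rewrite /grad mulmx_suml; apply: eq_bigr => i _; by rewrite -scalemxAl.
have [||mu [q [[Uq Eq] q0 Hq]]] := eigs_in (f := mop HB) (enum 'I_6) lK _ _ (mHH hhB) (ex_intro2 _ _ w (conj Uw Ew) w0).
- move=> j x [h1 h2]; split; first exact: UH.
 move=> i; have := heB j i; rewrite /brk => /(congr1 (fun A => A *m x)); rewrite mulmxBl -!mulmxA h2 mulmx0 sub0r -scalemxAl h2 scaler0.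
 by move=> /eqP; rewrite oppr_eq0 => /eqP.
- by move=> j; exact: annih.
have hq j : EB j *m q = 0 /\ HB j *m q = mu j *: q by split=> //; apply: Hq; rewrite mem_enum.
have nat j : exists m : nat, mu j = m%:R.
 apply: (sl2_nat (nF j) (E := EB j) (H := HB j)) q0; [by rewrite efB eqxx| |exact: Eq |exact: (hq j).2].
 rewrite hfB; congr (- _ *: _); rewrite /CB eqxx; case: ifP => // /norP [jm _].
 by rewrite C6_2.
have [c0 [c4 [c14 [c21 [ck hmu]]]]] := pwt q0 hq.
have [m1 e1] := nat (inord 1); have [m2 e2] := nat (inord 4).
(* Dominance at lambda_2 and lambda_5 says c4 >= c14 and c0 >= c21. As w14 = w2 - w4 and w21 = w2 -
   w0, the weight is that of the triple (c4 - c14, c14 + c21, c0 - c21), for which a1 + 2 a2 + a3 =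
   c0 + c4 + c14 + c21 = k. *)
have f1 : (c4 = m1 + c14)%N.
 apply/eqP; rewrite -(eqr_nat F) natrD -e1 hmu /wt_ !inordK //=; apply/eqP; ring.
have f2 : (c0 = m2 + c21)%N.
 apply/eqP; rewrite -(eqr_nat F) natrD -e2 hmu /wt_ !inordK //=; apply/eqP; ring.
have [a [a1 a2 a3]] : exists a, [/\ b1 a = m1, b2 a = (c14 + c21)%N & b3 a = m2] by apply: b_surj; lia.
have hmu' j : mu j = wtT F (b1 a) (b2 a) (b3 a) j.
 rewrite hmu a1 a2 a3 f1 f2 /wtT /wt_ !natrD.
 elim/ord6_ind: j; rewrite !inordK //=; ring.
have hq' j : EB j *m q = 0 /\ HB j *m q = wtT F (b1 a) (b2 a) (b3 a) j *: q by rewrite -hmu'.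
have [c qc] := puniq (p0 a) (fun j => conj (pE a j) (pH a j)) hq'.
have [e _ _ _ _] := psiP a; have := Uq a (vA a *m (vB a)^T); rewrite e qc.
have := fr c (p a) 0 (p a); rewrite addr0 form00.2 addr0 => -> /eqP.
rewrite mulf_eq0 conjC_eq0 => /orP [/eqP c00|/eqP /fpos pa]; last by have := p0 a; rewrite pa eqxx.
by move: q0; rewrite qc c00 scale0r eqxx.
Qed.

Definition Bm a : 'M[F]_(N, dA a * dB a) := \matrix_(i, l) psi a (delta_mx (mxtens_unindex l).1 (mxtens_unindex l).2) i 0.
Lemma Bm_vec a u : Bm a *m vecm u = psi a u.
Proof.
rewrite [in RHS](matrix_sum_delta u) linear_sum.
apply/matrixP => i j; rewrite ord1 mxE summxE.
rewrite (reindex (@mxtens_index (dA a) (dB a))) /=; last first.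
 by exists (@mxtens_unindex (dA a) (dB a)) => x _; [exact: mxtens_indexK | exact: mxtens_unindexK].
rewrite (eq_bigr (fun q => Bm a i (mxtens_index (q.1, q.2)) * vecm u (mxtens_index (q.1, q.2)) 0)); last by case.
rewrite -(pair_bigA _ (fun x y => Bm a i (mxtens_index (x, y)) * vecm u (mxtens_index (x, y)) 0)) /=.
apply: eq_bigr => x _; rewrite linear_sum summxE; apply: eq_bigr => y _.
have -> : psi a (u x y *: delta_mx x y) = u x y *: psi a (delta_mx x y) by exact: linearZ.
by rewrite !mxE mxtens_indexK mulrC.
Qed.
Notation dd := (fun j : 'I_#|I| => dA (enum_val j) * dB (enum_val j))%N.
Definition Pm : 'M[F]_(N, \sum_j dd j) := \mxrow_(j < #|I|) Bm (enum_val j).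

(** Injective since the images are mutually orthogonal and each embedding is injective; surjective
    since only 0 is orthogonal to all images. *)
Lemma Pm_inv : exists Q, Pm *m Q = 1%:M /\ Q *m Pm = 1%:M.
Proof.
have inj (x : 'cV_(\sum_j dd j)) : Pm *m x = 0 -> x = 0.
 move=> h; rewrite -[x]submxcolK; apply/matrixP => l l'; rewrite [RHS]mxE.
 have hz j : submxcol x j = 0.
  pose u j : 'M[F]_(dA (enum_val j), dB (enum_val j)) := \matrix_(a, c) (submxcol x j) (mxtens_index (a, c)) 0.
  have eu i : submxcol x i = vecm (u i) by exact: vecm_surj.
  have e : \sum_i psi (enum_val i) (u i) = 0.
   transitivity (\sum_i Bm (enum_val i) *m submxcol x i); last by rewrite -mul_mxrow_mxcol submxcolK.
   apply: eq_bigr => i _.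
   by rewrite eu Bm_vec.
  have : form (psi (enum_val j) (u j)) (psi (enum_val j) (u j)) = 0.
   have := form00.2 (psi (enum_val j) (u j)); rewrite -e.
   rewrite (bigD1 j) //= -[X in form _ (X + _)]scale1r fr rmorph1 mul1r.
   rewrite (_ : form _ (\sum_(i | i != j) _) = 0) ?addr0 //.
   elim/big_ind: _ => [|y z hy hz|i ij]; first exact: form00.2.
    by rewrite -[y]scale1r fr hy hz mulr0 addr0.
   apply: psi_orth; apply: contraNneq ij => /enum_val_inj -> //.
  move=> /fpos; have [_ hi _ _ _] := psiP (enum_val j) => /hi.
  by rewrite eu => ->; apply/matrixP => ? ?; rewrite !mxE.
 by rewrite mxE hz mxE.
have rf : row_free Pm^T.
 rewrite -kermx_eq0; apply/eqP/row_matrixP => i; rewrite row0.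
 apply: trmx_inj; rewrite trmx0; apply: inj; apply: trmx_inj; rewrite trmx_mul trmxK trmx0.
 by apply/sub_kermxP; exact: row_sub.
have rfull : row_full Pm^T.
 pose Gm : 'M[F]_N := \matrix_(i, j) form (delta_mx i 0) (delta_mx j 0).
 have formE u w : form u w = (u^T *m Gm *m map_mx Num.conj w) 0 0.
  have ue (x : 'cV[F]_N) : x = \sum_i x i 0 *: delta_mx i 0.
   by apply/matrixP => i j; rewrite summxE (bigD1 i) //= !mxE !eqxx ord1 mulr1 big1 ?addr0 // => l /negPf il; rewrite !mxE eq_sym il mulr0.
  have fsl (f : 'I_N -> 'cV[F]_N) c z : form (\sum_i c i *: f i) z = \sum_i c i * form (f i) z.
   by elim/big_rec2: _ => [|i x y _ h]; rewrite ?form00.1 // fl h.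
  have fsr (f : 'I_N -> 'cV[F]_N) c z : form z (\sum_i c i *: f i) = \sum_i (c i)^* * form z (f i).
   by elim/big_rec2: _ => [|i x y _ h]; rewrite ?form00.2 // fr h.
  rewrite {1}[w]ue fsr mxE; apply: eq_bigr => j _; rewrite {1}[u]ue fsl [RHS]mulrC; congr (_ * _); first by rewrite [RHS]mxE.
  by rewrite mxE; apply: eq_bigr => i _; rewrite !mxE.
 rewrite -col_leq_rank leqNgt; apply/negP => hr.
 have : \rank (Pm^T *m Gm)^T != N by rewrite mxrank_tr neq_ltn (leq_ltn_trans (mxrankM_maxl _ _) hr).
 rewrite -/(row_free _) -kermx_eq0 => /rowV0Pn [y /sub_kermxP hy y0].
 move/eqP: y0; apply.
 have u0 : map_mx Num.conj y^T = 0.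
  have H (j : 'I_#|I|) x : form (psi (enum_val j) x) (map_mx Num.conj y^T) = 0.
   rewrite formE -Bm_vec trmx_mul map_mxCK.
   have sub (M : 'M[F]_(\sum_j dd j, N)) (z : 'cV[F]_N) : submxcol (M *m z) j = submxcol M j *m z.
    by apply/matrixP => a0 c; rewrite !mxE; apply: eq_bigr => t _; rewrite mxE.
   have /(congr1 (fun A => submxcol A j)) : Pm^T *m (Gm *m y^T) = 0.
    by apply: trmx_inj; rewrite trmx0 trmx_mul [(Gm *m _)^T]trmx_mul trmxK -mulmxA -trmx_mul.
   rewrite sub /Pm tr_mxrow mxcolK => e.
   rewrite -!mulmxA e (_ : submxcol 0 j = 0) ?mulmx0 ?mxE //.
   by apply/matrixP => ? ?; rewrite !mxE.
  apply: psi_total => a; rewrite -(enum_rankK a); exact: H.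
 by apply: trmx_inj; rewrite trmx0 -[y^T]map_mxCK u0 map_mx0.
exists (pinvmx Pm^T)^T; split; apply: trmx_inj; rewrite trmx_mul trmxK trmx1.
 exact: mulVpmx.
exact: mulmxVp.
Qed.
Lemma decomp : exists psi : forall a, {linear 'M[F]_(dA a, dB a) -> 'cV[F]_N},
 (forall a, [/\ psi a (vA a *m (vB a)^T) = p a, forall u, psi a u = 0 -> u = 0,
   forall j u, psi a (tens (XA a j) (XZ a j) u) = EB j *m psi a u,
   forall j u, psi a (tens (YA a j) (YZ a j) u) = FB j *m psi a u &
   forall P : 'cV[F]_N -> Prop, linP P -> P (p a) -> (forall j w, P w -> P (FB j *m w)) -> forall u, P (psi a u)]) /\
 exists B : forall a, 'M[F]_(N, dA a * dB a), (forall a u, B a *m vecm u = psi a u) /\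
  exists Q, (\mxrow_(j < #|I|) B (enum_val j)) *m Q = 1%:M /\ Q *m (\mxrow_(j < #|I|) B (enum_val j)) = 1%:M.
Proof.
exists psi; split; first exact: psiP.
by exists Bm; split; [exact: Bm_vec | exact: Pm_inv].
Qed.
End Decomp.

Section ExpPsi.
Variable F : numClosedFieldType.
Lemma expm_psil d e N (psi : {linear 'M[F]_(d, e) -> 'cV[F]_N}) (X : 'M[F]_d) (E : 'M[F]_N) c : nilp X -> nilp E ->
 (forall u, psi (X *m u) = E *m psi u) -> forall u, psi (expm (c *: X) *m u) = expm (c *: E) *m psi u.
Proof.
move=> nX nE h u; pose K := maxn d N.
rewrite (@expmE _ _ _ K (nilpZ c nX)) ?leq_maxl // (@expmE _ _ _ K (nilpZ c nE)) ?leq_maxr //.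
rewrite !mulmx_suml linear_sum; apply: eq_bigr => k _.
have pZ a w : psi (a *: w) = a *: psi w by exact: linearZ.
rewrite !exprZmx !scalerA -!scalemxAl pZ; congr (_ *: _).
elim: (k : nat) => [|m IH]; first by rewrite !expr0 !mul1mx.
by rewrite !exprS -!mulmxA h IH.
Qed.
Lemma expm_psir d e N (psi : {linear 'M[F]_(d, e) -> 'cV[F]_N}) (X : 'M[F]_e) (E : 'M[F]_N) c : nilp X -> nilp E ->
 (forall u, psi (u *m X^T) = E *m psi u) -> forall u, psi (u *m (expm (c *: X))^T) = expm (c *: E) *m psi u.
Proof.
move=> nX nE h u; rewrite -[u]trmxK -trmx_mul; apply: (@expm_psil _ _ _ (psi \o trmx)) => //= w.
by rewrite trmx_mul h.
Qed.
Lemma expm_intertw n (A E E' : 'M[F]_n) : A \in unitmx -> nilp E -> nilp E' ->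
 (forall c, A *m expm (c *: E) = expm (c *: E') *m A) -> A *m E = E' *m A.
Proof.
move=> Au nE nE' h.
have e : A *m E *m invmx A = E'.
 apply: expm_inj => // [|c]; first exact: nilpJ.
 by rewrite scalemxAl scalemxAr expmJ // h mulmxK.
by rewrite -e mulmxKV.
Qed.
Lemma mx_ext (m n : nat) (M M' : 'M[F]_(m, n)) : (forall z : 'cV_n, M *m z = M' *m z) -> M = M'.
Proof.
move=> h; apply/matrixP => i j; have := h (delta_mx j 0); rewrite -!colE.
by move=> /matrixP /(_ i 0); rewrite !mxE.
Qed.
End ExpPsi.

(** * The branching rule for chosen root vectors *)

Section Branching.
Variables (F : numClosedFieldType) (n : nat) (G T : set 'M[F]_n) (alpha : 'I_6 -> 'M[F]_n -> F).
Hypotheses (Gs : simple_algebraic_group G) (Tm : maximal_torus G T) (Rb : root_base G T alpha).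
Variables (alphav betav : 'I_6 -> F -> 'M[F]_n) (X Y Q : 'I_6 -> 'M[F]_n) (z : 'I_6 -> 'I_n -> int)
 (XB YB QB : 'I_6 -> 'M[F]_n) (zB : 'I_6 -> 'I_n -> int).
Hypotheses (Coch : forall i c, c != 0 -> T (alphav i c))
 (D : forall i, sl2_triple G T (alpha i) (alphav i) (X i) (Y i) (Q i) (z i))
 (Ca : forall i j, pairing (alpha i) (alphav j) (C6 i j)) (CochB : forall i c, c != 0 -> T (betav i c))
 (DB : forall j, sl2_triple G T (E6_beta alpha j) (betav j) (XB j) (YB j) (QB j) (zB j)).
Let sG := simple_group Gs.
Let sT := T_subgroup Tm.
Let TG := T_subG Tm.

Variables (k : nat) (I : finType) (b1 b2 b3 : I -> nat).
Hypotheses (b_sum : forall a, (b1 a + 2 * b2 a + b3 a)%N = k)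
 (b_inj : forall a a', b1 a = b1 a' -> b2 a = b2 a' -> b3 a = b3 a' -> a = a')
 (b_surj : forall x y w, (x + 2 * y + w)%N = k -> exists a, [/\ b1 a = x, b2 a = y & b3 a = w]).
Variables (N : nat) (rho : 'M[F]_n -> 'M[F]_N) (v : 'cV[F]_N).
Hypotheses (hr : algebraic_hom G rho) (ir : irreducible_rep G rho) (v0 : v != 0)
 (vX : forall i c, rho (expm (c *: X i)) *m v = v)
 (vT : forall i c, c != 0 -> rho (alphav i c) *m v = (if i == inord 0 then c ^+ k else 1) *: v).
Notation S5 := (gens (UB XB YB (fun j => j != ord_max))).
Notation S1 := (gens (UB XB YB (fun j => j == ord_max))).
Notation SH := (gens (T `|` UB XB YB xpredT)).
Variables (dA dB : I -> nat) (rhoA : forall a, 'M[F]_n -> 'M[F]_(dA a)) (rhoB : forall a, 'M[F]_n -> 'M[F]_(dB a))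
 (vA : forall a, 'cV[F]_(dA a)) (vB : forall a, 'cV[F]_(dB a)).
Hypotheses (hA : forall a, algebraic_hom S5 (rhoA a)) (hB : forall a, algebraic_hom S1 (rhoB a))
 (iA : forall a, irreducible_rep S5 (rhoA a)) (iB : forall a, irreducible_rep S1 (rhoB a))
 (vA0 : forall a, vA a != 0) (vB0 : forall a, vB a != 0).
(** Values of b1 lambda_2 + b2 lambda_4 + b3 lambda_5 on the coroots of the chain, with nodes
    counted from 0. *)
Definition nA a (j : 'I_6) : nat :=
 if j == inord 1 then b1 a else if j == inord 3 then b2 a else if j == inord 4 then b3 a else 0%N.
Definition nB a (j : 'I_6) : nat := if j == ord_max then b3 a else 0%N.
Hypotheses (vAX : forall a j c, j != ord_max -> rhoA a (expm (c *: XB j)) *m vA a = vA a)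
 (vBX : forall a c, rhoB a (expm (c *: XB ord_max)) *m vB a = vB a)
 (vAT : forall a j c, j != ord_max -> c != 0 -> rhoA a (betav j c) *m vA a = c ^+ nA a j *: vA a)
 (vBT : forall a c, c != 0 -> rhoB a (betav ord_max c) *m vB a = c ^+ b3 a *: vB a).

Notation HBg := (Hi QB zB).
Notation C := (fun i j => (CB i j)%:~R : F).

Lemma XBg_G j c : G (expm (c *: XB j)). Proof. by case: (DB j) => _ _ _ _ [[h _ _ _ _] _ _]. Qed.
Lemma YBg_G j c : G (expm (c *: YB j)). Proof. by case: (DB j) => _ _ _ _ [_ [h _ _ _ _] _]. Qed.
Lemma UBg_G b : UB XB YB b `<=` G.
Proof. by move=> g [j [c [_ [] ->]]]; [exact: XBg_G | exact: YBg_G]. Qed.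
Lemma sS b : subgroup (gens (UB XB YB b)). Proof. exact: UB_subgroup (XB_nilp DB) (YB_nilp DB). Qed.
Lemma TUB_G : T `|` UB XB YB xpredT `<=` G. Proof. by move=> g [/TG|/UBg_G]. Qed.
Lemma SH_G : SH `<=` G.
Proof. exact: gens_min TUB_G. Qed.
Lemma S_G b : gens (UB XB YB b) `<=` G. Proof. exact: gens_min (@UBg_G b). Qed.
Lemma bv_S (b : pred 'I_6) j c : b j -> c != 0 -> gens (UB XB YB b) (betav j c).
Proof.
move=> bj c0; case: (DB j) => _ _ _ _ [_ _ h]; apply: h => // [|d|d]; first exact: sS.
 by have [] := in_UB XB YB d bj.
by have [] := in_UB XB YB d bj.
Qed.
Lemma bvE j c : c != 0 -> betav j c = cdiag (QB j) (fun i => c ^ zB j i).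
Proof. by move=> c0; case: (DB j) => _ _ [_ h _ _] _ _; exact: h. Qed.
Lemma CB_0 (b : pred 'I_6) : (forall j, j != ord_max -> b j = ~~ b ord_max) -> forall i j, b i != b j -> CB i j = 0.
Proof.
move=> hb i j; rewrite /CB; case: (eqVneq i ord_max) => [->|im]; case: (eqVneq j ord_max) => [->|jm] //=.
- by rewrite eqxx.
- by rewrite (negPf im).
by rewrite (hb i im) (hb j jm) eqxx.
Qed.
Lemma XYB i j : brk (XB i) (YB j) = if i == j then HBg i else 0.
Proof.
case: eqP => [<-|/eqP ij]; first exact: (brkXYB DB).
exact: (XBYB_0 Gs Tm Rb Coch D Ca DB).
Qed.
Lemma HXB i j : brk (HBg i) (XB j) = (CB i j)%:~R *: XB j.
Proof. by have [] := HB_act Gs Tm Rb Coch D Ca CochB DB i j. Qed.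
Lemma HYB i j : brk (HBg i) (YB j) = - (CB i j)%:~R *: YB j.
Proof. by have [] := HB_act Gs Tm Rb Coch D Ca CochB DB i j. Qed.

Notation opsP S f b := (ops_triple S f b XB YB QB zB CB).

Lemma ops_ex d S (f : 'M[F]_n -> 'M[F]_d) (b : pred 'I_6) : subgroup S -> algebraic_hom S f ->
 gens (UB XB YB b) `<=` S -> (forall i j, b i != b j -> CB i j = 0) -> exists t, opsP S f b t.
Proof.
move=> sSS hf hS C0.
have [|||t ht] := @rep_ops F n d S f _ b XB YB QB zB CB sSS hf (XB_nilp DB) (YB_nilp DB) _ _ (QB_unit DB) _ XYB HXB HYB C0.
- by move=> j c bj; apply: hS; have [] := in_UB XB YB c bj.
- by move=> j c bj; apply: hS; have [] := in_UB XB YB c bj.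
- by move=> j c bj c0; rewrite -bvE //; apply: hS; exact: bv_S.
by exists t.
Qed.

Lemma ext_opsG : exists E Fo H : 'I_6 -> 'M[F]_N,
 [/\ (forall i j, brk (E i) (Fo j) = if i == j then H i else 0) /\ (forall i j, brk (H i) (Fo j) = - (C6 i j)%:~R *: Fo j),
   forall i, E i *m v = 0, forall i, H i *m v = (if i == inord 0 then k%:R else 0) *: v,
   irrP (mop E) (mop Fo) &
   forall j, [/\ nilp (E j), nilp (Fo j), forall c, rho (expm (c *: X j)) = expm (c *: E j),
    forall c, rho (expm (c *: Y j)) = expm (c *: Fo j) & drho G rho (X j) (E j) /\ drho G rho (Y j) (Fo j)]].
Proof.
have [||||[[E Fo] H] [/= _ [h1 h1'] [h2 h3] h4 h5]] := @rep_ops F n N G rho _ xpredT X Y Q z C6 sG hr (Xnilp D) (Ynilp D) _ _ (Qunit D) _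
 (XY_0 Gs Tm Rb Coch D Ca) (HX_6 Coch D Ca) (HY_6 Coch D Ca).
- by move=> j c _; exact: (expX_G Gs Tm Rb D).
- by move=> j c _; exact: (expY_G Gs Tm Rb D).
- by move=> j c _ c0; rewrite -(avE D) //; apply: TG; exact: Coch.
- by [].
have h4' := fun j => h4 j isT.
exists E, Fo, H; split=> //.
- by move=> i; have [e1 _ e2 _ _] := h4' i; apply: expm_fix => // c; rewrite -e2.
- move=> i; have := h5 i v (if i == inord 0 then k%:Z else 0) isT; have := vT i.
 by case: (i == inord 0) => hv -> // c c0; rewrite -(avE D) // hv.
apply: (irr_ops (b := xpredT) sG hr (Xnilp D) (Ynilp D)) ir _ => //.
- by move=> j c _; exact: (expX_G Gs Tm Rb D).
- by move=> j c _; exact: (expY_G Gs Tm Rb D).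
- by move=> j _; have [_ _ e1 e2 _] := h4' j.
exact: (G_UB Gs Tm Rb Coch D Ca).
Qed.

Lemma drho_nest (Zg : 'I_6 -> 'M[F]_n) (Zr : 'I_6 -> 'M[F]_N) p A A' :
 (forall j, nilp (Zg j)) -> (forall j, nilp (Zr j)) -> (forall j c, G (expm (c *: Zg j))) ->
 (forall j c, rho (expm (c *: Zg j)) = expm (c *: Zr j)) -> drho G rho A A' ->
 drho G rho (nest Zg p A) (nest Zr p A').
Proof.
move=> n1 n2 g e; elim: p A A' => //= i p IH A A' h; apply: IH.
exact: drho_brk.
Qed.

(** Operators for the simple root vectors of G and those for the beta_j are differentials of the
    same [rho], so the proportionality of root vectors and the nested brackets for the highest root
    carry over to them. *)
Lemma ops_core : exists t, opsP G rho xpredT t /\ branch_data t.1.1 t.1.2 t.2 k.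
Proof.
have [t ht] := ops_ex (b := xpredT) sG hr (@S_G xpredT) (fun i j => fun h : true != true => match notF h with end).
exists t; split=> //.
have [_ [h1 h1'] [h2 h3] h4 h5] := ht.
have [E [Fo [H [[g1 g1'] g2 g3 g4 g5]]]] := ext_opsG.
have dfun A B B' : drho G rho A B -> drho G rho A B' -> B = B' by apply: drho_fun.
apply: (core g1 g1' v0 g2 g3 g4).
- move=> j jm; have [a a0 e] := XB_scale Gs Tm Rb Coch D Ca DB jm; exists a => //.
 have [_ _ _ _ [d1 _]] := h4 j isT; have [_ _ _ _ [d2 _]] := g5 (sj j).
 by rewrite e in d1; exact: (dfun _ _ _ d1 (drhoZ a d2)).
- move=> j jm; have [a a0 e] := YB_scale Gs Tm Rb Coch D Ca DB jm; exists a => //.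
 have [_ _ _ _ [_ d1]] := h4 j isT; have [_ _ _ _ [_ d2]] := g5 (sj j).
 by rewrite e in d1; exact: (dfun _ _ _ d1 (drhoZ a d2)).
- have [a a0 e] := XB_nest Gs Tm Rb Coch D Ca DB; exists a => //.
 have [_ _ _ _ [d1 _]] := h4 ord_max isT; have [_ _ _ _ [d2 _]] := g5 (inord 5).
 apply: (dfun _ _ _ _ (drhoZ a d1)); rewrite -e; apply: drho_nest d2.
 + exact: (Xnilp D).
 + by move=> j; have [] := g5 j.
 + by move=> j c; exact: (expX_G Gs Tm Rb D).
 + by move=> j c; have [_ _ e1 _ _] := g5 j.
- have [a a0 e] := YB_nest Gs Tm Rb Coch D Ca DB; exists a => //.
 have [_ _ _ _ [_ d1]] := h4 ord_max isT; have [_ _ _ _ [_ d2]] := g5 (inord 5).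
 apply: (dfun _ _ _ _ (drhoZ a d1)); rewrite -e; apply: drho_nest d2.
 + exact: (Ynilp D).
 + by move=> j; have [] := g5 j.
 + by move=> j c; exact: (expY_G Gs Tm Rb D).
 + by move=> j c; have [_ _ _ e1 _] := g5 j.
- by move=> j; rewrite h1 eqxx.
- by move=> j; rewrite h2 /CB eqxx; case: ifP => // /norP [jm _]; rewrite C6_2.
Qed.
Let p5 : pred 'I_6 := fun j => j != ord_max.
Let p1 : pred 'I_6 := fun j => j == ord_max.

Lemma opsA a : exists t, opsP S5 (rhoA a) p5 t.
Proof. by apply: ops_ex => //; [exact: sS | apply: CB_0 => j jm; rewrite /p5 jm eqxx]. Qed.
Lemma opsB a : exists t, opsP S1 (rhoB a) p1 t.
Proof. by apply: ops_ex => //; [exact: sS | apply: CB_0 => j jm; rewrite /p1 (negPf jm) eqxx]. Qed.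

Lemma ops_v (b : pred 'I_6) d (f : 'M[F]_n -> 'M[F]_d) (w : 'cV_d) (m : 'I_6 -> nat) t :
 algebraic_hom (gens (UB XB YB b)) f -> irreducible_rep (gens (UB XB YB b)) f ->
 (forall j c, b j -> f (expm (c *: XB j)) *m w = w) -> (forall j c, b j -> c != 0 -> f (betav j c) *m w = c ^+ m j *: w) ->
 (forall j, ~~ b j -> m j = 0%N) -> opsP (gens (UB XB YB b)) f b t ->
 [/\ forall j, t.1.1 j *m w = 0, forall j, t.2 j *m w = (m j)%:R *: w & irrP (mop t.1.1) (mop t.1.2)].
Proof.
move=> hf irf wX wT m0 [h0 _ _ h4 h5]; split=> [j|j|].
- have [bj|bj] := boolP (b j); last by have [-> _ _] := h0 j bj; rewrite mul0mx.
 by have [e1 _ e2 _ _] := h4 j bj; apply: expm_fix => // c; rewrite -e2 wX.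
- have [bj|bj] := boolP (b j); last by have [_ _ ->] := h0 j bj; rewrite mul0mx m0 // scale0r.
 by apply: (h5 j w (m j)%:Z bj) => c c0; rewrite -bvE // wT.
apply: (irr_ops (b := b) (sS _) hf (XB_nilp DB) (YB_nilp DB)) irf _.
- by move=> j c /(in_UB XB YB c) [].
- by move=> j c /(in_UB XB YB c) [].
- by move=> j bj; have [_ _ e1 e2 _] := h4 j bj.
by apply: sub_zcl; case: (sS b).
Qed.
Lemma opsA_v a t : opsP S5 (rhoA a) p5 t ->
 [/\ forall j, t.1.1 j *m vA a = 0, forall j, t.2 j *m vA a = (nA a j)%:R *: vA a & irrP (mop t.1.1) (mop t.1.2)].
Proof.
apply: ops_v (hA a) (iA a) (vAX a) (vAT a) _ => j; rewrite negbK => /eqP ->.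
by rewrite /nA -!val_eqE /= !inordK.
Qed.
Lemma opsB_v a t : opsP S1 (rhoB a) p1 t ->
 [/\ forall j, t.1.1 j *m vB a = 0, forall j, t.2 j *m vB a = (nB a j)%:R *: vB a & irrP (mop t.1.1) (mop t.1.2)].
Proof.
apply: ops_v (hB a) (iB a) _ _ _ => [j c /eqP ->|j c /eqP -> c0|j /negPf jm]; first exact: vBX.
 by rewrite /nB eqxx; exact: vBT.
by rewrite /nB jm.
Qed.
Lemma nAB a j : (nA a j)%:R + (nB a j)%:R = wtT F (b1 a) (b2 a) (b3 a) j.
Proof.
rewrite /nA /nB /wtT /wt_; elim/ord6_ind: j; rewrite -!val_eqE /= !inordK //= !(mulr0, mulr1, addr0, add0r) //.
Qed.

(** The torus scales root subgroups; [expm_intertw] extracts from the relation on exponentials the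
    one on operators. *)
Lemma vAB_T t (hE : opsP G rho xpredT t) g : T g -> exists c d : 'I_6 -> F,
 (forall j, rho g *m t.1.1 j = c j *: (t.1.1 j *m rho g)) /\
 (forall j, rho g *m t.1.2 j = d j *: (t.1.2 j *m rho g)) /\ (forall j, d j * c j = 1).
Proof.
move=> Tg; have Gg := TG Tg.
have [_ _ _ h4 _] := hE; have [_ _ hM] := hr; have [Gu _ _ Gi] := sG.
have ru : rho g \in unitmx by have [] := rho_inv sG hr Gg.
have step Z E chi : (forall t0 a, T t0 -> t0 *m expm (a *: Z) *m invmx t0 = expm ((chi t0 * a) *: Z)) ->
  (forall a, G (expm (a *: Z))) -> nilp E -> (forall a, rho (expm (a *: Z)) = expm (a *: E)) ->
  rho g *m E = chi g *: (E *m rho g).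
 move=> hu hG nE hE'; rewrite scalemxAl; apply: expm_intertw => //; first exact: nilpZ.
 move=> a; rewrite scalerA (mulrC a) -!hE' -!hM //; congr (rho _).
 by rewrite -(hu g a Tg) mulmxKV // Gu.
exists (E6_beta alpha ^~ g), (fun j => (E6_beta alpha j g)^-1); split=> [j|]; last split=> j.
- have [n1 n2 e1 e2 _] := h4 j isT; apply: (step (XB j)) => //; last exact: XBg_G.
 by case: (DB j) => _ _ _ _ [[_ _ _ _ h] _ _] t0 a; exact: h.
- have [n1 n2 e1 e2 _] := h4 j isT; apply: (step (YB j) _ (fun t0 => (E6_beta alpha j t0)^-1)) => //; last exact: YBg_G.
 by case: (DB j) => _ _ _ _ [_ [_ _ _ _ h] _] t0 a; exact: h.
by rewrite mulVf //; apply: (comb_neq0 Tm Rb).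
Qed.

Lemma branches_core : branches SH S5 S1 rho rhoA rhoB.
Proof.
have [[[EB FB] HB] [hE [[form [s [s' [fl fr fpos fs]]]] pex puniq pwt]]] := ops_core.
have [_ [/= h1 h1'] [/= h2 h3] h4 _] := hE; rewrite /= in pex puniq pwt fs h4.
pose tA a := projT1 (cid (opsA a)); pose tB a := projT1 (cid (opsB a)).
have hTA a : opsP S5 (rhoA a) p5 (tA a) := projT2 (cid (opsA a)).
have hTB a : opsP S1 (rhoB a) p1 (tB a) := projT2 (cid (opsB a)).
have hpp a : exists x : 'cV[F]_N, x != 0 /\ forall j, EB j *m x = 0 /\ HB j *m x = wtT F (b1 a) (b2 a) (b3 a) j *: x.
 by have [x x0 hx] := pex _ _ _ (b_sum a); exists x.
pose pp a := projT1 (cid (hpp a)).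
have p0 a : pp a != 0 := (projT2 (cid (hpp a))).1.
have pEH a j : EB j *m pp a = 0 /\ HB j *m pp a = wtT F (b1 a) (b2 a) (b3 a) j *: pp a := (projT2 (cid (hpp a))).2 j.
have nF j : nilp (FB j) by have [] := h4 j isT.
have nE j : nilp (EB j) by have [] := h4 j isT.
have zAh a j : j == ord_max -> [/\ (tA a).1.1 j = 0, (tA a).1.2 j = 0 & (tA a).2 j = 0].
 by move=> h; have [e _ _ _ _] := hTA a; apply: e; rewrite /p5 h.
have zBh a j : j != ord_max -> [/\ (tB a).1.1 j = 0, (tB a).1.2 j = 0 & (tB a).2 j = 0].
 by move=> h; have [e _ _ _ _] := hTB a; exact: e.
have [psi [psiP [B [Bv [Qm [PQ QP]]]]]] := decomp fl fr fpos fs p0 (fun a j => (pEH a j).1) (fun a j => (pEH a j).2)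
 puniq pwt nF h1 h1' h2 h3 b_inj b_surj
 (XA := fun a => (tA a).1.1) (YA := fun a => (tA a).1.2) (ZA := fun a => (tA a).2)
 (XZ := fun a => (tB a).1.1) (YZ := fun a => (tB a).1.2) (ZZ := fun a => (tB a).2)
 zAh zBh
 (fun a => (let: And5 _ e _ _ _ := hTA a in e).1) (fun a => (let: And5 _ e _ _ _ := hTA a in e).2)
 (fun a => (let: And5 _ _ e _ _ := hTA a in e).1) (fun a => (let: And5 _ _ e _ _ := hTA a in e).2)
 (fun a => (let: And5 _ e _ _ _ := hTB a in e).1) (fun a => (let: And5 _ e _ _ _ := hTB a in e).2)
 (fun a => (let: And5 _ _ e _ _ := hTB a in e).1) (fun a => (let: And5 _ _ e _ _ := hTB a in e).2)
 vA0 vB0 (fun a => let: And3 e _ _ := opsA_v (hTA a) in e) (fun a => let: And3 e _ _ := opsB_v (hTB a) in e)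
 (fun a => let: And3 _ e _ := opsA_v (hTA a) in e) (fun a => let: And3 _ e _ := opsB_v (hTB a) in e)
 nAB
 (fun a => let: And3 _ _ e := opsA_v (hTA a) in e) (fun a => let: And3 _ _ e := opsB_v (hTB a) in e).
have [hrr hr1 hrM] := hr; have [Gu G1 GM Gi] := sG.
have HBE j : HB j = EB j *m FB j - FB j *m EB j by have := h1 j j; rewrite eqxx => <-.
(* The torus rescales raising and lowering operators and commutes with the coroots, so it sends p_a
   to a primitive vector of the same weight, that is to a multiple of p_a. The image of psi_a is
   generated from p_a, hence stable. *)
have stT a g : T g -> forall x, exists y, rho g *m psi a x = psi a y.
 move=> Tg; have [c [d [/= hc [hd dc]]]] := vAB_T hE Tg.
 have [e1 _ _ e4 ind] := psiP a.
 have cE j : EB j *m rho g = d j *: (rho g *m EB j) by rewrite hc scalerA dc scale1r.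
 have cF j : FB j *m rho g = c j *: (rho g *m FB j) by rewrite hd scalerA mulrC dc scale1r.
 have cH j : HB j *m rho g = rho g *m HB j.
  rewrite HBE mulmxBl mulmxBr -!mulmxA cF cE -!scalemxAr !mulmxA cE cF -!scalemxAl !scalerA.
  by rewrite (mulrC (c j)) dc !scale1r.
 have [|c0 hc0] := puniq _ (pp a) (rho g *m pp a) (p0 a) (pEH a).
  move=> j; have [h5 h6] := pEH a j; rewrite !mulmxA cE cH -scalemxAl -!mulmxA h5 h6 mulmx0 scaler0.
  by rewrite -scalemxAr.
 apply: (ind (fun w => exists y, rho g *m w = psi a y)) => [||j w [y hy]].
 - split; first by exists 0; rewrite mulmx0 linear0.
  move=> b u w [y hy] [y' hy']; exists (b *: y + y').
  by rewrite mulmxDr -scalemxAr hy hy' linearP.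
 - by exists (c0 *: (vA a *m (vB a)^T)); rewrite hc0 -e1; symmetry; exact: linearZ.
 exists (d j *: tens ((tA a).1.2 j) ((tB a).1.2 j) y).
 have -> : psi a (d j *: tens ((tA a).1.2 j) ((tB a).1.2 j) y) = d j *: psi a (tens ((tA a).1.2 j) ((tB a).1.2 j) y) by exact: linearZ.
 by rewrite e4 -hy !mulmxA hd -scalemxAl.
have stE a j c x : exists y, rho (expm (c *: XB j)) *m psi a x = psi a y.
 have [_ _ e3 _ _] := psiP a; have [_ _ -> _ _] := h4 j isT.
 apply: (@expm_stab F N (EB j) (fun w => exists y, w = psi a y) c (psi a x)); last by exists x.
 - split; first by exists 0; rewrite linear0.
  by move=> b u w [y ->] [y' ->]; exists (b *: y + y'); rewrite linearP.
 - by move=> u [y ->]; exists (tens ((tA a).1.1 j) ((tB a).1.1 j) y); rewrite e3.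
have stF a j c x : exists y, rho (expm (c *: YB j)) *m psi a x = psi a y.
 have [_ _ _ e3 _] := psiP a; have [_ _ _ -> _] := h4 j isT.
 apply: (@expm_stab F N (FB j) (fun w => exists y, w = psi a y) c (psi a x)); last by exists x.
 - split; first by exists 0; rewrite linear0.
  by move=> b u w [y ->] [y' ->]; exists (b *: y + y'); rewrite linearP.
 - by move=> u [y ->]; exists (tens ((tA a).1.2 j) ((tB a).1.2 j) y); rewrite e3.
have stH a g : SH g -> forall x, exists y, rho g *m psi a x = psi a y.
 pose st g := forall x, exists y, rho g *m psi a x = psi a y.
 have BI g0 : (T `|` UB XB YB xpredT) g0 -> (T `|` UB XB YB xpredT) (invmx g0).
  case=> [Tg|/(UB_inv (XB_nilp DB) (YB_nilp DB))]; [left | by right].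
  by case: sT => _ _ _; apply.
 apply: (gens_ind (P := st) _ BI) => [x /TUB_G /Gu //|x|x h Hx Bh sx y]; first by exists x; rewrite hr1 mul1mx.
 have [y1 hy] : exists y1, rho h *m psi a y = psi a y1.
  by case: Bh => [/stT|[j [c [_ [] ->]]]]; [exact | exact: stE | exact: stF].
 have [y2 hy2] := sx y1; exists y2.
 by rewrite hrM; [rewrite -mulmxA hy | exact: SH_G | exact: TUB_G].
have lB a : exists Cm, Cm *m B a = 1%:M.
 have rf : row_free (B a)^T.
  rewrite -kermx_eq0; apply/eqP/row_matrixP => i; rewrite row0.
  apply: trmx_inj; rewrite trmx0 [X in X = _]vecm_surj.
  set u := \matrix_(_, _) _; have e : psi a u = 0.
   rewrite -Bv /u -vecm_surj; apply: trmx_inj; rewrite trmx_mul trmxK trmx0.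
   by apply/sub_kermxP; exact: row_sub.
  have [_ inj _ _ _] := psiP a; rewrite (inj _ e).
  by apply/matrixP => i0 j; rewrite !mxE.
 exists (pinvmx (B a)^T)^T; apply: trmx_inj; rewrite trmx_mul trmxK trmx1.
 exact: mulmxVp.
pose Cm a := projT1 (cid (lB a)); have CB1 a : Cm a *m B a = 1%:M := projT2 (cid (lB a)).
(* The action on the stable image of psi_a, transported to the tensor space by a left inverse of the
   embedding. *)
pose sigma a g := Cm a *m (rho g *m B a).
have key a g : SH g -> rho g *m B a = B a *m sigma a g.
 move=> Hg; apply: mx_ext => w; rewrite [w]vecm_surj; set u := \matrix_(_, _) _.
 have [y hy] := stH a g Hg u.
 by rewrite /sigma -!mulmxA Bv hy -Bv (mulmxA (Cm a)) CB1 mul1mx.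
have actA a x : S5 x -> forall u, rho x *m psi a u = psi a (rhoA a x *m u).
 apply: (UB_ind (b := p5) (sS p5) (XB_nilp DB) (YB_nilp DB) _ _ (P := fun x => forall u, rho x *m psi a u = psi a (rhoA a x *m u))).
 - by move=> j c /(in_UB XB YB c) [].
 - by move=> j c /(in_UB XB YB c) [].
 - by move=> u; have [_ q1 _] := hA a; rewrite hr1 q1 !mul1mx.
 - move=> g h Sg Sh hg hh u; have [_ _ qM] := hA a.
  by rewrite hrM ?qM //; [rewrite -!mulmxA hh hg | exact: S_G Sg | exact: S_G Sh].
 move=> j c pj; have [_ _ e3 e4 _] := psiP a; have [m1 m2 m3 m4 _] := h4 j isT.
 have [_ _ _ q _] := hTA a; have [q1 q2 q3 q4 _] := q j pj.
 have [z0 _ _ _ _] := hTB a; have [z1 z2 _] := z0 j pj.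
 split=> u; rewrite ?m3 ?m4 ?q3 ?q4; symmetry; apply: expm_psil => // w.
  by rewrite -e3 tensE z1 trmx0 mulmx0 addr0.
 by rewrite -e4 tensE z2 trmx0 mulmx0 addr0.
have actB a x : S1 x -> forall u, rho x *m psi a u = psi a (u *m (rhoB a x)^T).
 apply: (UB_ind (b := p1) (sS p1) (XB_nilp DB) (YB_nilp DB) _ _ (P := fun x => forall u, rho x *m psi a u = psi a (u *m (rhoB a x)^T))).
 - by move=> j c /(in_UB XB YB c) [].
 - by move=> j c /(in_UB XB YB c) [].
 - by move=> u; have [_ q1 _] := hB a; rewrite hr1 q1 trmx1 mul1mx mulmx1.
 - move=> g h Sg Sh hg hh u; have [_ _ qM] := hB a.
  by rewrite hrM ?qM //; [rewrite -!mulmxA hh hg trmx_mul mulmxA | exact: S_G Sg | exact: S_G Sh].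
 move=> j c pj; have [_ _ e3 e4 _] := psiP a; have [m1 m2 m3 m4 _] := h4 j isT.
 have [_ _ _ q _] := hTB a; have [q1 q2 q3 q4 _] := q j pj.
 have [z0 _ _ _ _] := hTA a; have [|z1 z2 _] := z0 j; first by rewrite /p5 negbK.
 split=> u; rewrite ?m3 ?m4 ?q3 ?q4; symmetry; apply: expm_psir => // w.
  by rewrite -e3 tensE z1 mul0mx add0r.
 by rewrite -e4 tensE z2 mul0mx add0r.
have SHU : SH `<=` @GLset F n by move=> g /SH_G /Gu.
exists sigma; split.
 move=> a; split.
  split.
  - move=> i j; apply: (regular_mulmxl SHU) => i' j'; apply: (regular_mulmxr SHU) => i'' j''.
   exact: regular_sub SH_G (hrr _ _).
  - by rewrite /sigma hr1 mul1mx CB1.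
  - move=> g h Hg Hh; rewrite {1}/sigma hrM; [|exact: SH_G|exact: SH_G].
   by rewrite -(mulmxA (rho g)) (key a h Hh) (mulmxA (rho g) (B a)) (key a g Hg) -(mulmxA (B a)) (mulmxA (Cm a)) CB1 mul1mx.
 move=> x y Sx Sy; apply: mx_ext => w; rewrite [w]vecm_surj; set u := \matrix_(_, _) _.
 rewrite tens_vecm /sigma hrM; [|exact: S_G Sx|exact: S_G Sy].
 by rewrite -!mulmxA Bv (actB a y Sy) (actA a x Sx) -Bv mulmxA CB1 mul1mx.
exists (\mxrow_(j < #|I|) B (enum_val j)), Qm; split=> // g Hg.
rewrite /dsum_rep mul_mxrow_mxdiag; apply/matrixP => i j; rewrite mxE [RHS]mxE.
rewrite -(key _ g Hg) [RHS]mxE; apply: eq_bigr => l _.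
by rewrite [X in _ * X]mxE.
Qed.
End Branching.

Section Triples.
Variables (F : numClosedFieldType) (n : nat) (G T : set 'M[F]_n).
Hypotheses (Gs : simple_algebraic_group G) (Tm : maximal_torus G T).

Lemma triples_ex (J : finType) (chi : J -> 'M[F]_n -> F) (gam : J -> F -> 'M[F]_n) :
 (forall j s t, T s -> T t -> chi j (s *m t) = chi j s * chi j t) -> (forall j t, T t -> chi j t != 0) ->
 (forall j, is_coroot G T (chi j) (gam j)) ->
 exists (X Y Q : J -> 'M[F]_n) (z : J -> 'I_n -> int), forall j, sl2_triple G T (chi j) (gam j) (X j) (Y j) (Q j) (z j).
Proof.
move=> cM c0 hc.
have H j : exists q : 'M[F]_n * 'M[F]_n * 'M[F]_n * ('I_n -> int), sl2_triple G T (chi j) (gam j) q.1.1.1 q.1.1.2 q.1.2 q.2.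
 have [X [Y [Q [z h]]]] := sl2_data (simple_group Gs) (T_subgroup Tm) (cM j) (c0 j) (hc j).
 by exists (X, Y, Q, z).
have [q hq] := choice H.
by exists (fun j => (q j).1.1.1), (fun j => (q j).1.1.2), (fun j => (q j).1.2), (fun j => (q j).2).
Qed.
End Triples.

(** * The diagram automorphism of E6 *)

Section Flip.
(** It exchanges alpha_1 with alpha_6 and alpha_3 with alpha_5 and fixes the highest root, so on the
    beta_j it acts by [rev5]: the A5 chain is reversed and beta_6 is kept. *)
Definition tau (i : 'I_6) : 'I_6 := inord (nth 0 [:: 5; 1; 4; 3; 2; 0] i)%N.
Definition rev5 (j : 'I_6) : 'I_6 := inord (nth 0 [:: 4; 3; 2; 1; 0; 5] j)%N.
Lemma tauK : involutive tau.
Proof. by elim/ord6_ind; rewrite /tau !inordK. Qed.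
Lemma rev5K : involutive rev5.
Proof. by elim/ord6_ind; rewrite /rev5 !inordK. Qed.
Lemma rev5_max j : (rev5 j == ord_max) = (j == ord_max).
Proof. by rewrite ord_max6; elim/ord6_ind: j; rewrite /rev5 -!val_eqE /= !inordK. Qed.
Lemma C6_tau i j : C6 (tau i) (tau j) = C6 i j.
Proof. by elim/ord6_ind: i; elim/ord6_ind: j; rewrite /tau !C6E !inordK. Qed.
Lemma coords_tau j i : E6_beta_coords (rev5 j) (tau i) = E6_beta_coords j i.
Proof. by elim/ord6_ind: i; elim/ord6_ind: j; rewrite /tau /rev5 /E6_beta_coords !mxE !inordK. Qed.
Lemma comb_tau (F : numClosedFieldType) n (alpha : 'I_6 -> 'M[F]_n -> F) m t :
 comb (fun i => alpha (tau i)) m t = comb alpha (fun i => m (tau i)) t.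
Proof.
rewrite /comb (reindex_inj (inv_inj tauK)) /=; apply: eq_bigr => i _.
by rewrite tauK.
Qed.
Lemma beta_tau (F : numClosedFieldType) n (alpha : 'I_6 -> 'M[F]_n -> F) j :
 E6_beta (fun i => alpha (tau i)) j = E6_beta alpha (rev5 j).
Proof.
apply/funext => t; rewrite /E6_beta comb_tau; apply: eq_bigr => i _.
by rewrite -[X in E6_beta_coords X]rev5K coords_tau.
Qed.
Lemma root_base_tau (F : numClosedFieldType) n (G T : set 'M[F]_n) (alpha : 'I_6 -> 'M[F]_n -> F) :
 root_base G T alpha -> root_base G T (fun i => alpha (tau i)).
Proof.
move=> [h1 h2 h3]; split=> [i|m hm i|chi hc]; first exact: h1.
 have := h2 (fun i => m (tau i)); rewrite -(tauK i); apply=> t Tt.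
 by rewrite -comb_tau hm.
have [m [hm hs]] := h3 chi hc; exists (fun i => m (tau i)); split.
 move=> t Tt; rewrite hm // comb_tau; apply: eq_bigr => i _.
 by rewrite tauK.
by case: hs => hs; [left | right] => i; exact: hs.
Qed.
End Flip.

Section Tri.
Variable k : nat.
Lemma tr_sum (a : triples k) : (tr1 a + 2 * tr2 a + tr3 a)%N = k.
Proof. exact: (eqP (valP a)). Qed.
Lemma tr_inj (a a' : triples k) : tr1 a = tr1 a' -> tr2 a = tr2 a' -> tr3 a = tr3 a' -> a = a'.
Proof.
rewrite /tr1 /tr2 /tr3 => h1 h2 h3; apply: val_inj.
by case: (val a) (val a') h1 h2 h3 => [[x y] w] [[x' y'] w'] /= /val_inj -> /val_inj -> /val_inj ->.
Qed.
Lemma tr_surj x y w : (x + 2 * y + w)%N = k -> exists a : triples k, [/\ tr1 a = x, tr2 a = y & tr3 a = w].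
Proof.
move=> h.
have [hx hy hw] : [/\ (x < k.+1)%N, (y < k.+1)%N & (w < k.+1)%N] by split; lia.
have P : ((Ordinal hx, Ordinal hy, Ordinal hw).1.1 + 2 * (Ordinal hx, Ordinal hy, Ordinal hw).1.2 + (Ordinal hx, Ordinal hy, Ordinal hw).2 == k)%N by apply/eqP.
by exists (exist _ (Ordinal hx, Ordinal hy, Ordinal hw) P).
Qed.
End Tri.

Section HW.
Variables (F : numClosedFieldType) (n : nat) (G T : set 'M[F]_n) (alpha : 'I_6 -> 'M[F]_n -> F).
Hypotheses (Gs : simple_algebraic_group G) (Tm : maximal_torus G T) (Rb : root_base G T alpha).
Lemma hw_vec (J : finType) (b : J -> 'I_6 -> int) (gam : J -> F -> 'M[F]_n) (X Y Q : J -> 'M[F]_n) z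
 d S chi (f : 'M[F]_n -> 'M[F]_d) :
 (forall j, exists i, b j i != 0) ->
 (forall j, sl2_triple G T (comb alpha (b j)) (gam j) (X j) (Y j) (Q j) (z j)) ->
 (forall j c, c != 0 -> T (gam j c)) -> (forall j c, c != 0 -> S (gam j c)) ->
 irreducible_of_highest_weight G T S (fun j => comb alpha (b j)) chi f ->
 exists v : 'cV[F]_d, [/\ v != 0, forall j c, f (expm (c *: X j)) *m v = v & forall j c, c != 0 -> f (gam j c) *m v = chi (gam j c) *: v].
Proof.
move=> bn0 D gT gS [_ _ [v [v0 vX vT]]]; exists v; split=> // [j c|j c c0]; last by apply: vT; [exact: gT | exact: gS].
have [[nX X0 LX wX] _ _ _ [hX _ _]] := D j.
have [[chi' [rc hc]] _] := wt_root Tm Rb X0 (conj LX wX) (bn0 j).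
apply: (vX chi' (ei j) rc) => [t Tt|i|]; first by rewrite comb_ei hc.
 by rewrite /ei; case: eqP.
exists (fun c => expm (c *: X j)), c; split=> //.
by apply: root_hom_ext hX => t Tt; rewrite hc.
Qed.
End HW.

Lemma c_zeq (F : fieldType) (c : F) (b : bool) (m : nat) : (c ^ (b%:Z)) ^+ m = if b then c ^+ m else 1.
Proof. by case: b; rewrite ?expr1z // expr0z expr1n. Qed.

(** * Assembly of both branching rules *)

Section Main.
Variables (F : numClosedFieldType) (n : nat) (G T : set 'M[F]_n)
 (alpha : 'I_6 -> 'M[F]_n -> F) (alphav : 'I_6 -> F -> 'M[F]_n)
 (omega : 'I_6 -> 'M[F]_n -> F) (betav : 'I_6 -> F -> 'M[F]_n) (lambda : 'I_6 -> 'M[F]_n -> F).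
Hypotheses (hE6 : simply_connected_simple_E6 G T alpha alphav) (hom_ : fundamental_weights T alphav omega)
 (hbv : forall j, is_coroot G T (E6_beta alpha j) (betav j)).
Notation A5 := (A5_factor G T alpha).
Notation A1 := (A1_factor G T alpha).
Notation H := (A5A1_subgroup G T alpha).
Hypotheses (hl5 : fundamental_weights (T `&` A5) (A5_part betav) (A5_part lambda))
 (hl1 : fundamental_weights (T `&` A1) (A1_part betav) (A1_part lambda)).

Lemma setup : exists (X Y Q : 'I_6 -> 'M[F]_n) z (XB YB QB : 'I_6 -> 'M[F]_n) zB,
 (forall i, sl2_triple G T (alpha i) (alphav i) (X i) (Y i) (Q i) (z i)) /\
 (forall j, sl2_triple G T (E6_beta alpha j) (betav j) (XB j) (YB j) (QB j) (zB j)).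
Proof.
have [Gs Tm Rb hc _] := hE6.
have aM i s t : T s -> T t -> alpha i (s *m t) = alpha i s * alpha i t.
 by case: Rb => h _ _; case: (h i) => -[_ _ m] _ _; exact: m.
have [X [Y [Q [z D]]]] := triples_ex Gs Tm aM (root_neq0 Tm Rb) hc.
have [XB [YB [QB [zB DB]]]] := triples_ex Gs Tm (fun j s t hs ht => combM Rb (E6_beta_coords j) hs ht) (fun j t ht => comb_neq0 Tm Rb (E6_beta_coords j) ht) hbv.
by exists X, Y, Q, z, XB, YB, QB, zB.
Qed.

Lemma UB_rev5 (XB YB : 'I_6 -> 'M[F]_n) (b : pred 'I_6) : (forall j, b (rev5 j) = b j) ->
 UB (fun j => XB (rev5 j)) (fun j => YB (rev5 j)) b = UB XB YB b.
Proof.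
move=> hb; apply/seteqP; split=> g [j [c [bj h]]]; exists (rev5 j), c; rewrite hb; split=> //.
by rewrite rev5K.
Qed.

Definition branching_rule k m nu b := forall N (rho : 'M[F]_n -> 'M[F]_N) dA dB
  (rhoA : forall a : triples k, 'M[F]_n -> 'M[F]_(dA a)) (rhoB : forall a, 'M[F]_n -> 'M[F]_(dB a)),
 irreducible_of_highest_weight G T G alpha (fun t => omega m t ^+ k) rho ->
 (forall a, irreducible_of_highest_weight G T A5 (A5_part (E6_beta alpha)) (nu a) (rhoA a)) ->
 (forall a, irreducible_of_highest_weight G T A1 (A1_part (E6_beta alpha))
   (fun t => lambda (node 6) t ^+ b a) (rhoB a)) ->
 branches H A5 A1 rho rhoA rhoB.

Lemma main_parts k :
 branching_rule (node 1) (fun a t => lambda (node 2) t ^+ tr1 a * lambda (node 4) t ^+ tr2 a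
  * lambda (node 5) t ^+ tr3 a) (@tr3 k) /\
 branching_rule (node 6) (fun a t => lambda (node 1) t ^+ tr1 a * lambda (node 2) t ^+ tr2 a
  * lambda (node 4) t ^+ tr3 a) (@tr1 k).
Proof.
have [Gs Tm Rb hc [Ca sc]] := hE6.
have [X [Y [Q [z [XB [YB [QB [zB [D DB]]]]]]]]] := setup.
have Coch i c : c != 0 -> T (alphav i c) by case: (hc i) => -[h _ _] _; exact: h.
have CochB i c : c != 0 -> T (betav i c) by case: (hbv i) => -[h _ _] _; exact: h.
have TG := T_subG Tm.
have e5 : A5 = gens (UB XB YB (fun j => j != ord_max)) := A5_gens Gs Tm Rb Coch D Ca DB.
have e1 : A1 = gens (UB XB YB (fun j => j == ord_max)) := A1_gens Gs Tm Rb Coch D Ca DB.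
have eH : H = gens (T `|` UB XB YB xpredT) := H_gens Gs Tm Rb Coch D Ca DB.
have b5 j c : j != ord_max -> c != 0 -> A5 (betav j c).
 by move=> jm c0; rewrite e5; exact: (bv_S DB (b := fun j => j != ord_max)).
have b1 c : c != 0 -> A1 (betav ord_max c).
 by move=> c0; rewrite e1; apply: (bv_S DB (b := fun j => j == ord_max)).
have hwG m N (rho : 'M[F]_n -> 'M[F]_N) :
  irreducible_of_highest_weight G T G alpha (fun t => omega m t ^+ k) rho ->
  exists v : 'cV[F]_N, [/\ v != 0, forall i c, rho (expm (c *: X i)) *m v = v &
   forall i c, c != 0 -> rho (alphav i c) *m v = (if i == m then c ^+ k else 1) *: v].
 move=> h.
 have ea : alpha = fun j => comb alpha (ei j) by apply/funext => j; apply/funext => t; rewrite comb_ei.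
 rewrite {1}ea in h.
 have [||||v [v0 vX vT]] := hw_vec Tm Rb (b := @ei 'I_6) (gam := alphav) (X := X) (Y := Y) (Q := Q) (z := z) _ _ _ _ h.
 - by move=> j; exists j; rewrite /ei eqxx.
 - by move=> j; have <- : alpha j = comb alpha (ei j) by apply/funext => t; rewrite comb_ei.
 - exact: Coch.
 - by move=> j c c0; apply: TG; exact: Coch.
 exists v; split=> // i c c0; rewrite vT //; congr (_ *: _).
 by rewrite ((hom_ m).2 i c c0) c_zeq.
have liftP j : j != ord_max -> exists i : 'I_5, j = lift ord_max i.
 by case: (unliftP ord_max j) => [i ->|->]; [exists i | rewrite eqxx].
have bn0 j : exists i, bc j i != 0 by exact: bc_neq0.
have hw5 d chi (f : 'M[F]_n -> 'M[F]_d) : irreducible_of_highest_weight G T A5 (A5_part (E6_beta alpha)) chi f ->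
  exists v : 'cV[F]_d, [/\ v != 0, forall j c, j != ord_max -> f (expm (c *: XB j)) *m v = v &
   forall j c, j != ord_max -> c != 0 -> f (betav j c) *m v = chi (betav j c) *: v].
 move=> h.
 have [||||v [v0 vX vT]] := hw_vec Tm Rb (b := fun i => bc (lift ord_max i)) (gam := A5_part betav)
  (X := A5_part XB) (Y := A5_part YB) (Q := A5_part QB) (z := A5_part zB) _ _ _ _ h.
 - by move=> j; exact: bn0.
 - by move=> j; exact: DB.
 - by move=> j c; exact: CochB.
 - by move=> j c c0; apply: b5; rewrite // eq_sym neq_lift.
 exists v; split=> // [j c /liftP [i ->]|j c /liftP [i ->]]; first exact: vX.
 exact: vT.
have hw1 d chi (f : 'M[F]_n -> 'M[F]_d) : irreducible_of_highest_weight G T A1 (A1_part (E6_beta alpha)) chi f ->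
  exists v : 'cV[F]_d, [/\ v != 0, forall c, f (expm (c *: XB ord_max)) *m v = v &
   forall c, c != 0 -> f (betav ord_max c) *m v = chi (betav ord_max c) *: v].
 move=> h.
 have [||||v [v0 vX vT]] := hw_vec Tm Rb (b := fun i => bc ord_max) (gam := A1_part betav)
  (X := A1_part XB) (Y := A1_part YB) (Q := A1_part QB) (z := A1_part zB) _ _ _ _ h.
 - by move=> j; exact: bn0.
 - by move=> j; exact: DB.
 - by move=> j c; exact: CochB.
 - by move=> j c c0; exact: b1.
 exists v; split=> // c; first exact: (vX 0).
 exact: (vT 0).
have lam5 m j c : m != ord_max -> j != ord_max -> c != 0 -> lambda m (betav j c) = c ^ (j == m)%:Z.
 move=> /liftP [m' ->] /liftP [i ->] c0; rewrite (inj_eq lift_inj).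
 exact: ((hl5 m').2 i c c0).
have lam1 c : c != 0 -> lambda (node 6) (betav ord_max c) = c.
 move=> c0; rewrite -[RHS]expr1z /node -ord_max6; exact: ((hl1 0).2 0 c c0).
have nm l : (l < 5)%N -> node l.+1 != ord_max.
 by move=> l5; rewrite -val_eqE /node /= inordK; lia.
rewrite /branching_rule eH; split=> N rho dA dB rhoA rhoB h hA hB.
 have [v [v0 vX vT]] := hwG _ _ _ h.
 have cA a := cid (hw5 _ _ _ (hA a)); have cB a := cid (hw1 _ _ _ (hB a)).
 pose vA a := projT1 (cA a); pose vB a := projT1 (cB a).
 have [hr ir _] := h.
 rewrite e5 e1 in hA hB *.
 apply: (branches_core Gs Tm Rb Coch D Ca CochB DB (@tr_sum k) (@tr_inj k) (@tr_surj k) hr ir v0 vX vT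
  (vA := vA) (vB := vB)).
 - by move=> a; case: (hA a).
 - by move=> a; case: (hB a).
 - by move=> a; case: (hA a).
 - by move=> a; case: (hB a).
 - by move=> a; rewrite /vA; case: (projT2 (cA a)).
 - by move=> a; rewrite /vB; case: (projT2 (cB a)).
 - by move=> a j c jm; rewrite /vA; case: (projT2 (cA a)) => _ q _; exact: q.
 - by move=> a c; rewrite /vB; case: (projT2 (cB a)) => _ q _; exact: q.
 - move=> a j c jm c0; rewrite /vA; case: (projT2 (cA a)) => _ _ ->//; congr (_ *: _).
  rewrite !lam5 ?nm // !c_zeq /nA /node /=.
  by move: jm; elim/ord6_ind: j; rewrite -!val_eqE /= !inordK //= ?mulr1 ?mul1r ?expr0.
 - move=> a c c0; rewrite /vB; case: (projT2 (cB a)) => _ _ ->//.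
  by rewrite lam1.
have [v [v0 vX vT]] := hwG _ _ _ h.
have cA a := cid (hw5 _ _ _ (hA a)); have cB a := cid (hw1 _ _ _ (hB a)).
pose vA a := projT1 (cA a); pose vB a := projT1 (cB a).
have [hr ir _] := h.
rewrite e5 e1 in hA hB *.
have r5 j : (fun j => j != ord_max) (rev5 j) = (fun j => j != ord_max) j by rewrite /= rev5_max.
have r1 j : (fun j => j == ord_max) (rev5 j) = (fun j => j == ord_max) j by rewrite /= rev5_max.
have rm : rev5 ord_max = ord_max by apply/eqP; rewrite rev5_max.
(* Reindexing the root vectors by [rev5] leaves the generating sets of A5, A1 and H unchanged. *)
rewrite -(UB_rev5 XB YB r5) -(UB_rev5 XB YB r1) -(@UB_rev5 XB YB xpredT (fun=> erefl)) in hA hB *.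
have D' i : sl2_triple G T (alpha (tau i)) (alphav (tau i)) (X (tau i)) (Y (tau i)) (Q (tau i)) (z (tau i)) := D (tau i).
have DB' j : sl2_triple G T (E6_beta (fun i => alpha (tau i)) j) (betav (rev5 j)) (XB (rev5 j)) (YB (rev5 j)) (QB (rev5 j)) (zB (rev5 j)).
 by rewrite beta_tau; exact: DB.
have Ca' i j : pairing (alpha (tau i)) (alphav (tau j)) (C6 i j) by rewrite -C6_tau; exact: Ca.
have vT' i c : c != 0 -> rho (alphav (tau i) c) *m v = (if i == inord 0 then c ^+ k else 1) *: v.
 move=> c0; rewrite vT // (_ : (tau i == node 6) = (i == inord 0)) //.
 by elim/ord6_ind: i; rewrite /tau /node -!val_eqE /= !inordK.
(* Reversal of the chain turns lambda_1, lambda_2, lambda_4 into lambda_5, lambda_4, lambda_2, so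
   the roles of a1 and a3 are exchanged. *)
apply: (branches_core Gs Tm (root_base_tau Rb) (fun i => Coch (tau i)) D' Ca' (fun j => CochB (rev5 j)) DB'
  (b1 := @tr3 k) (b2 := @tr2 k) (b3 := @tr1 k) _ _ _ hr ir v0 (fun i => vX (tau i)) vT' (vA := vA) (vB := vB)).
- by move=> a; have := tr_sum a; lia.
- by move=> a a' q1 q2 q3; exact: tr_inj.
- move=> x y w q; have [|a [q1 q2 q3]] := @tr_surj k w y x; first lia.
 by exists a.
- by move=> a; case: (hA a).
- by move=> a; case: (hB a).
- by move=> a; case: (hA a).
- by move=> a; case: (hB a).
- by move=> a; rewrite /vA; case: (projT2 (cA a)).
- by move=> a; rewrite /vB; case: (projT2 (cB a)).
- by move=> a j c jm; rewrite /vA; case: (projT2 (cA a)) => _ q _; apply: q; rewrite rev5_max.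
- by move=> a c; rewrite rm /vB; case: (projT2 (cB a)) => _ q _; exact: q.
- move=> a j c jm c0; have rj : rev5 j != ord_max by rewrite rev5_max.
 rewrite /vA; case: (projT2 (cA a)) => _ _ ->//; congr (_ *: _).
 rewrite (lam5 _ _ _ (nm 0%N isT) rj c0) (lam5 _ _ _ (nm 1%N isT) rj c0) (lam5 _ _ _ (nm 3 isT) rj c0).
 rewrite !c_zeq /nA /node /=.
 by move: jm {rj}; elim/ord6_ind: j; rewrite /rev5 -!val_eqE /= !inordK //= ?mulr1 ?mul1r ?expr0.
- move=> a c c0; rewrite rm /vB; case: (projT2 (cB a)) => _ _ ->//.
 by rewrite lam1.
Qed.
End Main.

Theorem theorem15 (R : realType) (n : nat) (G T : set 'M[R[i]]_n)
    (alpha : 'I_6 -> 'M[R[i]]_n -> R[i]) (alphav : 'I_6 -> R[i] -> 'M[R[i]]_n)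
    (omega : 'I_6 -> 'M[R[i]]_n -> R[i])
    (betav : 'I_6 -> R[i] -> 'M[R[i]]_n)
    (lambda : 'I_6 -> 'M[R[i]]_n -> R[i])
    (A5 A1 H : set 'M[R[i]]_n) (k : nat) :
  simply_connected_simple_E6 G T alpha alphav ->
  fundamental_weights T alphav omega ->
  A5 = A5_factor G T alpha ->
  A1 = A1_factor G T alpha ->
  H = A5A1_subgroup G T alpha ->
  (forall j, is_coroot G T (E6_beta alpha j) (betav j)) ->
  fundamental_weights (T `&` A5) (A5_part betav) (A5_part lambda) ->
  fundamental_weights (T `&` A1) (A1_part betav) (A1_part lambda) ->
  (forall (N : nat) (rho : 'M[R[i]]_n -> 'M[R[i]]_N)
      (dA dB : triples k -> nat)
      (rhoA : forall a, 'M[R[i]]_n -> 'M[R[i]]_(dA a))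
      (rhoB : forall a, 'M[R[i]]_n -> 'M[R[i]]_(dB a)),
    irreducible_of_highest_weight G T G alpha
      (fun t => omega (node 1) t ^+ k) rho ->
    (forall a : triples k,
      irreducible_of_highest_weight G T A5 (A5_part (E6_beta alpha))
        (fun t => lambda (node 2) t ^+ tr1 a * lambda (node 4) t ^+ tr2 a
                  * lambda (node 5) t ^+ tr3 a) (rhoA a)) ->
    (forall a : triples k,
      irreducible_of_highest_weight G T A1 (A1_part (E6_beta alpha))
        (fun t => lambda (node 6) t ^+ tr3 a) (rhoB a)) ->
    branches H A5 A1 rho rhoA rhoB)
  /\
  (forall (N : nat) (rho : 'M[R[i]]_n -> 'M[R[i]]_N)
      (dA dB : triples k -> nat)
      (rhoA : forall a, 'M[R[i]]_n -> 'M[R[i]]_(dA a))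
      (rhoB : forall a, 'M[R[i]]_n -> 'M[R[i]]_(dB a)),
    irreducible_of_highest_weight G T G alpha
      (fun t => omega (node 6) t ^+ k) rho ->
    (forall a : triples k,
      irreducible_of_highest_weight G T A5 (A5_part (E6_beta alpha))
        (fun t => lambda (node 1) t ^+ tr1 a * lambda (node 2) t ^+ tr2 a
                  * lambda (node 4) t ^+ tr3 a) (rhoA a)) ->
    (forall a : triples k,
      irreducible_of_highest_weight G T A1 (A1_part (E6_beta alpha))
        (fun t => lambda (node 6) t ^+ tr1 a) (rhoB a)) ->
    branches H A5 A1 rho rhoA rhoB).
Proof.
move=> hE6 hom_ -> -> -> hbv hl5 hl1.
exact: (main_parts hE6 hom_ hbv hl5 hl1).
Qed.
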